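(* Let $\Omega\subset\mathbb{R}^n$ be a domain and let $\mathcal{M}\in L^\infty(\Omega,\mathcal{L}(\mathbb{R}^n))$ with $\operatorname{ess\,sup}_{x\in\Omega}\|\mathcal{M}(x)\|<1$, extended to $\Lambda\mathbb{R}^n$ by its exterior extension. Let $F\in W^{1,2}_{d,\delta}(\Omega,\Lambda^{(0,2)})$ be a solution of $\mathcal{D}^-F=\mathcal{M}\,\mathcal{D}^+F$ in $\Omega$. Then $F\in C^{0,\alpha}_{loc}(\Omega,\Lambda)$ for some $0<\alpha<1$.
   Context: $\Lambda=\Lambda\mathbb{R}^n$ is the exterior algebra with induced inner product, $\Lambda^{(0,2)}=\Lambda^0\mathbb{R}^n\oplus\Lambda^2\mathbb{R}^n$. The interior product is defined by $\langle\Theta\lrcorner w_1,w_2\rangle=\langle w_1,\Theta\wedge w_2\rangle$. $dF=\sum_j e_j\wedge\partial_jF$, $\delta F=\sum_j e_j\lrcorner\partial_jF$ ($\delta=-d^*$) in the sense of distributions; $\mathcal{D}^\pm=d\pm\delta$. $W^{1,2}_{d,\delta}(\Omega,\Lambda^{(0,2)})$ is the space of $\Lambda^{(0,2)}$-valued fields with $F,dF,\delta F\in L^2$. The exterior extension of $T\in\mathcal{L}(\mathbb{R}^n)$ is the exterior-algebra homomorphism of $\Lambda\mathbb{R}^n$ fixing $1$ and restricting to $T$ on $\mathbb{R}^n$. *)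

(* Defs.v *)
From HB Require Import structures.
From mathcomp Require Import all_boot all_order all_algebra.
From mathcomp Require Import all_classical all_reals all_analysis.
From mathcomp Require Import ess_sup_inf.

Set Implicit Arguments.
Unset Strict Implicit.
Unset Printing Implicit Defensive.

Import Order.TTheory GRing.Theory Num.Theory.
Import numFieldNormedType.Exports.

Local Open Scope ring_scope.

(* The exterior algebra of R^n: w S is the coordinate of w on
   e_S = e_{s1} /\ ... /\ e_{sk}, where S = {s1 < ... < sk}. *)
Definition extalg (R : realType) (n : nat) := {ffun {set 'I_n} -> R^o}.

Section exterior_algebra.
Local Open Scope set_scope.
Local Open Scope ring_scope.
Variables (R : realType) (n : nat).
Implicit Types (S T U : {set 'I_n}) (u v w : extalg R n).

Definition blade S : extalg R n := [ffun T => (T == S)%:R].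

Definition basis_vec (i : 'I_n) : 'rV[R]_n := delta_mx 0 i.

Definition vec (v : 'rV[R]_n) : extalg R n :=
  \sum_(i < n) v 0 i *: blade [set i].

(* The number of transpositions that sort the concatenation of S and T; see
   wedge_blade for the resulting sign in e_S /\ e_T. *)
Definition inversions S T : nat := (\sum_(s in S) \sum_(t in T) (t < s))%N.

Definition wedge u v : extalg R n :=
  [ffun U : {set 'I_n} => \sum_(S : {set 'I_n} | S \subset U)
     (-1) ^+ inversions S (U :\: S) * u S * v (U :\: S)].

Definition inner u v : R := \sum_(S : {set 'I_n}) u S * v S.

Definition extnorm u : R := Num.sqrt (inner u u).

(* The coordinate of u _| w on e_S is <u _| w, e_S> = <w, u /\ e_S>;
   see inner_interior. *)
Definition interior u w : extalg R n :=
  [ffun S : {set 'I_n} => inner w (wedge u (blade S))].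

Definition ext02 w : Prop :=
  forall S, w S != 0 -> #|S| = 0%N \/ #|S| = 2%N.

(* The operator of R^n given by A : 'M_n is v |-> v *m A, so that e_i is mapped
   to row i A. Its exterior extension maps e_S to the wedge product, in
   increasing order, of the images of the e_s; see exterior_ext_wedge. *)
Definition exterior_ext (A : 'M[R]_n) w : extalg R n :=
  \sum_(S : {set 'I_n})
    w S *: \big[wedge/blade finset.set0]_(i <- enum S) vec (basis_vec i *m A).

Lemma vec_is_linear : linear vec.
Proof.
move=> a v w; rewrite /vec scaler_sumr -big_split/=; apply: eq_bigr => i _.
by rewrite !mxE scalerA -scalerDl.
Qed.

HB.instance Definition _ :=
  GRing.isLinear.Build R 'rV[R]_n (extalg R n) *:%R vec vec_is_linear.

Lemma extalg_sum_blade w : w = \sum_(S : {set 'I_n}) w S *: blade S.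
Proof.
apply/ffunP => T; rewrite sum_ffunE (bigD1 T)//= big1 ?addr0.
  by rewrite !ffunE eqxx /GRing.scale/= mulr1.
by move=> S ST; rewrite !ffunE eq_sym (negbTE ST) /GRing.scale/= mulr0.
Qed.

Lemma eq_linear_blade (f g : {linear extalg R n -> extalg R n}) :
  (forall S, f (blade S) = g (blade S)) -> f =1 g.
Proof.
move=> fg w; rewrite (extalg_sum_blade w) !linear_sum.
by apply: eq_bigr => S _; rewrite !linearZ/= fg.
Qed.

Lemma wedge_is_linear u : linear (wedge u).
Proof.
move=> a v w; apply/ffunP => U; rewrite !ffunE scaler_sumr -big_split/=.
apply: eq_bigr => S _; rewrite !ffunE /GRing.scale/=.
by rewrite mulrDr mulrCA.
Qed.

Lemma wedgel_is_linear w : linear (wedge ^~ w).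
Proof.
move=> a u v; apply/ffunP => U; rewrite !ffunE scaler_sumr -big_split/=.
apply: eq_bigr => S _; rewrite !ffunE /GRing.scale/=.
by rewrite mulrDr mulrDl -!mulrA mulrCA.
Qed.

HB.instance Definition _ u :=
  GRing.isLinear.Build R (extalg R n) (extalg R n) *:%R (wedge u)
    (wedge_is_linear u).

Definition wedgel w u := wedge u w.

HB.instance Definition _ w :=
  GRing.isLinear.Build R (extalg R n) (extalg R n) *:%R (wedgel w)
    (wedgel_is_linear w).

Lemma innerC u v : inner u v = inner v u.
Proof. by apply: eq_bigr => S _; rewrite mulrC. Qed.

Lemma inner_interior u v w : inner (interior u v) w = inner v (wedge u w).
Proof.
rewrite {2}(extalg_sum_blade w) linear_sum /inner.
under [RHS]eq_bigr do rewrite sum_ffunE mulr_sumr.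
rewrite exchange_big/=; apply: eq_bigr => S _.
rewrite ffunE /inner mulr_suml; apply: eq_bigr => T _.
rewrite linearZ/= [in RHS]ffunE /GRing.scale/=. by rewrite -mulrA [X in _ * X]mulrC.
Qed.

Lemma sum_disjointU S T (F : 'I_n -> nat) : [disjoint S & T] ->
  (\sum_(i in S :|: T) F i = \sum_(i in S) F i + \sum_(i in T) F i)%N.
Proof.
by move=> ST; rewrite -bigU//=; apply: eq_bigl => i; rewrite !inE.
Qed.

Lemma inversionsUl S T U : [disjoint S & T] ->
  inversions (S :|: T) U = (inversions S U + inversions T U)%N.
Proof. by move=> ST; rewrite /inversions sum_disjointU. Qed.

Lemma inversionsUr S T U : [disjoint T & U] ->
  inversions S (T :|: U) = (inversions S T + inversions S U)%N.
Proof.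
move=> TU; rewrite /inversions -big_split/=; apply: eq_bigr => s _.
by rewrite sum_disjointU.
Qed.

Lemma wedge_blade S T :
  wedge (blade S) (blade T) =
  if [disjoint S & T] then (-1) ^+ inversions S T *: blade (S :|: T) else 0.
Proof.
apply/ffunP => U; rewrite ffunE.
have [SU|SU] := boolP (S \subset U); last first.
  rewrite big1 => [|V VU]; last first.
    have VS : V != S by apply: contraNneq SU => <-.
    by rewrite !ffunE (negbTE VS) mulr0 mul0r.
  case: ifP => _; rewrite !ffunE//.
  suff /negbTE -> : U != S :|: T by rewrite /GRing.scale/= mulr0.
  by apply: contraNneq SU => ->; exact: finset.subsetUl.
rewrite (bigD1 S)//= big1 ?addr0; last first.
  by move=> V /andP[_ VS]; rewrite !ffunE (negbTE VS) mulr0 mul0r.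
rewrite !ffunE eqxx mulr1.
have [UT|UT] := eqVneq (U :\: S) T.
  have dST : [disjoint S & T].
    by rewrite -UT disjoint_sym finset.disjoints_subset finset.setDE finset.subsetIr.
  have UE : U = S :|: T.
    apply/setP => x; rewrite -UT !inE; case: (boolP (x \in S)) => //=.
    by move/(fintype.subsetP SU).
  by rewrite dST UT !ffunE UE eqxx.
rewrite mulr0; case: ifP => dST; rewrite !ffunE//.
suff /negbTE -> : U != S :|: T by rewrite /GRing.scale/= mulr0.
apply: contraNneq UT => ->.
rewrite finset.setDUl finset.setDv finset.set0U; apply/eqP/finset.setDidPl.
by rewrite disjoint_sym.
Qed.

Lemma wedge_suml (I : finType) (a : I -> R) (u : I -> extalg R n) w :
  wedge (\sum_i a i *: u i) w = \sum_i a i *: wedge (u i) w.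
Proof.
rewrite -[LHS]/(wedgel w _) linear_sum/=.
by apply: eq_bigr => i _; rewrite linearZ.
Qed.

Lemma wedge_sumr (I : finType) (a : I -> R) u (w : I -> extalg R n) :
  wedge u (\sum_i a i *: w i) = \sum_i a i *: wedge u (w i).
Proof. by rewrite linear_sum/=; apply: eq_bigr => i _; rewrite linearZ. Qed.

Lemma wedgeZl a u w : wedge (a *: u) w = a *: wedge u w.
Proof. by rewrite -!/(wedgel w _) linearZ. Qed.

Lemma wedgeZr a u w : wedge u (a *: w) = a *: wedge u w.
Proof. by rewrite linearZ. Qed.

Lemma wedge0l w : wedge 0 w = 0.
Proof. by rewrite -/(wedgel w _) linear0. Qed.

Lemma wedgeA u v w : wedge u (wedge v w) = wedge (wedge u v) w.
Proof.
rewrite (extalg_sum_blade u) !wedge_suml; apply: eq_bigr => S _; congr (_ *: _).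
rewrite (extalg_sum_blade v) wedge_sumr !wedge_suml wedge_sumr.
apply: eq_bigr => T _; congr (_ *: _).
rewrite (extalg_sum_blade w) !wedge_sumr; apply: eq_bigr => U _.
congr (_ *: _); rewrite !wedge_blade.
have [dTU|dTU] := boolP [disjoint T & U].
  rewrite wedgeZr wedge_blade.
  have -> : [disjoint S & T :|: U] = [disjoint S & T] && [disjoint S & U].
    rewrite -!finset.setI_eq0 finset.setIUr.
    by rewrite -!finset.subset0 finset.subUset.
  have [dST|dST]/= := boolP [disjoint S & T]; last by rewrite scaler0 wedge0l.
  rewrite wedgeZl wedge_blade.
  have -> : [disjoint S :|: T & U] = [disjoint S & U].
    rewrite -!finset.setI_eq0 finset.setIUl -!finset.subset0 finset.subUset.
    by move: dTU; rewrite -finset.setI_eq0 -finset.subset0 => ->; rewrite andbT.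
  case: ifP => dSU; last by rewrite !scaler0.
  rewrite !scalerA -!exprD inversionsUr// inversionsUl// finset.setUA.
  by congr (_ ^+ _ *: _); rewrite addnC -addnA.
rewrite linear0; case: ifP => dST; last by rewrite wedge0l.
rewrite wedgeZl wedge_blade ifF ?scaler0//.
apply: contraNF dTU => /fintype.disjointWl; apply.
exact: finset.subsetUr.
Qed.

Lemma inversions0 S : inversions finset.set0 S = 0%N.
Proof. by rewrite /inversions big_set0. Qed.

Lemma wedge1l w : wedge (blade finset.set0) w = w.
Proof.
rewrite [in RHS](extalg_sum_blade w) (extalg_sum_blade w) wedge_sumr.
rewrite -extalg_sum_blade; apply: eq_bigr => S _; congr (_ *: _).
rewrite wedge_blade ifT ?inversions0 ?expr0 ?scale1r ?finset.set0U//.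
by rewrite -finset.setI_eq0 finset.set0I.
Qed.

Lemma inversions11 (i j : 'I_n) : inversions [set i] [set j] = (j < i)%N.
Proof. by rewrite /inversions !big_set1. Qed.

Lemma wedge_vecC (v w : 'rV[R]_n) : wedge (vec v) (vec w) = - wedge (vec w) (vec v).
Proof.
rewrite /vec wedge_suml [in RHS]wedge_sumr -sumrN; apply: eq_bigr => i _.
rewrite -scalerN; congr (_ *: _).
rewrite wedge_sumr wedge_suml -sumrN; apply: eq_bigr => j _.
rewrite -scalerN; congr (_ *: _).
rewrite !wedge_blade !inversions11 disjoint_sym finset.setUC.
have [dij|_] := boolP [disjoint [set j] & [set i]]; last by rewrite oppr0.
have /lt_total/orP : j != i.
  by apply: contraTneq dij => ->; rewrite -finset.setI_eq0 finset.setIid -finset.card_gt0 finset.cards1.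
rewrite !ltEord => -[] lij; rewrite lij ltnNge (ltnW lij)/=.
  by rewrite expr1 expr0 scaleN1r scale1r.
by rewrite expr1 expr0 scaleN1r scale1r opprK.
Qed.

Lemma wedge_vecvv (v : 'rV[R]_n) : wedge (vec v) (vec v) = 0.
Proof.
have vv0 := wedge_vecC v v.
apply/ffunP => U; move/ffunP : vv0 => /(_ U) /=.
rewrite [X in _ = X -> _]ffunE => /eqP; rewrite eq_sym eqNr => /eqP.
by move=> ->; rewrite ffunE.
Qed.

Section exterior_ext_wedge.
Variable A : 'M[R]_n.
Let a i := vec (basis_vec i *m A).
Let E (l : seq 'I_n) := \big[wedge/blade finset.set0]_(i <- l) a i.

Lemma exterior_ext_is_linear : linear (exterior_ext A).
Proof.
move=> k u v; rewrite /exterior_ext scaler_sumr -big_split/=.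
apply: eq_bigr => S _; rewrite !ffunE scalerA -scalerDl.
by congr (_ *: _).
Qed.

HB.instance Definition _ :=
  GRing.isLinear.Build R (extalg R n) (extalg R n) *:%R (exterior_ext A)
    exterior_ext_is_linear.

Lemma exterior_ext_blade S : exterior_ext A (blade S) = E (enum S).
Proof.
rewrite /exterior_ext (bigD1 S)//= big1 ?addr0 ?ffunE ?eqxx ?scale1r//.
by move=> T TS; rewrite ffunE (negbTE TS) scale0r.
Qed.

Lemma exterior_ext1 : exterior_ext A (blade finset.set0) = blade finset.set0.
Proof. by rewrite exterior_ext_blade finset.enum_set0 /E big_nil. Qed.

Let wedge1r w : wedge w (blade finset.set0) = w.
Proof.
rewrite [in RHS](extalg_sum_blade w) (extalg_sum_blade w) wedge_suml.
rewrite -extalg_sum_blade; apply: eq_bigr => S _; congr (_ *: _).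
rewrite wedge_blade ifT; last by rewrite -finset.setI_eq0 finset.setI0.
rewrite finset.setU0 /inversions big1 ?scale1r// => s _.
by rewrite big_set0.
Qed.

Lemma exterior_ext_vec (v : 'rV[R]_n) : exterior_ext A (vec v) = vec (v *m A).
Proof.
rewrite [LHS]linear_sum mulmx_sum_row linear_sum; apply: eq_bigr => i _.
rewrite !linearZ/= exterior_ext_blade finset.enum_set1 /E big_cons big_nil.
by rewrite wedge1r /a rowE.
Qed.

Let E_dup i l : i \in l -> wedge (a i) (E l) = 0.
Proof.
elim: l => // j l IHl; rewrite inE /E big_cons wedgeA.
have [->|ij]/= := eqVneq i j; first by rewrite wedge_vecvv wedge0l.
move=> il; rewrite wedge_vecC -scaleN1r wedgeZl -wedgeA -/(E l) IHl//.
by rewrite linear0 scaler0.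
Qed.

Let E_move i l1 l2 :
  wedge (a i) (E (l1 ++ l2)) = (-1) ^+ size l1 *: E (l1 ++ i :: l2).
Proof.
elim: l1 => [|j l1 IHl]; first by rewrite expr0 scale1r /E big_cons.
rewrite /E !cat_cons !big_cons wedgeA wedge_vecC -scaleN1r wedgeZl -wedgeA.
by rewrite -!/(E _) IHl wedgeZr scalerA exprS.
Qed.

Let ext_wedge_vec i w : exterior_ext A (wedge (blade [set i]) w) =
  wedge (a i) (exterior_ext A w).
Proof.
pose f : {linear extalg R n -> extalg R n} :=
  exterior_ext A \o wedge (blade [set i]).
pose g : {linear extalg R n -> extalg R n} := wedge (a i) \o exterior_ext A.
apply: (eq_linear_blade (f := f) (g := g)) => T /=.
rewrite wedge_blade finset.disjoints1; case: ifPn => iT; last first.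
  by rewrite linear0 exterior_ext_blade E_dup// mem_enum -(negbK (i \in T)).
rewrite linearZ/= !exterior_ext_blade.
have [s1 [s2 [es ls1 ls2]]] : exists s1 s2 : seq 'I_n,
    [/\ enum 'I_n = s1 ++ i :: s2, {in s1, forall t : 'I_n, (t < i)%N}
      & {in s2, forall t : 'I_n, (i < t)%N}].
  have : pairwise ltn (map val (enum 'I_n)).
    by rewrite val_enum_ord -(sorted_pairwise ltn_trans) iota_ltn_sorted.
  have : i \in enum 'I_n by rewrite mem_enum.
  case/splitPr => s1 s2; rewrite map_cat/= pairwise_cat/= => /and3P[].
  rewrite allrel_consr => /andP[ls1 _] _ /andP[ls2 _].
  by exists s1, s2; split => // t; [move: ls1|move: ls2];
    rewrite all_map => /allP /[apply].
have i1 : i \notin s1 by apply/negP => /ls1; rewrite ltnn.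
have i2 : i \notin s2 by apply/negP => /ls2; rewrite ltnn.
have enumE (U : {set 'I_n}) :
    enum U = [seq t <- s1 | t \in U] ++ [seq t <- i :: s2 | t \in U].
  by rewrite -filter_cat -es enumT [LHS]/enum_mem.
have filterU1 s : i \notin s ->
    [seq t <- s | t \in [set i] :|: T] = [seq t <- s | t \in T].
  move=> iNs; apply: eq_in_filter => t ts; rewrite !inE.
  by case: eqVneq => // ti; rewrite ti (negbTE iNs) in ts.
rewrite !enumE/= (negbTE iT) !inE eqxx/= !filterU1// E_move.
congr (_ ^+ _ *: _).
rewrite /inversions big_set1 big_mkcond/= -big_enum/= es big_cat big_cons/=.
rewrite (negbTE iT) add0n [X in (_ + X)%N]big1_seq ?addn0; last first.
  by move=> t /= /ls2 it; rewrite ltnNge (ltnW it); case: ifP.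
rewrite size_filter -sum1_count [RHS]big_mkcond/= big_seq [RHS]big_seq.
by apply: eq_bigr => t /ls1 ->.
Qed.

Theorem exterior_ext_wedge u v :
  exterior_ext A (wedge u v) = wedge (exterior_ext A u) (exterior_ext A v).
Proof.
suff bladeE S w : exterior_ext A (wedge (blade S) w) =
    wedge (exterior_ext A (blade S)) (exterior_ext A w).
  pose f : {linear extalg R n -> extalg R n} := exterior_ext A \o wedgel v.
  pose g : {linear extalg R n -> extalg R n} :=
    wedgel (exterior_ext A v) \o exterior_ext A.
  by apply: (eq_linear_blade (f := f) (g := g)) => S; exact: bladeE.
elim: {S}#|S| {-2}S (erefl #|S|) w => [S S0|k IHk S Sk] w.
  by rewrite (cards0_eq S0) exterior_ext1 !wedge1l.
have /finset.set0Pn[i iS] : S != finset.set0.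
  by rewrite -finset.card_gt0 Sk.
pose S' := S :\ i.
have S'k : #|S'| = k by have := finset.cardsD1 i S; rewrite iS Sk => -[].
have [b SE] : exists b : nat, blade S = (-1) ^+ b *: wedge (blade [set i]) (blade S').
  exists (inversions [set i] S'); rewrite wedge_blade finset.disjoints1 !inE eqxx/=.
  by rewrite scalerA -exprD addnn -mul2n exprM sqrrN !expr1n scale1r finset.setD1K.
rewrite SE wedgeZl !linearZ/= wedgeZl -wedgeA !ext_wedge_vec IHk//.
by rewrite wedgeA.
Qed.


End exterior_ext_wedge.
End exterior_algebra.

Local Open Scope classical_set_scope.

(* The sigma-algebra of R^n is generated by the coordinates, i.e. it is the
   Borel sigma-algebra. *)
Definition rV_display : measure_display.
Proof. exact: default_measure_display. Qed.

Section measurable_rV.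
Variables (R : realType) (n : nat).

Let coord : 'I_n -> 'rV[R]_n -> R := fun i x => x 0 i.

Let rV_set0 : g_sigma_preimage coord set0.
Proof. exact: sigma_algebra0. Qed.

Let rV_setC A : g_sigma_preimage coord A -> g_sigma_preimage coord (~` A).
Proof. exact: sigma_algebraC. Qed.

Let rV_bigcup (A : _^nat) : (forall i, g_sigma_preimage coord (A i)) ->
  g_sigma_preimage coord (\bigcup_i (A i)).
Proof. exact: sigma_algebra_bigcup. Qed.

HB.instance Definition _ := @isMeasurable.Build rV_display
  'rV[R]_n (g_sigma_preimage coord) rV_set0 rV_setC rV_bigcup.

End measurable_rV.

Lemma measurable_coord (R : realType) (n : nat) (i : 'I_n) :
  measurable_fun [set: 'rV[R]_n] (fun x : 'rV[R]_n => x 0 i).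
Proof.
move=> _ Y mY; rewrite setTI; apply: sub_sigma_algebra => /=.
rewrite -bigcup_seq/=; exists i => /=; first by rewrite mem_index_enum.
by exists Y => //; rewrite setTI.
Qed.

Lemma measurable_fun_rVP d (T : measurableType d) (R : realType) (n : nat)
    (f : T -> 'rV[R]_n) :
  measurable_fun [set: T] f <->
  forall i, measurable_fun [set: T] (fun x => f x 0 i).
Proof.
split=> [mf i|mf]; first exact: (measurableT_comp (measurable_coord i)).
have : g_sigma_preimage (fun i x => f x 0 i) `<=` @measurable _ T.
  apply: smallest_sub; first exact: sigma_algebra_measurable.
  rewrite -bigcup_seq => A [i _ [B mB <-]]; exact: mf.
rewrite (g_sigma_preimage_comp (fun (i : 'I_n) (x : 'rV[R]_n) => x 0 i)).
by move=> fS _ A mA; apply: fS; exists A.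
Qed.

Section lebesgue_measure_rV.
Variable R : realType.

Definition rV_rcons (n : nat) (p : 'rV[R]_n * R) : 'rV[R]_n.+1 :=
  \row_(i < n.+1) if unlift ord_max i is Some j then p.1 0 j else p.2.

Lemma measurable_rV_rcons (n : nat) :
  measurable_fun [set: 'rV[R]_n * R] (@rV_rcons n).
Proof.
apply/measurable_fun_rVP => i; rewrite /rV_rcons.
case: (unliftP ord_max i) => [j|] ->.
  apply: (eq_measurable_fun (fun p : 'rV[R]_n * R => p.1 0 j)).
    by move=> p _; rewrite mxE liftK.
  exact: (measurableT_comp (measurable_coord j) measurable_fst).
apply: (eq_measurable_fun snd); last exact: measurable_snd.
by move=> p _; rewrite mxE unlift_none.
Qed.

(* Lebesgue measure of R^n: the image of leb (n - 1) \x lebesgue_measure under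
   (v, t) |-> (v, t); leb_box gives its value on boxes. *)
Fixpoint leb (n : nat) : {measure set 'rV[R]_n -> \bar R} :=
  match n with
  | 0%N => \d_(0 : 'rV[R]_0)
  | m.+1 => measure_function_pushforward__canonical__measure_function_Measure
              (leb m \x @lebesgue_measure R)%E (@measurable_rV_rcons m)
  end.

Lemma measurable_box (n : nat) (a b : 'I_n -> R) :
  measurable [set x : 'rV[R]_n | forall i, a i <= x 0 i <= b i].
Proof.
rewrite (_ : [set x | _] = \bigcap_(i in [set: 'I_n])
    ((fun x : 'rV[R]_n => x 0 i) @^-1` `[a i, b i])).
  apply: fin_bigcap_measurable => // i _; rewrite -[X in measurable X]setTI.
  exact: measurable_coord.
by apply/seteqP; split => x /= xB i; [move=> _|]; rewrite /= ?in_itv; [exact: xB|have := xB i I; rewrite /= in_itv].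
Qed.

Lemma leb_box (n : nat) (a b : 'I_n -> R) : (forall i, a i <= b i) ->
  leb n [set x | forall i, a i <= x 0 i <= b i] =
  (\prod_(i < n) (b i - a i))%:E.
Proof.
elim: n a b => [|n IHn] a b ab.
  by rewrite big_ord0 /= diracE mem_set// => -[].
pose w := widen_ord (leqnSn n).
rewrite /= /pushforward (_ : _ @^-1` _ =
    [set x : 'rV[R]_n | forall i, a (w i) <= x 0 i <= b (w i)] `*`
    `[a ord_max, b ord_max]); last first.
  have wE (i : 'I_n) : lift ord_max i = w i.
    by apply/val_inj => /=; rewrite /bump leqNgt ltn_ord.
  apply/seteqP; split => [p pB|p [p1B /= p2B] i].
    split => [i|] /=.
      by have := pB (w i); rewrite -wE mxE liftK.
    by have := pB ord_max; rewrite mxE unlift_none in_itv.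
  rewrite mxE; case: unliftP => [j ->|->]; last by move: p2B; rewrite in_itv.
  by rewrite wE; exact: p1B.
rewrite product_measure1E//; last exact: measurable_box.
rewrite IHn => [|i]; last exact: ab.
rewrite big_ord_recr/= EFinM lebesgue_measure_itv/= lte_fin.
have := ab ord_max; rewrite le_eqVlt => /predU1P[->|->].
  by rewrite ltxx subrr.
by rewrite -EFinB.
Qed.

End lebesgue_measure_rV.

Section function_spaces.
Local Open Scope classical_set_scope.
Variables (R : realType) (n : nat).
Local Notation mu := (leb R n).
Implicit Types (Omega : set 'rV[R]_n) (F G : 'rV[R]_n -> extalg R n)
  (phi : 'rV[R]_n -> R).

Definition domain Omega := [/\ open Omega, connected Omega & Omega !=set0].

Definition enorm (v : 'rV[R]_n) : R := Num.sqrt (\sum_(i < n) v 0 i ^+ 2).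

Definition opnorm (A : 'M[R]_n) : R :=
  sup [set enorm (v *m A) | v in [set v | enorm v <= 1]].

Definition partial (j : 'I_n) phi : 'rV[R]_n -> R :=
  fun x => 'D_(basis_vec R j) phi x.

Definition smooth phi :=
  forall (s : seq 'I_n) (x : 'rV[R]_n), differentiable (foldr partial phi s) x.

Definition test_function Omega phi :=
  [/\ smooth phi, compact (closure [set x | phi x != 0])
    & closure [set x | phi x != 0] `<=` Omega].

Definition ext_measurable Omega F :=
  forall S : {set 'I_n}, measurable_fun Omega (fun x => F x S).

Definition ext_L2 Omega F :=
  ext_measurable Omega F /\
  (\int[mu]_(x in Omega) (extnorm (F x) ^+ 2)%:E < +oo)%E.

(* sum_j c j (partial_j F) = G in the sense of distributions, for a first-order
   operator with constant coefficients c j acting linearly on the exterior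
   algebra and locally integrable F and G. *)
Definition distributional (c : 'I_n -> extalg R n -> extalg R n) Omega F G :=
  forall phi, test_function Omega phi -> forall S : {set 'I_n},
  \int[mu]_(x in Omega) (phi x * G x S) =
  - \int[mu]_(x in Omega) (\sum_(j < n) partial j phi x * c j (F x) S).

Definition d_coef (j : 'I_n) (w : extalg R n) : extalg R n :=
  wedge (blade R [set j]%SET) w.

Definition delta_coef (j : 'I_n) (w : extalg R n) : extalg R n :=
  interior (blade R [set j]%SET) w.

Definition is_d := distributional d_coef.
Definition is_delta := distributional delta_coef.
Definition is_Dplus := distributional (fun j w => d_coef j w + delta_coef j w).
Definition is_Dminus := distributional (fun j w => d_coef j w - delta_coef j w).

Definition W12_d_delta_02 Omega F :=
  [/\ ext_L2 Omega F, {ae mu, forall x, Omega x -> ext02 (F x)},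
      exists2 G, ext_L2 Omega G & is_d Omega F G
    & exists2 H, ext_L2 Omega H & is_delta Omega F H].

(* D^- F = M D^+ F. Both distributions are L^2 functions when F is in
   W12_d_delta_02, and M acts through its exterior extension. *)
Definition beltrami_solution Omega (M : 'rV[R]_n -> 'M[R]_n) F :=
  exists P Q : 'rV[R]_n -> extalg R n,
    [/\ ext_L2 Omega P, ext_L2 Omega Q, is_Dplus Omega F P, is_Dminus Omega F Q
      & {ae mu, forall x, Omega x -> Q x = exterior_ext (M x) (P x)}].

(* C^{0,alpha}_loc for an almost-everywhere defined field: some representative
   is alpha-Hoelder on every compact subset of Omega. *)
Definition holder_loc Omega (alpha : R) F :=
  exists F' : 'rV[R]_n -> extalg R n,
    {ae mu, forall x, Omega x -> F x = F' x} /\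
    forall K : set 'rV[R]_n, compact K -> K `<=` Omega ->
      exists C : R, forall x y : 'rV[R]_n, K x -> K y ->
        extnorm (F' x - F' y) <= C * enorm (x - y) `^ alpha.

(* M is in L^infty(Omega, L(R^n)) with ess sup_Omega |M| < 1; extending |M| by 0
   outside of Omega does not change its essential supremum over Omega. *)
Definition ess_contractive Omega (M : 'rV[R]_n -> 'M[R]_n) :=
  (forall i j : 'I_n, measurable_fun Omega (fun x => M x i j)) /\
  (ess_sup mu ((fun x => (opnorm (M x))%:E) \_ Omega) < 1)%E.

End function_spaces.

(* Main.v *)
(* The scalar part u of F solves a uniformly elliptic equation. In degree one the
   Beltrami equation reads q = p M, where p and q are the vector parts of D^+ F and
   D^- F; then (p + q)/2 = grad u, while V = (p - q)/2 is the divergence of the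
   bivector part, hence div V = 0, and V . grad u = (|p|^2 - |q|^2)/4 >= lam |p|^2. The
   degree three part w of D^+ F is fixed by the exterior extension of M, hence
   vanishes because the powers of M tend to 0; so D^+ F is just p.
   De Giorgi's theorem for u (truncation, a Poincare inequality for functions that
   vanish on a large set, a logarithmic test function) and the energy estimate give
   the decay r^2 int_{Q(x,r)} |p|^2 <= C kap^(2j) r^n for r = r0/5^j.
   All the coordinates of F satisfy Lap F = D^+ p. For the mollifiers K_r one has
   d/dr K_r = r^-1 Lap Theta_r with grad Theta_r = - z K_r, so the decay of p bounds
   d/dr (F * K_r), and its differences in x: F * K_r converges to a Hoelder
   continuous field, as in Morrey's lemma. *)
From HB Require Import structures.
Require Import Defs.
From mathcomp Require Import all_boot all_order all_algebra.
From mathcomp Require Import all_classical all_reals all_analysis.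
From mathcomp Require Import measurable_realfun ess_sup_inf ring lra.
Import Order.TTheory GRing.Theory Num.Theory.
Import numFieldNormedType.Exports.
Set Implicit Arguments.
Unset Strict Implicit.
Unset Printing Implicit Defensive.
Local Open Scope classical_set_scope.
Local Open Scope ring_scope.

(** * Lebesgue measure on R^n *)

(** Weak derivatives are given only against test functions, so every nonlinear function of u is
    reached through mollification: [comp_approx] mollifies u, composes with a smooth function and
    passes to the limit under one integrable majorant. This forces truncations and logarithms to be
    smooth; the functions p(1/t) exp(-1/t), extended by 0, are the source of the kernels, of the
    cutoffs and of the substitute for t^+. The De Giorgi iteration uses a Poincare inequality in
    place of the Sobolev inequality. Smallness of a level set enters as the right to use the
    Poincare inequality at a small scale l; with l a small multiple of the gap between consecutive
    cubes the energies decay geometrically, in every dimension. Cubes replace balls because Lebesgue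
    measure is computed on boxes. The ratio 5 of consecutive radii is the ratio of the two cubes in
    [oscillation]. Its contraction factor kap is kept at least 1/2: then 5 kap > 1, so the sums that
    bound the Lipschitz constants of the mollifications are governed by their last term, and the
    exponent - ln kap / ln 5 is less than 1. *)

Section lebesgue_rV.
Variables (R : realType) (n : nat).
Local Notation rV := 'rV[R]_n.

Definition cube (a : rV) (r : R) : set rV :=
  [set x | forall i, a 0 i - r <= x 0 i <= a 0 i + r].

Definition box (a b : 'I_n -> R) : set rV :=
  [set x | forall i, a i <= x 0 i <= b i].

Lemma measurable_cube a r : measurable (cube a r).
Proof. exact: measurable_box. Qed.

Lemma cube_norm a r x : 0 <= r -> cube a r x <-> `|x - a| <= r.
Proof.
move=> r0; split => [ax|].
  rewrite [`|_|]mx_normrE; apply/bigmax_leP; split => //= -[i j] _ /=.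
  rewrite ord1 ler_norml !mxE; have := ax j; lra.
rewrite [`|_|]mx_normrE => /bigmax_leP[_ h] i.
have := h (0, i) isT; rewrite /= ler_norml !mxE; lra.
Qed.

Lemma box_measure0 (a b : 'I_n -> R) i : b i < a i -> box a b = set0.
Proof.
move=> ba; apply/seteqP; split => // x /(_ i) /andP[h1 h2].
by move: ba; rewrite ltNge (le_trans h1 h2).
Qed.

Lemma leb_cube a r : 0 <= r -> leb R n (cube a r) = ((2 * r) ^+ n)%:E.
Proof.
move=> r0; rewrite leb_box => [|i]; last by lra.
congr (_%:E); rewrite -[in RHS](card_ord n) -prodr_const; apply: eq_bigr => i _; ring.
Qed.

Lemma leb_sigma_finite : sigma_finite setT (leb R n).
Proof.
exists (fun k => cube 0 k%:R).
  apply/esym/seteqP; split => // x _.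
  exists (Num.bound `|x|) => //; apply/cube_norm => //; rewrite subr0.
  exact/ltW/archi_boundP.
move=> k; split; first exact: measurable_cube.
by rewrite leb_cube ?ltry.
Qed.

(** The Borel sets of the line are generated by closed rays, and those of R^n by the preimages of
    Borel sets under the coordinates. Applied below with boxes and with open sets as generators. *)
Lemma rV_measurable_sub (G : set (set rV)) : sigma_algebra setT G ->
  (forall i x, G [set v : rV | x <= v 0 i]) -> @measurable _ rV `<=` G.
Proof.
move=> sG Gi; apply: smallest_sub => //.
rewrite -bigcup_seq => A [i _ [B mB <-]]; rewrite setTI.
have [G0 GC GU] := sG.
have E : @measurable _ R = <<s @RGenCInfty.G R >> :=
  RGenCInfty.measurableE R.
suff : <<s @RGenCInfty.G R >> `<=`
    (fun B => G ((fun x : rV => x 0 i) @^-1` B)) by rewrite -E; apply.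
apply: smallest_sub.
  split => [|D GD|D GD].
  - by rewrite preimage_set0.
  - by rewrite setTD preimage_setC -setTD; exact: GC.
  - by rewrite preimage_bigcup; exact: GU.
move=> _ [x ->]; rewrite (_ : _ @^-1` _ = [set v : rV | x <= v 0 i])//.
by apply/seteqP; split => v /=; rewrite in_itv/= andbT.
Qed.

Definition boxes : set (set rV) := [set A | exists a b, A = box a b].

Lemma rV_measurable_boxes : @measurable _ rV = <<s boxes >>.
Proof.
apply/seteqP; split; last first.
  apply: smallest_sub; first exact: sigma_algebra_measurable.
  by move=> _ [a [b ->]]; exact: measurable_box.
apply: rV_measurable_sub; first exact: smallest_sigma_algebra.
move=> i x; rewrite (_ : [set v | _] = \bigcup_k
  box (fun j => if j == i then x else - k%:R) (fun j => k%:R)).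
  apply: (@sigma_algebra_bigcup _ _ boxes) => k.
  by apply: sub_sigma_algebra; do 2 eexists.
apply/seteqP; split => [v /= xv|v [k _ /(_ i)]]; last by rewrite eqxx => /andP[].
exists (Num.bound `|v|) => // j.
have := cube_norm 0 v (ler0n R (Num.bound `|v|)); rewrite subr0 => -[_ h].
have /(_ j) := h (ltW (archi_boundP (normr_ge0 v))); rewrite mxE sub0r add0r.
by move=> /andP[h1 ->]; case: eqP => [->|]; rewrite ?h1 ?xv.
Qed.

Lemma boxes_setI : setI_closed boxes.
Proof.
move=> _ _ [a [b ->]] [c [d ->]].
exists (fun i => Num.max (a i) (c i)), (fun i => Num.min (b i) (d i)).
apply/seteqP; split => [v [h1 h2] i|v h].
  have /andP[h3 h4] := h1 i; have /andP[h5 h6] := h2 i.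
  by rewrite ge_max le_min h3 h4 h5.
by split => i; have := h i; rewrite ge_max le_min => /andP[/andP[h1 h2] /andP[h3 h4]];
  rewrite ?h1 ?h2 ?h3.
Qed.

Lemma measurable_affine (a : rV) (t : R) :
  measurable_fun setT (fun x : rV => a + t *: x).
Proof.
apply/measurable_fun_rVP => i; under eq_fun do rewrite !mxE.
by apply: measurable_funD => //; apply: measurable_funM => //; exact: measurable_coord.
Qed.

(* Proved on boxes, which determine the measure. *)
Lemma leb_affine (a : rV) (t : R) (A : set rV) : t != 0 -> measurable A ->
  (leb R n ((fun x : rV => a + t *: x)%R @^-1` A) = (`|t| ^- n)%R%:E * leb R n A)%E.
Proof.
move=> t0 mA.
have tn0 : 0 <= `|t| ^- n by rewrite invr_ge0 exprn_ge0.
pose mu1 : {measure set rV -> \bar R} :=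
  measure_function_pushforward__canonical__measure_function_Measure
    (leb R n) (measurable_affine a t).
pose mu2 : {measure set rV -> \bar R} := mscale (NngNum tn0) (leb R n).
rewrite -[LHS]/(mu1 A) -[RHS]/(mu2 A); apply/esym.
apply: (measure_unique boxes (fun k => cube 0 k%:R)) => //.
- exact: rV_measurable_boxes.
- exact: boxes_setI.
- by move=> k; exists (fun i => (0 : rV) 0 i - k%:R), (fun i => (0 : rV) 0 i + k%:R).
- by have [F FT _] := leb_sigma_finite; apply/seteqP; split => // x _;
  exists (Num.bound `|x|) => //; apply/cube_norm => //; rewrite subr0;
  exact/ltW/archi_boundP.
- move=> _ [b [c ->]]; rewrite /mu1 /mu2 /= /mscale /pushforward/=.
  have [bc|] := pselect (forall i, b i <= c i); last first.
    move=> /existsNP[i /negP]; rewrite -ltNge => cb.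
    by rewrite (box_measure0 cb) preimage_set0 !measure0 mule0.
  rewrite leb_box// -EFinM; apply/esym.
  rewrite (_ : _ @^-1` _ = box
    (fun i => Num.min ((b i - a 0 i) / t) ((c i - a 0 i) / t))
    (fun i => Num.max ((b i - a 0 i) / t) ((c i - a 0 i) / t))); last first.
    apply/seteqP; split => x h i; have := h i; rewrite /= ?mxE;
      have := bc i; move: (b i) (c i) (a 0 i) (x 0 i) => {h bc} b' c' a' x' bc;
      (have [t_gt0|t_lt0] : 0 < t \/ t < 0 by apply/orP; rewrite -neq_lt eq_sym).
    + have e : (b' - a') / t <= (c' - a') / t by rewrite ler_pM2r ?invr_gt0// lerB.
      rewrite (min_idPl e) (max_idPr e) ler_pdivrMr// ler_pdivlMr// (mulrC x'); lra.
    + have e : (c' - a') / t <= (b' - a') / t by rewrite ler_nM2r ?invr_lt0// lerB.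
      rewrite (min_idPr e) (max_idPl e) ler_ndivrMr// ler_ndivlMr// (mulrC x'); lra.
    + have e : (b' - a') / t <= (c' - a') / t by rewrite ler_pM2r ?invr_gt0// lerB.
      rewrite (min_idPl e) (max_idPr e) ler_pdivrMr// ler_pdivlMr// (mulrC x'); lra.
    + have e : (c' - a') / t <= (b' - a') / t by rewrite ler_nM2r ?invr_lt0// lerB.
      rewrite (min_idPr e) (max_idPl e) ler_ndivrMr// ler_ndivlMr// (mulrC x'); lra.
  rewrite leb_box; last by move=> i; rewrite ge_min !le_max !lexx.
  congr (_%:E).
  have -> : `|t| ^- n = \prod_(i < n) `|t|^-1 by rewrite prodr_const card_ord exprVn.
  rewrite -big_split/=.
  apply: eq_bigr => i _; rewrite -normfV.
  have [t_gt0|t_lt0] : 0 < t \/ t < 0 by apply/orP; rewrite -neq_lt eq_sym.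
    have e : (b i - a 0 i) / t <= (c i - a 0 i) / t by rewrite ler_pM2r ?invr_gt0// lerB.
    rewrite (min_idPl e) (max_idPr e) gtr0_norm ?invr_gt0//; ring.
  have e : (c i - a 0 i) / t <= (b i - a 0 i) / t by rewrite ler_nM2r ?invr_lt0// lerB.
  rewrite (min_idPr e) (max_idPl e) ltr0_norm ?invr_lt0//; ring.
- move=> k; rewrite /= /mscale/= -/(cube 0 k%:R) leb_cube//.
  by rewrite -EFinM ltry.
Qed.
End lebesgue_rV.

(** * Integrals of real-valued functions *)

Section real_integral.
Context d (T : measurableType d) (R : realType).
Variable mu : {measure set T -> \bar R}.
Implicit Types (D : set T) (f g h : T -> R).

Definition L1 D f := mu.-integrable D (EFin \o f).

Lemma L1_measurable D f : L1 D f -> measurable_fun D f.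
Proof. by case/integrableP => /measurable_EFinP. Qed.

Lemma L1_dom D f g : measurable D -> measurable_fun D f ->
  (forall x, D x -> `|f x| <= g x) -> L1 D g -> L1 D f.
Proof.
move=> mD mf fg; apply: le_integrable => //; first exact/measurable_EFinP.
move=> x Dx /=; rewrite lee_fin (le_trans (fg _ Dx))//; exact: ler_norm.
Qed.

Lemma L1D D f g : measurable D -> L1 D f -> L1 D g -> L1 D (fun x => f x + g x).
Proof. by move=> mD; exact: integrableD. Qed.

Lemma L1B D f g : measurable D -> L1 D f -> L1 D g -> L1 D (fun x => f x - g x).
Proof. by move=> mD; exact: integrableB. Qed.

Lemma L1Z D f c : measurable D -> L1 D f -> L1 D (fun x => c * f x).
Proof.
move=> mD Lf; have := integrableZl mD c Lf.
by apply: eq_integrable => // x _; rewrite /= EFinM.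
Qed.

Lemma L1Zr D f c : measurable D -> L1 D f -> L1 D (fun x => f x * c).
Proof. by move=> mD /(L1Z c mD); under eq_fun do rewrite mulrC. Qed.

Lemma L1_sum D (I : Type) (s : seq I) (P : pred I) (F : I -> T -> R) : measurable D ->
  (forall i, P i -> L1 D (F i)) -> L1 D (fun x => \sum_(i <- s | P i) F i x).
Proof.
move=> mD LF; elim: s => [|i s IH].
  by under eq_fun do rewrite big_nil; exact: integrable0.
case Pi : (P i); under eq_fun do rewrite big_cons Pi; last by [].
by apply: L1D => //; exact: LF.
Qed.

Lemma L1S D E f : measurable D -> measurable E -> E `<=` D -> L1 D f -> L1 E f.
Proof. by move=> mD mE ED; exact: integrableS. Qed.

Lemma L1_restrict D f : measurable D -> L1 D f <-> L1 setT (fun x => f x * \1_D x).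
Proof.
move=> mD; rewrite /L1 (integrable_mkcond (EFin \o f) mD).
suff -> : (EFin \o f) \_ D = EFin \o (fun x => f x * \1_D x) by [].
apply/funext => x; rewrite /patch /= indicE.
by case: ifP => _; rewrite ?mulr1 ?mulr0.
Qed.

Lemma L1_bounded D f c : measurable D -> (mu D < +oo)%E -> measurable_fun D f ->
  (forall x, D x -> `|f x| <= c) -> L1 D f.
Proof.
move=> mD Doo mf fc; apply: measurable_bounded_integrable => //.
exists c; split; [exact: num_real|move=> x cx y Dy].
exact: le_trans (fc _ Dy) (ltW cx).
Qed.

Lemma L1_fin D f : measurable D -> L1 D f ->
  (\int[mu]_(x in D) f x)%:E = (\int[mu]_(x in D) (f x)%:E)%E.
Proof. by move=> mD Lf; rewrite /Rintegral fineK// integrable_fin_num. Qed.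

Lemma L1_ge0 D f : measurable D -> measurable_fun D f -> (forall x, D x -> 0 <= f x) ->
  (\int[mu]_(x in D) (f x)%:E < +oo)%E -> L1 D f.
Proof.
move=> mD mf f0 foo; apply/integrableP; split; first exact/measurable_EFinP.
rewrite (eq_integral (fun x => (f x)%:E))// => x; rewrite inE => Dx.
by rewrite /= ger0_norm// f0.
Qed.

Lemma RintegralN D f : measurable D -> L1 D f ->
  \int[mu]_(x in D) (- f x) = - \int[mu]_(x in D) f x.
Proof.
move=> mD Lf; under eq_Rintegral do rewrite -mulN1r.
by rewrite RintegralZl// mulN1r.
Qed.

Lemma Rintegral_sum D (I : Type) (s : seq I) (P : pred I) (F : I -> T -> R) :
  measurable D -> (forall i, P i -> L1 D (F i)) ->
  \int[mu]_(x in D) (\sum_(i <- s | P i) F i x) =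
  \sum_(i <- s | P i) \int[mu]_(x in D) F i x.
Proof.
move=> mD LF; elim: s => [|i s IH].
  under eq_Rintegral do rewrite big_nil; rewrite big_nil.
  by rewrite /Rintegral integral0.
rewrite big_cons; under eq_Rintegral do rewrite big_cons.
case: ifP => Pi //; rewrite RintegralD ?IH//; first exact: LF.
exact: L1_sum.
Qed.

Lemma le_Rintegral_ae D f g : measurable D -> L1 D f -> L1 D g ->
  {ae mu, forall x, D x -> f x <= g x} ->
  \int[mu]_(x in D) f x <= \int[mu]_(x in D) g x.
Proof.
move=> mD Lf Lg fg; rewrite -lee_fin !L1_fin//.
rewrite -sube_ge0; last by rewrite orbC -L1_fin.
rewrite -integralB_EFin//.
(* The difference g - f agrees almost everywhere with its positive part, whose integral is
   nonnegative. *)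
rewrite (ae_eq_integral (fun x => ((Num.max (g x - f x) 0)%:E : \bar R)))//.
- by apply: integral_ge0 => x _; rewrite lee_fin le_max lexx orbT.
- by apply: emeasurable_funB; [exact: measurable_int Lg|exact: measurable_int Lf].
- apply/measurable_EFinP; apply: measurable_maxr => //.
  by apply: measurable_funB; exact: L1_measurable.
apply: filterS fg => x fg Dx; rewrite max_l// subr_ge0; exact: fg.
Qed.

Lemma eq_Rintegral_ae D f g : measurable D -> L1 D f -> L1 D g ->
  {ae mu, forall x, D x -> f x = g x} ->
  \int[mu]_(x in D) f x = \int[mu]_(x in D) g x.
Proof.
move=> mD Lf Lg fg; apply/eqP; rewrite eq_le; apply/andP; split;
apply: le_Rintegral_ae => //; apply: filterS fg => x h Dx; by rewrite h.
Qed.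

Lemma Rdominated_cvg D (f_ : nat -> T -> R) f g : measurable D ->
  (forall k, measurable_fun D (f_ k)) -> measurable_fun D f ->
  {ae mu, forall x, D x -> f_ ^~ x @ \oo --> f x} -> L1 D g ->
  {ae mu, forall x k, D x -> `|f_ k x| <= g x} ->
  L1 D f /\ \int[mu]_(x in D) f_ k x @[k --> \oo] --> \int[mu]_(x in D) f x.
Proof.
move=> mD mf_ mf cf Lg fg.
have [||||| Lf _ h] := @dominated_convergence _ _ _ mu D mD (fun k => EFin \o f_ k) (EFin \o f) (EFin \o g).
- by move=> k; exact/measurable_EFinP.
- exact/measurable_EFinP.
- by apply: filterS cf => x cf Dx; apply/fine_cvgP; split;
    [exact: nearW|exact: cf].
- exact: Lg.
- by apply: filterS fg => x fg k Dx; rewrite lee_fin; exact: fg.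
split=> //; rewrite /Rintegral; apply: fine_cvg.
by rewrite fineK// integrable_fin_num.
Qed.

(** With m the mean of g for the probability density rho, expand the variance, the integral of rho
    (g - m)^2, which is nonnegative. *)
Lemma Rjensen D (rho g : T -> R) : measurable D ->
  (forall x, D x -> 0 <= rho x) -> L1 D rho -> \int[mu]_(x in D) rho x = 1 ->
  L1 D (fun x => rho x * g x) -> L1 D (fun x => rho x * g x ^+ 2) ->
  (\int[mu]_(x in D) (rho x * g x)) ^+ 2 <= \int[mu]_(x in D) (rho x * g x ^+ 2).
Proof.
move=> mD rho0 Lrho rho1 Lg Lg2.
set m := \int[mu]_(x in D) (rho x * g x).
have : 0 <= \int[mu]_(x in D) (rho x * (g x - m) ^+ 2).
  by apply: Rintegral_ge0 => x Dx; rewrite mulr_ge0 ?sqr_ge0 ?rho0.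
have -> : \int[mu]_(x in D) (rho x * (g x - m) ^+ 2) =
    \int[mu]_(x in D) (rho x * g x ^+ 2 - 2 * m * (rho x * g x) + m ^+ 2 * rho x).
  by apply: eq_Rintegral => x _; ring.
rewrite RintegralD//; [|apply: L1B => //; exact: L1Z|exact: L1Z].
rewrite RintegralB//; [|exact: L1Z].
rewrite !RintegralZl// rho1 -/m; lra.
Qed.

Lemma Rintegral_setT D f : measurable D ->
  \int[mu]_(x in D) f x = \int[mu]_x (f x * \1_D x).
Proof.
move=> mD; rewrite Rintegral_mkcond; apply: eq_Rintegral => x _.
rewrite /patch /= indicE.
by case: ifP => _; rewrite ?mulr1 ?mulr0.
Qed.

Lemma le_Rintegral_subset D E f : measurable D -> measurable E -> E `<=` D ->
  L1 D f -> (forall x, D x -> 0 <= f x) ->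
  \int[mu]_(x in E) f x <= \int[mu]_(x in D) f x.
Proof.
move=> mD mE ED Lf f0; rewrite -lee_fin !L1_fin//; last exact: (L1S mD).
apply: ge0_subset_integral => //; first exact: measurable_int Lf.
Qed.

Lemma Rintegral0_ae D f : measurable D -> L1 D f -> (forall x, D x -> 0 <= f x) ->
  \int[mu]_(x in D) f x <= 0 -> {ae mu, forall x, D x -> f x = 0}.
Proof.
move=> mD Lf f0 int0.
have : (\int[mu]_(x in D) `|(f x)%:E| = 0)%E.
  rewrite (eq_integral (fun x => (f x)%:E)) => [|x]; last first.
    by rewrite inE => Dx; rewrite /= ger0_norm// f0.
  rewrite -L1_fin//; congr (_%:E); apply/eqP; rewrite eq_le int0.
  exact: Rintegral_ge0.
move/(ae_eq_integral_abs mu mD (measurable_int _ Lf)).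
by apply: filterS => x h Dx; have [] := h Dx.
Qed.
End real_integral.

(** * Borel sets and affine changes of variables *)

Section lebesgue_rV_more.
Variables (R : realType) (n : nat).
Local Notation rV := 'rV[R]_n.

(** A name for [leb R n] to which the sigma-finite structure required by the Fubini and Tonelli
    theorems is attached. *)
Definition lebn : set rV -> \bar R := leb R n.

HB.instance Definition _ := isMeasure.Build _ _ _ lebn
  (@measure0 _ _ _ (leb R n)) (@measure_ge0 _ _ _ (leb R n))
  (@measure_semi_sigma_additive _ _ _ (leb R n)).

HB.instance Definition _ := Measure_isSigmaFinite.Build _ _ _ lebn
  (@leb_sigma_finite R n).

Local Notation mu := lebn.

(** An open set is the union of the countably many cubes with rational centre and radius 1/(k+1)
    that it contains. *)
Lemma rV_open_measurable (U : set rV) : open U -> measurable U.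
Proof.
move=> oU.
pose S := [set p : 'rV[rat]_n * nat | cube (map_mx ratr p.1) p.2.+1%:R^-1 `<=` U].
rewrite (_ : U = \bigcup_p if p \in S then cube (map_mx ratr p.1 : rV) p.2.+1%:R^-1 else set0).
  apply: countable_bigcupT_measurable => [|p]; first exact: countableP.
  by case: ifP => _; [exact: measurable_cube|].
apply/seteqP; split => [x Ux|x [p _]]; last by case: ifP => // /[!inE] Sp; exact: Sp.
have /nbhs_ballP[e /= e0 xeU] : nbhs x U by exact: open_nbhs_nbhs.
have [k ke] : exists k, (k.+1%:R^-1 : R) < e / 2.
  exists (Num.bound (2 / e)); rewrite invf_plt ?posrE ?divr_gt0//.
  rewrite invf_div (lt_trans (archi_boundP _))// ?ltr_nat//.
  by rewrite divr_ge0// ltW.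
have q i : {q : rat | `|x 0 i - ratr q| < k.+1%:R^-1}.
  apply: cid; have xx : x 0 i - k.+1%:R^-1 < x 0 i + k.+1%:R^-1.
    by rewrite ltrD2l gtrN// invr_gt0.
  have [q] := rat_in_itvoo xx.
  rewrite in_itv/= => /andP[h1 h2]; exists q; by rewrite ltr_distlC h1 h2.
exists (\row_i sval (q i), k) => //; rewrite ifT /=; last rewrite inE /S/=.
  by move=> i; rewrite !mxE; case: (q i) => q' /=; rewrite ltr_distl => /andP[/ltW -> /ltW ->].
move=> y; rewrite cube_norm ?invr_ge0// => yx; apply: xeU.
rewrite -ball_normE/=; have {}ke : k.+1%:R^-1 + k.+1%:R^-1 < e :> R by move: ke; move: (k.+1%:R^-1) => z; lra.
apply: le_lt_trans ke.
rewrite (le_trans (ler_distD (map_mx ratr (\row_i sval (q i))) _ _))// lerD//.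
  rewrite -cube_norm ?invr_ge0// => i; rewrite !mxE.
  by case: (q i) => q' /=; rewrite ltr_distl => /andP[/ltW -> /ltW ->].
by rewrite distrC.
Qed.

Lemma rV_continuous_measurable (f : rV -> R) : continuous f -> measurable_fun setT f.
Proof.
move=> cf; apply: (measurability _ (RGenOpens.measurableE R)) => _ [_ [a [b ->] <-]].
rewrite setTI; apply: rV_open_measurable.
by move/continuousP : cf; apply; exact: interval_open.
Qed.

Lemma ge0_integral_affine (a : rV) (t : R) (f : rV -> \bar R) : t != 0 ->
  measurable_fun setT f -> (forall x, 0 <= f x)%E ->
  (\int[mu]_x f (a + t *: x)%R = (`|t| ^- n)%R%:E * \int[mu]_x f x)%E.
Proof.
move=> t0 mf f0.
have tn0 : 0 <= `|t| ^- n by rewrite invr_ge0 exprn_ge0.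
have := @ge0_integral_pushforward _ _ _ _ _ _ (measurable_affine a t) mu setT f
  measurableT mf (fun x _ => f0 x).
rewrite preimage_setT => <-.
rewrite -(ge0_integral_mscale _ _ (NngNum tn0))//.

pose mu1 : {measure set rV -> \bar R} :=
  measure_function_pushforward__canonical__measure_function_Measure
    mu (measurable_affine a t).
apply: (@eq_measure_integral _ _ _ _ _ mu1) => A mA _; rewrite /= /mscale/=.
exact (leb_affine a t0 mA).
Qed.

Lemma integrable_affine (a : rV) (t : R) (f : rV -> R) : t != 0 ->
  L1 mu setT f -> L1 mu setT (fun x => f (a + t *: x)).
Proof.
move=> t0 Lf; have mf := L1_measurable Lf.
have mg : measurable_fun setT (fun x : rV => f (a + t *: x)).
  exact: measurableT_comp mf (measurable_affine a t).
apply/integrableP; split; first exact/measurable_EFinP.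
rewrite (@ge0_integral_affine a t (fun x => `|(f x)%:E|%E))//.
  have /integrableP[_ foo] := Lf.
  by rewrite lte_mul_pinfty ?lee_fin ?invr_ge0 ?exprn_ge0.
by apply: measurableT_comp => //; exact/measurable_EFinP.
Qed.

Lemma Rintegral_affine (a : rV) (t : R) (f : rV -> R) : t != 0 ->
  L1 mu setT f ->
  \int[mu]_x f (a + t *: x) = `|t| ^- n * \int[mu]_x f x.
Proof.
move=> t0 Lf; apply: EFin_inj; rewrite EFinM !L1_fin//; last exact: integrable_affine.
have mf := L1_measurable Lf.
rewrite [LHS]integralE [X in (_ * X)%E]integralE.
have Ep (x : rV) : ((fun x0 : rV => (f (a + t *: x0)%R)%:E)^\+ x = (EFin \o f)^\+ (a + t *: x)%R)%E by rewrite !funeposE.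
have En (x : rV) : ((fun x0 : rV => (f (a + t *: x0)%R)%:E)^\- x = (EFin \o f)^\- (a + t *: x)%R)%E by rewrite !funenegE.
rewrite (eq_integral _ _ (fun x _ => Ep x)) (eq_integral _ _ (fun x _ => En x)).
have mF : measurable_fun setT (EFin \o f) by exact/measurable_EFinP.
rewrite ge0_integral_affine//; last exact: measurable_funepos.
rewrite ge0_integral_affine//; last exact: measurable_funeneg.
rewrite [RHS]muleBr// fin_num_adde_defl// fin_numN.
exact: (integrable_neg_fin_num measurableT Lf).
Qed.

Lemma Rintegral_shift (a : rV) (f : rV -> R) : L1 mu setT f ->
  \int[mu]_x f (a + x) = \int[mu]_x f x.
Proof.
move=> Lf; have := @Rintegral_affine a 1 f (oner_neq0 _) Lf.
rewrite normr1 expr1n invr1 mul1r => <-.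
by apply: eq_Rintegral => x _; rewrite scale1r.
Qed.

Lemma L1_shift (a : rV) (f : rV -> R) : L1 mu setT f ->
  L1 mu setT (fun x => f (a + x)).
Proof.
by move/(@integrable_affine a 1 f (oner_neq0 _)); under eq_fun do rewrite scale1r.
Qed.

Lemma Rintegral_reflect (a : rV) (f : rV -> R) : L1 mu setT f ->
  \int[mu]_x f (a - x) = \int[mu]_x f x.
Proof.
have t0 : -1 != 0 :> R by rewrite oppr_eq0 oner_neq0.
move=> Lf; have := @Rintegral_affine a (-1) f t0 Lf.
rewrite normrN normr1 expr1n invr1 mul1r => <-.
by apply: eq_Rintegral => x _; rewrite scaleN1r.
Qed.

Lemma L1_reflect (a : rV) (f : rV -> R) : L1 mu setT f ->
  L1 mu setT (fun x => f (a - x)).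
Proof.
have t0 : -1 != 0 :> R by rewrite oppr_eq0 oner_neq0.
by move/(@integrable_affine a (-1) f t0); under eq_fun do rewrite scaleN1r.
Qed.

Lemma ge0_integral_shift (a : rV) (f : rV -> \bar R) :
  measurable_fun setT f -> (forall x, 0 <= f x)%E ->
  (\int[mu]_x f (a + x)%R = \int[mu]_x f x)%E.
Proof.
move=> mf f0; have := @ge0_integral_affine a 1 f (oner_neq0 _) mf f0.
rewrite normr1 expr1n invr1 mul1e => <-.
by apply: eq_integral => x _; rewrite scale1r.
Qed.

Lemma measurable_rV_lin (d : measure_display) (T : measurableType d) (f g : T -> rV) (t : T -> R) :
  measurable_fun setT f -> measurable_fun setT g -> measurable_fun setT t ->
  measurable_fun setT (fun x => f x + t x *: g x).
Proof.
move=> mf mg mt; apply/measurable_fun_rVP => i; under eq_fun do rewrite !mxE.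
have /measurable_fun_rVP/(_ i) mfi := mf; have /measurable_fun_rVP/(_ i) mgi := mg.
by apply: measurable_funD => //; apply: measurable_funM.
Qed.

Lemma measurable_rV_sub (d : measure_display) (T : measurableType d) (f g : T -> rV) :
  measurable_fun setT f -> measurable_fun setT g ->
  measurable_fun setT (fun x => f x - g x).
Proof.
move=> mf mg; have := measurable_rV_lin mf mg (measurable_cst (-1 : R)).
by under eq_fun do rewrite scaleN1r.
Qed.

End lebesgue_rV_more.

(** * Smooth functions *)

Section flat_functions.
Variable R : realType.
Implicit Types (p q : {poly R}) (t : R).

(* [flat p] extends t |-> p(1/t) exp(-1/t) by 0 for t <= 0. *)
Definition flat p t : R := if 0 < t then p.[t^-1] * expR (- t^-1) else 0.

(** With y = 1/t one has d/dt = - y^2 d/dy, which turns p(y) exp(-y) into y^2 (p - p')(y) exp(-y).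
    The [flat] functions are thus closed under differentiation. *)
Definition dflat p : {poly R} := 'X^2 * (p - p^`()).

(** Termwise, since y^i exp(-y) <= i! by the exponential series. *)
Lemma poly_expRN_bounded p :
  exists c, 0 <= c /\ forall y, 0 <= y -> `|p.[y] * expR (- y)| <= c.
Proof.
exists (\sum_(i < size p) `|p`_i| * i`!%:R); split.
  by apply: sumr_ge0 => i _; rewrite mulr_ge0.
move=> y y0; rewrite horner_coef mulr_suml (le_trans (ler_norm_sum _ _ _))//.
apply: ler_sum => i _; rewrite -mulrA normrM ler_wpM2l//.
rewrite ger0_norm ?mulr_ge0 ?exprn_ge0 ?expR_ge0// expRN ler_pdivrMr ?expR_gt0//.
case: (i : nat) => [|k].
  by rewrite expr0 fact0 mul1r (le_trans _ (expR_ge1Dx _))// lerDl.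
rewrite mulrC -ler_pdivrMr ?ltr0n ?fact_gt0//.
by rewrite (le_trans _ (expR_ge1Dxn k y0))// lerDr.
Qed.

Lemma flat_bounded p : exists c, 0 <= c /\ forall t, `|flat p t| <= c.
Proof.
have [c [c0 pc]] := poly_expRN_bounded p; exists c; split => // t.
rewrite /flat; case: ifP => t0; last by rewrite normr0.
by apply: pc; rewrite invr_ge0 ltW.
Qed.

Lemma flat_le0 p t : t <= 0 -> flat p t = 0.
Proof. by rewrite /flat ltNge => ->. Qed.

Lemma is_derive_flat p t : is_derive t 1 (flat p) (flat (dflat p) t).
Proof.
have [t0|t0|->] := ltgtP t 0.
- rewrite flat_le0 ?(ltW t0)//.
  apply: (@near_eq_is_derive _ _ _ (cst 0)) => //; near=> x.
  by rewrite flat_le0// ltW//; near: x; exact: lt_nbhsl.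
- apply: (@near_eq_is_derive _ _ _ (fun t => p.[t^-1] * expR (- t^-1))).
    near=> x; rewrite /flat ifT//; near: x; exact: lt_nbhsr.
  have tn0 : t != 0 by rewrite gt_eqF.
  have dV : is_derive t 1 (fun t : R => t^-1) (- t ^- 2).
    apply: (@is_derive_eq _ _ _ _ _ _ _ _ (is_deriveV tn0 (is_derive_id _ _))).
    by rewrite scaler1.
  have dVN : is_derive t 1 (fun t : R => - t^-1) (t ^- 2).
    by apply: is_derive_eq; rewrite opprK.
  have d1 := @is_derive1_comp _ (horner p) (fun t : R => t^-1) t _ _ _ dV.
  have d2 := @is_derive1_comp _ expR (fun t : R => - t^-1) t _ _ _ dVN.
  apply: is_derive_eq.
  rewrite /flat t0 /dflat !hornerE /= /GRing.scale/= exprVn; ring.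
- rewrite flat_le0//.
  suff h : h^-1 *: ((flat p \o shift 0) (h *: 1) - flat p 0) @[h --> 0^'] --> (0 : R).
    by apply: DeriveDef; [apply/cvg_ex; exists 0|exact/cvg_lim].
  have [c [c0 pc]] := poly_expRN_bounded ('X^2 * p).
  apply/cvgrPdist_le => e e0; near=> h.
  have -> : h^-1 *: ((flat p \o shift 0) (h *: 1) - flat p 0) = h^-1 * flat p h.
    by rewrite /= [flat p 0]flat_le0// subr0 addr0 /GRing.scale/= mulr1.
  rewrite sub0r normrN /flat.
  case: ifP => h0; last by rewrite mulr0 normr0 ltW.
  have hn0 : h != 0 by rewrite gt_eqF.
  (* The difference quotient at 0 is h times a value of y^2 p(y) exp(-y), which is bounded; hence it
     tends to 0. *)
  have -> : h^-1 * (p.[h^-1] * expR (- h^-1)) = h * (('X^2 * p).[h^-1] * expR (- h^-1)).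
    by rewrite !hornerE /=; field.
  rewrite normrM (le_trans (ler_wpM2l _ (pc _ _)))// ?invr_ge0 ?(ltW h0)//.
  rewrite (le_trans (_ : _ <= `|h| * (c + 1)))// ?ler_wpM2l// ?lerDl//.
  rewrite -ler_pdivlMr ?ltr_wpDl//; near: h; apply: dnbhs0_le.
  by rewrite divr_gt0// ltr_wpDl.
Unshelve. all: by end_near. Qed.

End flat_functions.

Section smooth_functions.
Variables (R : realType) (n : nat).
Local Notation rV := 'rV[R]_n.
Implicit Types (phi : rV -> R) (x v : rV).

Lemma smooth_differentiable phi x : smooth phi -> differentiable phi x.
Proof. by move/(_ [::] x). Qed.

Lemma smooth_continuous phi : smooth phi -> continuous phi.
Proof. move=> sphi x; exact/differentiable_continuous/smooth_differentiable. Qed.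

Lemma smooth_partial phi j : smooth phi -> smooth (partial j phi).
Proof. by move=> sphi s x; rewrite -foldr_rcons; exact: sphi. Qed.

Lemma derive_partial phi x v : differentiable phi x ->
  'D_v phi x = \sum_i v 0 i * partial i phi x.
Proof.
move=> dphi; rewrite deriveE// {1}(matrix_sum_delta v).
rewrite big_ord1 linear_sum; apply: eq_bigr => i _.
by rewrite linearZ/= /partial deriveE// /GRing.scale/= /basis_vec.
Qed.

Lemma derive_comp1 (f : R -> R) phi x v df :
  is_derive (phi x) 1 f df -> differentiable phi x ->
  differentiable (f \o phi) x /\ 'D_v (f \o phi) x = df * 'D_v phi x.
Proof.
move=> dfx dphi.
have df1 : differentiable f (phi x) by apply/derivable1_diffP.
have dc := differentiable_comp dphi df1.
split=> //; rewrite !deriveE// diff_comp//= deriv1E; last by case: dfx.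
by rewrite derive1E; case: dfx => _ ->; rewrite mulrC.
Qed.

(* The least class that contains the smooth functions and the compositions needed
   below and that is stable under [partial]. *)
Inductive smooth_expr : (rV -> R) -> Prop :=
| SmoothBase phi : smooth phi -> smooth_expr phi
| SmoothCst c : smooth_expr (fun=> c)
| SmoothCoord i : smooth_expr (fun x => x 0 i)
| SmoothAdd phi psi : smooth_expr phi -> smooth_expr psi ->
    smooth_expr (fun x => phi x + psi x)
| SmoothMul phi psi : smooth_expr phi -> smooth_expr psi ->
    smooth_expr (fun x => phi x * psi x)
| SmoothFlat p phi : smooth_expr phi -> smooth_expr (flat p \o phi)
| SmoothInv phi : (forall x, 0 < phi x) -> smooth_expr phi ->
    smooth_expr (fun x => (phi x)^-1)
| SmoothLn phi : (forall x, 0 < phi x) -> smooth_expr phi ->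
    smooth_expr (fun x => ln (phi x)).

Lemma smooth_expr_partial phi : smooth_expr phi ->
  (forall x, differentiable phi x) /\ forall j, smooth_expr (partial j phi).
Proof.
elim=> {phi} [phi sphi|c|i|phi psi _ [dphi pphi] _ [dpsi ppsi]
  |phi psi sphi [dphi pphi] spsi [dpsi ppsi]|p phi sphi [dphi pphi]
  |phi phi0 sphi [dphi pphi]|phi phi0 sphi [dphi pphi]].
- split=> [x|j]; first exact: smooth_differentiable.
  by apply: SmoothBase; exact: smooth_partial.
- split=> [x|j]; first exact: differentiable_cst.
  rewrite (_ : partial _ _ = fun=> 0); first exact: SmoothCst.
  by apply/funext => x; exact: derive_cst.
- have dc x : differentiable (fun x : rV => x 0 i) x by exact: differentiable_coord.
  split=> // j; rewrite (_ : partial _ _ = fun=> (i == j)%:R); first exact: SmoothCst.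
  apply/funext => x; rewrite /partial deriveE//.
  have lin : linear (fun x : rV => x 0 i : R^o) by move=> a u v; rewrite !mxE.
  pose L := GRing.isLinear.Build _ _ _ _ _ lin.
  pose f : {linear rV -> R^o} := HB.pack (fun x : rV => x 0 i : R^o) L.
  have cf : continuous f by exact: coord_continuous.
  have := @diff_lin R _ _ f x cf => /= ->.
  by rewrite /f /= /basis_vec mxE eqxx/= eq_sym.
- split=> [x|j]; first exact: differentiableD.
  rewrite (_ : partial _ _ = fun x => partial j phi x + partial j psi x).
    exact: SmoothAdd.
  by apply/funext => x; rewrite /partial deriveD//; exact: diff_derivable.
- split=> [x|j]; first exact: differentiableM.
  rewrite (_ : partial _ _ = fun x => phi x * partial j psi x + psi x * partial j phi x).
    by apply: SmoothAdd; apply: SmoothMul.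
  by apply/funext => x; rewrite /partial deriveM//; exact: diff_derivable.
- have dfx x v := derive_comp1 v (is_derive_flat p (phi x)) (dphi x).
  split=> [x|j]; first by have [] := dfx x 0.
  rewrite (_ : partial _ _ = fun x => (flat (dflat p) \o phi) x * partial j phi x).
    by apply: SmoothMul => //; exact: SmoothFlat.
  by apply/funext => x; have [_] := dfx x (basis_vec R j).
- have dV x : is_derive (phi x) 1 (fun t : R => t^-1) (- (phi x) ^- 2).
    have p0 := lt0r_neq0 (phi0 x); apply: (@is_derive_eq _ _ _ _ _ _ _ _ (is_deriveV p0 (is_derive_id _ _))).
    by rewrite scaler1.
  have dfx x v := derive_comp1 v (dV x) (dphi x).
  split=> [x|j]; first by have [] := dfx x 0.
  rewrite (_ : partial _ _ = fun x => (- 1) * ((phi x)^-1 * (phi x)^-1) * partial j phi x).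
    apply: SmoothMul => //; apply: SmoothMul; first exact: SmoothCst.
    by apply: SmoothMul; exact: SmoothInv.
  apply/funext => x; have [_] := dfx x (basis_vec R j); rewrite /partial => ->.
  by rewrite mulN1r -expr2 exprVn.
- have dfx x v := derive_comp1 v (is_derive1_ln (phi0 x)) (dphi x).
  split=> [x|j]; first by have [] := dfx x 0.
  rewrite (_ : partial _ _ = fun x => (phi x)^-1 * partial j phi x).
    by apply: SmoothMul => //; exact: SmoothInv.
  by apply/funext => x; have [_] := dfx x (basis_vec R j).
Qed.

(** A class of differentiable functions that is stable under [partial] consists of smooth
    functions. *)
Lemma smooth_exprP phi : smooth_expr phi -> smooth phi.
Proof.
move=> sphi s x; have [] := smooth_expr_partial (_ : smooth_expr (foldr (@partial R n) phi s)).
  by elim: s => //= j s IH; have [_] := smooth_expr_partial IH; exact.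
by move=> d _; exact: d.
Qed.

Lemma is_derive_line phi x v t : differentiable phi (x + t *: v) ->
  is_derive t 1 (fun t : R => phi (x + t *: v)) ('D_v phi (x + t *: v)).
Proof.
move=> dphi; have /derivableP dv := @diff_derivable _ _ _ _ _ v dphi.
suff E : (fun h => h^-1 *: (((fun t : R => phi (x + t *: v)) \o shift t) (h *: 1) -
     phi (x + t *: v))) =
   (fun h => h^-1 *: ((phi \o shift (x + t *: v)) (h *: v) - phi (x + t *: v))).
  by apply: DeriveDef; rewrite ?/derivable ?/derive E; [case: dv|].
apply/funext => h /=; congr (_ *: (phi _ - _)).
have -> : h *: (1 : R) = h by rewrite /GRing.scale/= mulr1.
by rewrite scalerDl addrCA.
Qed.

Lemma line_MVT phi x v : (forall y, differentiable phi y) ->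
  exists2 t, t \in `[0, 1] & phi (x + v) - phi x = 'D_v phi (x + t *: v).
Proof.
move=> dphi.
have dline t := is_derive_line (dphi (x + t *: v)).
have [|t t01] := @MVT_segment _ _ _ 0 1 ler01 (fun t _ => dline t).
  by apply: derivable_within_continuous => t _; case: (dline t).
by rewrite scale1r scale0r addr0 subr0 mulr1 => E; exists t.
Qed.
End smooth_functions.

Section test_functions.
Variables (R : realType) (n : nat).
Local Notation rV := 'rV[R]_n.
Implicit Types (phi psi : rV -> R) (x y v : rV) (Omega : set rV).

Lemma basis_vecE (i j : 'I_n) : (basis_vec R i) 0 j = (i == j)%:R.
Proof. by rewrite /basis_vec mxE eqxx eq_sym. Qed.

Lemma norm_basis_vec (i : 'I_n) : `|basis_vec R i| <= 1.
Proof.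
have /(_ (basis_vec R i)) := @cube_norm R n 0 1 _ ler01; rewrite subr0 => -[h _].
by apply: h => j; rewrite basis_vecE mxE; case: (i == j) => /=; lra.
Qed.

Lemma coord_le_norm x i : `|x 0 i| <= `|x|.
Proof.
have := @cube_norm R n 0 `|x| x (normr_ge0 _); rewrite subr0 => -[_ h].
by have := h (lexx _) i; rewrite mxE sub0r add0r ler_norml.
Qed.

Lemma derive_scale phi x v (c : R) : differentiable phi x ->
  'D_(c *: v) phi x = c * 'D_v phi x.
Proof. by move=> dphi; rewrite !deriveE// linearZ. Qed.

(** Two applications of the mean value theorem, first along e_i to the difference in direction e_j,
    then along e_j. *)
Let second_difference phi x i j (h : R) : smooth phi -> 0 <= h ->
  exists2 y, `|y - x| <= h + h &
  phi (x + h *: basis_vec R i + h *: basis_vec R j) - phi (x + h *: basis_vec R i) -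
  (phi (x + h *: basis_vec R j) - phi x) = h * h * partial j (partial i phi) y.
Proof.
move=> sphi h0; set a := basis_vec R i; set b := basis_vec R j.
pose g y := phi (y + h *: b) - phi y.
have dsh y : differentiable (fun y => phi (y + h *: b)) y.
  apply: (@differentiable_comp _ _ _ _ (fun y => y + h *: b) phi).
    exact: differentiableD.
  exact: smooth_differentiable.
have dg y : differentiable g y.
  by apply: differentiableB => //; exact: smooth_differentiable.
have [s s01] := line_MVT x (h *: a) dg.
have spi := smooth_partial i sphi.
have -> : 'D_(h *: a) g (x + s *: (h *: a)) =
    h * (partial i phi (x + s *: (h *: a) + h *: b) - partial i phi (x + s *: (h *: a))).
  rewrite derive_scale//; congr (_ * _).
  rewrite deriveB; [|exact: diff_derivable..|exact/diff_derivable/smooth_differentiable].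
  suff -> : 'D_a (fun y => phi (y + h *: b)) (x + s *: (h *: a)) =
    'D_a phi (x + s *: (h *: a) + h *: b) by [].
  move: (x + _) => z; rewrite /derive.
  suff -> : (fun t => t^-1 *: (((fun y => phi (y + h *: b)) \o shift z) (t *: a) -
      phi (z + h *: b))) = (fun t => t^-1 *: ((phi \o shift (z + h *: b)) (t *: a) -
      phi (z + h *: b))) by [].
  by apply/funext => t /=; rewrite -addrA.
have [t t01] := line_MVT (x + s *: (h *: a)) (h *: b) (fun y => smooth_differentiable y spi).
rewrite derive_scale; last exact: smooth_differentiable.
move=> -> E; exists (x + s *: (h *: a) + t *: (h *: b)).
  rewrite addrAC (addrC x) addrK.
  move: s01 t01; rewrite !in_itv/= => /andP[s0 s1] /andP[t0 t1].
  rewrite (le_trans (ler_normD _ _))// !normrZ !ger0_norm// lerD//.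
    by rewrite -[leRHS]mulr1 -[leRHS]mul1r !ler_pM ?mulr_ge0// norm_basis_vec.
  by rewrite -[leRHS]mulr1 -[leRHS]mul1r !ler_pM ?mulr_ge0// norm_basis_vec.
by rewrite -mulrA; exact: E.
Qed.

Let tri (e a b c d : R) : `|a - c| < e / 2 -> `|b - d| < e / 2 -> c = d -> `|a - b| <= e.
Proof. by move=> h1 h2 cd; move: h1 h2; rewrite cd !ltr_norml ler_norml; lra. Qed.

(** The second difference is symmetric in i and j, so the two mixed derivatives agree at two points
    close to x; their continuity brings both points to x. *)
Lemma partialC phi i j : smooth phi -> partial i (partial j phi) = partial j (partial i phi).
Proof.
move=> sphi; apply/funext => x; apply/eqP; rewrite -subr_eq0 -normr_le0.
apply/ler_addgt0Pr => e e0; rewrite add0r.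
have cont k l : \forall y \near x,
    `|partial k (partial l phi) x - partial k (partial l phi) y| < e / 2.
  have /(_ x)/cvgrPdist_lt := smooth_continuous (smooth_partial k (smooth_partial l sphi)).
  by apply; rewrite divr_gt0.
have [d /= d0 xd] : exists2 d : R, 0 < d & forall y, `|y - x| < d ->
    `|partial i (partial j phi) x - partial i (partial j phi) y| < e / 2 /\
    `|partial j (partial i phi) x - partial j (partial i phi) y| < e / 2.
  have : nbhs x (fun y =>
    `|partial i (partial j phi) x - partial i (partial j phi) y| < e / 2 /\
    `|partial j (partial i phi) x - partial j (partial i phi) y| < e / 2).
    exact: filterI (cont i j) (cont j i).
  move=> /nbhs_ballP[d /= d0 xd].
  by exists d => // y yx; apply: xd; rewrite -ball_normE/= distrC.
have [r r0 rd] : exists2 r, 0 < r & r + r < d by exists (d / 3); lra.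
have [y yx E1] := @second_difference phi x j i r sphi (ltW r0).
have [z zx E2] := @second_difference phi x i j r sphi (ltW r0).
have Eyz : partial i (partial j phi) y = partial j (partial i phi) z.
  have hh : r * r != 0 by rewrite mulf_neq0 ?gt_eqF.
  have r4 (a b c e' : R) : a - b - (c - e') = a - c - (b - e') by ring.
  apply: (mulfI hh); apply: (etrans (esym E1)); apply: etrans E2.
  by rewrite [x + _ + r *: basis_vec R i]addrAC r4.
have [h1 _] := xd y (le_lt_trans yx rd).
have [_ h2] := xd z (le_lt_trans zx rd).
exact: (tri h1 h2 Eyz).
Qed.

Lemma partial_near0 phi j x : (\forall y \near x, phi y = 0) -> partial j phi x = 0.
Proof.
move=> h; rewrite /partial (@near_eq_derive _ _ _ _ (cst 0))//; exact: derive_cst.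
Qed.

Lemma partial_support phi j :
  closure [set x | partial j phi x != 0] `<=` closure [set x | phi x != 0].
Proof.
move=> x hx; apply: (@closed_closure _ [set x | phi x != 0]); move: x hx.
apply: closure_subset => x /=; apply: contra_neqP => nx.
apply: partial_near0; have : nbhs x (~` closure [set x | phi x != 0]).
  apply: open_nbhs_nbhs; split=> //; apply: closed_openC; exact: closed_closure.
apply: filterS => y /= ny; apply/eqP/negPn/negP => y0; apply: ny.
exact: subset_closure.
Qed.

Lemma test_partial Omega phi j : test_function Omega phi -> test_function Omega (partial j phi).
Proof.
case=> sphi cphi Ophi; split; first exact: smooth_partial.
  apply: subclosed_compact cphi _; first exact: closed_closure.
  exact: partial_support.
exact: subset_trans (@partial_support _ _) Ophi.
Qed.

Lemma test_mul Omega phi psi : smooth phi -> test_function Omega psi ->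
  test_function Omega (fun x => psi x * phi x).
Proof.
move=> sphi [spsi cpsi Opsi].
have sub : closure [set x | psi x * phi x != 0] `<=` closure [set x | psi x != 0].
  by apply: closure_subset => x /=; rewrite mulf_eq0 negb_or => /andP[].
split; last exact: subset_trans sub Opsi.
  by apply: smooth_exprP; apply: SmoothMul; exact: SmoothBase.
exact: subclosed_compact (@closed_closure _ _) cpsi sub.
Qed.

Lemma test_subset A B phi : A `<=` B -> test_function A phi -> test_function B phi.
Proof. by move=> AB [s c Aphi]; split => //; exact: subset_trans Aphi AB. Qed.

Lemma test_bounded Omega phi : test_function Omega phi ->
  exists c, 0 <= c /\ forall x, `|phi x| <= c.
Proof.
move=> [sphi cphi _].
have cn : continuous (fun x => `|phi x|).
  by move=> x; apply: continuous_comp; [exact: smooth_continuous|exact: norm_continuous].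
have [e0|/set0P ne] := eqVneq (closure [set x | phi x != 0]) set0.
  exists 0; split=> // x; rewrite normr_le0; apply/negPn/negP => px.
  have : closure [set x | phi x != 0] x by apply: subset_closure.
  by rewrite e0.
have [c _ hc] := EVT_max_rV ne cphi (continuous_subspaceT cn).
exists `|phi c|; split=> // x.
have [->|x0] := eqVneq (phi x) 0; first by rewrite normr0.
by apply: hc; rewrite inE; apply: subset_closure.
Qed.

(** The partial derivatives of a test function are Lipschitz. The remainder is uniform in x, so it
    can be integrated against a function that is merely integrable. *)
Lemma test_taylor Omega phi : test_function Omega phi ->
  exists c, 0 <= c /\ forall x v,
    `|phi (x + v) - phi x - \sum_i v 0 i * partial i phi x| <= c * `|v| ^+ 2.
Proof.
move=> tphi; have sphi : smooth phi by case: tphi.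
have lip i : exists c, 0 <= c /\ forall x v, `|partial i phi (x + v) - partial i phi x| <= c * `|v|.
  have tpi := test_partial i tphi.
  have bd j : {c | 0 <= c /\ forall x, `|partial j (partial i phi) x| <= c}.
    by apply: cid; exact: test_bounded (test_partial j tpi).
  exists (\sum_j sval (bd j)); split.
    by apply: sumr_ge0 => j _; case: (bd j) => c [].
  move=> x v.
  have [t _ ->] := line_MVT x v (fun y => smooth_differentiable y (smooth_partial i sphi)).
  rewrite derive_partial; last exact/smooth_differentiable/smooth_partial.
  rewrite (le_trans (ler_norm_sum _ _ _))// mulr_suml ler_sum// => j _.
  rewrite normrM mulrC ler_pM ?coord_le_norm//.
  by case: (bd j) => c [].
pose L i := cid (lip i).
exists (\sum_i sval (L i)); split.
  by apply: sumr_ge0 => j _; case: (L j) => c [].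
move=> x v.
have [t t01 ->] := line_MVT x v (fun y => smooth_differentiable y sphi).
rewrite derive_partial; last exact/smooth_differentiable.
rewrite -sumrB (le_trans (ler_norm_sum _ _ _))// mulr_suml ler_sum// => j _.
rewrite -mulrBr normrM; case: (L j) => c [c0 /= hc].
rewrite mulrC expr2 mulrA ler_pM ?coord_le_norm//.
rewrite (le_trans (hc _ _))// ler_wpM2l// normrZ.
move: t01; rewrite in_itv/= => /andP[t0 t1].
by rewrite ger0_norm// ler_piMl.
Qed.

Lemma test_lipschitz Omega phi : test_function Omega phi ->
  exists c, 0 <= c /\ forall x v, `|phi (x + v) - phi x| <= c * `|v|.
Proof.
move=> tphi; have sphi : smooth phi by case: tphi.
have bd j : {c | 0 <= c /\ forall x, `|partial j phi x| <= c}.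
  by apply: cid; exact: test_bounded (test_partial j tphi).
exists (\sum_j sval (bd j)); split.
  by apply: sumr_ge0 => j _; case: (bd j) => c [].
move=> x v.
have [t _ ->] := line_MVT x v (fun y => smooth_differentiable y sphi).
rewrite derive_partial; last exact/smooth_differentiable.
rewrite (le_trans (ler_norm_sum _ _ _))// mulr_suml ler_sum// => j _.
rewrite normrM mulrC ler_pM ?coord_le_norm//.
by case: (bd j) => c [].
Qed.
End test_functions.

(** * Mollification *)

Section convolution.
Variables (R : realType) (n : nat).
Local Notation rV := 'rV[R]_n.
Local Notation mu := (@lebn R n).
Implicit Types (f g : rV -> R) (phi rho : rV -> R) (x y v : rV) (Omega : set rV).

(** A quadratic remainder at the single point x identifies the differential there. *)
Lemma taylor_differentiable g x (a : 'I_n -> R) c : 0 <= c ->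
  (forall v, `|g (x + v) - g x - \sum_i v 0 i * a i| <= c * `|v| ^+ 2) ->
  differentiable g x /\ forall i, partial i g x = a i.
Proof.
move=> c0 hg.
pose W : normedModType R := R.
pose l (v : rV) : W := \sum_i v 0 i * a i.
have lin : linear l.
  move=> k u v; rewrite /l scaler_sumr -big_split/=; apply: eq_bigr => i _.
  by rewrite !mxE mulrDl /GRing.scale/= mulrA.
pose mL := GRing.isLinear.Build _ _ _ _ l lin.
pose L : {linear rV -> W} := HB.pack l mL.
have cL : continuous L.
  move=> v; rewrite (_ : (L : rV -> W) = \sum_i (fun v : rV => v 0 i * a i)).
    apply/differentiable_continuous/differentiable_sum => i.
    by apply: differentiableM => //; exact: differentiable_coord.
  by apply/funext => w; rewrite fct_sumE.
have near_o (e : R) : 0 < e -> \forall v \near (0 : rV),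
    `|g (v + x) - (g x + l v)| <= e * `|v|.
  move=> e0; near=> v.
  rewrite opprD addrA [v + x]addrC (le_trans (hg v))//.
  rewrite expr2 mulrA ler_wpM2r//.
  rewrite (@le_trans _ _ ((c + 1) * `|v|))// ?ler_wpM2r ?lerDl//.
  rewrite mulrC -ler_pdivlMr ?ltr_wpDl//; near: v.
  apply/nbhs_ballP; exists (e / (c + 1)); first by rewrite /= divr_gt0// ltr_wpDl.
  by move=> w; rewrite -ball_normE/= sub0r normrN => /ltW.
have dL : 'd (g : rV -> W) x = L :> (rV -> W).
  apply: (@diff_unique R rV W g L x cL).
  by apply/eqaddoP => e e0; exact: near_o.
have dg : differentiable (g : rV -> W) x.
  apply/diff_locallyP; rewrite dL; split; first exact: cL.
  by apply/eqaddoP => e e0; exact: near_o.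
split=> // i; rewrite /partial deriveE//.
rewrite [LHS](_ : _ = L (basis_vec R i)); last by rewrite -dL.
rewrite /L/= /l (bigD1 i)//= big1 ?addr0 => [|j ji].
  by rewrite basis_vecE eqxx mul1r.
by rewrite basis_vecE eq_sym (negbTE ji) mul0r.
Unshelve. all: by end_near. Qed.

Lemma smooth_measurable phi : smooth phi -> measurable_fun setT phi.
Proof. by move=> /smooth_continuous; exact: rV_continuous_measurable. Qed.

Lemma measurable_reflect x : measurable_fun setT (fun y : rV => x - y).
Proof. by apply: measurable_rV_sub. Qed.

Lemma conv_integrable Omega f phi x : L1 mu setT f -> test_function Omega phi ->
  L1 mu setT (fun y => f y * phi (x - y)).
Proof.
move=> Lf tphi; have [c [c0 hc]] := test_bounded tphi.
apply: (@L1_dom _ _ _ mu setT _ (fun y => c * `|f y|)) => //.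
- apply: measurable_funM; first exact: L1_measurable Lf.
  have sphi : smooth phi by case: tphi.
  exact: (measurableT_comp (smooth_measurable sphi) (measurable_reflect x)).
- by move=> y _; rewrite normrM mulrC ler_wpM2r.
- apply: L1Z => //; have := integrable_norm Lf; by apply.
Qed.

Definition conv f phi x : R := \int[mu]_y (f y * phi (x - y)).

(** Integrating the Taylor remainder of phi against |f| gives a quadratic remainder for the
    convolution, with constant c times the L^1 norm of f. *)
Lemma conv_taylor Omega f phi x : L1 mu setT f -> test_function Omega phi ->
  differentiable (conv f phi) x /\ forall i, partial i (conv f phi) x = conv f (partial i phi) x.
Proof.
move=> Lf tphi; have [c [c0 hc]] := test_taylor tphi.
have Lnf : L1 mu setT (fun y => `|f y|) by exact: integrable_norm Lf.
have Lc y := conv_integrable y Lf tphi.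
have Lp i := conv_integrable x Lf (test_partial i tphi).
apply: (@taylor_differentiable _ _ _ (c * \int[mu]_y `|f y|)).
  by apply: mulr_ge0 => //; apply: Rintegral_ge0.
move=> v.
have Ls : L1 mu setT (fun y => \sum_i v 0 i * (f y * partial i phi (x - y))).
  by apply: L1_sum => // i _; apply: L1Z.
have -> : conv f phi (x + v) - conv f phi x - \sum_i v 0 i * conv f (partial i phi) x =
    \int[mu]_y (f y * phi (x + v - y) - f y * phi (x - y) -
       \sum_i v 0 i * (f y * partial i phi (x - y))).
  rewrite [RHS]RintegralB; [|done|exact: L1B|done].
  rewrite RintegralB; [|done|exact: Lc|exact: Lc].
  rewrite Rintegral_sum; [|done|by move=> i _; exact: L1Z].
  congr (_ - _); apply: eq_bigr => i _; by rewrite RintegralZl; [|done|exact: Lp].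
apply: le_trans (le_normr_Rintegral _ _) _ => //; first by apply: L1B => //; exact: L1B.
rewrite mulrAC -[leRHS]RintegralZl//.
apply: le_Rintegral => //.
- by apply: integrable_norm; apply: L1B => //; exact: L1B.
- exact: L1Z.
move=> y _.
have -> : f y * phi (x + v - y) - f y * phi (x - y) - \sum_i v 0 i * (f y * partial i phi (x - y)) =
   f y * (phi (x - y + v) - phi (x - y) - \sum_i v 0 i * partial i phi (x - y)).
  rewrite mulrBr mulrBr mulr_sumr [x + v - y]addrAC; congr (_ - _).
  by apply: eq_bigr => i _; rewrite mulrCA.
by rewrite normrM mulrC ler_wpM2r.
Qed.

Lemma conv_partial Omega f phi i : L1 mu setT f -> test_function Omega phi ->
  partial i (conv f phi) = conv f (partial i phi).
Proof. by move=> Lf tphi; apply/funext => x; have [_] := conv_taylor x Lf tphi. Qed.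

Lemma conv_smooth Omega f phi : L1 mu setT f -> test_function Omega phi ->
  smooth (conv f phi).
Proof.
move=> Lf tphi s x.
suff [psi [tpsi ->]] : exists psi, test_function Omega psi /\
    foldr (@partial R n) (conv f phi) s = conv f psi.
  by have [] := conv_taylor x Lf tpsi.
elim: s => [|j s [psi [tpsi /= ->]]]; first by exists phi.
exists (partial j psi); split; first exact: test_partial.
exact: conv_partial tpsi.
Qed.

Lemma reflect_partial phi x i : smooth phi ->
  partial i (fun y => phi (x - y)) = fun y => - partial i phi (x - y).
Proof.
move=> sphi; apply/funext => y.
have dphi : differentiable phi (x - y) by exact: smooth_differentiable.
rewrite /partial -mulN1r -derive_scale// scaleN1r /derive.
suff -> : (fun h => h^-1 *: (((fun y => phi (x - y)) \o shift y) (h *: basis_vec R i) -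
     phi (x - y))) =
   (fun h => h^-1 *: ((phi \o shift (x - y)) (h *: - basis_vec R i) - phi (x - y))) by [].
by apply/funext => h /=; rewrite scalerN opprD addrCA.
Qed.

Lemma reflect_smooth phi x : smooth phi -> smooth (fun y => phi (x - y)).
Proof.
move=> sphi s y.
suff [psi [spsi ->]] : exists psi, smooth psi /\
    foldr (@partial R n) (fun y => phi (x - y)) s = fun y => psi (x - y).
  apply: (@differentiable_comp _ _ _ _ (fun y => x - y) psi); first exact: differentiableB.
  exact: smooth_differentiable.
elim: s => [|j s [psi [spsi /= ->]]]; first by exists phi.
exists (fun z => (- 1) * partial j psi z); split.
  apply: smooth_exprP; apply: SmoothMul; first exact: SmoothCst.
  by apply: SmoothBase; exact: smooth_partial.
by rewrite reflect_partial//; apply/funext => z; rewrite mulN1r.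
Qed.

Lemma cube_closed (a : rV) (r : R) : closed (cube a r).
Proof.
rewrite (_ : cube a r = \bigcap_i ((fun x : rV => x 0 i) @^-1` `[a 0 i - r, a 0 i + r])).
  apply: closed_bigI => i _; apply: preimage_closed; last exact: interval_closed.
  by move=> x _; exact: coord_continuous.
by apply/seteqP; split => x h i; [move=> _|]; have := h i; rewrite /= in_itv/=; [|apply].
Qed.

Lemma cube_compact (a : rV) (r : R) : compact (cube a r).
Proof.
apply: bounded_closed_compact; last exact: cube_closed.
exists (`|a| + `|r|); split; first exact: num_real.
move=> M aM x ax /=; rewrite (le_trans _ (ltW aM))//.
have [r0|r0] := leP 0 r.
  have /cube_norm -/(_ r0) h := ax; rewrite -(subrK a x) addrC (le_trans (ler_normD _ _))// lerD2l.
  by rewrite (ger0_norm r0).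
have [i|n0] := pickP (@predT 'I_n).
  by move=> _; have := ax i; move: (a 0 i) (x 0 i) => u w; lra.
have -> : x = 0 by apply/rowP => i; have := n0 i.
by rewrite normr0 addr_ge0.
Qed.

Lemma support_cube phi (a : rV) (r : R) : (forall x, phi x != 0 -> cube a r x) ->
  closure [set x | phi x != 0] `<=` cube a r.
Proof.
by move=> h x hx; apply: (@cube_closed a r); move: x hx; exact: closure_subset.
Qed.

Lemma test_cube phi (a : rV) (r : R) : smooth phi -> (forall x, phi x != 0 -> cube a r x) ->
  test_function (cube a r) phi.
Proof.
move=> sphi h; split=> //; last exact: support_cube.
exact: subclosed_compact (@closed_closure _ _) (@cube_compact a r) (support_cube h).
Qed.

Lemma test_supp phi a (r : R) x : test_function (cube a r) phi -> phi x != 0 -> cube a r x.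
Proof. by case=> _ _ h x0; apply: h; apply: subset_closure. Qed.

Lemma test_reflect phi (r : R) x : test_function (cube 0 r) phi ->
  test_function (cube x r) (fun y => phi (x - y)).
Proof.
move=> tphi; apply: test_cube; first by apply: reflect_smooth; case: tphi.
move=> y /(test_supp tphi) h i; have := h i; rewrite !mxE; lra.
Qed.
End convolution.

(** * Square-integrable functions and continuity of translations *)

Section square_integrable.
Variables (R : realType) (n : nat).
Local Notation rV := 'rV[R]_n.
Local Notation mu := (@lebn R n).
Implicit Types (f g : rV -> R) (phi : rV -> R) (x y v : rV).

Definition L2 f := measurable_fun setT f /\ L1 mu setT (fun x => f x ^+ 2).

Lemma L2_mul f g : L2 f -> L2 g -> L1 mu setT (fun x => f x * g x).
Proof.
move=> [mf Lf] [mg Lg]; apply: (L1_dom (g := fun x => f x ^+ 2 + g x ^+ 2)) => //.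
- exact: measurable_funM.
- move=> x _; rewrite normrM -(real_normK (num_real (f x))) -(real_normK (num_real (g x))).
  by have := sqr_ge0 (`|f x| - `|g x|); have := mulr_ge0 (normr_ge0 (f x)) (normr_ge0 (g x)); nra.
- exact: L1D.
Qed.

Lemma L2D f g : L2 f -> L2 g -> L2 (fun x => f x + g x).
Proof.
move=> [mf Lf] [mg Lg]; split; first exact: measurable_funD.
apply: (L1_dom (g := fun x => 2 * f x ^+ 2 + 2 * g x ^+ 2)) => //.
- by apply: measurable_funX; exact: measurable_funD.
- by move=> x _; rewrite ger0_norm ?sqr_ge0//; have := sqr_ge0 (f x - g x); nra.
- by apply: L1D => //; exact: L1Z.
Qed.

Lemma L2Z f c : L2 f -> L2 (fun x => c * f x).
Proof.
move=> [mf Lf]; split; first exact: measurable_funM.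
by under eq_fun do rewrite exprMn; exact: L1Z.
Qed.

Lemma L2B f g : L2 f -> L2 g -> L2 (fun x => f x - g x).
Proof.
move=> Lf Lg; have := L2D Lf (L2Z (-1) Lg).
by under eq_fun do rewrite mulN1r.
Qed.

Lemma L2_shift f a : L2 f -> L2 (fun x => f (a + x)).
Proof.
move=> [mf Lf]; split; last exact: (L1_shift a Lf).
apply: (measurableT_comp mf); have := @measurable_affine R n a 1.
by under eq_fun do rewrite scale1r.
Qed.

Lemma cube_finite (a : rV) (r : R) : (mu (cube a r) < +oo)%E.
Proof.
apply: (@le_lt_trans _ _ (mu (cube a `|r|))); last by rewrite /lebn leb_cube ?ltry.
apply: le_measure; rewrite ?inE; [exact: measurable_cube..|].
by move=> x h i; have := h i; have := ler_norm r; lra.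
Qed.

Lemma L1_indic (A : set rV) : measurable A -> (mu A < +oo)%E -> L1 mu setT (\1_A : rV -> R).
Proof.
move=> mA Aoo; rewrite (_ : (\1_A : rV -> R) = fun x => cst 1 x * \1_A x).
  apply: (@L1_restrict _ _ _ mu A (cst 1) mA).1; apply: (@L1_bounded _ _ _ mu _ _ 1) => // x _.
  by rewrite /= normr1.
by apply/funext => x; rewrite /= mul1r.
Qed.

Lemma L2_cube_L1 f a (r : R) : L2 f -> (forall x, ~ cube a r x -> f x = 0) -> L1 mu setT f.
Proof.
move=> [mf Lf] f0.
have mc := @measurable_cube R n a r.
apply: (L1_dom (g := fun x => f x ^+ 2 + \1_(cube a r) x)) => //.
- move=> x _; rewrite indicE; have [xc|xc] := pselect (cube a r x).
    rewrite mem_set//= -(real_normK (num_real (f x))).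
    have := sqr_ge0 (`|f x| - 1); have := normr_ge0 (f x); nra.
  by rewrite f0// normr0 addr_ge0// sqr_ge0.
- by apply: L1D => //; apply: L1_indic => //; exact: cube_finite.
Qed.

(** Continuity of translations in L^2, stated with squared norms. The sign of y is the one that
    occurs in f(x - y) under a convolution. *)
Definition shift_continuous f := forall e : R, 0 < e -> exists2 d : R, 0 < d &
  forall y, `|y| <= d -> \int[mu]_x (f (- y + x) - f x) ^+ 2 <= e.

Lemma L2_shift_sub f y : L2 f -> L1 mu setT (fun x => (f (- y + x) - f x) ^+ 2).
Proof. by move=> Lf; have [] := L2B (L2_shift (- y) Lf) Lf. Qed.

(** Three-term splitting through g. The translated error has the same integral as the error itself,
    and (a + b + c)^2 <= 3 (a^2 + b^2 + c^2) explains e / 9. *)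
Lemma shift_continuous_approx f : L2 f ->
  (forall e : R, 0 < e -> exists g, [/\ L2 g, shift_continuous g &
     \int[mu]_x (f x - g x) ^+ 2 <= e]) -> shift_continuous f.
Proof.
move=> Lf happ e e0; have e90 : 0 < e / 9 by rewrite divr_gt0.
have [g [Lg cg fg]] := happ _ e90; have [d d0 hd] := cg _ e90.
exists d => // y yd.
have Lfg : L1 mu setT (fun x => (f x - g x) ^+ 2) by have [] := L2B Lf Lg.
have Lfgs : L1 mu setT (fun x => (f (- y + x) - g (- y + x)) ^+ 2).
  exact: (L1_shift (- y) Lfg).
have Lgy := L2_shift_sub y Lg.
apply: (@le_trans _ _ (\int[mu]_x (3 * (f (- y + x) - g (- y + x)) ^+ 2 +
    3 * (g (- y + x) - g x) ^+ 2 + 3 * (f x - g x) ^+ 2))).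
  apply: le_Rintegral => //; first exact: L2_shift_sub.
    by apply: L1D => //; [apply: L1D => //|]; exact: L1Z.
  move=> x _; move: (f (- y + x)) (f x) (g (- y + x)) (g x) => a b c k.
  have := sqr_ge0 (a - c - (c - k)); have := sqr_ge0 (a - c + (b - k));
  have := sqr_ge0 (c - k + (b - k)); nra.
rewrite RintegralD//; [|by apply: L1D => //; exact: L1Z|exact: L1Z].
rewrite RintegralD//; [|exact: L1Z..].
rewrite !RintegralZl//.
have -> : \int[mu]_x (f (- y + x) - g (- y + x)) ^+ 2 = \int[mu]_x (f x - g x) ^+ 2.
  exact: (Rintegral_shift (- y) Lfg).
by have := hd _ yd; move: fg; lra.
Qed.

Lemma shift_continuousD f g : L2 f -> L2 g -> shift_continuous f -> shift_continuous g ->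
  shift_continuous (fun x => f x + g x).
Proof.
move=> Lf Lg cf cg e e0; have e40 : 0 < e / 4 by rewrite divr_gt0.
have [d d0 hd] := cf _ e40; have [d' d'0 hd'] := cg _ e40.
exists (Num.min d d'); first by rewrite lt_min d0.
move=> y; rewrite le_min => /andP[yd yd'].
have Lfy := L2_shift_sub y Lf; have Lgy := L2_shift_sub y Lg.
apply: (@le_trans _ _ (\int[mu]_x (2 * (f (- y + x) - f x) ^+ 2 + 2 * (g (- y + x) - g x) ^+ 2))).
  apply: le_Rintegral => //; first exact: (L2_shift_sub y (L2D Lf Lg)).
    by apply: L1D => //; exact: L1Z.
  move=> x _; move: (f (- y + x)) (f x) (g (- y + x)) (g x) => a b c k.
  have := sqr_ge0 (a - b - (c - k)); nra.
rewrite RintegralD//; [|exact: L1Z..].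
rewrite !RintegralZl//.
have := hd _ yd; have := hd' _ yd'; lra.
Qed.

Lemma shift_continuousZ f c : L2 f -> shift_continuous f -> shift_continuous (fun x => c * f x).
Proof.
move=> Lf cf e e0; have e1 : 0 < e / (c ^+ 2 + 1) by rewrite divr_gt0// ltr_wpDl// sqr_ge0.
have [d d0 hd] := cf _ e1; exists d => // y yd.
under eq_Rintegral do rewrite -mulrBr exprMn.
rewrite RintegralZl//; last exact: L2_shift_sub.
apply: le_trans (ler_wpM2l (sqr_ge0 c) (hd _ yd)) _.
have c1 : 0 < c ^+ 2 + 1 by rewrite ltr_wpDl// sqr_ge0.
by rewrite mulrCA ler_piMr ?(ltW e0)// ler_pdivrMr// mul1r lerDl.
Qed.

Lemma L2_indic (A U : set rV) : measurable A -> measurable U -> (mu U < +oo)%E -> A `<=` U ->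
  L2 (\1_A : rV -> R).
Proof.
move=> mA mU Uoo AU; split => //.
have -> : (fun x => (\1_A x : R) ^+ 2) = \1_A.
  by apply/funext => x; rewrite indicE; case: (x \in A); rewrite ?expr1n ?expr0n.
apply: L1_indic => //.
by apply: le_lt_trans Uoo; apply: le_measure; rewrite ?inE.
Qed.

Import HBNNSimple.

(** The squared distance is 2 |U| - 2 |U and its translate|. Along a sequence of translations
    tending to 0 the product of the indicators tends to that of U, because U is open; dominated
    convergence contradicts a positive lower bound. *)
Let shift_continuous_open (U : set rV) : open U -> (mu U < +oo)%E ->
  shift_continuous (\1_U : rV -> R).
Proof.
move=> oU Uoo e e0; have mU := rV_open_measurable oU.
have L2U := @L2_indic U U mU mU Uoo (@subset_refl _ U).
have [_ sqL] := L2U.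
apply: contrapT => H.
have /choice[y hy] : forall k : nat, exists y : rV, `|y| <= k.+1%:R^-1 /\
    e < \int[mu]_x (\1_U (- y + x) - \1_U x) ^+ 2.
  move=> k; apply: contrapT => nex; apply: H; exists k.+1%:R^-1; first by rewrite invr_gt0.
  move=> y yk; rewrite leNgt; apply/negP => ey; apply: nex; by exists y.
have Lp k : L1 mu setT (fun x => \1_U (- y k + x) * \1_U x : R).
  by apply: L2_mul => //; exact: L2_shift.
have Lsh k : L1 mu setT (fun x => \1_U (- y k + x) ^+ 2 : R).
  by have [] := L2_shift (- y k) L2U.
have E k : \int[mu]_x (\1_U (- y k + x) - \1_U x) ^+ 2 =
   2 * \int[mu]_x (\1_U x ^+ 2) - 2 * \int[mu]_x (\1_U (- y k + x) * \1_U x).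
  transitivity (\int[mu]_x (\1_U (- y k + x) ^+ 2 + \1_U x ^+ 2 -
      2 * (\1_U (- y k + x) * \1_U x))).
    by apply: eq_Rintegral => x _; ring.
  rewrite RintegralB; [|done|exact: L1D|exact: L1Z].
  rewrite RintegralD; [|done|exact: Lsh|exact: sqL].
  rewrite RintegralZl; [|done|exact: Lp].
  rewrite (Rintegral_shift (- y k) sqL); ring.
have [||||_ cv] := @Rdominated_cvg _ _ _ mu setT (fun k x => \1_U (- y k + x) * \1_U x)
    (fun x => \1_U x ^+ 2) (\1_U) measurableT _ _ _ (L1_indic mU Uoo).
- by move=> k; exact: L1_measurable (Lp k).
- by apply: measurable_funX.
- apply: aeW => x _ /=; have [xU|xU] := pselect (U x); last first.
    rewrite [\1_U x]indicE memNset//= expr0n/=.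
    by under eq_cvg do rewrite mulr0; exact: cvg_cst.
  apply: cvg_near_cst.
    have /nbhs_ballP[d /= d0 hd] : nbhs x U by exact: open_nbhs_nbhs.
    near=> k; apply/esym; rewrite !indicE (mem_set xU) expr1n mulr1 mem_set//.
    apply: hd; rewrite -ball_normE/= opprD opprK addrCA subrr addr0.
    have [yk _] := hy k; apply: le_lt_trans yk _.
    by near: k; exact: (near_infty_natSinv_lt (PosNum d0)).
- apply: aeW => x k _ /=; rewrite !indicE.
  by case: (_ \in _); case: (_ \in _); rewrite /= ?mulr1 ?mulr0 ?normr1 ?normr0.
have e2 : 0 < e / 2 by rewrite divr_gt0.
have /cvgrPdist_lt/(_ _ e2)[N _ /(_ N (leqnn N))]/= := cv.
have [_] := hy N; rewrite E.
move: (\int[mu]_x (\1_U x ^+ 2)) (\int[mu]_x (\1_U (- y N + x) * \1_U x)) => a b h.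
rewrite ltr_norml; move: h; lra.
Unshelve. all: by end_near. Qed.
(** Dominated convergence with majorant 4 f^2. *)
Lemma Rdominated_L2 (f_ : nat -> rV -> R) f : (forall k, L2 (f_ k)) -> L2 f ->
  (forall x, f_ ^~ x @ \oo --> f x) -> (forall k x, `|f_ k x| <= `|f x|) ->
  forall e : R, 0 < e -> exists k, \int[mu]_x (f x - f_ k x) ^+ 2 <= e.
Proof.
move=> Lf_ Lf cf hf e e0; have [mf sf] := Lf.
have [||||_ cv] := @Rdominated_cvg _ _ _ mu setT (fun k x => (f x - f_ k x) ^+ 2)
    (fun=> 0) (fun x => 4 * f x ^+ 2) measurableT _ _ _ (L1Z 4 measurableT sf).
- move=> k; apply: measurable_funX; apply: measurable_funB => //.
  by have [] := Lf_ k.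
- by [].
- apply: aeW => x _.
  have h : f x - f_ k x @[k --> \oo] --> (0 : R).
    by rewrite -(subrr (f x)); apply: cvgB; [exact: cvg_cst|exact: cf].
  under eq_cvg do rewrite expr2.
  by have := cvgM h h; rewrite mulr0; exact.
- apply: aeW => x k _; rewrite ger0_norm ?sqr_ge0//.
  have := hf k x; rewrite -(real_normK (num_real (f x - f_ k x))) -(real_normK (num_real (f x))).
  move=> h; have h2 : `|f x - f_ k x| <= 2 * `|f x|.
    by rewrite (le_trans (ler_normB _ _))//; move: h; lra.
  by have := normr_ge0 (f x - f_ k x); have := normr_ge0 (f x); nra.
move: cv; rewrite /Rintegral integral0/= -/(Rintegral _ _ _) => /cvgrPdist_lt/(_ _ e0)[N _ /(_ N (leqnn N))]/=.
rewrite sub0r normrN => h; exists N; apply/ltW; apply: le_lt_trans h; exact: ler_norm.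
Qed.

Lemma shift_continuous_sum (I : Type) (s : seq I) (F : I -> rV -> R) :
  (forall i, L2 (F i) /\ shift_continuous (F i)) ->
  L2 (fun x => \sum_(i <- s) F i x) /\ shift_continuous (fun x => \sum_(i <- s) F i x).
Proof.
move=> hF; elim: s => [|i s [Ls cs]].
  split=> [|e e0]; last first.
    exists 1 => // y _; under eq_Rintegral do rewrite !big_nil subrr expr0n/=.
    by rewrite /Rintegral integral0/= ltW.
  under eq_fun do rewrite big_nil; split => //.
  by under eq_fun do rewrite expr0n/=; exact: integrable0.
have [Li ci] := hF i.
under eq_fun do rewrite big_cons.
split; [exact: L2D|].
exact: shift_continuousD.
Qed.

(** Dynkin's theorem with the open sets as generating pi-system; intersecting with U keeps the
    measures finite. Complements in U are differences, and disjoint unions are limits in L^2 of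
    finite sums. *)
Let shift_continuous_indic (A U : set rV) : measurable A -> open U -> (mu U < +oo)%E ->
  shift_continuous (\1_(A `&` U) : rV -> R).
Proof.
move=> mA oU Uoo; have mU := rV_open_measurable oU.
have L2I B : measurable B -> L2 (\1_(B `&` U) : rV -> R).
  by move=> mB; apply: (@L2_indic _ U) => //; exact: measurableI.
have mE : @measurable _ rV = <<s [set V : set rV | open V] >>.
  apply/seteqP; split; last first.
    by apply: smallest_sub; [exact: sigma_algebra_measurable|exact: rV_open_measurable].
  apply: rV_measurable_sub; first exact: smallest_sigma_algebra.
  move=> i x; rewrite -[X in <<s _ >> X]setCK.
  apply: sigma_algebraC.
  apply: sub_sigma_algebra => /=; apply: closed_openC.
  rewrite (_ : [set v | _] = (fun v : rV => v 0 i) @^-1` `[x, +oo[%classic).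
    apply: preimage_closed; last exact: interval_closed.
    by move=> v _; exact: coord_continuous.
  by apply/seteqP; split => v /=; rewrite in_itv/= andbT.
move: mA; rewrite mE; move: A.
apply: (dynkin_induction mE) => /=.
- by move=> V W oV oW; exact: openI.
- by rewrite setTI; exact: shift_continuous_open.
- move=> V oV; apply: shift_continuous_open; first exact: openI.
  by apply: le_lt_trans Uoo; apply: le_measure; rewrite ?inE//; exact: rV_open_measurable (openI oV oU).
- move=> S mS cS.
  rewrite (_ : \1_(~` S `&` U) = fun x => (\1_U x + (- 1) * \1_(S `&` U) x : R)).
    apply: shift_continuousD; [|exact: L2Z (L2I _ mS)|exact: shift_continuous_open|].
      exact: (@L2_indic _ U).
    by apply: shift_continuousZ => //; exact: L2I.
  apply/funext => x; rewrite !indicE !in_setI in_setC.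
  by case: (x \in S); case: (x \in U); rewrite /= ?mulr1 ?mulr0 ?subrr ?addr0 ?mulN1r ?subrr.
- move=> S mS tS cS.
  have mSU : measurable (\bigcup_k S k) by exact: bigcup_measurable.
  apply: shift_continuous_approx; first exact: L2I.
  pose g N : rV -> R := fun x => \sum_(k < N) \1_(S k `&` U) x.
  have gE N x : g N x = \1_((\big[setU/set0]_(k < N) S k) `&` U) x.
    rewrite /g; elim: N => [|N IH]; first by rewrite !big_ord0 set0I indic0.
    rewrite !big_ord_recr/= IH !indicE !in_setI in_setU.
    have [xN|xN] := boolP (x \in S N); last by rewrite /= addr0 orbF.
    rewrite orbT/= (_ : x \in _ = false) ?add0r//.
    apply/negbTE; rewrite notin_setE => xS; move: xS.
    rewrite -bigcup_mkord => -[k /= kN xk].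
    have := @trivIsetP _ _ setT S; case=> /(_ tS k N I I) h _.
    have kN' : k != N by rewrite ltn_eqF.
    have /seteqP[/(_ x) + _] := h kN'; apply; split => //; by move: xN; rewrite inE.
  have Lg N : L2 (g N).
    rewrite (_ : g N = \1_((\big[setU/set0]_(k < N) S k) `&` U)); last by apply/funext.
    by apply: L2I; exact: bigsetU_measurable.
  have cg N : shift_continuous (g N).
    elim: N => [|N IH].
      move=> e e0; exists 1 => // y _; rewrite /g.
      under eq_Rintegral do rewrite !big_ord0 subrr expr0n/=.
      by rewrite /Rintegral integral0/= ltW.
    rewrite (_ : g N.+1 = fun x => g N x + \1_(S N `&` U) x).
      by apply: shift_continuousD => //; exact: L2I.
    by apply/funext => x; rewrite /g big_ord_recr.
  move=> e e0.
  have [||k hk] := @Rdominated_L2 g _ Lg (L2I _ mSU) _ _ e e0; last by exists (g k).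
  + move=> x.
    apply: cvg_near_cst; suff near_g : \forall N \near \oo, \1_(\bigcup_k S k `&` U) x = g N x.
      by apply: filterS near_g => N ->.
      have [[j _ xj]|nx] := pselect ((\bigcup_k S k) x).
        exists j.+1 => // N /= jN; rewrite gE !indicE !in_setI.
        have m1 : (\bigcup_k S k) x by exists j.
        have m2 : (\big[setU/set0]_(k < N) S k) x by rewrite -bigcup_mkord; exists j.
        by rewrite (mem_set m1) (mem_set m2).
      exists 0%N => // N _ /=; rewrite gE !indicE !in_setI.
      have n2 : ~ (\big[setU/set0]_(k < N) S k) x.
        by rewrite -bigcup_mkord => -[j _ xj]; apply: nx; exists j.
      by rewrite (memNset nx) (memNset n2).
  + move=> k x; rewrite gE !indicE !in_setI !ger0_norm// ler_nat.
    case: (x \in U); rewrite ?andbF// !andbT.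
    case: (boolP (x \in _)) => // /set_mem; rewrite -bigcup_mkord => -[j _ xj].
    by rewrite mem_set//; exists j.
Unshelve. all: by end_near. Qed.

(** Positive and negative parts reduce to f >= 0, which is a limit in L^2 of simple functions from
    below. *)
Lemma L2_shift_continuous f (U : set rV) : L2 f -> open U -> (mu U < +oo)%E ->
  (forall x, ~ U x -> f x = 0) -> shift_continuous f.
Proof.
move=> Lf oU Uoo fU.
wlog f0 : f Lf fU / forall x, 0 <= f x.
  move=> H; have [mf sf] := Lf.
  have part (g : rV -> R) : measurable_fun setT g -> (forall x, 0 <= g x <= `|f x|) ->
      L2 g /\ shift_continuous g.
    move=> mg hg.
    have Lg : L2 g.
      split=> //; apply: (L1_dom (g := fun x => f x ^+ 2)) => //.
        exact: measurable_funX.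
      move=> x _; rewrite ger0_norm ?sqr_ge0// -(real_normK (num_real (f x))).
      have /andP[h1 h2] := hg x; exact: lerXn2r.
    split=> //; apply: H => // x; last by have /andP[] := hg x.
    move=> xU; apply/eqP; rewrite eq_le; have := hg x; rewrite fU// normr0.
    by case/andP=> -> ->.
  have mp : measurable_fun setT (fun x => Num.max (f x) 0) by exact: measurable_maxr.
  have [x|Lp cp] := part _ mp.
    have := ler_norm (f x); have := normr_ge0 (f x); rewrite le_max lexx orbT ge_max => -> -> //.
  have mN : measurable_fun setT (fun x => - f x) by exact: measurableT_comp.
  have mn : measurable_fun setT (fun x => Num.max (- f x) 0) by exact: measurable_maxr.
  have [x|Ln cn] := part _ mn.
    have := ler_norm (- f x); have := normr_ge0 (f x).
    by rewrite normrN le_max lexx orbT ge_max => -> -> //.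
  rewrite (_ : f = fun x => Num.max (f x) 0 + (-1) * Num.max (- f x) 0).
    by apply: shift_continuousD => //; [exact: L2Z|exact: shift_continuousZ].
  apply/funext => x; case: (leP (f x) 0) => h; case: (leP (- f x) 0) => h'; lra.
have [mf sf] := Lf.
have mF : measurable_fun setT (EFin \o f) by exact/measurable_EFinP.
apply: shift_continuous_approx => // e e0.
pose g := nnsfun_approx measurableT mF.
have gcv x : (g k : rV -> R) x @[k --> \oo] --> f x.
  have /fine_cvgP[_] := @cvg_nnsfun_approx _ _ _ _ measurableT _ mF (fun x _ => f0 x) x I.
  exact.
have gf k x : 0 <= g k x <= f x.
  apply/andP; split => //; rewrite -(cvg_lim _ (gcv x))//.
  apply: (@nondecreasing_cvgn_le _ (fun k => (g k : rV -> R) x)) => [i j ij|]; last by apply/cvg_ex; exists (f x).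
  by have /lefP := @nd_nnsfun_approx _ _ _ _ measurableT _ mF _ _ ij; apply.
have Lg k : L2 (g k).
  split => //; apply: (L1_dom (g := fun x => f x ^+ 2)) => //.
    exact: measurable_funX.
  move=> x _; rewrite ger0_norm ?sqr_ge0//; have /andP[h1 h2] := gf k x.
  by apply: lerXn2r => //; rewrite nnegrE f0.
have [||k hk] := @Rdominated_L2 (fun k => g k) f Lg Lf _ _ e e0.
- exact: gcv.
- move=> k x; have /andP[h1 h2] := gf k x; rewrite !ger0_norm//.
exists (g k); split => //.
rewrite (_ : (g k : rV -> R) = fun x => \sum_(r <- finmap.enum_fset (fset_set (range (g k))))
    (r * \1_(g k @^-1` [set r] `&` U) x)).
  apply: (shift_continuous_sum _ _).2 => i; split.
    by apply: L2Z; apply: (@L2_indic _ U) => //; [apply: measurableI => //; exact: rV_open_measurable|exact: rV_open_measurable].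
  apply: shift_continuousZ; last exact: shift_continuous_indic.
  by apply: (@L2_indic _ U) => //; [apply: measurableI => //; exact: rV_open_measurable|exact: rV_open_measurable].
apply/funext => x; rewrite fimfunE fsbig_finite//=; apply: eq_bigr => r _.
(* A nonzero level of a simple function below f lies in U, since f vanishes outside of U; the zero
   level contributes nothing. *)
have [->|s0] := eqVneq r 0; first by rewrite !mul0r.
congr (_ * _); rewrite !indicE; congr ((_ : bool)%:R).
apply/idP/idP => /set_mem h; apply/mem_set; last by case: h.
split=> //; apply: contrapT => /fU fx0; have := gf k x; rewrite fx0 h => /andP[h1 h2].
by move: s0; rewrite (_ : r = 0) ?eqxx//; apply/eqP; rewrite eq_le h1 h2.
Qed.
End square_integrable.

(** * The mollifying kernel *)

Section kernels.
Variables (R : realType) (n : nat).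
Local Notation rV := 'rV[R]_n.
Local Notation mu := (@lebn R n).
Implicit Types (f g : rV -> R) (phi : rV -> R) (x y v z : rV) (p : {poly R}) (r : R).

Definition sqn z : R := \sum_i z 0 i ^+ 2.

Lemma sqn_ge0 z : 0 <= sqn z.
Proof. by apply: sumr_ge0 => i _; exact: sqr_ge0. Qed.

Lemma coord_sqn z i : z 0 i ^+ 2 <= sqn z.
Proof.
rewrite /sqn (bigD1 i)//= lerDl; apply: sumr_ge0 => j _; exact: sqr_ge0.
Qed.

Lemma sqn_norm z : sqn z <= n%:R * `|z| ^+ 2.
Proof.
rewrite mulr_natl -[X in _ *+ X]card_ord -sumr_const; apply: ler_sum => i _.
rewrite -(real_normK (num_real (z 0 i))); apply: lerXn2r; rewrite ?nnegrE//.
exact: coord_le_norm.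
Qed.

Definition bump p r z : R := flat p (1 - sqn z / r ^+ 2).

Lemma smooth_expr_sum (I : Type) (s : seq I) (F : I -> rV -> R) :
  (forall i, smooth_expr (F i)) -> smooth_expr (fun x => \sum_(i <- s) F i x).
Proof.
move=> hF; elim: s => [|i s IH].
  by under eq_fun do rewrite big_nil; exact: SmoothCst.
by under eq_fun do rewrite big_cons; exact: SmoothAdd.
Qed.

Lemma bump_smooth p r : smooth (bump p r).
Proof.
apply: smooth_exprP; apply: SmoothFlat.
rewrite (_ : (fun z => _) = fun z => 1 + (- r ^- 2) * \sum_i z 0 i * z 0 i).
  apply: SmoothAdd; first exact: SmoothCst.
  apply: SmoothMul; first exact: SmoothCst.
  by apply: smooth_expr_sum => i; apply: SmoothMul; exact: SmoothCoord.
by apply/funext => z; rewrite /sqn mulNr mulrC.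
Qed.

Lemma sqn_taylor z v : `|sqn (z + v) - sqn z - \sum_i v 0 i * (2 * z 0 i)| <= n%:R * `|v| ^+ 2.
Proof.
rewrite -!sumrB (le_trans (ler_norm_sum _ _ _))//.
rewrite [leRHS]mulr_natl -[X in _ <= _ *+ X]card_ord -sumr_const; apply: ler_sum => i _.
rewrite !mxE (_ : _ - _ - _ = v 0 i ^+ 2); last by ring.
by rewrite normrX; apply: lerXn2r; rewrite ?nnegrE// coord_le_norm.
Qed.

Lemma partial_sqn z i : differentiable sqn z /\ partial i sqn z = 2 * z 0 i.
Proof.
have [d h] := @taylor_differentiable R n sqn z (fun i => 2 * z 0 i) n%:R (ler0n _ _) (sqn_taylor z).
by split => //; exact: h.
Qed.

Lemma bump_partial p r i z :
  partial i (bump p r) z = - (2 * z 0 i / r ^+ 2) * bump (dflat p) r z.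
Proof.
have [ds ps] := partial_sqn z i.
have da : is_derive (sqn z) 1 (fun t => 1 - t / r ^+ 2) (- r ^- 2).
  have := is_deriveB (is_derive_cst (1 : R) (sqn z) 1)
    (is_deriveZ (r ^- 2) (is_derive_id (sqn z) 1)).
  have -> : (fun t : R => 1 - t / r ^+ 2) = cst (1 : R) - r ^- 2 \*: id.
    by apply/funext => t; rewrite /= !fctE mulrC.
  by move=> /is_derive_eq; apply; rewrite /GRing.scale/= mulr1 sub0r.
have [da2 Ea] := derive_comp1 (basis_vec R i) da ds.
have [_ E] := derive_comp1 (basis_vec R i) (is_derive_flat p (1 - sqn z / r ^+ 2)) da2.
rewrite /partial [LHS]E Ea -/(partial i sqn z) ps /bump; ring.
Qed.

Lemma bump_neq0 p r z : 0 < r -> bump p r z != 0 -> sqn z < r ^+ 2.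
Proof.
move=> r0; rewrite ltNge; apply: contraNN => zr.
rewrite /bump flat_le0// subr_le0 ler_pdivlMr ?exprn_gt0// mul1r //.
Qed.

Lemma bump_support p r z : 0 < r -> bump p r z != 0 -> `|z| <= r.
Proof.
move=> r0 /(bump_neq0 r0) zr; have := @cube_norm R n 0 r z (ltW r0); rewrite subr0 => -[h _].
apply: h => i; have := le_lt_trans (coord_sqn z i) zr; rewrite mxE; nra.
Qed.

Lemma bump_test p r : 0 < r -> test_function (cube 0 r) (bump p r).
Proof.
move=> r0; apply: test_cube; first exact: bump_smooth.
by move=> x /(bump_support r0) xr; apply/cube_norm; rewrite ?subr0// ltW.
Qed.

Lemma test_L1 phi a r : test_function (cube a r) phi -> L1 mu setT phi.
Proof.
move=> tphi; have [c [c0 hc]] := test_bounded tphi.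
have sphi : smooth phi by case: tphi.
apply: (L1_dom (g := fun x => c * \1_(cube a r) x)) => //.
- exact: smooth_measurable.
- move=> x _; rewrite indicE; have [xc|/contra_notP xc] := pselect (cube a r x).
    by rewrite mem_set// mulr1.
  rewrite [phi x](_ : _ = 0) ?normr0 ?mulr_ge0//.
  by apply/eqP/negPn/negP => x0; apply: xc => _; exact: test_supp tphi x0.
- by apply: L1Z => //; apply: L1_indic; [exact: measurable_cube|exact: cube_finite].
Qed.

Lemma bump_L1 p r : 0 < r -> L1 mu setT (bump p r).
Proof. by move=> r0; exact: test_L1 (bump_test p r0). Qed.

Lemma bump_scale p r z : 0 < r -> bump p r z = bump p 1 (0 + r^-1 *: z).
Proof.
move=> r0; rewrite /bump add0r expr1n divr1; congr (flat _ (1 - _)).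
by rewrite /sqn mulr_suml; apply: eq_bigr => i _; rewrite mxE exprMn exprVn mulrC.
Qed.

(** Chosen so that [flat pker] is the derivative of t exp(-1/t), which is [psi] below: this makes z
    times the kernel an explicit gradient. *)
Definition pker : {poly R} := 1 + 'X.

Definition kmass : R := \int[mu]_z bump pker 1 z.

Lemma flat_pker_ge0 t : 0 <= flat pker t.
Proof.
rewrite /flat; case: ifP => // t0; rewrite mulr_ge0 ?expR_ge0// !hornerE.
by rewrite addr_ge0// invr_ge0 ltW.
Qed.

Lemma bump_mass r : 0 < r -> \int[mu]_z bump pker r z = r ^+ n * kmass.
Proof.
move=> r0; under eq_Rintegral do rewrite bump_scale//.
rewrite (@Rintegral_affine R n 0 r^-1)//; last first.
- by apply: bump_L1.
- by rewrite invr_eq0 gt_eqF.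
by rewrite ger0_norm ?invr_ge0 ?(ltW r0)// exprVn invrK.
Qed.

Lemma kmass_gt0 : 0 < kmass.
Proof.
(* On this cube |z|^2 <= n s^2 <= 1/2, so the argument of the profile is at least 1/2 and the
   profile at least exp(-2). *)
pose s : R := (2 * n.+1%:R)^-1.
have s0 : 0 < s by rewrite invr_gt0 mulr_gt0.
have mc := @measurable_cube R n 0 s.
apply: (@lt_le_trans _ _ (\int[mu]_(z in cube 0 s) expR (- 2))).
  rewrite Rintegral_cst// mulr_gt0 ?expR_gt0// /lebn leb_cube ?ltW//=.
  by rewrite exprn_gt0// mulr_gt0.
apply: (@le_trans _ _ (\int[mu]_(z in cube 0 s) bump pker 1 z)).
  apply: le_Rintegral => //.
  - apply: (@L1_bounded _ _ _ mu _ _ (expR (-2))) => //; first exact: cube_finite.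
    by move=> x _; rewrite ger0_norm// expR_ge0.
  - by apply: (L1S measurableT) => //; exact: bump_L1.
  move=> z /(cube_norm _ _ (ltW s0)); rewrite subr0 => zs.
  have h : 2^-1 <= 1 - sqn z / 1 ^+ 2.
    have zz : sqn z <= n%:R * s ^+ 2.
      by rewrite (le_trans (sqn_norm z))// ler_wpM2l// lerXn2r ?nnegrE// ltW.
    have ns : n%:R * s ^+ 2 <= 2^-1.
      rewrite /s exprVn ler_pdivrMr ?exprn_gt0 ?mulr_gt0//.
      rewrite -[n.+1%:R]natr1; have := ler0n R n; move: (n%:R : R) => N N0.
      nra.
    rewrite expr1n divr1; lra.
  rewrite /bump; move: (1 - _ / _) h => t t2.
  have t0 : 0 < t by rewrite (lt_le_trans _ t2)// invr_gt0.
  rewrite /flat t0 !hornerE /=.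
  rewrite -[leLHS]mul1r ler_pM ?expR_ge0// ?lerDl ?invr_ge0 ?(ltW t0)//.
  by rewrite ler_expR lerN2 invf_ple// ?posrE.
apply: le_Rintegral_subset => //; first exact: bump_L1.
by move=> x _; exact: flat_pker_ge0.
Qed.

Definition ker r z : R := (kmass * r ^+ n)^-1 * bump pker r z.

Lemma ker_test r : 0 < r -> test_function (cube 0 r) (ker r).
Proof.
move=> r0; rewrite (_ : ker r = fun z => bump pker r z * (kmass * r ^+ n)^-1).
  apply: test_mul (bump_test pker r0).
  exact/smooth_exprP/SmoothCst.
by apply/funext => z; rewrite mulrC.
Qed.

Lemma kerN_ge0 r : 0 < r -> 0 < (kmass * r ^+ n)^-1.
Proof. by move=> r0; rewrite invr_gt0 mulr_gt0 ?kmass_gt0 ?exprn_gt0. Qed.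

Lemma ker_ge0 r z : 0 < r -> 0 <= ker r z.
Proof. by move=> r0; rewrite mulr_ge0 ?flat_pker_ge0// ltW// kerN_ge0. Qed.

Lemma ker_L1 r : 0 < r -> L1 mu setT (ker r).
Proof. by move=> r0; exact: test_L1 (ker_test r0). Qed.

Lemma ker_int r : 0 < r -> \int[mu]_z ker r z = 1.
Proof.
move=> r0; rewrite /ker RintegralZl//; last exact: bump_L1.
by rewrite bump_mass// mulrC [r ^+ n * _]mulrC mulfV// gt_eqF// mulr_gt0 ?kmass_gt0 ?exprn_gt0.
Qed.

Lemma ker_supp r z : 0 < r -> ker r z != 0 -> `|z| <= r.
Proof.
by move=> r0; rewrite mulf_eq0 negb_or => /andP[_]; exact: bump_support.
Qed.

Lemma conv_reflect f phi x : L1 mu setT (fun y => f y * phi (x - y)) ->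
  conv f phi x = \int[mu]_y (phi y * f (x - y)).
Proof.
move=> Lf; rewrite /conv -(Rintegral_reflect x Lf); apply: eq_Rintegral => y _.
by rewrite subKr mulrC.
Qed.

Section mollification.
Variables (f : rV -> R) (a : rV) (s : R).
Hypotheses (Lf : L2 f) (f0 : forall x, ~ cube a s x -> f x = 0).

Let Lf1 : L1 mu setT f. Proof. exact: L2_cube_L1 Lf f0. Qed.

Let f_shift : shift_continuous f.
Proof.
have sb : cube a s `<=` ball a (`|s| + 1).
  move=> x xc; have xs : cube a `|s| x.
    by move=> i; have := xc i; have := ler_norm s; lra.
  have /cube_norm := xs; rewrite -ball_normE/= distrC => /(_ (normr_ge0 _)); lra.
apply: (@L2_shift_continuous R n f (ball a (`|s| + 1))) => //.
- exact: ball_open.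
- apply: (@le_lt_trans _ _ (mu (cube a (`|s| + 1)))); last exact: cube_finite.
  have mb : measurable (ball a (`|s| + 1)) by apply: rV_open_measurable; exact: ball_open.
  apply: le_measure; [exact: mem_set|apply: mem_set; exact: measurable_cube|].
  move=> x; rewrite -ball_normE/= distrC => h; apply/cube_norm; last exact: ltW.
  by rewrite addr_ge0.
- by move=> x nx; apply: f0 => /sb.
Qed.

Lemma conv_measurable r : 0 < r -> measurable_fun setT (conv f (ker r)).
Proof. by move=> r0; apply: smooth_measurable; exact: conv_smooth (ker_test r0). Qed.

(** The kernel is a probability density. Jensen's inequality bounds the squared error at x by the
    average of (f(x - y) - f(x))^2, Tonelli's theorem exchanges the integrals, and translations by
    |y| <= r are controlled in L^2. *)
Lemma mollify_L2 (e : R) : 0 < e -> exists2 d : R, 0 < d & forall r, 0 < r <= d ->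
  (\int[mu]_x ((conv f (ker r) x - f x) ^+ 2)%:E <= e%:E)%E.
Proof.
move=> e0; have [d d0 hd] := f_shift e0; exists d => // r /andP[r0 rd].
have mf : measurable_fun setT f by case: Lf.
have kt := ker_test r0.
have mk : measurable_fun setT (ker r) by apply: smooth_measurable; case: kt.
have mfxy : measurable_fun setT (fun p : rV * rV => f (p.1 - p.2)).
  apply: (measurableT_comp mf); apply: measurable_rV_sub.
  - exact: measurable_fst.
  - exact: measurable_snd.
pose F (p : rV * rV) : \bar R := (ker r p.2 * (f (p.1 - p.2) - f p.1) ^+ 2)%:E.
have mF : measurable_fun setT F.
  apply/measurable_EFinP; apply: measurable_funM.
    exact: (measurableT_comp mk measurable_snd).
  apply: measurable_funX; apply: measurable_funB => //.
  exact: (measurableT_comp mf measurable_fst).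
have F0 (p : rV * rV) : (0 <= F p)%E by rewrite lee_fin mulr_ge0 ?ker_ge0 ?sqr_ge0.
have [c [c0 kc]] := test_bounded kt.
apply: (@le_trans _ _ (\int[mu]_x \int[mu]_y F (x, y))%E).
  apply: ge0_le_integral => //.
  - by move=> x _; rewrite lee_fin sqr_ge0.
  - by apply/measurable_EFinP/measurable_funX/measurable_funB => //; exact: conv_measurable.
  - exact: (@measurable_fun_fubini_tonelli_F _ _ _ _ _ mu F mF F0).
  move=> x _.
  have Lkf : L1 mu setT (fun y => ker r y * f (x - y)).
    have := L1_reflect x (conv_integrable x Lf1 kt).
    by apply: eq_integrable => // y _; rewrite /= subKr mulrC.
  have Lk : L1 mu setT (fun y => ker r y * (f (x - y) - f x)).
    have := L1B measurableT Lkf (L1Zr (f x) measurableT (ker_L1 r0)).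
    by apply: eq_integrable => // y _; rewrite /= mulrBr.
  have Lk2 : L1 mu setT (fun y => ker r y * (f (x - y) - f x) ^+ 2).
    apply: (L1_dom (g := fun y => c * (2 * f (x - y) ^+ 2) + 2 * f x ^+ 2 * ker r y)) => //.
    + apply: measurable_funM => //; apply: measurable_funX; apply: measurable_funB => //.
      exact: (measurableT_comp mf (measurable_reflect x)).
    + move=> y _; have k0 := @ker_ge0 r y r0; rewrite ger0_norm; last by apply: mulr_ge0 => //; exact: sqr_ge0.
      have := kc y; rewrite ger0_norm// => ky.
      have := sqr_ge0 (f (x - y)); have := sqr_ge0 (f x); have := sqr_ge0 (f (x - y) + f x).
      move: (f (x - y)) (f x) (ker r y) k0 ky => u w k k0 ky h1 h2 h3.
      apply: (@le_trans _ _ (k * (2 * u ^+ 2 + 2 * w ^+ 2))).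
        by rewrite ler_wpM2l//; nra.
      rewrite mulrDr lerD//; last by rewrite mulrC.
      by rewrite ler_wpM2r// mulr_ge0.
    + apply: (@L1D _ _ _ mu setT (fun y => c * (2 * f (x - y) ^+ 2)) (fun y => 2 * f x ^+ 2 * ker r y)) => //;
        last by apply: L1Z => //; exact: ker_L1.
      apply: L1Z => //; apply: L1Z => //.
      by have [_ sf] := Lf; exact: (L1_reflect x sf).
  rewrite -(L1_fin measurableT Lk2) lee_fin.
  rewrite (_ : conv f (ker r) x - f x = \int[mu]_y (ker r y * (f (x - y) - f x))).
    apply: Rjensen => //; [by move=> y _; exact: ker_ge0|exact: ker_L1|exact: ker_int].
  rewrite conv_reflect; last exact: conv_integrable kt.
  under [RHS]eq_Rintegral do rewrite mulrBr.
  rewrite RintegralB//; last by apply: L1Zr => //; exact: ker_L1.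
  by rewrite RintegralZr ?ker_int ?mul1r//; exact: ker_L1.
rewrite (fubini_tonelli F mF F0).
apply: (@le_trans _ _ (\int[mu]_y (e * ker r y)%:E)%E).
  apply: ge0_le_integral => //.
  - by move=> y _; exact: integral_ge0.
  - exact: (@measurable_fun_fubini_tonelli_G _ _ _ _ _ mu F mF F0).
  - by apply/measurable_EFinP; exact: measurable_funM.
  move=> y _; rewrite /F/=.
  have [->|k0] := eqVneq (ker r y) 0.
    by under eq_integral do rewrite mul0r; rewrite integral0 mulr0.
  have Ls := L2_shift_sub y Lf.
  have Es : (\int[mu]_x (ker r y * (f (x - y) - f x) ^+ 2)%:E)%E =
      (ker r y * \int[mu]_x (f (- y + x) - f x) ^+ 2)%:E.
    rewrite -RintegralZl// L1_fin//; last exact: L1Z.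
    by apply: eq_integral => x _; rewrite [x - y]addrC.
  rewrite Es lee_fin mulrC ler_wpM2r ?ker_ge0// hd//.
  exact: le_trans (ker_supp r0 k0) rd.
rewrite -L1_fin//; last by apply: L1Z => //; exact: ker_L1.
by rewrite RintegralZl ?ker_int ?mulr1//; exact: ker_L1.
Qed.
End mollification.
End kernels.

Section mollified_family.
Variables (R : realType) (n : nat).
Local Notation rV := 'rV[R]_n.
Local Notation mu := (@lebn R n).

(** The radii are chosen so that the squared L^2 errors are summable. The sum of all squared errors
    is then integrable, which yields at once the convergence almost everywhere and a majorant m
    common to all members of the family and all k. *)
Lemma mollified_family (I : finType) (f : I -> rV -> R) (a : rV) (s r0 : R) :
  (forall i, L2 (f i)) -> (forall i x, ~ cube a s x -> f i x = 0) -> 0 < r0 ->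
  exists (r : nat -> R) (m : rV -> R),
  [/\ forall k, 0 < r k <= r0, L1 mu setT m & {ae mu, forall x,
    forall i, [/\ conv (f i) (@ker R n (r k)) x @[k --> \oo] --> f i x,
      forall k, conv (f i) (@ker R n (r k)) x ^+ 2 <= m x & f i x ^+ 2 <= m x]}].
Proof.
move=> Lf f0 r00.
pose c : R := #|I|.+1%:R.
pose e k : R := c^-1 * (1 / (2 ^ k.+1)%:R).
have c0 : 0 < c by [].
have e0 k : 0 < e k by rewrite mulr_gt0 ?invr_gt0// divr_gt0// ltr0n expn_gt0.
have /choice[r hr] : forall k, exists r, 0 < r <= r0 /\ forall i,
    (\int[mu]_x ((conv (f i) (@ker R n r) x - f i x) ^+ 2)%:E <= (e k)%:E)%E.
  move=> k; have d i := cid2 (mollify_L2 (Lf i) (f0 i) (e0 k)).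
  (* The inverse of a sum of inverses is a positive number below each of the finitely many radii;
     the same device recurs below. *)
  pose D := r0^-1 + \sum_i (sval (d i))^-1.
  have D0 : 0 < D.
    rewrite /D ltr_wpDr ?invr_gt0// sumr_ge0// => i _.
    by case: (d i) => /= x x0 _; rewrite invr_ge0 ltW.
  have Dr : D^-1 <= r0.
    rewrite invf_ple ?posrE// lerDl sumr_ge0// => i _.
    by case: (d i) => /= x x0 _; rewrite invr_ge0 ltW.
  exists D^-1; rewrite invr_gt0 D0 Dr; split=> // i.
  case E : (d i) => [x x0 hx]; apply: (hx); rewrite invr_gt0 D0/= invf_ple ?posrE//.
  rewrite /D (bigD1 i)//= E/= addrCA lerDl addr_ge0 ?invr_ge0 ?(ltW r00)//.
  by apply: sumr_ge0 => j _; case: (d j) => /= y y0 _; rewrite invr_ge0 ltW.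
have r_gt0 k : 0 < r k by have [/andP[]] := hr k.
pose D k x : R := \sum_i (conv (f i) (@ker R n (r k)) x - f i x) ^+ 2.
have D0 k x : 0 <= D k x by apply: sumr_ge0 => i _; exact: sqr_ge0.
have mfi i : measurable_fun setT (f i) by have [] := Lf i.
have mD1 k i : measurable_fun setT (fun x => (conv (f i) (@ker R n (r k)) x - f i x) ^+ 2).
  apply: measurable_funX; apply: measurable_funB => //.
  exact: (conv_measurable (Lf i) (f0 i) (r_gt0 k)).
have mD k : measurable_fun setT (D k) by apply: measurable_sum => i.
have intD k : (\int[mu]_x (D k x)%:E <= (1 / (2 ^ k.+1)%:R)%:E)%E.
  rewrite /D; under eq_integral do rewrite -sumEFin.
  rewrite ge0_integral_sum//; last 2 first.
  - by move=> i; exact/measurable_EFinP.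
  - by move=> i x _; rewrite lee_fin sqr_ge0.
  apply: (@le_trans _ _ (\sum_(i in I) (e k)%:E)%E).
    by apply: lee_sum => i _; have [_] := hr k; apply.
  rewrite sumEFin lee_fin /e; set X := 1 / _.
  rewrite sumr_const -[Y in Y <= _]mulr_natl mulrA ler_piMl ?divr_ge0//.
  by rewrite ler_pdivrMr// mul1r ler_nat.
pose G x : \bar R := (\sum_(k <oo) (D k x)%:E)%E.
have G0 x : (0 <= G x)%E by apply: nneseries_ge0 => k _ _; rewrite lee_fin.
have mG : measurable_fun setT G.
  apply: ge0_emeasurable_sum => k; last by move=> _; exact/measurable_EFinP.
  by move=> x _ _; rewrite lee_fin.
have intG : (\int[mu]_x G x < +oo)%E.
  rewrite integral_nneseries//; last 2 first.
  - by move=> k; exact/measurable_EFinP.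
  - by move=> k x _; rewrite lee_fin.
  apply: (@le_lt_trans _ _ (\sum_(k <oo) (1 / (2 ^ k.+1)%:R)%:E)%E).
    apply: lee_nneseries => [k _ _|k _]; last exact: intD.
    by apply: integral_ge0 => x _; rewrite lee_fin.
  apply: le_lt_trans (epsilon_trick0 xpredT ler01) _; exact: ltry.
have iG : mu.-integrable setT G.
  apply/integrableP; split=> //; under eq_integral do rewrite gee0_abs//.
  exact: intG.
have LG : L1 mu setT (fun x => fine (G x)).
  apply: L1_ge0 => //; first exact: measurableT_comp.
    by move=> x _; exact: fine_ge0.
  apply: le_lt_trans intG; apply: ge0_le_integral => //.
  - by move=> x _; rewrite lee_fin fine_ge0.
  - by apply/measurable_EFinP; exact: measurableT_comp.
  - by move=> x _; have := G0 x; case: (G x) => //= *; rewrite leey.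
exists r, (fun x => 2 * fine (G x) + 2 * \sum_i f i x ^+ 2); split.
- by move=> k; have [] := hr k.
- apply: L1D => //; apply: L1Z => //; apply: L1_sum => // i _; by have [] := Lf i.
have := integrable_ae measurableT iG; apply: filterS => x Gx i.
have {}Gx := Gx Logic.I.
have DG k : D k x <= fine (G x).
  rewrite -lee_fin fineK//; apply: le_trans (@nneseries_lim_ge _ _ xpredT 0%N k.+1 _).
    rewrite big_mkord big_ord_recr/= leeDr// sume_ge0// => j _; by rewrite lee_fin.
  by move=> j _ _; rewrite lee_fin.
have Dcv : D ^~ x @ \oo --> 0.
  apply: cvg_series_cvg_0; apply: nondecreasing_is_cvgn.
    by apply: nondecreasing_series => j _ _.
  exists (fine (G x)) => _ [k _ <-]; rewrite -lee_fin fineK// /series/= -sumEFin.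
  by apply: (@nneseries_lim_ge _ _ xpredT 0%N k) => j _ _; rewrite lee_fin.
have Dk k : (conv (f i) (@ker R n (r k)) x - f i x) ^+ 2 <= D k x.
  by rewrite /D (bigD1 i)//= lerDl sumr_ge0// => j _; exact: sqr_ge0.
have fs : f i x ^+ 2 <= \sum_i f i x ^+ 2.
  by rewrite (bigD1 i)//= lerDl sumr_ge0// => j _; exact: sqr_ge0.
split.
- apply/cvgrPdist_lt => d d0; have d20 : 0 < d ^+ 2 by rewrite exprn_gt0.
  have /cvgrPdist_lt/(_ _ d20) := Dcv; apply: filterS => k.
  rewrite sub0r normrN ger0_norm// => h.
  rewrite distrC -(ltr_pXn2r (ltn0Sn 1))// ?nnegrE ?ltW//.
  by rewrite real_normK ?num_real// (le_lt_trans (Dk k)).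
- move=> k; have := Dk k; have := DG k; have := fs.
  move: (conv _ _ _) (f i x) (D k x) (fine _) (\sum__ _) => u v d g q h1 h2 h3.
  (* This square is the gap in u^2 <= 2 (u - v)^2 + 2 v^2. *)
  have := sqr_ge0 (u - 2 * v); nra.
- have := fs; have := fine_ge0 (G0 x); have := sqr_ge0 (f i x).
  move: (fine _) (\sum__ _) (f i x ^+ 2) => *; lra.
Qed.

Lemma ker_partial (r : R) j (z : rV) : 0 < r ->
  partial j (@ker R n r) z =
  - (kmass R n * r ^+ n)^-1 * (2 * z 0 j / r ^+ 2) * bump (dflat (@pker R)) r z.
Proof.
move=> r0; rewrite (_ : @ker R n r = (kmass R n * r ^+ n)^-1 \*: bump (@pker R) r)//.
rewrite /partial deriveZ; last exact/diff_derivable/smooth_differentiable/bump_smooth.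
by rewrite -/(partial j _ z) bump_partial /GRing.scale/=; ring.
Qed.

(** The indicator of the cube halfway between the two, mollified at radius d = (r - r') / 2. The
    constant depends only on n by scaling. *)
Lemma cutoff : exists C : R, 0 <= C /\ forall (a : rV) (r' r : R), 0 <= r' -> r' < r ->
  exists eta : rV -> R, [/\ test_function (cube a r) eta, forall x, 0 <= eta x <= 1,
    forall x, cube a r' x -> eta x = 1 &
    forall x, \sum_j partial j eta x ^+ 2 <= C / (r - r') ^+ 2].
Proof.
have [c [c0 hc]] := flat_bounded (dflat (@pker R)).
have km := @kmass_gt0 R n.
pose B := 2 * c * 2 ^+ n / kmass R n.
have B0 : 0 <= B by rewrite !mulr_ge0// invr_ge0 ltW.
exists (n%:R * B ^+ 2 * 4); split; first by rewrite mulr_ge0// mulr_ge0// sqr_ge0.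
move=> a r' r r'0 r'r.
pose d := (r - r') / 2; have d0 : 0 < d by rewrite divr_gt0// subr_gt0.
pose s := r' + d; have s0 : 0 <= s by rewrite addr_ge0// ltW.
have mc := @measurable_cube R n a s.
pose f : rV -> R := \1_(cube a s).
have Lf : L1 mu setT f by apply: L1_indic => //; exact: cube_finite.
have kt := @ker_test R n d d0.
have Lk x : L1 mu setT (fun y => @ker R n d (x - y)) by apply: L1_reflect; exact: ker_L1.
have Ik x : \int[mu]_y @ker R n d (x - y) = 1 by rewrite Rintegral_reflect ?ker_int//; exact: ker_L1.
have cs (x y : rV) : @ker R n d (x - y) != 0 -> forall i, `|x 0 i - y 0 i| <= d.
  move=> /(ker_supp d0) h i; apply: le_trans h; have := coord_le_norm (x - y) i.
  by rewrite !mxE.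
have eta_ge0 x : 0 <= conv f (@ker R n d) x.
  by apply: Rintegral_ge0 => y _; rewrite mulr_ge0 ?ker_ge0// /f indicE.
have eta_supp x : ~ cube a r x -> conv f (@ker R n d) x = 0.
  move=> nx; transitivity (\int[mu]_(y in [set: rV]) (0 : R)); last first.
    by rewrite /Rintegral integral0.
  apply: eq_Rintegral => y _.
  have [->|k0] := eqVneq (@ker R n d (x - y)) 0; first by rewrite mulr0.
  rewrite /f indicE memNset ?mul0r// => ys; apply: nx => i.
  have := cs _ _ k0 i; have := ys i; rewrite ler_norml /s /d; lra.
have Lc x := conv_integrable x Lf kt.
exists (conv f (@ker R n d)); split.
- apply: test_cube; first exact: conv_smooth kt.
  by move=> x /eqP h; apply: contrapT => /eta_supp.
- move=> x; rewrite eta_ge0 -(Ik x); apply: le_Rintegral => //; [exact: Lc|exact: Lk|].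
  move=> y _; by rewrite ler_piMl ?ker_ge0// /f indicE; case: (_ \in _).
- move=> x xr; rewrite -(Ik x); apply: eq_Rintegral => y _.
  have [->|k0] := eqVneq (@ker R n d (x - y)) 0; first by rewrite mulr0.
  rewrite /f indicE mem_set ?mul1r// => i.
  have := cs _ _ k0 i; have := xr i; rewrite ler_norml /s /d; lra.
move=> x.
(* The derivative of the kernel is of order d^(-n-1) on a cube of measure (2 d)^n, whence a bound of
   order 1/d for the gradient. *)
have Pk j z : `|partial j (@ker R n d) z| <= 2 * c / (kmass R n * d ^+ n * d) * \1_(cube 0 d) z.
  rewrite ker_partial// indicE.
  have [->|b0] := eqVneq (bump (dflat (@pker R)) d z) 0.
    rewrite mulr0 normr0; apply: mulr_ge0 => //; apply: divr_ge0; first exact: mulr_ge0.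
    by rewrite ltW// mulr_gt0// mulr_gt0// exprn_gt0.
  have zd := bump_support d0 b0.
  rewrite mem_set; last by apply/cube_norm; rewrite ?subr0// ltW.
  have kd : 0 < (kmass R n * d ^+ n)^-1 by exact: kerN_ge0.
  have d2 : 0 < d ^+ 2 by rewrite exprn_gt0.
  rewrite mulr1 !normrM normrN (gtr0_norm kd) normfV (gtr0_norm d2) (ger0_norm (ler0n R 2)).
  have -> : 2 * c / (kmass R n * d ^+ n * d) = (kmass R n * d ^+ n)^-1 * (2 * d / d ^+ 2) * c.
    by field; rewrite !gt_eqF// exprn_gt0.
  have dd : 0 <= 2 * `|z 0 j| / d ^+ 2 by apply: divr_ge0; [exact: mulr_ge0|exact: ltW].
  apply: ler_pM => //; first by apply: mulr_ge0 => //; exact: ltW.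
    rewrite ler_pM2l// ler_pM2r ?invr_gt0// ler_pM2l//.
    exact: le_trans (coord_le_norm _ _) _.
  exact: hc.
have bd j : `|partial j (conv f (@ker R n d)) x| <= B / d.
  rewrite (conv_partial j Lf kt).
  have Lp := conv_integrable x Lf (test_partial j kt).
  apply: le_trans (le_normr_Rintegral _ Lp) _ => //.
  have Li : L1 mu setT (\1_(cube 0 d) : rV -> R).
    by apply: L1_indic; [exact: measurable_cube|exact: cube_finite].
  have Lir : L1 mu setT (fun y => 2 * c / (kmass R n * d ^+ n * d) * \1_(cube 0 d) (x - y)).
    by apply: L1Z => //; exact: L1_reflect.
  apply: (@le_trans _ _ (\int[mu]_y (2 * c / (kmass R n * d ^+ n * d) * \1_(cube 0 d) (x - y)))).
    apply: le_Rintegral => //; first exact: integrable_norm Lp.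
    move=> y _; rewrite normrM; apply: le_trans (Pk j _).
    by rewrite ler_piMl// /f indicE; case: (_ \in _); rewrite ?normr1 ?normr0.
  rewrite RintegralZl//; last exact: L1_reflect.
  rewrite (Rintegral_reflect x Li).
  have -> : \int[mu]_y (\1_(cube 0 d) y : R) = (2 * d) ^+ n.
    rewrite /Rintegral integral_indic//; last exact: measurable_cube.
    by rewrite setIT /lebn leb_cube// ltW.
  rewrite le_eqVlt; apply/orP; left; apply/eqP; rewrite /B [(2 * d) ^+ n]exprMn.
  have X0 : d ^+ n != 0 by rewrite gt_eqF// exprn_gt0.
  move: (d ^+ n) (2 ^+ n) X0 => X Y X0; field.
  by rewrite X0 !gt_eqF.
have -> : n%:R * B ^+ 2 * 4 / (r - r') ^+ 2 = \sum_(j < n) (B / d) ^+ 2.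
  rewrite sumr_const card_ord -mulr_natl /d; field.
  by rewrite subr_eq0 gt_eqF.
apply: ler_sum => j _; rewrite -(real_normK (num_real (partial _ _ _))).
by apply: lerXn2r; rewrite ?nnegrE// ?bd// divr_ge0// ltW.
Qed.
End mollified_family.

(** * Caccioppoli and Poincare inequalities *)

Section local_solutions.
Variables (R : realType) (n : nat).
Local Notation rV := 'rV[R]_n.
Local Notation mu := (@lebn R n).
Implicit Types (a x y : rV) (s r lam : R) (u e : rV -> R) (g V : 'I_n -> rV -> R).

(* A weak solution u on a cube of div V = 0, where V plays the role of A grad u,
   g is the weak gradient of u, and e controls |g|^2 and |V|^2. *)
Record local_sol lam a s u g V e : Prop := LocalSol {
  sol_L2 : L2 u;
  sol_gL2 : forall i, L2 (g i);
  sol_VL2 : forall i, L2 (V i);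
  sol_eL1 : L1 mu setT e;
  sol_u0 : forall x, ~ cube a s x -> u x = 0;
  sol_g0 : forall i x, ~ cube a s x -> g i x = 0;
  sol_grad : forall phi i, test_function (cube a s) phi ->
    \int[mu]_x (u x * partial i phi x) = - \int[mu]_x (g i x * phi x);
  sol_div : forall phi, test_function (cube a s) phi ->
    \int[mu]_x (\sum_i V i x * partial i phi x) = 0;
  sol_ell : {ae mu, forall x, cube a s x -> [/\ lam * e x <= \sum_i V i x * g i x,
    \sum_i g i x ^+ 2 <= e x & \sum_i V i x ^+ 2 <= e x]}
}.

Lemma sol_L1 lam a s u g V e : local_sol lam a s u g V e -> L1 mu setT u.
Proof. by case=> Lu _ _ _ u0 _ _ _ _; exact: L2_cube_L1 Lu u0. Qed.

Lemma sol_gL1 lam a s u g V e i : local_sol lam a s u g V e -> L1 mu setT (g i).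
Proof. by case=> _ Lg _ _ _ g0 _ _ _; exact: L2_cube_L1 (Lg i) (g0 i). Qed.

(** The reflected kernel centred at x is a test function, because its support stays in the cube of
    the solution. *)
Lemma weak_grad_conv lam a s u g V e i x r : local_sol lam a s u g V e -> 0 < r ->
  cube x r `<=` cube a s ->
  partial i (conv u (@ker R n r)) x = conv (g i) (@ker R n r) x.
Proof.
move=> sol r0 sub; have kt := @ker_test R n r r0.
have Lu := sol_L1 sol; have Lg := sol_gL1 i sol.
rewrite (conv_partial i Lu kt) /conv.
have tx := test_subset sub (test_reflect x kt).
have := sol_grad sol i tx.
rewrite reflect_partial; last by case: kt.
under eq_Rintegral do rewrite mulrN.
rewrite RintegralN//; last exact: conv_integrable (test_partial i kt).
by move/oppr_inj.
Qed.

(** Nonlinearities that may be composed with a weak solution. The set D contains the values of u and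
    of its mollifications: it is the line, or a half-line for the logarithm. The bounds provide the
    majorants for dominated convergence. *)
Record c1_op (D : set R) (H dH : R -> R) (C : R) : Prop := C1Op {
  op_smooth : forall w : rV -> R, smooth w -> (forall x, D (w x)) -> smooth (H \o w);
  op_derive : forall t, D t -> is_derive t 1 H (dH t);
  op_cont : forall t, D t -> {for t, continuous dH};
  op_bound : forall t, D t -> `|dH t| <= C;
  op_growth : forall t, D t -> `|H t| <= C * (1 + `|t|);
  op_meas : measurable_fun setT H;
  op_dmeas : measurable_fun setT dH
}.

(** The majorant of [comp_approx], from (1 + P + Q)^2 <= 3 (1 + P^2 + Q^2). *)
Lemma sqr_sum_le (c p q m : R) : 0 <= c -> p ^+ 2 <= m -> q ^+ 2 <= m ->
  (c * (c * (1 + `|p|)) + c * (c * `|q|)) ^+ 2 <= 6 * c ^+ 4 * (1 + m).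
Proof.
rewrite -(real_normK (num_real p)) -(real_normK (num_real q)).
have := normr_ge0 p; have := normr_ge0 q; move: (`|p|) (`|q|) => P Q Q0 P0 c0 pm qm.
have -> : (c * (c * (1 + P)) + c * (c * Q)) ^+ 2 = c ^+ 4 * (1 + P + Q) ^+ 2 by ring.
have -> : 6 * c ^+ 4 * (1 + m) = c ^+ 4 * (6 * (1 + m)) by ring.
rewrite ler_wpM2l ?exprn_ge0//.
have := sqr_ge0 (1 - P); have := sqr_ge0 (1 - Q); have := sqr_ge0 (P - Q); nra.
Qed.

(** The chain and product rules for eta H(u), in the form in which they are used: smooth
    approximations converging almost everywhere with their gradients, under a single integrable
    majorant of the squares. *)
Lemma comp_approx lam a s s' u g V e D H dH C (eta : rV -> R) c :
  local_sol lam a s u g V e -> s' < s ->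
  c1_op D H dH C ->
  (forall r x, 0 < r -> D (conv u (@ker R n r) x)) -> {ae mu, forall x, D (u x)} ->
  smooth eta -> (forall x, `|eta x| <= c) -> (forall i x, `|partial i eta x| <= c) ->
  exists (v : nat -> rV -> R) (m : rV -> R),
  [/\ forall k, smooth (v k), L1 mu setT m,
    forall k, exists psi, smooth psi /\ v k = fun x => eta x * psi x &
    {ae mu, forall x, cube a s' x ->
      [/\ v k x @[k --> \oo] --> eta x * H (u x),
        forall i, partial i (v k) x @[k --> \oo] -->
          eta x * dH (u x) * g i x + partial i eta x * H (u x),
        forall k, v k x ^+ 2 <= m x & forall k i, partial i (v k) x ^+ 2 <= m x]}].
Proof.
move=> sol ss op Dc Du seta hc hdc.
pose f (o : option 'I_n) := if o is Some i then g i else u.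
have Lf o : L2 (f o) by case: o => [i|]; [exact: sol_gL2 sol i|exact: sol_L2 sol].
have f0 o x : ~ cube a s x -> f o x = 0.
  by case: o => [i|]; [exact: sol_g0 sol i x|exact: sol_u0 sol x].
have ss0 : 0 < s - s' by rewrite subr_gt0.
have [r [m [hr Lm hm]]] := mollified_family Lf f0 ss0.
have r0 k : 0 < r k by have /andP[] := hr k.
pose uk k := conv u (@ker R n (r k)).
have Lu := sol_L1 sol.
have suk k : smooth (uk k) by apply: (conv_smooth Lu); exact: (@ker_test R n _ (r0 k)).
have c0 : 0 <= c by exact: le_trans (normr_ge0 _) (hc 0).
have C0 : 0 <= C by apply: le_trans (normr_ge0 _) (op_bound op (Dc 1 0 ltr01)).
pose K := c + C.
have [cK CK K0] : [/\ c <= K, C <= K & 0 <= K] by rewrite /K; split; lra.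
have sH k : smooth (H \o uk k) by apply: (op_smooth op (suk k)) => x; exact: Dc.
have gk k i x : cube a s' x -> partial i (uk k) x = conv (g i) (@ker R n (r k)) x.
  move=> xs; apply: (weak_grad_conv i sol (r0 k)) => y yx j.
  have := xs j; have := yx j; have /andP[_] := hr k; move: (r k) (a 0 j) (x 0 j) (y 0 j) => *; lra.
pose v k x := eta x * (H \o uk k) x.
have dv k i x : partial i (v k) x =
    eta x * dH (uk k x) * partial i (uk k) x + partial i eta x * H (uk k x).
  have dH1 := op_derive op (Dc (r k) x (r0 k)).
  have [_ dHu] := derive_comp1 (basis_vec R i) dH1 (smooth_differentiable x (suk k)).
  rewrite /partial deriveM; last 2 first.
  - exact/diff_derivable/smooth_differentiable.
  - exact/diff_derivable/smooth_differentiable.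
  rewrite dHu /GRing.scale/=.
  by rewrite mulrA [X in _ + X]mulrC.
exists v, (fun x => 6 * K ^+ 4 * (\1_(cube a s') x + m x)); split.
- move=> k; apply: smooth_exprP; apply: SmoothMul; exact: SmoothBase.
- apply: L1Z => //; apply: L1D => //; apply: L1_indic; [exact: measurable_cube|exact: cube_finite].
- by move=> k; exists (H \o uk k).
apply: filterS2 hm Du => x hm Dux xs.
have [cu mu_ _] := hm None.
have Duk k : D (uk k x) by exact: Dc.
have cH : H (uk k x) @[k --> \oo] --> H (u x).
  have cHu : {for u x, continuous H}.
    by apply/differentiable_continuous/derivable1_diffP; case: (op_derive op Dux).
  exact: (@cvg_comp _ _ _ (uk ^~ x) H _ _ _ cu cHu).
have cdH : dH (uk k x) @[k --> \oo] --> dH (u x).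
  by apply: (@cvg_comp _ _ _ (uk ^~ x) dH _ _ _ cu); exact: (op_cont op Dux).
have bH k : `|H (uk k x)| <= K * (1 + `|uk k x|).
  by apply: le_trans (op_growth op (Duk k)) _; rewrite ler_wpM2r// addr_ge0.
have bdH k : `|dH (uk k x)| <= K by apply: le_trans (op_bound op (Duk k)) CK.
rewrite indicE mem_set//=; split.
- by apply: cvgMl_tmp.
- move=> i; have [cg _ _] := hm (Some i).
  under eq_cvg do rewrite dv gk//.
  apply: cvgD; last by apply: cvgMl_tmp.
  by apply: cvgM => //; apply: cvgMl_tmp.
- move=> k; apply: le_trans (sqr_sum_le K0 (mu_ k) (mu_ k)).
  rewrite -(real_normK (num_real (v k x))); apply: lerXn2r; rewrite ?nnegrE//.
    by rewrite addr_ge0// !mulr_ge0// addr_ge0.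
  rewrite /v normrM; apply: le_trans (_ : K * (K * (1 + `|uk k x|)) <= _).
    by rewrite ler_pM//; [exact: le_trans (hc x) cK|exact: bH].
  by rewrite lerDl !mulr_ge0.
- move=> k i; have [_ mg _] := hm (Some i).
  apply: le_trans (sqr_sum_le K0 (mu_ k) (mg k)).
  rewrite -(real_normK (num_real (partial i (v k) x))); apply: lerXn2r; rewrite ?nnegrE//.
    by rewrite addr_ge0// !mulr_ge0// addr_ge0.
  rewrite dv gk// addrC (le_trans (ler_normD _ _))// lerD//.
    by rewrite normrM ler_pM//; exact: le_trans (hdc i x) cK.
  rewrite !normrM -mulrA ler_pM// ?mulr_ge0//; first exact: le_trans (hc x) cK.
  by rewrite ler_wpM2r.
Qed.

Definition grad_sqr (eta : rV -> R) x : R := \sum_i partial i eta x ^+ 2.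

(** The function eta^2 G(u) is only a limit of test functions. The equation passes to the limit by
    dominated convergence, since |V_i d_i v| <= V_i^2 + |d_i v|^2 and the last square is
    majorized. *)
Lemma energy_identity lam a s s' u g V e D G dG C (eta : rV -> R) :
  local_sol lam a s u g V e -> s' < s -> c1_op D G dG C ->
  (forall r x, 0 < r -> D (conv u (@ker R n r) x)) -> {ae mu, forall x, D (u x)} ->
  test_function (cube a s') eta ->
  L1 mu setT (fun x => \sum_i V i x *
    (eta x ^+ 2 * dG (u x) * g i x + 2 * eta x * partial i eta x * G (u x))) /\
  \int[mu]_x (\sum_i V i x *
    (eta x ^+ 2 * dG (u x) * g i x + 2 * eta x * partial i eta x * G (u x))) = 0.
Proof.
move=> sol ss op Dc Du teta.
have seta : smooth eta by case: teta.
have teta2 : test_function (cube a s') (fun x => eta x * eta x) by exact: test_mul.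
have [c1 [c10 hc1]] := test_bounded teta2.
have bdi i : {c | 0 <= c /\ forall x, `|partial i (fun x => eta x * eta x) x| <= c}.
  by apply: cid; exact: test_bounded (test_partial i teta2).
pose c := c1 + \sum_i sval (bdi i).
have bs0 i : 0 <= sval (bdi i) by case: (bdi i) => q [].
have hc x : `|eta x * eta x| <= c by rewrite (le_trans (hc1 x))// lerDl sumr_ge0.
have hdc i x : `|partial i (fun x => eta x * eta x) x| <= c.
  apply: (@le_trans _ _ (sval (bdi i))); first by case: (bdi i) => q [].
  by rewrite /c (bigD1 i)//= addrCA lerDl addr_ge0// sumr_ge0.
have p2 i x : partial i (fun x => eta x * eta x) x = 2 * eta x * partial i eta x.
  rewrite /partial deriveM; last 2 first.
  - exact/diff_derivable/smooth_differentiable.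
  - exact/diff_derivable/smooth_differentiable.
  by rewrite /GRing.scale/=; ring.
have seta2 : smooth (fun x => eta x * eta x) by case: teta2.
have [v [m [sv Lm hv cv]]] := comp_approx sol ss op Dc Du seta2 hc hdc.
have tv k : test_function (cube a s') (v k).
  by have [psi [spsi ->]] := hv k; exact: test_mul.
pose F k x := \sum_i V i x * partial i (v k) x.
pose F0 x := \sum_i V i x *
    (eta x ^+ 2 * dG (u x) * g i x + 2 * eta x * partial i eta x * G (u x)).
have mV i : measurable_fun setT (V i) by have [] := sol_VL2 sol i.
have mg i : measurable_fun setT (g i) by have [] := sol_gL2 sol i.
have mu' : measurable_fun setT u by have [] := sol_L2 sol.
have sub : cube a s' `<=` cube a s.
  by move=> x xs i; have := xs i; move: ss (a 0 i) (x 0 i) => *; lra.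
have IF k : \int[mu]_x F k x = 0.
  exact: (sol_div sol (test_subset sub (tv k))).
have Lg : L1 mu setT (fun x => \sum_i (V i x ^+ 2 + `|m x|)).
  apply: L1_sum => // i _; apply: L1D => //; first by have [] := sol_VL2 sol i.
  exact: integrable_norm Lm.
have [||||LF cvF] := @Rdominated_cvg _ _ _ mu setT F F0 _ measurableT _ _ _ Lg.
- move=> k; apply: measurable_sum => i; apply: measurable_funM => //.
  by apply: smooth_measurable; exact: smooth_partial.
- apply: measurable_sum => i; apply: measurable_funM => //; apply: measurable_funD.
    apply: measurable_funM => //; apply: measurable_funM => //.
      by apply: measurable_funX; exact: smooth_measurable.
    exact: (measurableT_comp (op_dmeas op) mu').
  apply: measurable_funM; last exact: (measurableT_comp (op_meas op) mu').
  apply: measurable_funM; last by apply: smooth_measurable; exact: smooth_partial.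
  by apply: measurable_funM => //; exact: smooth_measurable.
- apply: filterS cv => x cv _; have [xs|xs] := pselect (cube a s' x); last first.
    have z k i : partial i (v k) x = 0.
      by apply/eqP/negPn/negP => /(test_supp (test_partial i (tv k))).
    have e0 : eta x = 0 by apply/eqP/negPn/negP => /(test_supp teta).
    apply: cvg_near_cst; apply: nearW => k; rewrite /F /F0 !big1// => i _.
      by rewrite e0 expr0n/= mulr0 !mul0r addr0 mulr0.
    by rewrite z mulr0.
  have [_ ci _ _] := cv xs.
  rewrite /F /F0; apply: cvg_big => [|i _]; first exact: add_continuous.
  apply: cvgMl_tmp; have := ci i; rewrite p2 expr2.
  by [].
- apply: filterS cv => x cv k _; apply: le_trans (ler_norm_sum _ _ _) _.
  apply: ler_sum => i _; rewrite normrM.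
  have [xs|xs] := pselect (cube a s' x); last first.
    rewrite [partial i (v k) x](_ : _ = 0) ?normr0 ?mulr0 ?addr_ge0 ?sqr_ge0//.
    by apply/eqP/negPn/negP => /(test_supp (test_partial i (tv k))).
  have [_ _ _ /(_ k i) bm] := cv xs.
  have := ler_norm (m x); move: bm; rewrite -(real_normK (num_real (partial _ _ _))).
  rewrite -(real_normK (num_real (V i x))).
  have := normr_ge0 (V i x); have := normr_ge0 (partial i (v k) x).
  move: (`|V i x|) (`|partial i (v k) x|) (m x) (`|m x|) => p q M N p0 q0 h1 h2.
  have := sqr_ge0 (p - q); nra.
split => //.
have c0 : \int[mu]_x F k x @[k --> \oo] --> (0 : R).
  by apply: cvg_near_cst; apply: nearW => k; exact: IF.
by rewrite -(cvg_lim _ cvF)//; exact: cvg_lim c0.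
Qed.

(** From (k p |v| - h |w|)^2 >= 0 after division by k. *)
Lemma young (v w k q p h : R) : 0 < k -> 0 <= p -> 0 <= h -> `|q| <= p * h ->
  - (k * (p * v) ^+ 2 + k^-1 * (h * w) ^+ 2) <= 2 * q * (v * w).
Proof.
move=> k0 p0 h0 qph.
have E : k * (p * v) ^+ 2 + k^-1 * (h * w) ^+ 2 =
    k^-1 * (k * (p * `|v|) - h * `|w|) ^+ 2 + 2 * (p * h) * (`|v| * `|w|).
  have -> : (p * v) ^+ 2 = (p * `|v|) ^+ 2 by rewrite !exprMn real_normK ?num_real.
  have -> : (h * w) ^+ 2 = (h * `|w|) ^+ 2 by rewrite !exprMn real_normK ?num_real.
  by field; rewrite gt_eqF.
have : `|2 * q * (v * w)| <= 2 * (p * h) * (`|v| * `|w|).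
  by rewrite !normrM (ger0_norm (ler0n R 2)) ler_wpM2r ?mulr_ge0// ler_wpM2l.
have : 0 <= k^-1 * (k * (p * `|v|) - h * `|w|) ^+ 2.
  by rewrite mulr_ge0 ?sqr_ge0// invr_ge0 ltW.
rewrite E ler_norml; move: (k^-1 * _) (2 * (p * h) * _) (2 * q * _) => A B F; lra.
Qed.

(* Test the equation with eta^2 G(u); Young's inequality absorbs the cross term. *)
Lemma energy_estimate lam a s s' u g V e D G dG C (gam h : R -> R) (eta : rV -> R) :
  0 < lam -> local_sol lam a s u g V e -> s' < s -> c1_op D G dG C ->
  (forall r x, 0 < r -> D (conv u (@ker R n r) x)) -> {ae mu, forall x, D (u x)} ->
  test_function (cube a s') eta ->
  (forall t, D t -> [/\ 0 <= gam t, gam t ^+ 2 <= dG t & `|G t| <= gam t * h t]) ->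
  L1 mu setT (fun x => (eta x * gam (u x)) ^+ 2 * e x) ->
  L1 mu setT (fun x => h (u x) ^+ 2 * grad_sqr eta x) ->
  \int[mu]_x ((eta x * gam (u x)) ^+ 2 * e x) <=
  4 / lam ^+ 2 * \int[mu]_x (h (u x) ^+ 2 * grad_sqr eta x).
Proof.
move=> lam0 sol ss op Dc Du teta hG Lg Lh.
have [LI I0] := energy_identity sol ss op Dc Du teta.
(* Young's inequality with k = lam / 2 spends half of the ellipticity on the cross term and costs
   the factor 2 / lam; dividing by the remaining lam / 2 gives 4 / lam^2. *)
have : \int[mu]_x (lam / 2 * ((eta x * gam (u x)) ^+ 2 * e x) -
    2 / lam * (h (u x) ^+ 2 * grad_sqr eta x)) <= 0.
  rewrite -I0; apply: le_Rintegral_ae => //; first by apply: L1B => //; exact: L1Z.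
  have sub : cube a s' `<=` cube a s.
    by move=> x xs i; have := xs i; move: ss (a 0 i) (x 0 i) => *; lra.
  apply: filterS2 Du (sol_ell sol) => x Dx ell _.
  have [xs|xs] := pselect (cube a s' x); last first.
    have e0 : eta x = 0 by apply/eqP/negPn/negP => /(test_supp teta).
    rewrite [leRHS]big1 => [|i _]; last by rewrite e0 expr0n/= mulr0 !mul0r addr0 mulr0.
    rewrite e0 mul0r expr0n/= mul0r mulr0 sub0r oppr_le0.
    apply: mulr_ge0; first by rewrite divr_ge0// ltW.
    by apply: mulr_ge0; [exact: sqr_ge0|apply: sumr_ge0 => i _; exact: sqr_ge0].
  have [e1 e2 e3] := ell (sub _ xs).
  have [g0 g2 Gg] := hG _ Dx.
  have e_ge0 : 0 <= e x by apply: le_trans e2; apply: sumr_ge0 => i _; exact: sqr_ge0.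
  have eg0 : 0 <= `|eta x| * gam (u x) by rewrite mulr_ge0.
  have h0 : `|eta x * G (u x)| <= `|eta x| * gam (u x) * `|h (u x)|.
    rewrite normrM -mulrA ler_wpM2l// (le_trans Gg)// ler_wpM2l//; exact: ler_norm.
  apply: (@le_trans _ _ (eta x ^+ 2 * dG (u x) * (lam * e x) -
     (lam / 2 * (`|eta x| * gam (u x)) ^+ 2 * e x + 2 / lam * h (u x) ^+ 2 * grad_sqr eta x))).
    have -> : (`|eta x| * gam (u x)) ^+ 2 = (eta x * gam (u x)) ^+ 2.
      by rewrite !exprMn real_normK ?num_real.
    have k1 : lam * ((eta x * gam (u x)) ^+ 2 * e x) <= eta x ^+ 2 * dG (u x) * (lam * e x).
      have -> : lam * ((eta x * gam (u x)) ^+ 2 * e x) = eta x ^+ 2 * gam (u x) ^+ 2 * (lam * e x) by ring.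
      by apply: ler_wpM2r; [rewrite mulr_ge0// ltW|rewrite ler_wpM2l ?sqr_ge0].
    rewrite -[lam / 2 * _ * e x]mulrA -[2 / lam * _ * _]mulrA.
    move: k1; move: ((eta x * gam (u x)) ^+ 2 * e x) (eta x ^+ 2 * dG (u x) * (lam * e x))
      (2 / lam * (h (u x) ^+ 2 * grad_sqr eta x)) => A B E; lra.
  apply: (@le_trans _ _ (eta x ^+ 2 * dG (u x) * (\sum_i V i x * g i x) -
     \sum_i (lam / 2 * (`|eta x| * gam (u x) * V i x) ^+ 2 +
        2 / lam * (`|h (u x)| * partial i eta x) ^+ 2))).
    apply: lerB.
      apply: ler_wpM2l => //; apply: mulr_ge0; first exact: sqr_ge0.
      by apply: le_trans g2; exact: sqr_ge0.
    rewrite big_split/= -!mulr_sumr lerD//.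
      rewrite -[leRHS]mulrA ler_wpM2l ?divr_ge0 ?(ltW lam0)//.
      under eq_bigr do rewrite exprMn; rewrite -mulr_sumr ler_wpM2l ?sqr_ge0//.
    under eq_bigr do rewrite exprMn; by rewrite -mulr_sumr real_normK ?num_real// -[leRHS]mulrA.
  rewrite mulr_sumr -sumrB; apply: ler_sum => i _.
  have -> : V i x * (eta x ^+ 2 * dG (u x) * g i x + 2 * eta x * partial i eta x * G (u x)) =
    eta x ^+ 2 * dG (u x) * (V i x * g i x) + 2 * (eta x * G (u x)) * (V i x * partial i eta x) by ring.
  rewrite lerD2l.
  have k0 : 0 < lam / 2 by rewrite divr_gt0.
  have := young (V i x) (partial i eta x) k0 eg0 (normr_ge0 _) h0.
  by rewrite invf_div.
rewrite RintegralB//; [|exact: L1Z..].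
rewrite !RintegralZl//.
move: (\int[mu]_x _) (\int[mu]_x _) => B A E.
have -> : 4 / lam ^+ 2 * B = 2 / lam * (2 / lam * B) by field; rewrite gt_eqF.
rewrite -ler_pdivrMl ?divr_gt0// invf_div; move: E; lra.
Qed.
End local_solutions.

(** * A Poincare inequality at scale l *)

Section poincare.
Variables (R : realType) (n : nat).
Local Notation rV := 'rV[R]_n.
Local Notation mu := (@lebn R n).
Local Notation lam := (@lebesgue_measure R).
Implicit Types (a x y h : rV) (s l : R) (w : rV -> R).

Lemma L1_continuous_cube w a s : continuous w -> L1 mu (cube a s) w.
Proof.
move=> cw; have mc := @measurable_cube R n a s.
have mw : measurable_fun (cube a s) w by apply: measurable_funS (rV_continuous_measurable cw).
have cn : continuous (fun x => `|w x|).
  by move=> x; apply: continuous_comp; [exact: cw|exact: norm_continuous].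
have [e0|/set0P ne] := eqVneq (cube a s) set0.
  by rewrite e0 /L1; exact: integrable_set0.
have [c _ hc] := EVT_max_rV ne (@cube_compact R n a s) (continuous_subspaceT cn).
apply: (@L1_bounded _ _ _ mu _ _ `|w c|) => //; first exact: cube_finite.
by move=> x xs; apply: hc; rewrite inE.
Qed.

Lemma sum_sqr_le (b : 'I_n -> R) : (\sum_i b i) ^+ 2 <= n%:R * \sum_i b i ^+ 2.
Proof.
rewrite expr2 mulr_suml.
apply: (@le_trans _ _ (\sum_i \sum_j (b i ^+ 2 / 2 + b j ^+ 2 / 2))).
  apply: ler_sum => i _; rewrite mulr_sumr; apply: ler_sum => j _.
  have := sqr_ge0 (b i - b j); move: (b i) (b j) => p q; lra.
have E i : \sum_j (b i ^+ 2 / 2 + b j ^+ 2 / 2) = n%:R * (b i ^+ 2 / 2) + (\sum_j b j ^+ 2) / 2.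
  by rewrite big_split/= sumr_const card_ord mulr_natl -mulr_suml.
under eq_bigr do rewrite E.
rewrite big_split/= -mulr_sumr -mulr_suml sumr_const card_ord -[X in _ + X]mulr_natl.
move: (\sum_i _) => S; lra.
Qed.

Lemma dot_sqr_le h (b : 'I_n -> R) :
  (\sum_i h 0 i * b i) ^+ 2 <= n%:R * `|h| ^+ 2 * \sum_i b i ^+ 2.
Proof.
apply: le_trans (sum_sqr_le _) _; rewrite -mulrA ler_wpM2l// mulr_sumr.
apply: ler_sum => i _; rewrite exprMn ler_wpM2r ?sqr_ge0//.
rewrite -(real_normK (num_real (h 0 i))); apply: lerXn2r; rewrite ?nnegrE//.
exact: coord_le_norm.
Qed.

(** The fundamental theorem of calculus along the segment, then Jensen's inequality on [0, 1] and
    the Cauchy-Schwarz inequality; n appears because |h| is the sup norm. *)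
Lemma segment_sqr w x h : smooth w ->
  (((w (h + x) - w x) ^+ 2)%:E <=
   \int[lam]_(t in `[0%R, 1%R]) ((n%:R * `|h| ^+ 2 * grad_sqr w (x + t *: h))%:E))%E.
Proof.
move=> sw; have mI : measurable (`[0, 1] : set R) by [].
have dw y := smooth_differentiable y sw.
pose f (t : R) := w (x + t *: h); pose df (t : R) := 'D_h w (x + t *: h).
have df_is (t : R) : is_derive t 1 f (df t) by exact: is_derive_line.
have cline : continuous (fun t : R => x + t *: h).
  by move=> t; apply: cvgD; [exact: cvg_cst|apply: cvgZl; exact: cvg_id].
have cdf : continuous df.
  move=> t; rewrite /df.
  have -> : (fun t : R => 'D_h w (x + t *: h)) = fun t => \sum_i h 0 i * partial i w (x + t *: h).
    by apply/funext => u; rewrite derive_partial.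
  apply: cvg_big => [|i _]; first exact: add_continuous.
  apply: cvgMl_tmp; apply: (continuous_comp (cline t)).
  exact/smooth_continuous/smooth_partial.
have cf : continuous f.
  by move=> t; apply: (continuous_comp (cline t)); exact: smooth_continuous.
have ftc : (\int[lam]_(t in `[0%R, 1%R]) (df t)%:E = (f 1)%:E - (f 0)%:E)%E.
  apply: continuous_FTC2 => //; first exact: continuous_subspaceT.
    split.
    - by move=> t _; case: (df_is t).
    - by apply: cvg_at_right_filter; exact: cf.
    - by apply: cvg_at_left_filter; exact: cf.
  by move=> t _; rewrite derive1E; case: (df_is t).
have L (g : R -> R) : continuous g -> L1 lam `[0, 1] g.
  move=> cg; apply: continuous_compact_integrable; first exact: segment_compact.
  exact: continuous_subspaceT.
have E : w (h + x) - w x = \int[lam]_(t in `[0, 1]) (1 * df t).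
  under eq_Rintegral do rewrite mul1r.
  by rewrite /Rintegral ftc /f scale1r scale0r addr0 [x + h]addrC.
have cc : continuous (fun t : R => n%:R * `|h| ^+ 2 * grad_sqr w (x + t *: h)).
  move=> t; apply: cvgMl_tmp; apply: cvg_big => [|i _]; first exact: add_continuous.
  have c1 : {for t, continuous (fun t : R => partial i w (x + t *: h))}.
    apply: (continuous_comp (cline t)); exact/smooth_continuous/smooth_partial.
  under eq_cvg do rewrite expr2; rewrite expr2; exact: cvgM.
rewrite -L1_fin//; last exact: L.
rewrite lee_fin E.
have cd2 : continuous (fun t : R => 1 * df t ^+ 2).
  move=> t; apply: cvgMl_tmp; under eq_cvg do rewrite expr2; rewrite expr2.
  by apply: cvgM; exact: cdf.
have l1 : \int[lam]_(t in `[0, 1]) (1 : R) = 1.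
  rewrite /Rintegral integral_cst//=; have := lebesgue_measure_itv (`[0, 1] : interval R).
  by rewrite /= lte_fin ltr01 -EFinB subr0 => ->; rewrite mul1e.
apply: le_trans (@Rjensen _ _ _ lam _ (fun=> 1) df mI _ _ _ _ _) _ => //.
- by apply: L => t; exact: cvg_cst.
- apply: L => t; apply: cvgMl_tmp; exact: cdf.
- exact: L.
apply: le_Rintegral => //; [exact: L|exact: L|].
move=> t _; rewrite mul1r /df derive_partial//; exact: dot_sqr_le.
Qed.

Lemma grad_sqr_ge0 w x : 0 <= grad_sqr w x.
Proof. by apply: sumr_ge0 => i _; exact: sqr_ge0. Qed.

Lemma grad_sqr_continuous w : smooth w -> continuous (grad_sqr w).
Proof.
move=> sw; apply: smooth_continuous; apply: smooth_exprP.
apply: smooth_expr_sum => i; rewrite (_ : (fun x => _) = fun x => partial i w x * partial i w x).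
  by apply: SmoothMul; apply: SmoothBase; exact: smooth_partial.
by apply/funext => x; rewrite expr2.
Qed.

Lemma cube_convex a s x h (t : R) : 0 <= t <= 1 -> cube a s x -> cube a s (h + x) ->
  cube a s (x + t *: h).
Proof.
move=> /andP[t0 t1] xs hs i; have := xs i; have := hs i; rewrite !mxE.
move: (a 0 i) (x 0 i) (h 0 i) => p q k; nra.
Qed.

(** Integrate [segment_sqr] over x. By convexity the segment stays in the cube, and after Tonelli's
    theorem each time t contributes the same integral by translation invariance. *)
Lemma difference_quotient a s w h : smooth w ->
  (\int[mu]_x (\1_(cube a s) x * \1_(cube a s) (h + x) * (w (h + x) - w x) ^+ 2)%:E <=
   (n%:R * `|h| ^+ 2 * \int[mu]_(x in cube a s) grad_sqr w x)%:E)%E.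
Proof.
move=> sw; have mc := @measurable_cube R n a s.
have cg := grad_sqr_continuous sw.
have Lg := L1_continuous_cube a s cg.
have c0 : 0 <= n%:R * `|h| ^+ 2 by rewrite mulr_ge0 ?sqr_ge0.
pose q : rV -> R := \1_(cube a s).
have mq : measurable_fun setT q by exact: measurable_indic.
have q0 x : 0 <= q x by rewrite /q indicE.
have mN : measurable_fun setT (grad_sqr w) by exact: rV_continuous_measurable.
have mw : measurable_fun setT w by exact: smooth_measurable.
have msh : measurable_fun setT (fun x : rV => h + x).
  by have := @measurable_affine R n h 1; under eq_fun do rewrite scale1r.
pose I01 : R -> R := \1_(`[0, 1]).
pose F (p : rV * R) : \bar R :=
  (I01 p.2 * (n%:R * `|h| ^+ 2 * (q (p.1 + p.2 *: h) * grad_sqr w (p.1 + p.2 *: h))))%:E.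
have mI01 : measurable_fun setT I01 by exact: measurable_indic.
have I0 t : 0 <= I01 t by rewrite /I01 indicE.
have mline : measurable_fun setT (fun p : rV * R => p.1 + p.2 *: h).
  by apply: measurable_rV_lin; [exact: measurable_fst|exact: measurable_cst|exact: measurable_snd].
have mF : measurable_fun setT F.
  apply/measurable_EFinP; apply: measurable_funM.
    exact: (measurableT_comp mI01 measurable_snd).
  apply: measurable_funM => //; apply: measurable_funM.
    exact: (measurableT_comp mq mline).
  exact: (measurableT_comp mN mline).
have F0 (p : rV * R) : (0 <= F p)%E.
  by rewrite lee_fin !mulr_ge0 ?sqr_ge0 ?grad_sqr_ge0.
apply: (@le_trans _ _ (\int[mu]_x \int[lam]_t F (x, t))%E).
  apply: ge0_le_integral => //.
  - by move=> x _; rewrite lee_fin; apply: mulr_ge0; [exact: mulr_ge0|exact: sqr_ge0].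
  - apply/measurable_EFinP; apply: measurable_funM.
      by apply: measurable_funM => //; exact: (measurableT_comp mq msh).
    by apply: measurable_funX; apply: measurable_funB => //; exact: (measurableT_comp mw msh).
  - exact: (@measurable_fun_fubini_tonelli_F _ _ _ _ _ lam F mF F0).
  move=> x _; rewrite -/q.
  have Fx0 : (0 <= \int[lam]_t F (x, t))%E by apply: integral_ge0.
  rewrite {1 2}/q !indicE; have [xs|xs] := pselect (cube a s x); last first.
    by rewrite memNset// !mul0r.
  have [hs|hs] := pselect (cube a s (h + x)); last first.
    by rewrite [h + x \in _]memNset// mulr0 mul0r.
  rewrite !mem_set// !mul1r; apply: le_trans (segment_sqr x h sw) _.
  rewrite integral_mkcond; apply: ge0_le_integral => //.
  - move=> t _; rewrite /patch; case: ifP => // _.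
    by rewrite lee_fin mulr_ge0// grad_sqr_ge0.
  - apply/(measurable_restrictT _ _).1 => //; apply/measurable_EFinP; apply: measurable_funTS.
    apply: measurable_funM => //; apply: (measurableT_comp mN).
    by apply: measurable_rV_lin => //; exact: measurable_cst.
  - by apply/measurable_EFinP; move/measurable_EFinP : mF => mF; exact: (measurableT_comp mF (measurable_pair1 x)).
  move=> t _; rewrite /patch; case: ifPn => [t01|_]; last exact: F0.
  rewrite /F/= /I01 indicE t01 mul1r lee_fin ler_wpM2l//.
  rewrite {1}/q indicE mem_set ?mul1r//; apply: cube_convex => //.
  by move: t01; rewrite inE/= in_itv.
rewrite [leLHS](_ : _ = (\int[lam]_t \int[mu]_x F (x, t))%E); last exact: fubini_tonelli.
have E t : (\int[mu]_x F (x, t) = (I01 t * (n%:R * `|h| ^+ 2 *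
    \int[mu]_(x in cube a s) grad_sqr w x))%:E)%E.
  rewrite /F/=; under eq_integral do rewrite mulrA EFinM.
  have mqN : measurable_fun setT (fun x => (q x * grad_sqr w x)%:E).
    by apply/measurable_EFinP; exact: measurable_funM.
  have mqNs : measurable_fun setT (fun x => (q (x + t *: h) * grad_sqr w (x + t *: h))%:E).
    apply: (measurableT_comp mqN); have := @measurable_affine R n (t *: h) 1.
    by under eq_fun do rewrite scale1r addrC.
  rewrite ge0_integralZl//; last 2 first.
  - by move=> x _; rewrite lee_fin mulr_ge0 ?grad_sqr_ge0.
  - by rewrite lee_fin mulr_ge0.
  rewrite [RHS](_ : _ = ((I01 t * (n%:R * `|h| ^+ 2))%:E *
    (\int[mu]_(x in cube a s) grad_sqr w x)%:E)%E); last by rewrite -EFinM mulrA.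
  congr (_ * _)%E.
  under eq_integral do rewrite addrC.
  rewrite (ge0_integral_shift (t *: h) mqN); last first.
    by move=> x; rewrite lee_fin mulr_ge0 ?grad_sqr_ge0.
  rewrite L1_fin// integral_mkcond; apply: eq_integral => x _.
  by rewrite /patch /q indicE; case: ifP => _; rewrite ?mul1r ?mul0r.
under eq_integral do rewrite E EFinM.
rewrite ge0_integralZr//; last 3 first.
- by apply/measurable_EFinP.
- by move=> t _; rewrite lee_fin.
- by rewrite lee_fin mulr_ge0// Rintegral_ge0// => x _; exact: grad_sqr_ge0.
rewrite /I01 integral_indic// setIT; have := lebesgue_measure_itv (`[0, 1] : interval R).
by rewrite /= lte_fin ltr01 -EFinB subr0 => ->; rewrite mul1e.
Qed.

(* Integrate 2 (w y - w x)^2 + 2 (w y)^2 >= (w x)^2 over pairs at distance <= l with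
   y in Z; substituting y = x + h reduces the first term to difference quotients. *)
Lemma poincare a s l th w (Z : set rV) : smooth w -> 0 < l -> 0 <= th -> measurable Z ->
  (forall x, cube a s x -> (th%:E <= mu (Z `&` cube a s `&` cube x l))%E) ->
  th * \int[mu]_(x in cube a s) w x ^+ 2 <=
  2 * (2 * l) ^+ n * (n%:R * l ^+ 2 * \int[mu]_(x in cube a s) grad_sqr w x) +
  2 * fine (mu (cube a s)) * \int[mu]_(x in cube a s `&` Z) w x ^+ 2.
Proof.
move=> sw l0 th0 mZ hZ; have mc := @measurable_cube R n a s.
have mcl := @measurable_cube R n 0 l.
have mw : measurable_fun setT w by exact: smooth_measurable.
have cw2 : continuous (fun x => w x ^+ 2).
  rewrite (_ : (fun x => _) = fun x => w x * w x); last by apply/funext => x; rewrite expr2.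
  apply: smooth_continuous; apply: smooth_exprP; apply: SmoothMul; exact: SmoothBase.
have Lw := L1_continuous_cube a s cw2.
have LwZ : L1 mu (cube a s `&` Z) (fun x => w x ^+ 2).
  by apply: (L1S mc) => //; exact: measurableI.
pose q : rV -> R := \1_(cube a s); pose k : rV -> R := \1_(cube 0 l); pose z : rV -> R := \1_Z.
have [mq mk mz] : [/\ measurable_fun setT q, measurable_fun setT k & measurable_fun setT z].
  by split; exact: measurable_indic.
have q0 x : 0 <= q x by rewrite /q indicE.
have k0 x : 0 <= k x by rewrite /k indicE.
have z0 x : 0 <= z x by rewrite /z indicE.
pose J := \int[mu]_(x in cube a s) grad_sqr w x.
have J0 : 0 <= J by apply: Rintegral_ge0 => x _; exact: grad_sqr_ge0.
pose F (p : rV * rV) : \bar R :=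
  (k p.2 * (q p.1 * q (p.2 + p.1) * (w (p.2 + p.1) - w p.1) ^+ 2))%:E.
have madd : measurable_fun setT (fun p : rV * rV => p.2 + p.1).
  have := @measurable_rV_lin R n _ _ snd fst (fun=> 1) measurable_snd measurable_fst (measurable_cst _).
  by under eq_fun do rewrite scale1r.
have mF : measurable_fun setT F.
  apply/measurable_EFinP; apply: measurable_funM; first exact: (measurableT_comp mk measurable_snd).
  apply: measurable_funM.
    by apply: measurable_funM; [exact: (measurableT_comp mq measurable_fst)|exact: (measurableT_comp mq madd)].
  by apply: measurable_funX; apply: measurable_funB;
    [exact: (measurableT_comp mw madd)|exact: (measurableT_comp mw measurable_fst)].
have F0 (p : rV * rV) : (0 <= F p)%E.
  by rewrite lee_fin mulr_ge0// mulr_ge0 ?sqr_ge0// mulr_ge0.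
have intF : (\int[mu]_x \int[mu]_h F (x, h) <= ((2 * l) ^+ n * (n%:R * l ^+ 2 * J))%:E)%E.
  rewrite [leLHS](_ : _ = (\int[mu]_h \int[mu]_x F (x, h))%E); last exact: fubini_tonelli.
  apply: (@le_trans _ _ (\int[mu]_h (n%:R * l ^+ 2 * J * k h)%:E)%E).
    apply: ge0_le_integral => //.
    - by move=> h _; apply: integral_ge0.
    - exact: (@measurable_fun_fubini_tonelli_G _ _ _ _ _ mu F mF F0).
    - by apply/measurable_EFinP; apply: measurable_funM.
    move=> h _; have [hl|hl] := pselect (cube 0 l h); last first.
      rewrite /F/= {1}/k indicE memNset//=; under eq_integral do rewrite mul0r.
      by rewrite integral0 lee_fin mulr_ge0// mulr_ge0// mulr_ge0// sqr_ge0.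
    rewrite /F /k indicE mem_set//=; under eq_integral do rewrite mul1r.
    apply: le_trans (difference_quotient a s h sw) _.
    rewrite mulr1 lee_fin ler_wpM2r// ler_wpM2l// lerXn2r ?nnegrE// ?(ltW l0)//.
    by have := (@cube_norm R n 0 l h (ltW l0)).1 hl; rewrite subr0.
  have Lk : L1 mu setT k by apply: L1_indic => //; exact: cube_finite.
  rewrite -L1_fin//; last exact: L1Z.
  rewrite RintegralZl// lee_fin mulrC ler_wpM2r//.
    by rewrite mulr_ge0// mulr_ge0// sqr_ge0.
  by rewrite /Rintegral /k integral_indic//= setIT /lebn leb_cube// ltW.
pose B : \bar R := (\int[mu]_y (q y * z y * w y ^+ 2)%:E)%E.
have BE : B = (\int[mu]_(x in cube a s `&` Z) w x ^+ 2)%:E.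
  rewrite L1_fin//; last exact: measurableI.
  rewrite [RHS]integral_mkcond; apply: eq_integral => x _.
  rewrite /patch /q /z !indicE in_setI.
  by case: (x \in _); case: (x \in _); rewrite /= ?mul1r ?mul0r.
have mqzw : measurable_fun setT (fun y => (q y * z y * w y ^+ 2)%:E).
  by apply/measurable_EFinP; apply: measurable_funM; [exact: measurable_funM|exact: measurable_funX].
have main x : ((q x * (th * w x ^+ 2))%:E <= 2%:E * \int[mu]_h F (x, h) + 2%:E * ((q x)%:E * B))%E.
  have [xs|xs] := pselect (cube a s x); last first.
    rewrite {1 2}/q indicE memNset//= mul0r mul0e mule0 adde0.
    by rewrite mule_ge0// integral_ge0.
  rewrite {1 2}/q indicE mem_set//= mul1r mul1e.
  pose A : rV -> R := fun y => \1_(Z `&` cube a s `&` cube x l) y.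
  have mZA : measurable (Z `&` cube a s `&` cube x l).
    by apply: measurableI; [exact: measurableI|exact: measurable_cube].
  apply: (@le_trans _ _ (\int[mu]_y ((w x ^+ 2)%:E * (A y)%:E))%E).
    rewrite ge0_integralZl//; last 3 first.
    - by apply/measurable_EFinP; exact: measurable_indic.
    - by move=> y _; rewrite lee_fin /A indicE.
    - by rewrite lee_fin sqr_ge0.
    rewrite /A integral_indic// setIT mulrC EFinM lee_wpmul2l ?lee_fin ?sqr_ge0//.
    exact: hZ.
  have shiftE : (\int[mu]_h F (x, h) =
      \int[mu]_y (k (y - x) * (q y * (w y - w x) ^+ 2))%:E)%E.
    pose f0 y : \bar R := (k (y - x) * (q y * (w y - w x) ^+ 2))%:E.
    rewrite -(@ge0_integral_shift R n x f0); last 2 first.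
    - apply/measurable_EFinP; apply: measurable_funM.
        by apply: (measurableT_comp mk); exact: measurable_rV_sub.
      by apply: measurable_funM => //; apply: measurable_funX; apply: measurable_funB.
    - by move=> y; rewrite lee_fin mulr_ge0// mulr_ge0// sqr_ge0.
    apply: eq_integral => h _; rewrite /F /f0/=.
    have qx : q x = 1 by rewrite /q indicE mem_set.
    have xh : x + h - x = h by rewrite addrAC subrr add0r.
    by rewrite qx mul1r xh [x + h]addrC.
  have mG1 : measurable_fun setT (fun y => (k (y - x) * (q y * (w y - w x) ^+ 2))%:E).
    apply/measurable_EFinP; apply: measurable_funM.
      by apply: (measurableT_comp mk); exact: measurable_rV_sub.
    by apply: measurable_funM => //; apply: measurable_funX; apply: measurable_funB.
  have G10 y : (0 <= (k (y - x) * (q y * (w y - w x) ^+ 2))%:E)%E.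
    by rewrite lee_fin mulr_ge0// mulr_ge0// sqr_ge0.
  have G20 y : (0 <= (q y * z y * w y ^+ 2)%:E)%E.
    by rewrite lee_fin mulr_ge0 ?sqr_ge0// mulr_ge0.
  rewrite shiftE /B -(ge0_integralZl mu measurableT mG1)// -(ge0_integralZl mu measurableT mqzw)//.
  rewrite -ge0_integralD//; last 4 first.
  - by move=> y _; rewrite mule_ge0.
  - exact: measurable_funeM.
  - by move=> y _; rewrite mule_ge0.
  - exact: measurable_funeM.
  apply: ge0_le_integral => //.
  - by move=> y _; rewrite mule_ge0// lee_fin ?sqr_ge0// /A indicE.
  - by apply: measurable_funeM; apply/measurable_EFinP; exact: measurable_indic.
  - by apply: emeasurable_funD; exact: measurable_funeM.
  move=> y _; rewrite -!EFinM -EFinD lee_fin /A indicE.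
  have [[[Zy Qy] yl]|nA] := pselect ((Z `&` cube a s `&` cube x l) y); last first.
    by rewrite memNset// mulr0 addr_ge0// mulr_ge0// -lee_fin.
  have yl0 : cube 0 l (y - x).
    by move=> i; have := yl i; rewrite !mxE; move: (x 0 i) (y 0 i) => *; lra.
  rewrite mem_set// /k /q /z !indicE !mem_set// !mul1r mulr1.
  (* The square is the gap in (w x)^2 <= 2 (w y - w x)^2 + 2 (w y)^2. *)
  by have := sqr_ge0 (2 * w y - w x); move: (w x) (w y) => *; nra.
rewrite -lee_fin.
have -> : (th * \int[mu]_(x in cube a s) w x ^+ 2)%:E = (\int[mu]_x (q x * (th * w x ^+ 2))%:E)%E.
  rewrite -RintegralZl// L1_fin//; last exact: L1Z.
  rewrite integral_mkcond; apply: eq_integral => x _.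
  by rewrite /patch /q indicE; case: (_ \in _); rewrite ?mul1r ?mul0r.
have Qfin : mu (cube a s) \is a fin_num.
  by rewrite ge0_fin_numE//; exact: cube_finite.
have mGF := @measurable_fun_fubini_tonelli_F _ _ _ _ _ mu F mF F0.
have GF0 x : (0 <= \int[mu]_h F (x, h))%E by apply: integral_ge0.
have B0 : (0 <= B)%E by apply: integral_ge0 => y _; rewrite lee_fin mulr_ge0 ?sqr_ge0// mulr_ge0.
have qB0 x : (0 <= (q x)%:E * B)%E by rewrite mule_ge0// lee_fin.
apply: (@le_trans _ _ (\int[mu]_x (2%:E * \int[mu]_h F (x, h) + 2%:E * ((q x)%:E * B)))%E).
  apply: ge0_le_integral => //.
  - by move=> x _; rewrite lee_fin mulr_ge0// mulr_ge0// sqr_ge0.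
  - apply/measurable_EFinP; apply: measurable_funM => //; apply: measurable_funM => //.
    exact: measurable_funX.
  - apply: emeasurable_funD; first exact: measurable_funeM.
    apply: measurable_funeM; apply: emeasurable_funM => //; exact/measurable_EFinP.
rewrite ge0_integralD//; last 4 first.
- by move=> x _; rewrite mule_ge0.
- exact: measurable_funeM.
- by move=> x _; rewrite mule_ge0.
- apply: measurable_funeM; apply: emeasurable_funM => //; exact/measurable_EFinP.
have mqB : measurable_fun setT (fun x => (q x)%:E * B)%E.
  by apply: emeasurable_funM => //; exact/measurable_EFinP.
rewrite (ge0_integralZl mu measurableT mGF)//.
rewrite (ge0_integralZl mu measurableT mqB)//.
have mqE : measurable_fun setT (fun x => (q x)%:E) by exact/measurable_EFinP.
rewrite (ge0_integralZr mu measurableT mqE)//; last by move=> x _; rewrite lee_fin.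
  have Ei : (\int[mu]_x (q x)%:E = mu (cube a s))%E by rewrite /q integral_indic// setIT.
  rewrite Ei BE [leRHS]EFinD; apply: leeD.
    by rewrite -mulrA EFinM lee_wpmul2l//; exact: intF.
  by rewrite -(fineK Qfin) -!EFinM mulrA.
by move=> x _; exact: GF0.
Qed.
End poincare.

(** * De Giorgi iteration *)

Section truncations.
Variables (R : realType) (n : nat).
Local Notation rV := 'rV[R]_n.
Implicit Types (t d k b : R).

(* psi is convex, 0 <= psi' <= 1 and psi(t) <= t^+: a smooth substitute for t^+. *)
Definition psi t : R := t * flat 1 t.
Definition dpsi : R -> R := flat (@pker R).
Definition d2psi : R -> R := flat ('X^3).

Lemma psi_le0 t : t <= 0 -> psi t = 0.
Proof. by move=> t0; rewrite /psi flat_le0// mulr0. Qed.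

Lemma flat_gt0E p t : 0 < t -> flat p t = p.[t^-1] * expR (- t^-1).
Proof. by move=> t0; rewrite /flat t0. Qed.

Lemma is_derive_psi t : is_derive t 1 psi (dpsi t).
Proof.
have := is_deriveM (is_derive_id t 1) (is_derive_flat 1 t).
rewrite (_ : id * flat 1 = psi) => [/is_derive_eq|]; last by apply/funext.
apply; rewrite /GRing.scale/= mulr1 /dpsi.
have [t0|t0] := leP t 0; first by rewrite !flat_le0// mulr0 addr0.
rewrite !flat_gt0E// /dflat /pker !hornerE/= derivC !hornerE/=.
by field; rewrite gt_eqF.
Qed.

Lemma is_derive_dpsi t : is_derive t 1 dpsi (d2psi t).
Proof.
have := is_derive_flat (@pker R) t; rewrite /dpsi /d2psi.
suff -> : dflat (pker R) = 'X^3 by [].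
by rewrite /dflat /pker derivD derivC derivX add0r addrAC subrr add0r -exprSr.
Qed.

Lemma dpsi_ge0 t : 0 <= dpsi t. Proof. exact: flat_pker_ge0. Qed.

Lemma dpsi_le1 t : dpsi t <= 1.
Proof.
have [t0|t0] := leP t 0; first by rewrite /dpsi flat_le0.
rewrite /dpsi flat_gt0E// /pker !hornerE expRN ler_pdivrMr ?expR_gt0// mul1r.
exact: expR_ge1Dx.
Qed.

Lemma d2psi_ge0 t : 0 <= d2psi t.
Proof.
rewrite /d2psi /flat; case: ifP => // t0.
by rewrite mulr_ge0 ?expR_ge0// hornerXn exprn_ge0// invr_ge0 ltW.
Qed.

Lemma flat1_ge0 t : 0 <= flat 1 t.
Proof. by rewrite /flat; case: ifP => // t0; rewrite hornerC mul1r expR_ge0. Qed.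

Lemma psi_ge0 t : 0 <= psi t.
Proof.
have [t0|t0] := leP t 0; first by rewrite psi_le0.
by rewrite mulr_ge0 ?flat1_ge0// ltW.
Qed.

Lemma psi_le t : psi t <= Num.max t 0.
Proof.
have [t0|t0] := leP t 0; first by rewrite psi_le0.
rewrite /psi ler_piMr// ?(ltW t0)// flat_gt0E// hornerC mul1r -[leRHS]expR0 ler_expR.
by rewrite oppr_le0 invr_ge0 ltW.
Qed.

Definition psi1 : R := expR (- 1).

Lemma psi1_gt0 : 0 < psi1. Proof. exact: expR_gt0. Qed.

Lemma psi_ge t : 1 <= t -> psi1 * t <= psi t.
Proof.
move=> t1; have t0 : 0 < t by exact: lt_le_trans t1.
rewrite mulrC /psi ler_wpM2l// ?(ltW t0)// flat_gt0E// hornerC mul1r ler_expR lerN2.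
by rewrite invf_le1.
Qed.

(** The product of t exp(-1/t) and t^-3 exp(-1/t) is the square of t^-1 exp(-1/t). It is bounded
    although [psi] is not, which makes the product of a truncation and its derivative an admissible
    nonlinearity. *)
Lemma psi_d2psi t : psi t * d2psi t = flat 'X t ^+ 2.
Proof.
have [t0|t0] := leP t 0; first by rewrite psi_le0// mul0r flat_le0// expr0n.
rewrite /psi /d2psi !flat_gt0E// !hornerE/=; field; by rewrite gt_eqF.
Qed.

Lemma flat_continuous p : continuous (@flat R p).
Proof.
by move=> t; apply/differentiable_continuous/derivable1_diffP; case: (is_derive_flat p t).
Qed.

Lemma flat_measurable p : measurable_fun setT (@flat R p).
Proof. by apply: continuous_measurable_fun; exact: flat_continuous. Qed.

Lemma psi_measurable : measurable_fun setT psi.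
Proof. by apply: measurable_funM => //; exact: flat_measurable. Qed.

(* Convex profiles B, whose truncations are used as test functions. *)
Record base_op (D : set R) (B dB d2B : R -> R) (b : R) : Prop := BaseOp {
  base_smooth : forall w : rV -> R, smooth w -> (forall x, D (w x)) ->
    smooth (B \o w) /\ smooth (dB \o w);
  base_derive : forall t, D t -> is_derive t 1 B (dB t);
  base_derive2 : forall t, D t -> is_derive t 1 dB (d2B t);
  base_cont : forall t, D t -> {for t, continuous d2B};
  base_bound : forall t, D t -> `|dB t| <= b;
  base_convex : forall t, D t -> 0 <= d2B t;
  base_bound2 : forall t, D t -> Num.max (B t) 0 * d2B t <= b;
  base_bound3 : forall t, D t -> d2B t <= b;
  base_growth : forall t, D t -> `|B t| <= b * (1 + `|t|);
  base_meas : [/\ measurable_fun setT B, measurable_fun setT dB & measurable_fun setT d2B]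
}.

Section trunc.
Variables (D : set R) (B dB d2B : R -> R) (b k d : R).
Hypotheses (op : base_op D B dB d2B b) (d0 : 0 < d) (k0 : 0 <= k).

(** A smooth substitute for (B - k)^+ with smoothing width d: it vanishes for B <= k and is
    comparable to B - k as soon as B >= k + d. *)
Definition trunc t := d * psi ((B t - k) / d).
Definition dtrunc t := dpsi ((B t - k) / d) * dB t.
Definition d2trunc t := d2psi ((B t - k) / d) * dB t ^+ 2 / d + dpsi ((B t - k) / d) * d2B t.

Let b0 t : D t -> 0 <= b.
Proof. by move=> Dt; exact: le_trans (normr_ge0 _) (base_bound op Dt). Qed.

Let is_derive_arg t : D t -> is_derive t 1 (fun t => (B t - k) / d) (dB t / d).
Proof.
move=> Dt; have dBt := base_derive op Dt.
have := is_deriveZ (d^-1) (is_deriveB dBt (is_derive_cst k t 1)).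
rewrite (_ : d^-1 \*: (B - cst k) = fun t => (B t - k) / d) => [/is_derive_eq|].
  by apply; rewrite subr0 /GRing.scale/= mulrC.
by apply/funext => z; rewrite !fctE /GRing.scale/= mulrC.
Qed.

Lemma is_derive_trunc t : D t -> is_derive t 1 trunc (dtrunc t).
Proof.
move=> Dt; have da := is_derive_arg Dt.
have := is_deriveZ d (@is_derive1_comp _ psi (fun t => (B t - k) / d) t _ _ (is_derive_psi _) da).
move=> /is_derive_eq; apply; rewrite /GRing.scale/= /dtrunc.
by field; rewrite gt_eqF.
Qed.

Lemma is_derive_dtrunc t : D t -> is_derive t 1 dtrunc (d2trunc t).
Proof.
move=> Dt; have da := is_derive_arg Dt.
have := is_deriveM (@is_derive1_comp _ dpsi (fun t => (B t - k) / d) t _ _ (is_derive_dpsi _) da) (base_derive2 op Dt).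
move=> /is_derive_eq; apply; rewrite /GRing.scale/= /d2trunc.
by field; rewrite gt_eqF.
Qed.

Lemma trunc_ge0 t : 0 <= trunc t.
Proof. by rewrite mulr_ge0 ?psi_ge0// ltW. Qed.

Lemma trunc_le t : trunc t <= Num.max (B t - k) 0.
Proof.
rewrite /trunc; apply: le_trans (ler_wpM2l (ltW d0) (psi_le _)) _.
rewrite maxr_pMr ?(ltW d0)// mulr0 mulrC divfK// gt_eqF//.
Qed.

Lemma trunc0 t : B t <= k -> trunc t = 0.
Proof.
move=> Bk; rewrite /trunc psi_le0 ?mulr0// pmulr_lle0 ?invr_gt0//; lra.
Qed.

Lemma trunc_ge t : k + d <= B t -> psi1 * (B t - k) <= trunc t.
Proof.
move=> kd; have h : 1 <= (B t - k) / d by rewrite ler_pdivlMr// mul1r; lra.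
have := ler_wpM2l (ltW d0) (psi_ge h).
by rewrite (_ : d * _ = psi1 * (B t - k))//; field; rewrite gt_eqF.
Qed.

Lemma dtrunc_bound t : D t -> `|dtrunc t| <= b.
Proof.
move=> Dt; rewrite normrM ger0_norm ?dpsi_ge0// -[leRHS]mul1r.
by rewrite ler_pM ?dpsi_ge0// ?dpsi_le1//; exact: (base_bound op Dt).
Qed.

Lemma d2trunc_ge0 t : D t -> 0 <= d2trunc t.
Proof.
move=> Dt; rewrite addr_ge0//.
  by rewrite divr_ge0 ?(ltW d0)// mulr_ge0 ?d2psi_ge0// sqr_ge0.
by rewrite mulr_ge0 ?dpsi_ge0//; exact: (base_convex op).
Qed.

(** The term with [d2psi] is controlled by [psi_d2psi], the other one by [base_bound2], because the
    truncation is at most the positive part of B. *)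
Lemma trunc_d2trunc_bound : exists c, forall t, D t -> trunc t * d2trunc t <= c.
Proof.
have [c [c0 hc]] := @flat_bounded R 'X.
exists (c ^+ 2 * b ^+ 2 + b) => t Dt; rewrite /d2trunc mulrDr lerD//.
  rewrite /trunc (_ : _ * _ = psi ((B t - k) / d) * d2psi ((B t - k) / d) * dB t ^+ 2); last first.
    by field; rewrite gt_eqF.
  rewrite psi_d2psi ler_pM ?sqr_ge0//.
    by rewrite -(real_normK (num_real (flat _ _))); apply: lerXn2r; rewrite ?nnegrE.
  rewrite -(real_normK (num_real (dB t))); apply: lerXn2r; rewrite ?nnegrE//; first exact: b0 Dt.
  exact: (base_bound op Dt).
apply: le_trans (base_bound2 op Dt); have c2 := base_convex op Dt.
rewrite ler_pM ?trunc_ge0 ?mulr_ge0 ?dpsi_ge0//.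
  apply: le_trans (trunc_le t) _; rewrite ge_max !le_max lexx orbT andbT.
  by apply/orP; left; move: k0 (B t) => k0' z; lra.
by rewrite ler_piMl// dpsi_le1.
Qed.

Let sm_arg (w : rV -> R) : smooth w -> (forall x, D (w x)) ->
  smooth_expr (fun x => (B (w x) - k) / d).
Proof.
move=> sw Dw; have [sB _] := base_smooth op sw Dw.
by apply: SmoothMul; [apply: SmoothAdd; [exact: SmoothBase|exact: SmoothCst]|exact: SmoothCst].
Qed.

Let meas_arg : measurable_fun setT (fun t => (B t - k) / d).
Proof. by have [mB _ _] := base_meas op; apply: measurable_funM => //; exact: measurable_funB. Qed.

Let sm_trunc (w : rV -> R) : smooth w -> (forall x, D (w x)) -> smooth_expr (trunc \o w).
Proof.
move=> sw Dw; have sa := sm_arg sw Dw.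
apply: (@SmoothMul _ _ (fun=> d) (fun x => psi ((B (w x) - k) / d))); first exact: SmoothCst.
by apply: SmoothMul => //; exact: (SmoothFlat 1 sa).
Qed.

Let sm_dtrunc (w : rV -> R) : smooth w -> (forall x, D (w x)) -> smooth_expr (dtrunc \o w).
Proof.
move=> sw Dw; have sa := sm_arg sw Dw; have [_ sdB] := base_smooth op sw Dw.
by apply: SmoothMul; [exact: (SmoothFlat (@pker R) sa)|exact: SmoothBase].
Qed.

Let m_trunc : measurable_fun setT trunc.
Proof. by apply: measurable_funM => //; exact: (measurableT_comp psi_measurable meas_arg). Qed.

Let m_dtrunc : measurable_fun setT dtrunc.
Proof.
have [_ mdB _] := base_meas op; apply: measurable_funM => //.
exact: (measurableT_comp (flat_measurable _) meas_arg).
Qed.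

Let m_d2trunc : measurable_fun setT d2trunc.
Proof.
have [_ mdB md2B] := base_meas op; apply: measurable_funD; apply: measurable_funM => //.
  apply: measurable_funM; last exact: measurable_funX.
  exact: (measurableT_comp (flat_measurable _) meas_arg).
exact: (measurableT_comp (flat_measurable _) meas_arg).
Qed.

Let isd_cont (f : R -> R) (t df : R) : is_derive t 1 f df -> {for t, continuous f}.
Proof. by case=> h _; apply/differentiable_continuous/derivable1_diffP. Qed.

Lemma trunc_growth t : D t -> `|trunc t| <= b * (1 + `|t|).
Proof.
move=> Dt; rewrite ger0_norm ?trunc_ge0// (le_trans (trunc_le t))//.
have := base_growth op Dt; have := ler_norm (B t).
rewrite ge_max => h1 h2; apply/andP; split.
  by move: (b * _) h1 h2 k0 => X; move: (B t) (`|B t|) => *; lra.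
by rewrite mulr_ge0 ?addr_ge0//; exact: b0 Dt.
Qed.

Lemma trunc_op : c1_op n D trunc dtrunc b.
Proof.
split=> //.
- by move=> w sw Dw; apply: smooth_exprP; exact: sm_trunc.
- exact: is_derive_trunc.
- by move=> t Dt; exact: isd_cont (is_derive_dtrunc Dt).
- exact: dtrunc_bound.
- exact: trunc_growth.
Qed.

(** Testing with H H' is the point: its derivative H'^2 + H H'' is at least H'^2, as H is
    nonnegative and convex, so the energy estimate controls the gradient of H(u) by H(u) itself. *)
Lemma trunc_mul_op : exists C, c1_op n D (fun t => trunc t * dtrunc t)
  (fun t => dtrunc t ^+ 2 + trunc t * d2trunc t) C.
Proof.
have [c hc] := trunc_d2trunc_bound.
exists (b ^+ 2 + `|c|); split.
- move=> w sw Dw; apply: smooth_exprP.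
  exact: (@SmoothMul _ _ (trunc \o w) (dtrunc \o w) (sm_trunc sw Dw) (sm_dtrunc sw Dw)).
- move=> t Dt; have := is_deriveM (is_derive_trunc Dt) (is_derive_dtrunc Dt).
  by move=> /is_derive_eq; apply; rewrite /GRing.scale/=; ring.
- move=> t Dt; have ct := isd_cont (is_derive_trunc Dt).
  have cdt := isd_cont (is_derive_dtrunc Dt).
  have carg := isd_cont (is_derive_arg Dt).
  apply: cvgD; first by under eq_cvg do rewrite expr2; rewrite expr2; exact: cvgM.
  apply: cvgM => //; apply: cvgD.
    apply: cvgMr_tmp; apply: cvgM.
      by apply: (continuous_comp carg); exact: flat_continuous.
    have cdB := isd_cont (base_derive2 op Dt).
    by under eq_cvg do rewrite expr2; rewrite expr2; exact: cvgM.
  apply: cvgM; last exact: (base_cont op Dt).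
  by apply: (continuous_comp carg); exact: flat_continuous.
- move=> t Dt; have h := hc t Dt; have p := mulr_ge0 (trunc_ge0 t) (d2trunc_ge0 Dt).
  rewrite ger0_norm ?addr_ge0 ?sqr_ge0// lerD//; last exact: le_trans h (ler_norm _).
  rewrite -(real_normK (num_real (dtrunc t))); apply: lerXn2r; rewrite ?nnegrE//; first exact: b0 Dt.
  exact: dtrunc_bound.
- move=> t Dt; rewrite normrM mulrC.
  apply: (@le_trans _ _ (b * (b * (1 + `|t|)))).
    by rewrite ler_pM//; [exact: dtrunc_bound|exact: trunc_growth].
  by rewrite mulrA -expr2 ler_wpM2r ?addr_ge0// lerDl.
- exact: measurable_funM.
- by apply: measurable_funD; [exact: measurable_funX|exact: measurable_funM].
Qed.
End trunc.

(** Applied with c = 1 and c = -1, to bound u from both sides. *)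
Lemma base_op_linear (c : R) : base_op setT (fun t => c * t) (fun=> c) (fun=> 0) (`|c| + 1).
Proof.
split.
- move=> w sw _; split; apply: smooth_exprP; last exact: SmoothCst.
  by apply: SmoothMul; [exact: SmoothCst|exact: SmoothBase].
- move=> t _; have := is_deriveZ c (is_derive_id t 1).
  by move=> /is_derive_eq; apply; rewrite /GRing.scale/= mulr1.
- by move=> t _; exact: is_derive_cst.
- by move=> t _; exact: cvg_cst.
- by move=> t _; rewrite lerDl.
- by [].
- by move=> t _; rewrite mulr0 addr_ge0.
- by move=> t _; rewrite addr_ge0.
- move=> t _; rewrite normrM; have := normr_ge0 c; have := normr_ge0 t; nra.
- by split => //; exact: measurable_funM.
Qed.

Lemma measurable_invr : measurable_fun setT (fun t : R => t^-1).
Proof.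
have m0 : measurable [set t : R | t != 0].
  rewrite (_ : [set t | _] = ~` [set 0]); first exact: measurableC.
  by apply/seteqP; split => t /= /eqP.
rewrite -(setvU [set t : R | t != 0]); apply/measurable_funU => //; first exact: measurableC.
split.
  rewrite (_ : ~` _ = [set 0]); first exact: measurable_fun_set1.
  by apply/seteqP; split => t /= => [/negP/negPn/eqP|-> ]; rewrite ?eqxx.
apply: open_continuous_measurable_fun; last by move=> t; rewrite inE => /= t0; exact: inv_continuous.
rewrite (_ : [set t | _] = ~` [set 0]); first exact/closed_openC/closed_eq.
by apply/seteqP; split => t /= /eqP.
Qed.

Definition nonneg : set R := [set t | 0 <= t].

(** The factor 2 makes the profile negative where t >= 1/2, and its second derivative is the square
    of the first. The bound b blows up as dl tends to 0, while the constants of [caccioppoli] and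
    [sup_bound] are free of b. *)
Lemma base_op_log (dl : R) : 0 < dl -> exists b, base_op nonneg
  (fun t => - ln (2 * (t + dl))) (fun t => - (t + dl)^-1) (fun t => (t + dl) ^- 2) b.
Proof.
move=> dl0.
have pos t : nonneg t -> 0 < t + dl by rewrite /nonneg/= => t0; rewrite ltr_wpDl.
have i0 : 0 < dl^-1 by rewrite invr_gt0.
have inv_le t : nonneg t -> (t + dl)^-1 <= dl^-1.
  by move=> t0; rewrite lef_pV2 ?posrE ?pos// lerDr.
pose L := `|ln (2 * dl)|.
have lnlow t : nonneg t -> ln (2 * dl) <= ln (2 * (t + dl)).
  move=> t0; rewrite ler_ln ?posrE ?mulr_gt0 ?pos// ler_wpM2l//.
  by rewrite lerDr.
have d2le t : nonneg t -> (t + dl) ^- 2 <= dl ^- 2.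
  move=> t0; rewrite -!exprVn lerXn2r ?nnegrE ?invr_ge0 ?(ltW (pos _ t0)) ?(ltW dl0)//.
  exact: inv_le.
have i2 : 0 < dl ^- 2 by rewrite invr_gt0 exprn_gt0.
have L0 : 0 <= L by exact: normr_ge0.
have [dl0' pos' pos2] : [/\ 0 <= dl, forall t, nonneg t -> t + dl != 0 &
    forall t, nonneg t -> 0 < 2 * (t + dl)].
  by split=> [|t t0|t t0]; [exact: ltW|rewrite gt_eqF// pos|rewrite mulr_gt0// pos].
pose b := dl^-1 + L * dl ^- 2 + dl ^- 2 + (2 * dl + 2 + L).
have [b1 b2 b3 b4] : [/\ dl^-1 <= b, L * dl ^- 2 <= b, dl ^- 2 <= b & 2 * dl + 2 + L <= b].
  have := mulr_ge0 L0 (ltW i2); rewrite /b; move: (L * _) => X X0.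
  by split; move: dl0' i0 i2 L0; move: (dl^-1) (dl ^- 2) => *; lra.
have da t : is_derive t 1 (fun t => t + dl) 1.
  have := is_deriveD (is_derive_id t 1) (is_derive_cst dl t 1).
  by move=> /is_derive_eq; apply; rewrite addr0.
have dinv t : nonneg t -> is_derive t 1 (fun t => (t + dl)^-1) (- (t + dl) ^- 2).
  move=> t0; have := @is_deriveV R (fun t => t + dl) t 1 1 (pos' t t0) (da t).
  by move=> /is_derive_eq; apply; rewrite /GRing.scale/= mulr1.
have isd_cont (f : R -> R) (t df : R) : is_derive t 1 f df -> {for t, continuous f}.
  by case=> h _; apply/differentiable_continuous/derivable1_diffP.
exists b; split.
- move=> w sw Dw; have se : smooth_expr (fun x => w x + dl).
    by apply: SmoothAdd; [exact: SmoothBase|exact: SmoothCst].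
  split; apply: smooth_exprP.
    rewrite (_ : _ \o w = fun x => -1 * ln (2 * (w x + dl))); last first.
      by apply/funext => x /=; rewrite mulN1r.
    apply: (@SmoothMul _ _ (fun=> -1)); first exact: SmoothCst.
    apply: (@SmoothLn _ _ (fun x => 2 * (w x + dl))); first by move=> x; exact: pos2.
    by apply: (@SmoothMul _ _ (fun=> 2)); first exact: SmoothCst.
  rewrite (_ : _ \o w = fun x => -1 * (w x + dl)^-1); last first.
    by apply/funext => x /=; rewrite mulN1r.
  apply: (@SmoothMul _ _ (fun=> -1)); first exact: SmoothCst.
  by apply: (@SmoothInv _ _ (fun x => w x + dl)) => // x; exact: pos.
- move=> t t0; have d2 : is_derive t 1 (fun t => 2 * (t + dl)) 2.
    by have := is_deriveZ 2 (da t) => /is_derive_eq; apply; rewrite /GRing.scale/= mulr1.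
  have := is_deriveN (@is_derive1_comp _ (@ln R) (fun t => 2 * (t + dl)) t _ _ (is_derive1_ln (pos2 t t0)) d2).
  by move=> /is_derive_eq; apply; field; rewrite pos'.
- move=> t t0; have := is_deriveN (dinv t t0); move=> /is_derive_eq; apply.
  by rewrite opprK.
- move=> t t0; apply: cvgV; first by rewrite expf_neq0// pos'.
  have c := isd_cont _ _ _ (da t).
  by under eq_cvg do rewrite expr2; rewrite expr2; exact: cvgM.
- by move=> t t0; rewrite normrN gtr0_norm ?invr_gt0 ?pos// (le_trans (inv_le t t0)).
- by move=> t t0; rewrite invr_ge0 exprn_ge0// ltW// pos.
- move=> t t0; apply: le_trans b2; rewrite ler_pM//.
  + by rewrite le_max lexx orbT.
  + by rewrite invr_ge0 exprn_ge0// ltW// pos.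
  + have := ler_norm (- ln (2 * dl)); rewrite normrN -/L => h; rewrite ge_max L0 andbT.
    by apply: le_trans h; rewrite lerN2; exact: lnlow.
  + exact: d2le.
- by move=> t t0; apply: le_trans b3; exact: d2le.
- move=> t t0; rewrite normrN.
  have := lnlow t t0; have h2 := ln_sublinear (pos2 t t0).
  have h3 := ler_norm (- ln (2 * dl)); rewrite normrN -/L in h3.
  move=> h1; apply: (@le_trans _ _ (2 * dl + 2 + L + 2 * t)).
    by rewrite ler_norml; move: t0; rewrite /nonneg/=; move: L0 h1 h2 h3 dl0'; move: (ln _) (ln _) => *; apply/andP; split; lra.
  by rewrite (ger0_norm t0); move: t0 b4 dl0' L0; rewrite /nonneg/=; move: (b) => *; nra.
- split.
  + apply: measurableT_comp => //; apply: measurableT_comp; first exact: measurable_ln.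
    by apply: measurable_funM => //; exact: measurable_funD.
  + apply: measurableT_comp => //; apply: (measurableT_comp measurable_invr).
    exact: measurable_funD.
  + apply: (measurableT_comp measurable_invr); apply: measurable_funX.
    exact: measurable_funD.
Qed.
End truncations.

Section de_giorgi.
Variables (R : realType) (n : nat).
Local Notation rV := 'rV[R]_n.
Local Notation mu := (@lebn R n).
Implicit Types (a x y : rV) (s r lam sig rho l d b c th : R) (u e : rV -> R) (g V : 'I_n -> rV -> R).

Lemma L1_dom_ae (D : set rV) (f g : rV -> R) : measurable D -> measurable_fun D f ->
  {ae mu, forall x, D x -> `|f x| <= g x} -> L1 mu D g -> L1 mu D f.
Proof.
move=> mD mf fg Lg; apply/integrableP; split; first exact/measurable_EFinP.
have /integrableP[mg gfin] := Lg.
apply: le_lt_trans gfin; apply: ae_ge0_le_integral => //.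
- by apply: measurableT_comp => //; exact/measurable_EFinP.
- by apply: measurableT_comp.
- apply: filterS fg => x fg Dx /=; rewrite lee_fin (le_trans (fg Dx))//; exact: ler_norm.
Qed.

Lemma cubeS a s r : r <= s -> cube a r `<=` cube a s.
Proof. by move=> rs x xr i; have := xr i; move: (a 0 i) (x 0 i) => *; lra. Qed.

Lemma cvgX2 (f : nat -> R) (l : R) : f k @[k --> \oo] --> l -> f k ^+ 2 @[k --> \oo] --> l ^+ 2.
Proof. by move=> fl; under eq_cvg do rewrite expr2; rewrite expr2; exact: cvgM. Qed.

(** [poincare] for the approximations of eta H(u), in the limit; the integral over Z tends to 0
    because H(u) vanishes on Z. *)
Lemma sol_poincare lam a s s' u g V e D H dH C (eta : rV -> R) c l th (Z : set rV) :
  local_sol lam a s u g V e -> s' < s -> c1_op n D H dH C ->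
  (forall r x, 0 < r -> D (conv u (@ker R n r) x)) -> {ae mu, forall x, D (u x)} ->
  smooth eta -> (forall x, `|eta x| <= c) -> (forall i x, `|partial i eta x| <= c) ->
  0 < l -> 0 <= th -> measurable Z ->
  (forall x, cube a s' x -> (th%:E <= mu (Z `&` cube a s' `&` cube x l))%E) ->
  {ae mu, forall x, cube a s' x -> Z x -> H (u x) = 0} ->
  [/\ L1 mu (cube a s') (fun x => (eta x * H (u x)) ^+ 2),
    L1 mu (cube a s') (fun x => \sum_i (eta x * dH (u x) * g i x + partial i eta x * H (u x)) ^+ 2)
  & th * \int[mu]_(x in cube a s') (eta x * H (u x)) ^+ 2 <=
    2 * (2 * l) ^+ n * (n%:R * l ^+ 2 * \int[mu]_(x in cube a s')
      \sum_i (eta x * dH (u x) * g i x + partial i eta x * H (u x)) ^+ 2)].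
Proof.
move=> sol ss op Dc Du seta hc hdc l0 th0 mZ hZ HZ.
have [v [m [sv Lm _ cv]]] := comp_approx sol ss op Dc Du seta hc hdc.
have mQ := @measurable_cube R n a s'.
have mQZ : measurable (cube a s' `&` Z) by exact: measurableI.
have mg i : measurable_fun setT (g i) by have [] := sol_gL2 sol i.
have mu' : measurable_fun setT u by have [] := sol_L2 sol.
have mHu : measurable_fun setT (fun x => H (u x)) by exact: (measurableT_comp (op_meas op) mu').
have mdHu : measurable_fun setT (fun x => dH (u x)) by exact: (measurableT_comp (op_dmeas op) mu').
have meta : measurable_fun setT eta by exact: smooth_measurable.
have mdeta i : measurable_fun setT (partial i eta) by apply: smooth_measurable; exact: smooth_partial.
pose w x := (eta x * H (u x)) ^+ 2.
pose q x := \sum_i (eta x * dH (u x) * g i x + partial i eta x * H (u x)) ^+ 2.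
have mw : measurable_fun setT w by apply: measurable_funX; exact: measurable_funM.
have mq : measurable_fun setT q.
  apply: measurable_sum => i; apply: measurable_funX; apply: measurable_funD.
    by apply: measurable_funM => //; exact: measurable_funM.
  exact: measurable_funM.
have Lm' (E : set rV) : measurable E -> L1 mu E m by move=> mE; exact: (L1S measurableT).
have mvk k : measurable_fun setT (fun x => v k x ^+ 2).
  by apply: measurable_funX; exact: smooth_measurable.
have W (E : set rV) : measurable E -> E `<=` cube a s' ->
    L1 mu E w /\ \int[mu]_(x in E) v k x ^+ 2 @[k --> \oo] --> \int[mu]_(x in E) w x.
  move=> mE EQ; apply: (@Rdominated_cvg _ _ _ mu E _ w m) => //; last 2 first.
  - exact: Lm'.
  - by apply: filterS cv => x cv k /EQ /cv [_ _ b _]; rewrite ger0_norm ?sqr_ge0.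
  - by move=> k; exact: measurable_funTS.
  - exact: measurable_funTS.
  - by apply: filterS cv => x cv /EQ /cv [b _ _ _]; exact: cvgX2.
have [Lq cq] : L1 mu (cube a s') q /\
    \int[mu]_(x in cube a s') grad_sqr (v k) x @[k --> \oo] --> \int[mu]_(x in cube a s') q x.
  apply: (@Rdominated_cvg _ _ _ mu (cube a s') _ q (fun x => \sum_(i < n) m x)) => //; last 2 first.
  - by apply: L1_sum => // i _; exact: Lm'.
  - apply: filterS cv => x cv k /cv [_ _ _ b]; rewrite ger0_norm ?grad_sqr_ge0//.
    by apply: ler_sum => i _; exact: b.
  - move=> k; apply: measurable_funTS; apply: measurable_sum => i; apply: measurable_funX.
    by apply: smooth_measurable; exact: smooth_partial.
  - exact: measurable_funTS.
  - apply: filterS cv => x cv /cv [_ b _ _]; rewrite /grad_sqr /q.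
    apply: cvg_big => [|i _]; first exact: add_continuous.
    exact: cvgX2.
have [Lw cw] := W _ mQ (@subset_refl _ _).
have [_ cwZ] := W _ mQZ (@subIsetl _ _ _).
split => //.
have wZ : \int[mu]_(x in cube a s' `&` Z) w x = 0.
  rewrite (@eq_Rintegral_ae _ _ _ mu _ w (fun=> 0))//.
  - by rewrite /Rintegral integral0.
  - exact: (L1S mQ).
  - exact: integrable0.
  - by apply: filterS HZ => x HZ [xQ xZ]; rewrite /w HZ// mulr0 expr0n.
rewrite wZ in cwZ.
pose lhs k := th * \int[mu]_(x in cube a s') v k x ^+ 2.
pose rhs k := 2 * (2 * l) ^+ n * (n%:R * l ^+ 2 * \int[mu]_(x in cube a s') grad_sqr (v k) x) +
  2 * fine (mu (cube a s')) * \int[mu]_(x in cube a s' `&` Z) v k x ^+ 2.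
have cl : lhs k @[k --> \oo] --> th * \int[mu]_(x in cube a s') w x by exact: cvgMl_tmp.
have cr : rhs k @[k --> \oo] --> 2 * (2 * l) ^+ n * (n%:R * l ^+ 2 * \int[mu]_(x in cube a s') q x) + 2 * fine (mu (cube a s')) * 0.
  by apply: cvgD; [apply: cvgMl_tmp; exact: cvgMl_tmp|exact: cvgMl_tmp].
rewrite mulr0 addr0 in cr.
apply: (ler_cvg_to cl cr); apply: nearW => k.
exact: (poincare (sv k) l0 th0 mZ hZ).
Qed.

(** A cube of side l with a corner at x, turned in each coordinate towards the centre a, lies in
    both cubes. *)
Lemma cube_orthant a s x l : cube a s x -> 0 < l -> l <= s ->
  ((l ^+ n)%:E <= mu (cube a s `&` cube x l))%E.
Proof.
move=> xs l0 ls; pose b : rV := \row_i (if a 0 i <= x 0 i then x 0 i - l / 2 else x 0 i + l / 2).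
have h0 : 0 <= l / 2 by lra.
have E : mu (cube b (l / 2)) = (l ^+ n)%:E.
  by rewrite /lebn leb_cube// mulrCA divff ?mulr1// pnatr_eq0.
rewrite -E; apply: le_measure; rewrite ?inE; first exact: measurable_cube.
  by apply: measurableI; exact: measurable_cube.
move=> y yb; split=> i; have := yb i; have := xs i; rewrite !mxE; case: ifPn => ax;
  move: ax; rewrite -?ltNge; move: (a 0 i) (x 0 i) (y 0 i) => *; lra.
Qed.

(** The derivative of a profile as test nonlinearity G; for the logarithm this is G(t) = -1/(t +
    dl). *)
Lemma base_dop (D : set R) (B dB d2B : R -> R) b : base_op n D B dB d2B b ->
  D !=set0 -> c1_op n D dB d2B b.
Proof.
move=> op [t0 Dt0].
have b0 : 0 <= b by apply: le_trans (base_bound op Dt0).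
split.
- by move=> w sw Dw; have [] := base_smooth op sw Dw.
- exact: (base_derive2 op).
- exact: (base_cont op).
- by move=> t Dt; rewrite ger0_norm; [exact: (base_bound3 op)|exact: (base_convex op)].
- move=> t Dt; apply: le_trans (base_bound op Dt) _.
  by rewrite ler_peMr// lerDl.
- by have [] := base_meas op.
- by have [] := base_meas op.
Qed.

Lemma sqrD_le (p q : R) : (p + q) ^+ 2 <= 2 * p ^+ 2 + 2 * q ^+ 2.
Proof. by have := sqr_ge0 (p - q); nra. Qed.

Lemma op_sqr_L1 (D : set R) H dH C u (A : set rV) : c1_op n D H dH C -> L2 u ->
  {ae mu, forall x, D (u x)} -> measurable A -> (mu A < +oo)%E ->
  L1 mu A (fun x => H (u x) ^+ 2).
Proof.
move=> op [mu' Lu] Du mA Afin.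
apply: (@L1_dom_ae _ _ (fun x => 2 * C ^+ 2 * (1 + u x ^+ 2))) => //.
- apply: measurable_funTS; apply: measurable_funX.
  exact: (measurableT_comp (op_meas op) mu').
- apply: filterS Du => x Dx _; rewrite ger0_norm ?sqr_ge0//; have := op_growth op Dx.
  have := normr_ge0 (H (u x)).
  rewrite -(real_normK (num_real (H (u x)))) -(real_normK (num_real (u x))).
  move: (`|H (u x)|) (`|u x|) => p q p0 h.
  apply: (@le_trans _ _ ((C * (1 + q)) ^+ 2)); first by rewrite ler_sqr// nnegrE (le_trans p0).
  rewrite exprMn [leRHS](_ : _ = C ^+ 2 * (2 * (1 + q ^+ 2))); last by ring.
  rewrite ler_wpM2l ?sqr_ge0//.
  by have := sqrD_le 1 q; rewrite expr1n; lra.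
- apply: L1Z => //; apply: L1D => //; last exact: (L1S measurableT).
  by apply: (@L1_bounded _ _ _ _ _ _ 1) => // x _; rewrite normr1.
Qed.

Lemma grad_cutoff0 a s (eta : rV -> R) x : test_function (cube a s) eta -> ~ cube a s x ->
  grad_sqr eta x = 0.
Proof.
move=> teta nx; rewrite /grad_sqr big1// => i _.
rewrite (_ : partial i eta x = 0) ?expr0n//.
by apply/eqP/negPn/negP => /(test_supp (test_partial i teta)).
Qed.

Definition cutoff_cst : R := sval (cid (cutoff R n)).

Lemma cutoff_cst_ge0 : 0 <= cutoff_cst.
Proof. by rewrite /cutoff_cst; case: cid => C []. Qed.

Lemma cutoffP a r' r : 0 <= r' -> r' < r ->
  exists eta : rV -> R, [/\ test_function (cube a r) eta, forall x, 0 <= eta x <= 1,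
    forall x, cube a r' x -> eta x = 1 &
    forall x, grad_sqr eta x <= cutoff_cst / (r - r') ^+ 2].
Proof. by rewrite /cutoff_cst; case: cid => C [C0 h]; exact: h. Qed.

(** [energy_estimate] with its integrability conditions checked: gam(u)^2 <= dG(u) is bounded, and
    the gradient of the cutoff lives on the cube. *)
Lemma caccioppoli lam a s s' rho u g V e D G dG C (gam h : R -> R) (eta : rV -> R) :
  0 < lam -> local_sol lam a s u g V e -> s' < s -> c1_op n D G dG C ->
  (forall r x, 0 < r -> D (conv u (@ker R n r) x)) -> {ae mu, forall x, D (u x)} ->
  (forall t, D t -> [/\ 0 <= gam t, gam t ^+ 2 <= dG t & `|G t| <= gam t * h t]) ->
  measurable_fun setT gam -> measurable_fun setT h ->
  L1 mu (cube a s') (fun x => h (u x) ^+ 2) ->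
  rho < s' ->
  test_function (cube a s') eta -> (forall x, 0 <= eta x <= 1) ->
  (forall x, grad_sqr eta x <= cutoff_cst / (s' - rho) ^+ 2) ->
  L1 mu (cube a s') (fun x => (eta x * gam (u x)) ^+ 2 * e x) /\
  \int[mu]_(x in cube a s') ((eta x * gam (u x)) ^+ 2 * e x) <=
  4 * cutoff_cst / (lam * (s' - rho)) ^+ 2 * \int[mu]_(x in cube a s') h (u x) ^+ 2.
Proof.
move=> lam0 sol ss op Dc Du hG mgam mh Lh rs teta eta01 geta.
have mQ := @measurable_cube R n a s'.
have mu' : measurable_fun setT u by have [] := sol_L2 sol.
have seta : smooth eta by case: teta.
have meta : measurable_fun setT eta by exact: smooth_measurable.
have mhu : measurable_fun setT (fun x => h (u x)) by exact: (measurableT_comp mh mu').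
have mgu : measurable_fun setT (fun x => gam (u x)) by exact: (measurableT_comp mgam mu').
have Le := sol_eL1 sol.
have me : measurable_fun setT e by exact: (L1_measurable Le).
have mG : measurable_fun setT (grad_sqr eta).
  by apply: rV_continuous_measurable; exact: grad_sqr_continuous.
pose k := cutoff_cst / (s' - rho) ^+ 2.
have k0 : 0 <= k by rewrite divr_ge0 ?cutoff_cst_ge0// sqr_ge0.
have LhQ : L1 mu setT (fun x => h (u x) ^+ 2 * \1_(cube a s') x) by apply/(L1_restrict mu (fun x => h (u x) ^+ 2) mQ).
have Lg : L1 mu setT (fun x => (eta x * gam (u x)) ^+ 2 * e x).
  apply: (@L1_dom_ae _ _ (fun x => C * `|e x|)) => //.
  - by apply: measurable_funM => //; apply: measurable_funX; exact: measurable_funM.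
  - apply: filterS Du => x Dx _; rewrite normrM ler_wpM2r// ger0_norm ?sqr_ge0//.
    have [g0 g2 _] := hG _ Dx; have /andP[e0 e1] := eta01 x.
    have b := op_bound op Dx; have := ler_norm (dG (u x)).
    have : (eta x * gam (u x)) ^+ 2 <= gam (u x) ^+ 2.
      by rewrite exprMn ler_piMl ?sqr_ge0// expr_le1.
    by move: b g2; move: (dG _) (`|_|) (_ ^+ 2) (_ ^+ 2) => *; lra.
  - by apply: L1Z => //; exact: integrable_norm Le.
have hk x : h (u x) ^+ 2 * grad_sqr eta x <= k * (h (u x) ^+ 2 * \1_(cube a s') x).
  have [xQ|xQ] := pselect (cube a s' x).
    by rewrite indicE mem_set//= mulr1 mulrC ler_wpM2r ?sqr_ge0.
  by rewrite (grad_cutoff0 teta xQ) mulr0 mulr_ge0// mulr_ge0 ?sqr_ge0// indicE.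
have h0 x : 0 <= h (u x) ^+ 2 * grad_sqr eta x by rewrite mulr_ge0 ?sqr_ge0// grad_sqr_ge0.
have Lh' : L1 mu setT (fun x => h (u x) ^+ 2 * grad_sqr eta x).
  apply: (@L1_dom _ _ _ _ _ _ (fun x => k * (h (u x) ^+ 2 * \1_(cube a s') x))) => //.
  - by apply: measurable_funM => //; exact: measurable_funX.
  - by move=> x _; rewrite ger0_norm.
  - exact: L1Z.
split; first exact: (L1S measurableT).
rewrite Rintegral_setT// (_ : (fun x => _ * \1_(cube a s') x) =
    fun x => (eta x * gam (u x)) ^+ 2 * e x); last first.
  apply/funext => x; have [xQ|xQ] := pselect (cube a s' x); first by rewrite indicE mem_set//= mulr1.
  rewrite (_ : eta x = 0) ?mul0r ?expr0n/= ?mul0r//.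
  by apply/eqP/negPn/negP => /(test_supp teta).
apply: le_trans (energy_estimate lam0 sol ss op Dc Du teta hG Lg Lh') _.
have -> : 4 * cutoff_cst / (lam * (s' - rho)) ^+ 2 = 4 / lam ^+ 2 * k.
  rewrite /k; have : s' - rho != 0 by rewrite gt_eqF// subr_gt0.
  by move: (s' - rho) cutoff_cst => p q p0; field; rewrite p0 gt_eqF.
rewrite -[leRHS]mulrA ler_wpM2l ?divr_ge0 ?sqr_ge0//.
rewrite [X in k * X]Rintegral_setT// -RintegralZl//.
by apply: le_Rintegral => //; exact: L1Z.
Qed.
End de_giorgi.

Section de_giorgi_iteration.
Variables (R : realType) (n : nat).
Local Notation rV := 'rV[R]_n.
Local Notation mu := (@lebn R n).
Local Notation cutoff_cst := (cutoff_cst R n).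
Implicit Types (a x y : rV) (s r lam sig rho l d b c th : R) (u e : rV -> R) (g V : 'I_n -> rV -> R).

(** The Poincare factor 2 (2 l)^n n l^2 divided by l^n / 2, times the two contributions to the
    gradient of eta H(u): the energy of H(u) and the gradient of the cutoff. *)
Definition step_cst lam : R := 4 * 2 ^+ n * n%:R * (2 * (4 * cutoff_cst / lam ^+ 2) + 2 * cutoff_cst).

Lemma step_cst_ge0 lam : 0 < lam -> 0 <= step_cst lam.
Proof.
move=> lam0; have c0 := @cutoff_cst_ge0 R n; rewrite /step_cst.
apply: mulr_ge0; first by rewrite !mulr_ge0 ?exprn_ge0.
have h : 0 <= 4 * cutoff_cst / lam ^+ 2.
  by apply: mulr_ge0; [exact: mulr_ge0|rewrite invr_ge0; exact: sqr_ge0].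
by rewrite addr_ge0// mulr_ge0.
Qed.

(** At every x of the cube, the part of the cube within distance l of x has measure at least l^n.
    The level set fills at most half of that, so the truncation vanishes on the other half and the
    Poincare inequality holds at scale l. The Caccioppoli inequality then bounds the gradient by the
    truncation. *)
Lemma de_giorgi_step lam a s sig rho l u g V e D B dB d2B b (k : R) d :
  0 < lam -> local_sol lam a s u g V e -> base_op n D B dB d2B b -> 0 < d -> 0 <= k ->
  (forall r x, 0 < r -> D (conv u (@ker R n r) x)) -> {ae mu, forall x, D (u x)} ->
  0 <= rho -> rho < sig -> sig < s -> 0 < l -> l <= sig ->
  (mu (cube a sig `&` [set x | trunc B k d (u x) != 0%R]) <= (l ^+ n / 2)%:E)%E ->
  \int[mu]_(x in cube a rho) trunc B k d (u x) ^+ 2 <=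
  step_cst lam * (l / (sig - rho)) ^+ 2 * \int[mu]_(x in cube a sig) trunc B k d (u x) ^+ 2.
Proof.
move=> lam0 sol op d0 k0 Dc Du rho0 rs ss l0 ls hlev.
set H := trunc B k d in hlev *; set dH := dtrunc B dB k d.
have opH : c1_op n D H dH b by exact: (trunc_op op d0 k0).
have [C opG] : exists C, c1_op n D (fun t => H t * dH t) (fun t => dH t ^+ 2 + H t * d2trunc B dB d2B k d t) C.
  exact: (trunc_mul_op op d0 k0).
have mQ := @measurable_cube R n a sig.
have mu' : measurable_fun setT u by have [] := sol_L2 sol.
have Lu := sol_L2 sol.
have mHu : measurable_fun setT (fun x => H (u x)) by exact: (measurableT_comp (op_meas opH) mu').
have LHQ : L1 mu (cube a sig) (fun x => H (u x) ^+ 2).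
  by apply: (op_sqr_L1 opH) => //; exact: cube_finite.
have [eta [teta eta01 eta1 geta]] := @cutoffP R n a rho sig rho0 rs.
have seta : smooth eta by case: teta.
have hG t : D t -> [/\ 0 <= `|dH t|, `|dH t| ^+ 2 <= dH t ^+ 2 + H t * d2trunc B dB d2B k d t
    & `|H t * dH t| <= `|dH t| * H t].
  move=> Dt; split => //.
    by rewrite real_normK ?num_real// lerDl mulr_ge0// ?trunc_ge0// (d2trunc_ge0 k op d0 Dt).
  by rewrite normrM mulrC (ger0_norm (trunc_ge0 _ _ d0 _)).
have mdH : measurable_fun setT (fun t => `|dH t|).
  by apply: measurableT_comp => //; exact: (op_dmeas opH).
have [Len En] := caccioppoli lam0 sol ss opG Dc Du hG mdH (op_meas opH) LHQ rs teta eta01 geta.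
set Z := [set x | H (u x) = 0].
have mZ : measurable Z.
  rewrite (_ : Z = setT `&` (fun x => H (u x)) @^-1` [set 0]); last by rewrite setTI.
  exact: (mHu measurableT _ (measurable_set1 0)).
have lev x : cube a sig x -> ((l ^+ n / 2)%:E <= mu (Z `&` cube a sig `&` cube x l))%E.
  move=> xs; have mc := @measurable_cube R n x l.
  have mA : measurable (Z `&` cube a sig `&` cube x l) by apply: measurableI => //; exact: measurableI.
  have mE : measurable (cube a sig `&` [set x | H (u x) != 0]).
    rewrite (_ : [set x | H (u x) != 0] = ~` Z); last by apply/seteqP; split => y /= /eqP.
    by apply: measurableI => //; exact: measurableC.
  have := cube_orthant xs l0 ls.
  have : (mu (cube a sig `&` cube x l) <= mu (Z `&` cube a sig `&` cube x l) +
      mu (cube a sig `&` [set x | H (u x) != 0%R]))%E.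
    apply: le_trans (measureU2 _ mA mE); apply: le_measure; rewrite ?inE.
    - exact: measurableI.
    - exact: measurableU.
    move=> y [yQ yl]; have [H0|H0] := eqVneq (H (u y)) 0; first by left.
    by right.
  have Afin : mu (Z `&` cube a sig `&` cube x l) \is a fin_num.
    rewrite ge0_fin_numE//; apply: le_lt_trans (cube_finite x l).
    by apply: le_measure; rewrite ?inE.
  move=> h1 /le_trans/(_ h1)/le_trans/(_ (leeD2l _ hlev)).
  rewrite -(fineK Afin) -EFinD !lee_fin; lra.
have [c hc] : exists c, (forall x, `|eta x| <= c) /\ forall i x, `|partial i eta x| <= c.
  pose c := 1 + cutoff_cst / (sig - rho) ^+ 2.
  have k0' : 0 <= cutoff_cst / (sig - rho) ^+ 2 by rewrite divr_ge0 ?cutoff_cst_ge0// sqr_ge0.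
  exists c; split => [x|i x].
    by have /andP[e0 e1] := eta01 x; rewrite ger0_norm// (le_trans e1)// lerDl.
  have h : `|partial i eta x| ^+ 2 <= cutoff_cst / (sig - rho) ^+ 2.
    rewrite real_normK ?num_real//; apply: le_trans (geta x).
    by rewrite /grad_sqr (bigD1 i)//= lerDl sumr_ge0// => j _; exact: sqr_ge0.
  have := sqr_ge0 (`|partial i eta x| - 1); rewrite /c.
  by move: (`|_|) (_ / _) h k0' => p q; nra.
have th0 : 0 <= l ^+ n / 2 by rewrite divr_ge0// exprn_ge0// ltW.
have HZ : {ae mu, forall x, cube a sig x -> Z x -> H (u x) = 0} by apply: aeW => x _.
have [Lw Lq P] := sol_poincare sol ss opH Dc Du seta hc.1 hc.2 l0 th0 mZ lev HZ.
set q := fun x => \sum_i _ in Lq P.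
set E0 := Rintegral _ _ _ in En.
set I0 := (\int[mu]_(x in cube a sig) H (u x) ^+ 2) in En *.
have I00 : 0 <= I0 by apply: Rintegral_ge0 => x _; exact: sqr_ge0.
set k1 := cutoff_cst / (sig - rho) ^+ 2 in geta.
have k10 : 0 <= k1 by rewrite divr_ge0 ?cutoff_cst_ge0// sqr_ge0.
(* The weak gradient of eta H(u) is eta H'(u) g + H(u) grad eta; the two terms are separated by (a +
   b)^2 <= 2 a^2 + 2 b^2. *)
have Iq : \int[mu]_(x in cube a sig) q x <= 2 * E0 + 2 * (k1 * I0).
  apply: (@le_trans _ _ (\int[mu]_(x in cube a sig)
      (2 * ((eta x * `|dH (u x)|) ^+ 2 * e x) + 2 * (k1 * H (u x) ^+ 2)))).
    apply: le_Rintegral_ae => //.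
      by apply: L1D => //; apply: L1Z => //; exact: L1Z.
    apply: filterS (sol_ell sol) => x ell xQ.
    have [_ ge _] := ell (cubeS (ltW ss) xQ).
    apply: (@le_trans _ _ (\sum_i (2 * (eta x * dH (u x)) ^+ 2 * g i x ^+ 2 +
         2 * H (u x) ^+ 2 * partial i eta x ^+ 2))).
      apply: ler_sum => i _; apply: le_trans (sqrD_le _ _) _.
      by rewrite le_eqVlt; apply/orP; left; apply/eqP; ring.
    rewrite big_split/= -!mulr_sumr lerD//.
      rewrite -mulrA ler_wpM2l//.
      have -> : (eta x * `|dH (u x)|) ^+ 2 = (eta x * dH (u x)) ^+ 2.
        by move: (dH (u x)) => p; rewrite !exprMn real_normK ?num_real.
      by rewrite ler_wpM2l// sqr_ge0.
    by rewrite -mulrA ler_wpM2l// [leRHS]mulrC ler_wpM2l ?sqr_ge0//; exact: geta.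
  rewrite RintegralD//; last 2 first.
  - exact: L1Z.
  - by apply: L1Z => //; exact: L1Z.
  rewrite !RintegralZl//; last exact: L1Z.
have LHr : L1 mu (cube a rho) (fun x => H (u x) ^+ 2).
  by apply: (L1S mQ) => //; [exact: measurable_cube|exact: cubeS (ltW rs)].
apply: (@le_trans _ _ (\int[mu]_(x in cube a sig) (eta x * H (u x)) ^+ 2)).
  have -> : \int[mu]_(x in cube a rho) H (u x) ^+ 2 = \int[mu]_(x in cube a rho) (eta x * H (u x)) ^+ 2.
    by apply: eq_Rintegral => x; rewrite inE => /eta1 ->; rewrite mul1r.
  apply: le_Rintegral_subset => //; [exact: measurable_cube|exact: cubeS (ltW rs)|].
  by move=> x _; exact: sqr_ge0.
rewrite -(ler_pM2l (_ : 0 < l ^+ n / 2)); last by rewrite divr_gt0// exprn_gt0.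
apply: le_trans P _.
apply: (@le_trans _ _ (2 * (2 * l) ^+ n * (n%:R * l ^+ 2 *
    (2 * (4 * cutoff_cst / (lam * (sig - rho)) ^+ 2 * I0) + 2 * (k1 * I0))))).
  apply: ler_wpM2l; first by rewrite mulr_ge0// exprn_ge0// mulr_ge0// ltW.
  apply: ler_wpM2l; first by rewrite mulr_ge0// sqr_ge0.
  by apply: le_trans Iq _; rewrite lerD2r ler_wpM2l.
rewrite le_eqVlt; apply/orP; left; apply/eqP; rewrite /k1 /step_cst exprMn.
have : sig - rho != 0 by rewrite gt_eqF// subr_gt0.
have : lam != 0 by rewrite gt_eqF.
move: (sig - rho) (l ^+ n) (2 ^+ n) (cutoff_cst) (n%:R) => p ln tn cc nn lam1 p0.
by field; rewrite p0 lam1.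
Qed.
End de_giorgi_iteration.

(** * Local boundedness by De Giorgi iteration *)

Section sup_bound.
Variables (R : realType) (n : nat).
Local Notation rV := 'rV[R]_n.
Local Notation mu := (@lebn R n).
Implicit Types (a x y : rV) (s r lam sig rho l d b c th : R) (u e : rV -> R) (g V : 'I_n -> rV -> R).

(** Chebyshev's inequality. *)
Lemma level_set (A E : set rV) (f : rV -> R) c : measurable A -> measurable E -> E `<=` A ->
  L1 mu A f -> (forall x, A x -> 0 <= f x) -> 0 < c -> (forall x, E x -> c <= f x) ->
  (mu E <= (\int[mu]_(x in A) f x / c)%:E)%E.
Proof.
move=> mA mE EA Lf f0 c0 cf.
have LfE : L1 mu E f by exact: (L1S mA).
apply: (@le_trans _ _ (\int[mu]_(x in E) f x / c)%:E); last first.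
  by rewrite lee_fin ler_wpM2r ?invr_ge0 ?(ltW c0)//; exact: le_Rintegral_subset.
have -> : (\int[mu]_(x in E) f x / c)%:E = (\int[mu]_(x in E) (c^-1 * f x)%:E)%E.
  by rewrite -L1_fin//; [rewrite RintegralZl// mulrC|exact: L1Z].
rewrite -[leLHS]mul1e -(integral_cst mu mE 1).
apply: ge0_le_integral => //.
- by apply/measurable_EFinP; apply: measurable_funM => //; exact: (L1_measurable LfE).
- by move=> x Ex; rewrite lee_fin mulrC ler_pdivlMr// mul1r; exact: cf.
Qed.

Lemma le_sqr (x y : R) : 0 <= x -> x <= y -> x ^+ 2 <= y ^+ 2.
Proof. by move=> x0 xy; rewrite ler_sqr ?nnegrE// (le_trans x0). Qed.

(** Levels increase to K while radii decrease from 2 r to r. The bound Y j <= q^j Y 0 reproduces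
    itself: it makes the next level set small enough to apply [de_giorgi_step] at scale l = r t
    2^-j, and that step returns the factor q because l is the fraction 2 t of the gap between the
    radii. *)
Lemma sup_bound lam : 0 < lam -> exists eps : R, 0 < eps /\
  forall a s r u g V e D B dB d2B b (K : R),
  local_sol lam a s u g V e -> base_op n D B dB d2B b ->
  (forall r x, 0 < r -> D (conv u (@ker R n r) x)) -> {ae mu, forall x, D (u x)} ->
  0 < r -> 2 * r < s -> 0 < K ->
  \int[mu]_(x in cube a (2 * r)) trunc B 0 (K / 2) (u x) ^+ 2 <= eps * K ^+ 2 * r ^+ n ->
  {ae mu, forall x, cube a r x -> B (u x) <= K}.
Proof.
move=> lam0; pose p : R := psi1 R.
have p0 : 0 < p by exact: psi1_gt0.
pose h (j : nat) : R := 2^-1 ^+ j.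
have h0 j : 0 < h j by rewrite exprn_gt0.
have h1 j : h j <= 1 by rewrite exprn_ile1// invf_le1// ler1n.
have hS j : h j.+1 = h j / 2 by rewrite /h exprSr.
(* In 2^-(n+2), n powers of 2 match l^n and two match the square of the shrinking width [dd j] in
   Chebyshev's inequality. *)
pose q : R := 2^-1 ^+ n.+2.
have q0 : 0 < q by rewrite exprn_gt0.
have q1 : q < 1 by rewrite exprn_ilt1// invf_lt1// ltr1n.
have qh j : q ^+ j = h j ^+ n * h j ^+ 2 by rewrite /q /h -exprM mulnC exprM -exprD addn2.
pose K1 := step_cst n lam.
have K10 : 0 <= K1 by exact: step_cst_ge0.
(* So small that the step constant times (2 t)^2, with the loss p^-2 between consecutive
   truncations, is at most q. *)
pose t : R := Num.min 1 (q * p ^+ 2 / (4 * K1 + 1)).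
have k40 : 0 < 4 * K1 + 1 by rewrite ltr_wpDl// mulr_ge0.
have qp0 : 0 < q * p ^+ 2 by rewrite mulr_gt0// exprn_gt0.
have t0 : 0 < t by rewrite lt_min ltr01 divr_gt0.
have t1 : t <= 1 by rewrite ge_min lexx.
have ht : K1 * (2 * t) ^+ 2 <= q * p ^+ 2.
  apply: (@le_trans _ _ ((4 * K1 + 1) * t)).
    have := mulr_ge0 (mulr_ge0 K10 (ltW t0)) (_ : 0 <= 1 - t); rewrite subr_ge0 => /(_ t1).
    by move: t0 K10; move: (t) (K1) => x y *; nra.
  by rewrite mulrC -ler_pdivlMr// ge_min lexx orbT.
(* Exactly the value for which Chebyshev's inequality gives (r t 2^-j)^n / 2: the width is K 2^-j /
   2, whose square contributes the factor 4. *)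
pose eps := t ^+ n * p ^+ 2 / 8.
have eps0 : 0 < eps by rewrite divr_gt0// mulr_gt0 ?exprn_gt0.
exists eps; split => // a s r u g V e D B dB d2B b K sol op Dc Du r0 rs K0 Y0le.
pose kk j : R := K * (1 - h j); pose dd j : R := K * h j / 2; pose rr j : R := r * (1 + h j).
have kk0 j : 0 <= kk j by rewrite mulr_ge0 ?(ltW K0)// subr_ge0.
have dd0 j : 0 < dd j by rewrite divr_gt0// mulr_gt0.
have kS j : kk j.+1 = kk j + dd j by rewrite /kk /dd hS; field.
have rS j : rr j - rr j.+1 = r * h j / 2 by rewrite /rr hS; field.
have rr0 j : 0 <= rr j by rewrite mulr_ge0 ?addr_ge0 ?(ltW r0) ?(ltW (h0 j)).
have rrs j : rr j < s.
  apply: le_lt_trans rs; rewrite /rr [leRHS]mulrC ler_wpM2l ?(ltW r0)//.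
  by have := h1 j; move: (h j) => *; lra.
pose H j := trunc B (kk j) (dd j).
pose Y j := \int[mu]_(x in cube a (rr j)) H j (u x) ^+ 2.
have Lu := sol_L2 sol.
have mu' : measurable_fun setT u by have [] := Lu.
have opH j : c1_op n D (H j) (dtrunc B dB (kk j) (dd j)) b by exact: (trunc_op op).
have LH j c : L1 mu (cube a c) (fun x => H j (u x) ^+ 2).
  by apply: (op_sqr_L1 (opH j)) => //; [exact: measurable_cube|exact: cube_finite].
have H0 j z : 0 <= H j z by exact: trunc_ge0.
have HS j z : H j.+1 z != 0 -> [/\ kk j + dd j <= B z, p * (B z - kk j) <= H j z & H j.+1 z <= B z - kk j].
  move=> Hz; have Bk : kk j + dd j <= B z.
    rewrite leNgt; apply/negP => Bz; move: Hz; rewrite /H trunc0 ?eqxx// kS.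
    exact: ltW.
  split => //; first exact: trunc_ge.
  apply: le_trans (trunc_le _ _ (dd0 _) _) _.
  rewrite ge_max kS; have := dd0 j; move: Bk; move: (dd j) (kk j) (B z) => *.
  by apply/andP; split; lra.
(* Where the truncation at level j+1 is positive, B exceeds [kk j + dd j], and there the truncation
   at level j is at least p (B - kk j). *)
have A1 j z : H j.+1 z ^+ 2 <= p ^- 2 * H j z ^+ 2.
  have [->|/HS[Bk pH HB]] := eqVneq (H j.+1 z) 0.
    by rewrite expr0n mulr_ge0 ?sqr_ge0// invr_ge0 sqr_ge0.
  rewrite mulrC ler_pdivlMr ?exprn_gt0// -exprMn; apply: le_sqr.
    by apply: mulr_ge0; [exact: H0|exact: ltW].
  by apply: le_trans pH; rewrite mulrC ler_wpM2l// ltW.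
have A2 j z : H j.+1 z != 0 -> (p * dd j) ^+ 2 <= H j z ^+ 2.
  move=> /HS[Bk pH _]; apply: le_sqr; first by apply: mulr_ge0; exact: ltW.
  apply: le_trans pH; rewrite ler_wpM2l ?(ltW p0)//.
  by move: Bk; move: (dd j) (kk j) (B z) => *; lra.
have Yj j : Y j <= q ^+ j * (eps * K ^+ 2 * r ^+ n).
  elim: j => [|j IH].
    rewrite expr0 mul1r; apply: le_trans Y0le; rewrite /Y /H /rr /kk /dd /h expr0.
    by rewrite subrr mulr0 mulr1 (_ : r * (1 + 1) = 2 * r)//; ring.
  have l0 : 0 < r * t * h j by rewrite mulr_gt0// mulr_gt0.
  have ls : r * t * h j <= rr j.
    rewrite /rr -mulrA ler_wpM2l ?(ltW r0)//; have := h0 j; have := h1 j.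
    by move: (h j) t0 t1 => *; nra.
  have rSj : rr j.+1 < rr j by rewrite -subr_gt0 rS divr_gt0// mulr_gt0.
  have lev : (mu (cube a (rr j) `&` [set x | trunc B (kk j.+1) (dd j.+1) (u x) != 0%R]) <=
      ((r * t * h j) ^+ n / 2)%:E)%E.
    apply: le_trans (_ : (Y j / (p * dd j) ^+ 2)%:E <= _)%E.
      apply: level_set => //.
      - exact: measurable_cube.
      - apply: measurableI; first exact: measurable_cube.
        rewrite (_ : [set x | _] = setT `&` (fun x => H j.+1 (u x)) @^-1` [set~ 0]); last first.
          by rewrite setTI; apply/seteqP; split => y /= /eqP.
        have mH : measurable_fun setT (fun x => H j.+1 (u x)).
          exact: (measurableT_comp (op_meas (opH j.+1)) mu').
        by apply: mH => //; apply: measurableC; exact: measurable_set1.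
      - by move=> x _; exact: sqr_ge0.
      - by rewrite exprn_gt0// mulr_gt0.
      - by move=> x [_ Hx]; exact: A2.
    rewrite lee_fin ler_pdivrMr; last by rewrite exprn_gt0// mulr_gt0.
    apply: le_trans IH _; rewrite qh /eps /dd le_eqVlt; apply/orP; left; apply/eqP.
    rewrite !exprMn; have := h0 j; move: (h j) (h j ^+ n) (t ^+ n) (r ^+ n) => *.
    by field.
  apply: le_trans (de_giorgi_step lam0 sol op (dd0 _) (kk0 _) Dc Du (rr0 _) rSj (rrs _) l0 ls lev) _.
  rewrite rS (_ : r * t * h j / (r * h j / 2) = 2 * t); last first.
    by field; rewrite !gt_eqF.
  rewrite -/K1 [q ^+ j.+1]exprS -[leRHS]mulrA -/(H j.+1).
  apply: (@le_trans _ _ (K1 * (2 * t) ^+ 2 * (p ^- 2 * Y j))).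
    apply: ler_wpM2l; first by apply: mulr_ge0 => //; exact: sqr_ge0.
    rewrite /Y -RintegralZl; [|exact: measurable_cube|exact: LH].
    apply: le_Rintegral; [exact: measurable_cube|exact: LH| |by move=> x _; exact: A1].
    by apply: L1Z; [exact: measurable_cube|exact: LH].
  apply: (@le_trans _ _ (q * p ^+ 2 * (p ^- 2 * Y j))).
    by rewrite ler_wpM2r// mulr_ge0 ?invr_ge0 ?sqr_ge0//; apply: Rintegral_ge0 => x _; exact: sqr_ge0.
  rewrite (_ : q * p ^+ 2 * (p ^- 2 * Y j) = q * Y j); last by field; rewrite gt_eqF.
  by rewrite ler_wpM2l// ltW.
(* Every truncation dominates p (B - K)^+, whose integral over the smallest cube is therefore 0. *)
pose f x := (p * Num.max (B (u x) - K) 0) ^+ 2.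
have fH j x : f x <= H j (u x) ^+ 2.
  have [BK|BK] := leP (B (u x) - K) 0; first by rewrite /f max_r// mulr0 expr0n sqr_ge0.
  rewrite /f max_l ?(ltW BK)//; apply: le_sqr; first by apply: mulr_ge0; exact: ltW.
  apply: le_trans (trunc_ge (dd0 j) _).
    rewrite ler_wpM2l ?(ltW p0)// lerD2l lerN2 /kk ler_piMr ?(ltW K0)//.
    by have := h0 j; move: (h j) => *; lra.
  rewrite -kS /kk; move: BK; have := mulr_gt0 K0 (h0 j.+1); move: (h _) (B _) => *; lra.
have mB : measurable_fun setT (fun x => B (u x)).
  by have [mB _ _] := base_meas op; exact: (measurableT_comp mB mu').
have mf : measurable_fun setT f.
  apply: measurable_funX; apply: measurable_funM => //; apply: measurable_maxr => //.
  exact: measurable_funB.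
have f0 x : 0 <= f x by exact: sqr_ge0.
have mc := @measurable_cube R n a r.
have Lf : L1 mu (cube a r) f.
  apply: (@L1_dom _ _ _ _ _ _ (fun x => H 0%N (u x) ^+ 2)) => //; first exact: measurable_funTS.
  by move=> x _; rewrite ger0_norm.
have fint : \int[mu]_(x in cube a r) f x <= 0.
  have cq : q ^+ j * (eps * K ^+ 2 * r ^+ n) @[j --> \oo] --> (0 : R).
    rewrite -[X in _ --> X](mul0r (eps * K ^+ 2 * r ^+ n)); apply: cvgMr_tmp.
    by apply: cvg_expr; rewrite gtr0_norm.
  apply: (ler_cvg_to (cvg_cst (\int[mu]_(x in cube a r) f x)) cq); apply: nearW => j.
  apply: le_trans (Yj j); apply: (@le_trans _ _ (\int[mu]_(x in cube a r) H j (u x) ^+ 2)).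
    by apply: le_Rintegral; [exact: mc|exact: Lf|exact: LH|move=> x _; exact: fH].
  apply: le_Rintegral_subset; [exact: measurable_cube|exact: mc| |exact: LH|by move=> x _; exact: sqr_ge0].
  apply: cubeS; rewrite /rr; have := mulr_gt0 r0 (h0 j); move: (h j) => *; lra.
apply: filterS (Rintegral0_ae mc Lf (fun x _ => f0 x) fint) => x fx0 /fx0.
rewrite /f => /eqP; rewrite sqrf_eq0 mulf_eq0 gt_eqF//= => /eqP hm; rewrite -subr_le0 -hm.
by rewrite le_max lexx.
Qed.
End sup_bound.

Section oscillation.
Variables (R : realType) (n : nat).
Local Notation rV := 'rV[R]_n.
Local Notation mu := (@lebn R n).
Local Notation cutoff_cst := (cutoff_cst R n).
Implicit Types (a x y : rV) (s r lam sig rho l d b c th m : R) (f u e : rV -> R) (g V : 'I_n -> rV -> R).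

Lemma le_Rintegral_subset_ae (D E : set rV) f : measurable D -> measurable E -> E `<=` D ->
  L1 mu D f -> {ae mu, forall x, D x -> 0 <= f x} ->
  \int[mu]_(x in E) f x <= \int[mu]_(x in D) f x.
Proof.
move=> mD mE ED Lf f0; rewrite (Rintegral_setT mu f mD) (Rintegral_setT mu f mE).
have LD : L1 mu setT (fun x => f x * \1_D x) by apply/(L1_restrict mu f mD).
have LE : L1 mu setT (fun x => f x * \1_E x) by apply/(L1_restrict mu f mE); exact: (L1S mD).
apply: le_Rintegral_ae => //; apply: filterS f0 => x f0 _.
rewrite !indicE; have [xE|xE] := pselect (E x); first by rewrite !mem_set//; exact: ED.
rewrite memNset// mulr0; have [xD|xD] := pselect (D x); last by rewrite memNset// mulr0.
by rewrite mem_set// mulr1 f0.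
Qed.

Lemma L1_mul_test (Omega : set rV) f phi : L1 mu setT f -> test_function Omega phi ->
  L1 mu setT (fun x => f x * phi x).
Proof.
move=> Lf tphi; have [c [c0 hc]] := test_bounded tphi.
have mphi : measurable_fun setT phi by apply: smooth_measurable; case: tphi.
have mf := L1_measurable Lf.
apply: (@L1_dom _ _ _ _ _ _ (fun x => c * `|f x|)) => //; first exact: measurable_funM.
  by move=> x _; rewrite normrM mulrC ler_wpM2r.
by apply: L1Z => //; exact: integrable_norm Lf.
Qed.

(** Translation by t e_i leaves the integral of phi unchanged, so Taylor's formula gives t |I| <= c
    m t^2 for all t in ]0, 1]. *)
Lemma Rintegral_partial0 phi a s i : test_function (cube a s) phi ->
  \int[mu]_x partial i phi x = 0.
Proof.
move=> tphi; have [c [c0 hc]] := test_taylor tphi.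
have Lphi := test_L1 tphi; have Ldphi := test_L1 (test_partial i tphi).
set I := \int[mu]_x _; pose v : rV := basis_vec R i.
have mQ := @measurable_cube R n a (s + 1).
have L1Q : L1 mu setT (\1_(cube a (s + 1)) : rV -> R) by apply: L1_indic => //; exact: cube_finite.
pose m := \int[mu]_x \1_(cube a (s + 1)) x.
have v1 : `|v| <= 1 by exact: norm_basis_vec.
have vE t j : (t *: v) 0 j = t * (i == j)%:R by rewrite mxE /v basis_vecE.
have key t : 0 < t -> t <= 1 -> `|I| <= c * m * t.
  move=> t0 t1.
  have Ls := L1_shift (t *: v) Lphi.
  have LD : L1 mu setT (fun x => phi (t *: v + x) - phi x - t * partial i phi x).
    by apply: L1B => //; [exact: L1B|exact: L1Z].
  have E : \int[mu]_x (phi (t *: v + x) - phi x - t * partial i phi x) = - (t * I).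
    rewrite RintegralB//; [|exact: L1B|exact: L1Z].
    by rewrite RintegralB// Rintegral_shift// subrr sub0r RintegralZl.
  have : t * `|I| <= c * t ^+ 2 * m.
    rewrite -[t in t * `|I|]gtr0_norm// -normrM -normrN -E.
    apply: le_trans (le_normr_Rintegral _ _) _ => //.
    rewrite /m -RintegralZl//; apply: le_Rintegral => //; [exact: integrable_norm LD|exact: L1Z|].
    move=> x _; have [xQ|xQ] := pselect (cube a (s + 1) x).
      rewrite indicE mem_set// mulr1.
      have := hc x (t *: v); rewrite (bigD1 i)//= big1 ?addr0 => [|j ji].
        rewrite vE eqxx/= mulr1 [x + _]addrC => /le_trans; apply; rewrite ler_wpM2l//.
        by apply: le_sqr => //; rewrite normrZ gtr0_norm// ler_piMr// ltW.
      by rewrite vE eq_sym (negbTE ji) mulr0 mul0r.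
    have z y : (forall j, `|x 0 j - y 0 j| <= 1) -> ~ cube a s y.
      move=> xy ys; apply: xQ => j; have := ys j; have := xy j; rewrite ler_norml.
      by move: (x 0 j) (y 0 j) (a 0 j) => *; lra.
    have phi0 y : (forall j, `|x 0 j - y 0 j| <= 1) -> phi y = 0.
      by move=> /z ny; apply/eqP/negPn/negP => /(test_supp tphi).
    have dphi0 : partial i phi x = 0.
      apply/eqP/negPn/negP => /(test_supp (test_partial i tphi)).
      by apply: z => j; rewrite subrr normr0.
    rewrite dphi0 !phi0 ?subrr ?mulr0 ?subr0 ?normr0 ?mulr_ge0 ?sqr_ge0//; last 2 first.
    - by move=> j; rewrite subrr normr0.
    - move=> j; rewrite mxE vE opprD addrCA subrr addr0 normrN normrM gtr0_norm//.
      by rewrite mulr_ile1 ?(ltW t0)//; case: (_ == _); rewrite ?normr1 ?normr0.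
    exact: ltW.
    exact: ltW.
  rewrite expr2 => h; rewrite -(ler_pM2l t0); apply: le_trans h _.
  by rewrite le_eqVlt; apply/orP; left; apply/eqP; ring.
apply/eqP; rewrite -normr_le0 leNgt; apply/negP => I0.
have m0 : 0 <= c * m by rewrite mulr_ge0// Rintegral_ge0.
(* For this t the bound |I| <= c m t would give |I| <= |I| / 2. *)
pose t := Num.min 1 (`|I| / (2 * (c * m + 1))).
have k0 : 0 < 2 * (c * m + 1) by rewrite mulr_gt0// ltr_wpDl.
have t0 : 0 < t by rewrite lt_min ltr01 divr_gt0.
have t1 : t <= 1 by rewrite ge_min lexx.
have ht : t * (2 * (c * m + 1)) <= `|I| by rewrite -ler_pdivlMr// ge_min lexx orbT.
have := key _ t0 t1; move: ht I0 m0 t0; move: (t) (`|I|) (c * m) => *; nra.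
Qed.

Lemma L2_restrict f (A : set rV) : L2 f -> measurable A -> L2 (fun x => f x * \1_A x).
Proof.
move=> [mf Lf] mA.
have m1 : measurable_fun setT (fun x => f x * \1_A x) by apply: measurable_funM => //; exact: measurable_indic.
split => //; apply: (@L1_dom _ _ _ _ _ _ (fun x => f x ^+ 2)) => //; first exact: measurable_funX.
move=> x _; rewrite ger0_norm ?sqr_ge0// exprMn indicE.
by case: (_ \in _); rewrite ?expr1n ?mulr1// expr0n mulr0 sqr_ge0.
Qed.

(** Adding a constant is harmless because derivatives of test functions have integral 0. The
    function and its gradient are cut off again, so that the result is a solution on the smaller
    cube. *)
Lemma sol_affine lam a s a' s' u g V e c b : local_sol lam a s u g V e ->
  cube a' s' `<=` cube a s ->
  local_sol lam a' s' (fun x => (c * u x + b) * \1_(cube a' s') x)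
    (fun i x => c * g i x * \1_(cube a' s') x) (fun i x => c * V i x) (fun x => c ^+ 2 * e x).
Proof.
move=> sol sub; have mQ := @measurable_cube R n a' s'.
have L2Q : L2 (\1_(cube a' s') : rV -> R) by apply: (L2_indic mQ mQ) => //; exact: cube_finite.
have ex (f phi : rV -> R) : test_function (cube a' s') phi ->
    (fun x => f x * \1_(cube a' s') x * phi x) = fun x => f x * phi x.
  move=> tphi; apply/funext => x; have [xQ|xQ] := pselect (cube a' s' x).
    by rewrite indicE mem_set// mulr1.
  rewrite (_ : phi x = 0) ?mulr0//; by apply/eqP/negPn/negP => /(test_supp tphi).
split.
- have : L2 (fun x => c * (u x * \1_(cube a' s') x) + b * \1_(cube a' s') x).
    by apply: L2D; apply: L2Z => //; apply: L2_restrict => //; exact: sol_L2 sol.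
  by under eq_fun do rewrite mulrA -mulrDl.
- move=> i; have : L2 (fun x => c * (g i x * \1_(cube a' s') x)).
    by apply: L2Z => //; apply: L2_restrict => //; exact: sol_gL2 sol i.
  by under eq_fun do rewrite mulrA.
- by move=> i; apply: L2Z; exact: sol_VL2 sol i.
- by apply: L1Z => //; exact: sol_eL1 sol.
- by move=> x nx; rewrite indicE memNset// mulr0.
- by move=> i x nx; rewrite indicE memNset// mulr0.
- move=> phi i tphi; have tphi' := test_subset sub tphi.
  have tdphi := test_partial i tphi.
  rewrite (ex (fun x => c * u x + b) _ tdphi) (ex (fun x => c * g i x) _ tphi).
  have Lud := L1_mul_test (sol_L1 sol) tdphi.
  have Lgd := L1_mul_test (sol_gL1 i sol) tphi.
  under eq_Rintegral do rewrite mulrDl -mulrA.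
  rewrite RintegralD//; [|exact: L1Z|by apply: L1Z => //; exact: test_L1 tdphi].
  rewrite !RintegralZl//; last exact: test_L1 tdphi.
  rewrite (Rintegral_partial0 i tphi) mulr0 addr0 (sol_grad sol i tphi') mulrN.
  by under [in RHS]eq_Rintegral do rewrite -mulrA; rewrite RintegralZl.
- move=> phi tphi; have := sol_div sol (test_subset sub tphi) => E.
  under eq_Rintegral do under eq_bigr do rewrite -mulrA.
  under eq_Rintegral do rewrite -mulr_sumr.
  rewrite RintegralZl ?E ?mulr0//; apply: L1_sum => // i _.
  have [mV LV] := sol_VL2 sol i.
  apply: L2_mul => //; split.
    by apply: smooth_measurable; apply: smooth_partial; case: tphi.
  have tp := test_partial i tphi.
  rewrite (_ : (fun x => _) = fun x => partial i phi x * partial i phi x).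
    by apply: (L1_mul_test _ tp); exact: test_L1 tp.
  by apply/funext => x; rewrite expr2.
apply: filterS (sol_ell sol) => x ell xQ; have [e1 e2 e3] := ell (sub _ xQ).
have c0 := sqr_ge0 c; rewrite indicE mem_set//; split.
- rewrite (_ : \sum_i _ = c ^+ 2 * \sum_i V i x * g i x); last first.
    by rewrite mulr_sumr; apply: eq_bigr => i _; rewrite mulr1; ring.
  by rewrite mulrCA ler_wpM2l.
- rewrite (_ : \sum_i _ = c ^+ 2 * \sum_i g i x ^+ 2) ?ler_wpM2l//.
  by rewrite mulr_sumr; apply: eq_bigr => i _; rewrite mulr1 exprMn.
- rewrite (_ : \sum_i _ = c ^+ 2 * \sum_i V i x ^+ 2) ?ler_wpM2l//.
  by rewrite mulr_sumr; apply: eq_bigr => i _; rewrite exprMn.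
Qed.

Lemma sol_bounded lam a s r u g V e : 0 < lam -> local_sol lam a s u g V e -> 0 < r -> 2 * r < s ->
  exists M : R, 0 < M /\ {ae mu, forall x, cube a r x -> `|u x| <= M}.
Proof.
move=> lam0 sol r0 rs; have [eps [eps0 sup]] := @sup_bound R n lam lam0.
have [mu' Lu] := sol_L2 sol.
have mQ := @measurable_cube R n a (2 * r).
pose I := \int[mu]_(x in cube a (2 * r)) u x ^+ 2.
have I0 : 0 <= I by apply: Rintegral_ge0 => x _; exact: sqr_ge0.
have er : 0 < eps * r ^+ n by rewrite mulr_gt0// exprn_gt0.
(* Then I <= eps r^n M <= eps r^n M^2, as M >= 1: the smallness condition of [sup_bound] holds by
   making the bound large. *)
pose M := 1 + I / (eps * r ^+ n).
have M1 : 1 <= M by rewrite lerDl divr_ge0// ltW.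
have M0 : 0 < M by exact: lt_le_trans M1.
have side c : `|c| = 1 -> {ae mu, forall x, cube a r x -> c * u x <= M}.
  move=> c1; apply: (sup _ _ _ _ _ _ _ _ _ _ _ _ M sol (base_op_linear n c)) => //.
    exact: aeW.
  apply: (@le_trans _ _ I).
    have M2 : 0 < M / 2 by rewrite divr_gt0.
    have opH := trunc_op (base_op_linear n c) M2 (lexx 0).
    apply: le_Rintegral => //.
    - by apply: (op_sqr_L1 opH); [exact: sol_L2 sol|exact: aeW|exact: mQ|exact: cube_finite].
    - exact: (L1S measurableT).
    - move=> x _; rewrite -[leRHS]real_normK ?num_real//; apply: le_sqr.
        by apply: trunc_ge0; rewrite divr_gt0.
      apply: le_trans (trunc_le _ _ _ _) _; first by rewrite divr_gt0.
      rewrite ge_max normr_ge0 andbT subr0 (le_trans (ler_norm _))//.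
      by rewrite normrM c1 mul1r.
  have MI : I <= (eps * r ^+ n) * M by rewrite /M mulrDr mulr1 mulrCA divff ?mulr1 ?lerDr ?gt_eqF// ltW.
  apply: le_trans MI _; rewrite [leRHS](_ : _ = eps * r ^+ n * M ^+ 2); last by ring.
  by rewrite ler_wpM2l ?(ltW er)// expr2 ler_peMl// ltW.
exists M; split => //.
have h1 : `|1 : R| = 1 by rewrite normr1.
have h2 : `|-1 : R| = 1 by rewrite normrN1.
apply: filterS2 (side _ h1) (side _ h2) => x b1 b2 xr.
by have := b1 xr; have := b2 xr; rewrite mulN1r mul1r ler_norml => *; apply/andP; split; lra.
Qed.

Lemma conv_ge0 u r x : {ae mu, forall x, 0 <= u x} -> L1 mu setT u -> 0 < r ->
  0 <= conv u (@ker R n r) x.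
Proof.
move=> u0 Lu r0; rewrite /conv (_ : 0 = \int[mu]_(y in setT) (0 : R)); last by rewrite /Rintegral integral0.
apply: le_Rintegral_ae => //; first exact: integrable0.
  exact: conv_integrable (@ker_test R n r r0).
by apply: filterS u0 => y uy _; rewrite mulr_ge0// ker_ge0.
Qed.
End oscillation.

(** * Decay of oscillation and energy *)

Section oscillation_decay.
Variables (R : realType) (n : nat).
Local Notation rV := 'rV[R]_n.
Local Notation mu := (@lebn R n).
Local Notation cutoff_cst := (cutoff_cst R n).
Implicit Types (a x y : rV) (s r lam sig rho l d b c th m : R) (f u e : rV -> R) (g V : 'I_n -> rV -> R).

(* -ln(2(u + dl)) is bounded above independently of dl: the energy estimate with
   G(t) = -1/(t + dl) bounds its gradient, the Poincare inequality its L^2 norm. *)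
Lemma lower_bound lam : 0 < lam -> exists c : R, [/\ 0 < c, c <= 1/2 & forall a r u g V e,
  local_sol lam a (5 * r) u g V e -> 0 < r -> {ae mu, forall x, 0 <= u x} ->
  (((4 * r) ^+ n / 2)%:E <= mu ([set x | 1/2 <= u x]%R `&` cube a (2 * r)))%E ->
  {ae mu, forall x, cube a r x -> c <= u x}].
Proof.
move=> lam0; have [eps [eps0 sup]] := @sup_bound R n lam lam0.
have cc0 := @cutoff_cst_ge0 R n.
(* The Poincare factor for l = 4 r and th = (4 r)^n / 2, times the Caccioppoli bound with h = 1 on
   the cube of radius 3 r, whose measure is (6 r)^n. *)
pose C2 := 4 * 2 ^+ n * n%:R * 16 * (4 * cutoff_cst / lam ^+ 2) * 6 ^+ n.
have C20 : 0 <= C2.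
  have h : 0 <= 4 * cutoff_cst / lam ^+ 2.
    by apply: mulr_ge0; [exact: mulr_ge0|rewrite invr_ge0; exact: sqr_ge0].
  by rewrite /C2; do 5 (apply: mulr_ge0; last by []); rewrite ?exprn_ge0.
(* As K >= 1, eps K^2 >= eps K >= C2. A bound K for the logarithm means 2 (u + dl) >= exp(-K). *)
pose K := 1 + C2 / eps.
have K1 : 1 <= K by rewrite lerDl divr_ge0// ltW.
have K0 : 0 < K by exact: lt_le_trans K1.
have CK : C2 <= eps * K ^+ 2.
  apply: (@le_trans _ _ (eps * K)).
    by rewrite /K mulrDr mulr1 mulrCA divff ?mulr1 ?lerDr ?gt_eqF// ltW.
  by rewrite ler_wpM2l ?(ltW eps0)// expr2 ler_peMl// ltW.
exists (expR (- K) / 2); split.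
- by rewrite divr_gt0// expR_gt0.
- by rewrite ler_wpM2r// -[leRHS]expR0 ler_expR oppr_le0 ltW.
move=> a r u g V e sol r0 u0 half.
have [mu' Lu2] := sol_L2 sol.
have Lu := sol_L1 sol.
(* The shift dl keeps the logarithm finite; it is removed at the end along dl = 1/(k+1), as the
   lower bound is independent of it. *)
have key dl : 0 < dl -> {ae mu, forall x, cube a r x -> expR (- K) / 2 <= u x + dl}.
  move=> dl0; have [b op] := base_op_log n dl0.
  set B := (fun t => _) in op; set dB := (fun t => _) in op; set d2B := (fun t => _) in op.
  have Dc r' x : 0 < r' -> nonneg (conv u (@ker R n r') x) by move=> ?; exact: conv_ge0.
  have Du : {ae mu, forall x, nonneg (u x)} by exact: u0.
  have [r2 rr2 rr3] : [/\ 2 * r < 5 * r, 2 * r < 3 * r & 3 * r < 5 * r] by split; lra.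
  suff h : {ae mu, forall x, cube a r x -> B (u x) <= K}.
    apply: filterS2 h u0 => x h ux /h; rewrite /B lerNl => hx.
    have p0 : 0 < 2 * (u x + dl) by rewrite mulr_gt0// ltr_wpDl.
    by rewrite ler_pdivrMr// mulrC -[leRHS]lnK ?posrE// ler_expR.
  apply: (sup _ _ _ _ _ _ _ _ _ _ _ _ K sol op) => //.
  have K2 : 0 < K / 2 by rewrite divr_gt0.
  have opH := trunc_op op K2 (lexx 0).
  set H := trunc B 0 (K / 2) in opH *; set dH := dtrunc B dB 0 (K / 2) in opH.
  pose Z := [set x | 1/2 <= u x].
  have mZ : measurable Z.
    rewrite (_ : Z = setT `&` u @^-1` `[1/2, +oo[); first exact: mu'.
    by rewrite setTI; apply/seteqP; split => y; rewrite /Z/= in_itv/= andbT.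
  have mQ := @measurable_cube R n a (2 * r).
  (* The scale l = 4 r is the side of the cube of radius 2 r, so every point of that cube sees the
     whole set Z. *)
  have lev x : cube a (2 * r) x -> (((4 * r) ^+ n / 2)%:E <= mu (Z `&` cube a (2 * r) `&` cube x (4 * r)))%E.
    move=> xQ; apply: le_trans half _; apply: le_measure; rewrite ?inE.
    - exact: measurableI.
    - by apply: measurableI; [exact: measurableI|exact: measurable_cube].
    move=> y [yZ yQ]; split => // i; have := xQ i; have := yQ i.
    by move: (x 0 i) (y 0 i) (a 0 i) => *; lra.
  have HZ : {ae mu, forall x, cube a (2 * r) x -> Z x -> H (u x) = 0}.
    apply: aeW => x _ Zx; rewrite /H trunc0// /B oppr_le0 ln_ge0//.
    by move: Zx; rewrite /Z/=; move: dl0; move: (u x) => *; lra.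
  have s1 : smooth (fun _ : rV => 1 : R) by apply: smooth_exprP; exact: SmoothCst.
  have p1 i x : partial i (fun _ : rV => 1 : R) x = 0.
    by rewrite /partial; exact: derive_cst.
  have b1 (x : rV) : `|1 : R| <= 1 by rewrite normr1.
  have b2 (i : 'I_n) x : `|partial i (fun _ : rV => 1 : R) x| <= 1 by rewrite p1 normr0.
  have l0 : 0 < 4 * r by rewrite mulr_gt0.
  have th0 : 0 <= (4 * r) ^+ n / 2 by rewrite divr_ge0// exprn_ge0// ltW.
  have [_ Lq P] := sol_poincare sol r2 opH Dc Du s1 b1 b2 l0 th0 mZ lev HZ.
  have [eta [teta eta01 eta1 geta]] := @cutoffP R n a (2 * r) (3 * r) (mulr_ge0 (ler0n R 2) (ltW r0)) rr2.
  have opdB := base_dop op (ex_intro _ 0 (lexx 0)).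
  (* Here gam(t) = 1/(t + dl), gam^2 = G' and |G| = gam, so h = 1 and the energy bound does not
     depend on u or dl. *)
  have hG t : nonneg t -> [/\ 0 <= (t + dl)^-1, (t + dl)^-1 ^+ 2 <= d2B t & `|dB t| <= (t + dl)^-1 * 1].
    move=> t0; have tp : 0 < t + dl by rewrite ltr_wpDl.
    by split; rewrite ?invr_ge0 ?(ltW tp)// ?exprVn// /dB normrN mulr1 ger0_norm// invr_ge0 ltW.
  have mg : measurable_fun setT (fun t : R => (t + dl)^-1).
    by apply: (measurableT_comp (@measurable_invr R)); exact: measurable_funD.
  have L1c : L1 mu (cube a (3 * r)) (fun x => (1 : R) ^+ 2).
    apply: (@L1_bounded _ _ _ _ _ _ 1); [exact: measurable_cube|exact: cube_finite|by []|].
    by move=> x _; rewrite expr1n normr1.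
  have [Le Ee] := caccioppoli lam0 sol rr3 opdB Dc Du hG mg (measurable_cst (1 : R)) L1c rr2 teta eta01 geta.
  pose f x := dB (u x) ^+ 2 * e x.
  have fE x : cube a (2 * r) x -> (eta x * (u x + dl)^-1) ^+ 2 * e x = f x.
    by move=> xQ; rewrite eta1// mul1r /f /dB sqrrN.
  have sub23 : cube a (2 * r) `<=` cube a (3 * r) by exact: cubeS (ltW rr2).
  have Lf2 : L1 mu (cube a (2 * r)) (fun x => (eta x * (u x + dl)^-1) ^+ 2 * e x).
    by apply: (L1S _ _ _ Le) => //; exact: measurable_cube.
  have If : \int[mu]_(x in cube a (2 * r)) ((eta x * (u x + dl)^-1) ^+ 2 * e x) <=
      4 * cutoff_cst / (lam * r) ^+ 2 * (6 * r) ^+ n.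
    apply: (@le_trans _ _ (\int[mu]_(x in cube a (3 * r)) ((eta x * (u x + dl)^-1) ^+ 2 * e x))).
      apply: le_Rintegral_subset_ae => //; first exact: measurable_cube.
      apply: filterS (sol_ell sol) => x ell xQ; apply: mulr_ge0; first exact: sqr_ge0.
      have [_ h _] := ell (cubeS (ltW rr3) xQ); apply: le_trans h.
      by apply: sumr_ge0 => i _; exact: sqr_ge0.
    apply: le_trans Ee _; rewrite (_ : 3 * r - 2 * r = r); last by ring.
    rewrite le_eqVlt; apply/orP; left; apply/eqP; congr (_ * _).
    rewrite expr1n /Rintegral integral_cst ?mul1e/=; last exact: measurable_cube.
    by rewrite /lebn leb_cube//=; [congr (_ ^+ n); ring|rewrite mulr_ge0// ltW].
  have Iq := le_trans P (ler_wpM2l (_ : 0 <= 2 * (2 * (4 * r)) ^+ n)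
    (ler_wpM2l (_ : 0 <= n%:R * (4 * r) ^+ 2) (_ : _ <= 4 * cutoff_cst / (lam * r) ^+ 2 * (6 * r) ^+ n))).
  have {}Iq : (4 * r) ^+ n / 2 * \int[mu]_(x in cube a (2 * r)) H (u x) ^+ 2 <=
     2 * (2 * (4 * r)) ^+ n * (n%:R * (4 * r) ^+ 2 * (4 * cutoff_cst / (lam * r) ^+ 2 * (6 * r) ^+ n)).
    have -> : \int[mu]_(x in cube a (2 * r)) H (u x) ^+ 2 =
        \int[mu]_(x in cube a (2 * r)) (1 * H (u x)) ^+ 2.
      by under [RHS]eq_Rintegral do rewrite mul1r.
    apply: Iq.
    - by rewrite mulr_ge0// exprn_ge0// mulr_ge0// ltW.
    - by rewrite mulr_ge0// sqr_ge0.
    apply: le_trans If; apply: le_Rintegral_ae => //.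
    apply: filterS2 Du (sol_ell sol) => x Dx ell xQ.
    have [_ ge _] := ell (cubeS (ltW r2) xQ); rewrite fE// /f.
    apply: (@le_trans _ _ (dH (u x) ^+ 2 * \sum_i g i x ^+ 2)).
      by rewrite mulr_sumr; apply: ler_sum => i _; rewrite p1 mul0r addr0 mul1r exprMn.
    apply: ler_pM => //; [exact: sqr_ge0|by apply: sumr_ge0 => i _; exact: sqr_ge0|].
    rewrite /dH /dtrunc exprMn ler_piMl ?sqr_ge0// expr_le1//; [exact: dpsi_le1|exact: dpsi_ge0].
  rewrite -(ler_pM2l (_ : 0 < (4 * r) ^+ n / 2)); last by rewrite divr_gt0// exprn_gt0.
  apply: le_trans Iq _; apply: (@le_trans _ _ ((4 * r) ^+ n / 2 * (C2 * r ^+ n))).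
    rewrite le_eqVlt; apply/orP; left; apply/eqP; rewrite /C2 !exprMn.
    move: (r ^+ n) (2 ^+ n) (4 ^+ n) (6 ^+ n) (cutoff_cst) (n%:R : R) => rn tn fn sn cc nn.
    by field; rewrite !gt_eqF.
  apply: ler_wpM2l => //; apply: ler_wpM2r => //; by rewrite exprn_ge0// ltW.
have all : {ae mu, forall x, forall k : nat, cube a r x -> expR (- K) / 2 <= u x + k.+1%:R^-1}.
  by apply/ae_foralln => k; apply: key; rewrite invr_gt0.
apply: filterS all => x h xr; rewrite leNgt; apply/negP => /ltr_add_invr[k].
by rewrite ltNge h.
Qed.
End oscillation_decay.

Section energy_decay.
Variables (R : realType) (n : nat).
Local Notation rV := 'rV[R]_n.
Local Notation mu := (@lebn R n).
Local Notation cutoff_cst := (cutoff_cst R n).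
Implicit Types (a x y : rV) (s r lam sig rho l d b c th m w : R) (f u e : rV -> R) (g V : 'I_n -> rV -> R).

(** The functions (u - m + w)/(2 w) and (m - u + w)/(2 w) are nonnegative solutions with sum 1, so
    one of them is at least 1/2 on half of the cube of radius 2 r. [lower_bound] raises it by c on
    the cube of radius r; moving the centre m by c w shrinks the amplitude to (1 - c) w. *)
Lemma oscillation lam : 0 < lam -> exists kap : R, [/\ 1/2 <= kap, kap < 1 & forall a r u g V e m w,
  local_sol lam a (5 * r) u g V e -> 0 < r -> 0 < w ->
  {ae mu, forall x, cube a (5 * r) x -> `|u x - m| <= w} ->
  exists m', {ae mu, forall x, cube a r x -> `|u x - m'| <= kap * w}].
Proof.
move=> lam0; have [c [c0 c1 lower]] := lower_bound n lam0.
exists (1 - c); split; [by lra|by lra|].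
move=> a r u g V e m w sol r0 w0 hu.
have [mu' _] := sol_L2 sol.
have mQ5 := @measurable_cube R n a (5 * r); have mQ2 := @measurable_cube R n a (2 * r).
have [s25 s15] : cube a (2 * r) `<=` cube a (5 * r) /\ cube a r `<=` cube a (5 * r).
  by split; apply: cubeS; lra.
pose k := (2 * w)^-1.
have k0 : 0 < k by rewrite invr_gt0 mulr_gt0.
have kw : k * (2 * w) = 1 by rewrite mulVf// gt_eqF// mulr_gt0.
pose v1 x := (k * u x + k * (w - m)) * \1_(cube a (5 * r)) x.
pose v2 x := (- k * u x + k * (w + m)) * \1_(cube a (5 * r)) x.
have sol1 := sol_affine k (k * (w - m)) sol (@subset_refl _ _).
have sol2 := sol_affine (- k) (k * (w + m)) sol (@subset_refl _ _).
have v1E x : cube a (5 * r) x -> v1 x = k * (u x - m + w).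
  by move=> xQ; rewrite /v1 indicE mem_set// mulr1; ring.
have v2E x : cube a (5 * r) x -> v2 x = k * (m - u x + w).
  by move=> xQ; rewrite /v2 indicE mem_set// mulr1; ring.
have v10 : {ae mu, forall x, 0 <= v1 x}.
  apply: filterS hu => x hx; have [xQ|xQ] := pselect (cube a (5 * r) x); last first.
    by rewrite /v1 indicE memNset// mulr0.
  rewrite v1E//; apply: mulr_ge0; first exact: ltW.
  by move: (hx xQ); rewrite ler_norml; move: (u x) => *; lra.
have v20 : {ae mu, forall x, 0 <= v2 x}.
  apply: filterS hu => x hx; have [xQ|xQ] := pselect (cube a (5 * r) x); last first.
    by rewrite /v2 indicE memNset// mulr0.
  rewrite v2E//; apply: mulr_ge0; first exact: ltW.
  by move: (hx xQ); rewrite ler_norml; move: (u x) => *; lra.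
have mlev (v : rV -> R) : measurable_fun setT v -> measurable ([set x | 1/2 <= v x]%R `&` cube a (2 * r)).
  move=> mv; apply: measurableI => //.
  rewrite (_ : [set x | _] = setT `&` v @^-1` `[1/2, +oo[); first exact: mv.
  by rewrite setTI; apply/seteqP; split => y; rewrite /= in_itv/= andbT.
have m1 : measurable ([set x | 1/2 <= v1 x]%R `&` cube a (2 * r)).
  by apply: mlev; have [] := sol_L2 sol1.
have m2 : measurable ([set x | 1/2 <= v2 x]%R `&` cube a (2 * r)).
  by apply: mlev; have [] := sol_L2 sol2.
have half : (mu (cube a (2 * r)) <= mu ([set x | 1/2 <= v1 x]%R `&` cube a (2 * r)) +
    mu ([set x | 1/2 <= v2 x]%R `&` cube a (2 * r)))%E.
  apply: le_trans (measureU2 _ m1 m2); apply: le_measure; rewrite ?inE//.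
    exact: measurableU.
  move=> x xQ; have xQ5 := s25 _ xQ.
  have : v1 x + v2 x = 1 by rewrite v1E// v2E// -mulrDr -[RHS]kw; congr (_ * _); ring.
  have [h|h] := leP (1/2) (v1 x); first by left.
  by right; split => //=; lra.
have Q2 : mu (cube a (2 * r)) = ((4 * r) ^+ n)%:E.
  by rewrite /lebn leb_cube ?mulr_ge0 ?(ltW r0)// mulrA -natrM.
have alt : (((4 * r) ^+ n / 2)%:E <= mu ([set x | 1/2 <= v1 x]%R `&` cube a (2 * r)))%E \/
    (((4 * r) ^+ n / 2)%:E <= mu ([set x | 1/2 <= v2 x]%R `&` cube a (2 * r)))%E.
  have [h|h] := leP ((4 * r) ^+ n / 2)%:E (mu ([set x | 1/2 <= v1 x]%R `&` cube a (2 * r))); first by left.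
  right; rewrite leNgt; apply/negP => h2; have := le_lt_trans half (lteD h h2).
  by rewrite Q2 -EFinD -splitr ltxx.
case: alt => [h|h].
  exists (m + c * w); apply: filterS2 (lower _ _ _ _ _ _ sol1 r0 v10 h) hu => x hc hx xQ.
  have xQ5 := s15 _ xQ; have := hc xQ; rewrite -/(v1 x) v1E// => hk.
  have w2 : 0 <= 2 * w by rewrite mulr_ge0// ltW.
  have := ler_wpM2l w2 hk.
  rewrite mulrA [2 * w * k]mulrC kw mul1r.
  by move: (hx xQ5); rewrite !ler_norml; move: (u x) => *; nra.
exists (m - c * w); apply: filterS2 (lower _ _ _ _ _ _ sol2 r0 v20 h) hu => x hc hx xQ.
have xQ5 := s15 _ xQ; have := hc xQ; rewrite -/(v2 x) v2E// => hk.
have w2 : 0 <= 2 * w by rewrite mulr_ge0// ltW.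
  have := ler_wpM2l w2 hk.
rewrite mulrA [2 * w * k]mulrC kw mul1r.
by move: (hx xQ5); rewrite !ler_norml; move: (u x) => *; nra.
Qed.

Lemma id_op : c1_op n setT (fun t : R => t) (fun=> 1) 1.
Proof.
split => //.
- by move=> t _; exact: is_derive_id.
- by move=> t _; exact: cvg_cst.
- by move=> t _; rewrite normr1.
- by move=> t _; rewrite mul1r lerDr.
Qed.

(** The Caccioppoli inequality with G(t) = t for the solution u - m. *)
Lemma osc_energy lam a r u g V e m w : 0 < lam -> local_sol lam a (5 * r) u g V e -> 0 < r -> 0 <= w ->
  {ae mu, forall x, cube a (5 * r) x -> `|u x - m| <= w} ->
  \int[mu]_(x in cube a r) e x <= 4 * cutoff_cst / (lam * r) ^+ 2 * (w ^+ 2 * (4 * r) ^+ n).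
Proof.
move=> lam0 sol r0 w0 hu.
have [[r2 r25] r1] : (r < 2 * r /\ 2 * r < 5 * r) /\ 0 <= r by split; [split|]; lra.
have mQ2 := @measurable_cube R n a (2 * r).
have s25 : cube a (2 * r) `<=` cube a (5 * r) by exact: cubeS (ltW r25).
have solm := sol_affine 1 (- m) sol (@subset_refl _ _).
have Du : {ae mu, forall x, setT ((1 * u x - m) * \1_(cube a (5 * r)) x)} by exact: aeW.
have [eta [teta eta01 eta1 geta]] := @cutoffP R n a r (2 * r) r1 r2.
have hG (t : R) : setT t -> [/\ 0 <= (1 : R), (1 : R) ^+ 2 <= 1 & `|t| <= 1 * `|t|].
  by move=> _; rewrite expr1n mul1r.
have mn : measurable_fun setT (fun t : R => `|t|) by exact: normr_measurable.
set v := fun x => (1 * u x - m) * \1_(cube a (5 * r)) x in solm Du.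
have Lv : L1 mu (cube a (2 * r)) (fun x => `|v x| ^+ 2).
  have [_ Lv] := sol_L2 solm; apply: (L1S measurableT) => //.
  by under eq_fun do rewrite real_normK ?num_real//.
have [Le Ee] := caccioppoli lam0 solm r25 id_op (fun _ _ _ => I) Du hG (measurable_cst _) mn Lv r2 teta eta01 geta.
have sub : cube a r `<=` cube a (2 * r) by exact: cubeS (ltW r2).
apply: (@le_trans _ _ (\int[mu]_(x in cube a (2 * r)) ((eta x * 1) ^+ 2 * (1 ^+ 2 * e x)))).
  rewrite (_ : \int[mu]_(x in cube a r) e x = \int[mu]_(x in cube a r) ((eta x * 1) ^+ 2 * (1 ^+ 2 * e x))).
    apply: le_Rintegral_subset_ae => //; first exact: measurable_cube.
    apply: filterS (sol_ell sol) => x ell /s25/ell [_ h _]; apply: mulr_ge0; first exact: sqr_ge0.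
    rewrite expr1n mul1r; apply: le_trans h; apply: sumr_ge0 => i _; exact: sqr_ge0.
  by apply: eq_Rintegral => x; rewrite inE => /eta1 ->; rewrite mulr1 !expr1n !mul1r.
apply: le_trans Ee _; rewrite (_ : 2 * r - r = r); last by ring.
apply: ler_wpM2l.
  by apply: mulr_ge0; [rewrite mulr_ge0// cutoff_cst_ge0|rewrite invr_ge0 sqr_ge0].
have -> : w ^+ 2 * (4 * r) ^+ n = \int[mu]_(x in cube a (2 * r)) w ^+ 2.
  rewrite /Rintegral integral_cst//= /lebn leb_cube ?mulr_ge0//=.
  by rewrite mulrA -natrM.
apply: le_Rintegral_ae => //.
  apply: (@L1_bounded _ _ _ _ _ _ (w ^+ 2)) => //; first exact: cube_finite.
  by move=> x _; rewrite ger0_norm ?sqr_ge0.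
apply: filterS hu => x hu /s25 xQ; rewrite /v indicE mem_set// mulr1 mul1r.
by apply: le_sqr => //; exact: hu.
Qed.

(* The decay exponent is encoded by kap: scaling by 1/5 multiplies the oscillation by kap. *)
Lemma energy_decay lam : 0 < lam -> exists kap C : R, [/\ 1/2 <= kap, kap < 1, 0 <= C &
  forall a s r x u g V e M, local_sol lam a s u g V e -> 0 < r -> cube x (5 * r) `<=` cube a s ->
  0 < M -> {ae mu, forall y, cube x (5 * r) y -> `|u y| <= M} -> forall j : nat,
  (r / 5 ^+ j) ^+ 2 * \int[mu]_(y in cube x (r / 5 ^+ j)) e y <= C * M ^+ 2 * kap ^+ j ^+ 2 * (r / 5 ^+ j) ^+ n].
Proof.
move=> lam0; have [kap [k12 k1 osc]] := oscillation lam0.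
exists kap, (4 * cutoff_cst / lam ^+ 2 * 4 ^+ n).
have kap0 : 0 < kap by lra.
split => //.
  apply: mulr_ge0; last exact: exprn_ge0.
  by apply: mulr_ge0; [rewrite mulr_ge0// cutoff_cst_ge0|rewrite invr_ge0 sqr_ge0].
move=> a s r x u g V e M sol r0 sub M0 hM.
pose rr j := r / 5 ^+ j.
have rr0 j : 0 < rr j by rewrite divr_gt0// exprn_gt0.
have rrS j : 5 * rr j.+1 = rr j.
  rewrite /rr exprS; have : 5 ^+ j != 0 :> R by rewrite gt_eqF// exprn_gt0.
  by move: (5 ^+ j) => z z0; field.
have rr1 j : rr j <= r by rewrite ler_pdivrMr ?exprn_gt0// ler_peMr ?(ltW r0)// exprn_ege1// ler1n.
have subj j : cube x (5 * rr j) `<=` cube a s.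
  by apply: subset_trans sub; apply: cubeS; rewrite ler_wpM2l.
have solj j := sol_affine 1 0 sol (subj j).
have restr j y : cube x (5 * rr j) y -> (1 * u y + 0) * \1_(cube x (5 * rr j)) y = u y.
  by move=> yQ; rewrite indicE mem_set// mul1r addr0 mulr1.
(* The cube of radius 5 rr(j+1) has radius rr(j): the conclusion of [oscillation] at step j is its
   hypothesis at step j+1. *)
have oscj j : exists m, {ae mu, forall y, cube x (5 * rr j) y -> `|u y - m| <= kap ^+ j * M}.
  elim: j => [|j [m IH]].
    exists 0; apply: filterS hM => y hy yQ; rewrite subr0 expr0 mul1r; apply: hy.
    by move: yQ; rewrite /rr expr0 divr1.
  have w0 : 0 < kap ^+ j * M by rewrite mulr_gt0// exprn_gt0.
  have hj : {ae mu, forall y, cube x (5 * rr j) y -> `|(1 * u y + 0) * \1_(cube x (5 * rr j)) y - m| <= kap ^+ j * M}.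
    by apply: filterS IH => y hy yQ; rewrite restr//; exact: hy.
  have [m' hm'] := osc _ _ _ _ _ _ _ _ (solj j) (rr0 j) w0 hj.
  exists m'; apply: filterS hm' => y hy; rewrite rrS => yQ.
  rewrite exprS -mulrA -(restr j y); first exact: hy.
  by move: yQ; apply: cubeS; have := rr0 j; lra.
move=> j; rewrite -/(rr j); have [m hm] := oscj j.
have w0 : 0 <= kap ^+ j * M by rewrite mulr_ge0 ?exprn_ge0 ?ltW.
have hj : {ae mu, forall y, cube x (5 * rr j) y -> `|(1 * u y + 0) * \1_(cube x (5 * rr j)) y - m| <= kap ^+ j * M}.
  by apply: filterS hm => y hy yQ; rewrite restr//; exact: hy.
have := osc_energy lam0 (solj j) (rr0 j) w0 hj.
under eq_Rintegral do rewrite expr1n mul1r.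
move=> h; have := ler_wpM2l (sqr_ge0 (rr j)) h.
move=> /le_trans; apply; rewrite le_eqVlt; apply/orP; left; apply/eqP.
rewrite [(4 * _) ^+ n]exprMn; have := rr0 j; move: (rr j) (rr j ^+ n) (4 ^+ n : R) (kap ^+ j) cutoff_cst => z zn fn kj cc z0.
by field; rewrite !gt_eqF.
Qed.
End energy_decay.

(** * Morrey estimates for mollifications *)

Section kernel_derivative.
Variables (R : realType) (n : nat).
Local Notation rV := 'rV[R]_n.
Local Notation mu := (@lebn R n).
Local Notation kr := (@ker R n).
Local Notation kmass := (kmass R n).
Implicit Types (f : rV -> R) (x y v z w : rV) (r k q : R).

(* grad theta = - z ker and d/dr ker = lap theta / r. *)
Definition theta r z : R := (kmass * r ^+ n)^-1 * (r ^+ 2 / 2) * psi (1 - sqn z / r ^+ 2).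

Definition lap_theta r z : R := \sum_i partial i (partial i (theta r)) z.

Lemma theta_smooth r : smooth (theta r).
Proof.
apply: smooth_exprP; apply: (@SmoothMul _ _ (fun=> _)); first exact: SmoothCst.
have sarg : smooth_expr (fun z : rV => 1 - sqn z / r ^+ 2).
  rewrite (_ : (fun z => _) = fun z : rV => 1 + - (r ^+ 2)^-1 * sqn z); last first.
    by apply/funext => z; rewrite mulNr mulrC.
  apply: SmoothAdd; first exact: SmoothCst.
  apply: (@SmoothMul _ _ (fun=> _)); first exact: SmoothCst.
  apply: smooth_expr_sum => i; rewrite (_ : (fun x => _) = fun x : rV => x 0 i * x 0 i).
    by apply: SmoothMul; exact: SmoothCoord.
  by apply/funext => x; rewrite expr2.
by apply: SmoothMul => //; exact: (SmoothFlat 1 sarg).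
Qed.

Lemma theta_neq0 r z : 0 < r -> theta r z != 0 -> sqn z < r ^+ 2.
Proof.
move=> r0; apply: contraNT; rewrite -leNgt => h; rewrite /theta psi_le0 ?mulr0//.
by rewrite subr_le0 ler_pdivlMr ?exprn_gt0// mul1r.
Qed.

Lemma sqn_cube r z : 0 < r -> sqn z < r ^+ 2 -> cube 0 r z.
Proof.
move=> r0 h i; rewrite mxE sub0r add0r -ler_norml -(ler_sqr) ?nnegrE ?(ltW r0)//.
by rewrite real_normK ?num_real// (le_trans (coord_sqn z i))// ltW.
Qed.

Lemma theta_test r : 0 < r -> test_function (cube 0 r) (theta r).
Proof.
move=> r0; apply: test_cube; first exact: theta_smooth.
by move=> x /(theta_neq0 r0)/(sqn_cube r0).
Qed.

Lemma theta_partial r i z : 0 < r -> partial i (theta r) z = - (z 0 i * kr r z).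
Proof.
move=> r0; have [ds ps] := partial_sqn z i.
pose g (t : R) := (kmass * r ^+ n)^-1 * (r ^+ 2 / 2) * psi (1 - t / r ^+ 2).
have dg : is_derive (sqn z) 1 g ((kmass * r ^+ n)^-1 * (r ^+ 2 / 2) *
    (- (r ^+ 2)^-1 * dpsi (1 - sqn z / r ^+ 2))).
  have da : is_derive (sqn z) 1 (fun t : R => 1 - t / r ^+ 2) (- (r ^+ 2)^-1).
    have := is_deriveD (is_derive_cst (1 : R) (sqn z) 1) (is_deriveZ (- (r ^+ 2)^-1) (is_derive_id (sqn z) (1 : R))).
    rewrite (_ : _ + _ = fun t => 1 - t / r ^+ 2) => [/is_derive_eq|].
      by apply; rewrite add0r /GRing.scale/= mulr1.
    by apply/funext => t; rewrite !fctE; congr (_ + _); rewrite mulrC -mulNr.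
  have := is_deriveZ ((kmass * r ^+ n)^-1 * (r ^+ 2 / 2))
    (@is_derive1_comp _ (@psi R) (fun t => 1 - t / r ^+ 2) (sqn z) _ _ (is_derive_psi _) da).
  by move=> /is_derive_eq; apply; rewrite /GRing.scale/=; congr (_ * _); rewrite mulrC.
have [_ E] := derive_comp1 (basis_vec R i) dg ds.
have -> : partial i (theta r) z = 'D_(basis_vec R i) (g \o @sqn R n) z by [].
rewrite E; move: ps; rewrite /partial => ->; rewrite /dpsi /ker /bump.
move: (flat _ _) (kmass * r ^+ n)^-1 => p N; field; by rewrite gt_eqF.
Qed.

Lemma lap_thetaE r z : 0 < r -> lap_theta r z = - (n%:R * kr r z) +
  (kmass * r ^+ n)^-1 * (2 * sqn z / r ^+ 2) * bump (dflat (@pker R)) r z.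
Proof.
move=> r0; rewrite /lap_theta (eq_bigr (fun i => - kr r z + (kmass * r ^+ n)^-1 *
    (2 / r ^+ 2) * bump (dflat (@pker R)) r z * z 0 i ^+ 2)).
  rewrite big_split/= sumr_const card_ord -mulr_sumr -/(sqn z) mulNrn mulr_natl.
  by congr (_ + _); ring.
move=> i _; have sk : smooth (kr r) by case: (@ker_test R n r r0).
have -> : partial i (theta r) = fun z => - (z 0 i * kr r z).
  by apply/funext => y; exact: theta_partial.
have sc : smooth (fun z : rV => z 0 i) by apply: smooth_exprP; exact: SmoothCoord.
have dc : 'D_(basis_vec R i) (fun z : rV => z 0 i) z = 1.
  have [|_ h] := @taylor_differentiable R n (fun z => z 0 i) z (fun j => (j == i)%:R) 0 (lexx 0).
    move=> v; rewrite (bigD1 i)//= big1 => [|j /negbTE ->]; last by rewrite mulr0.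
    by rewrite eqxx mulr1 addr0 !mxE (_ : _ - _ = 0) ?normr0 ?mul0r//; ring.
  by have := h i; rewrite eqxx.
rewrite /partial deriveN; last first.
  apply/derivableM; exact/diff_derivable/smooth_differentiable.
rewrite deriveM; [|exact/diff_derivable/smooth_differentiable|exact/diff_derivable/smooth_differentiable].
rewrite dc; have := @ker_partial R n r i z r0; rewrite /partial => ->.
rewrite /GRing.scale/= mulr1; move: (bump _ _ _) (ker _ _) (kmass * _)^-1 => b kk N.
by field; rewrite gt_eqF.
Qed.

Lemma bump_bounded p : exists c, 0 <= c /\ forall r z, `|bump p r z| <= c :> R.
Proof. by have [c [c0 hc]] := flat_bounded p; exists c; split => // r z; exact: hc. Qed.

Lemma lap_theta_bound : exists c : R, 0 <= c /\ forall r z, 0 < r -> `|lap_theta r z| <= c / r ^+ n.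
Proof.
have [c1 [c10 h1]] := bump_bounded (@pker R).
have [c2 [c20 h2]] := bump_bounded (dflat (@pker R)).
have k0 := @kmass_gt0 R n.
exists ((n%:R * c1 + 2 * c2) / kmass); split; first by rewrite divr_ge0 ?(ltW k0)// addr_ge0// mulr_ge0.
move=> r z r0; rewrite lap_thetaE//; have rn : 0 < r ^+ n by rewrite exprn_gt0.
have N0 := @kerN_ge0 R n r r0.
have -> : (n%:R * c1 + 2 * c2) / kmass / r ^+ n = (kmass * r ^+ n)^-1 * (n%:R * c1 + 2 * c2).
  by move: rn k0; move: (r ^+ n) => rn rn0 k0; field; rewrite !gt_eqF.
rewrite /ker (_ : _ + _ = (kmass * r ^+ n)^-1 * (- (n%:R * bump (@pker R) r z) +
    2 * (sqn z / r ^+ 2 * bump (dflat (@pker R)) r z))); last first.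
  by move: (bump _ _ _) (bump _ _ _) (_^-1) => *; ring.
rewrite normrM (ger0_norm (ltW N0)) ler_wpM2l ?(ltW N0)//.
apply: le_trans (ler_normD _ _) _; rewrite normrN lerD//.
  by rewrite normrM ger0_norm// ler_wpM2l.
rewrite normrM ger0_norm// ler_wpM2l// normrM.
have [->|/(bump_neq0 r0) h] := eqVneq (bump (dflat (@pker R)) r z) 0; first by rewrite normr0 mulr0.
rewrite -[leRHS]mul1r; apply: ler_pM => //.
rewrite ger0_norm; first by rewrite ler_pdivrMr ?exprn_gt0// mul1r ltW.
by rewrite divr_ge0 ?sqn_ge0// sqr_ge0.
Qed.

Lemma is_derive_powV k r m : k != 0 -> r != 0 ->
  is_derive r 1 (fun r : R => (k * r ^+ m)^-1) (- (m%:R / r) * (k * r ^+ m)^-1).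
Proof.
move=> k0 r0.
have dp : is_derive r 1 (fun r : R => k * r ^+ m) (m%:R / r * (k * r ^+ m)).
  elim: m => [|m IH].
    have := is_derive_cst k r (1 : R); rewrite (_ : cst k = fun r : R => k * r ^+ 0); last first.
      by apply/funext => t; rewrite expr0 mulr1.
    by move=> /is_derive_eq; apply; rewrite mul0r mul0r.
  have := is_deriveM (is_derive_id r 1) IH.
  rewrite (_ : _ * _ = fun r : R => k * r ^+ m.+1) => [/is_derive_eq|]; last first.
    by apply/funext => t; rewrite fctE /= exprS mulrCA.
  apply; rewrite /GRing.scale/= exprS -natr1; move: (r ^+ m) (m%:R) => p q.
  by field.
have nz : k * r ^+ m != 0 by rewrite mulf_neq0// expf_neq0.
have := @is_deriveV R (fun r => k * r ^+ m) r _ _ nz dp.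
move=> /is_derive_eq; apply; rewrite /GRing.scale/=; move: nz; move: (k * _) => p p0.
by field; rewrite p0.
Qed.

(** By homogeneity r d/dr ker = - n ker - z . grad ker = - div (z ker), and z ker is minus the
    gradient of [theta]. *)
Lemma is_derive_ker r z : 0 < r -> is_derive r 1 (fun r => kr r z) (r^-1 * lap_theta r z).
Proof.
move=> r0; have rn0 : r != 0 by rewrite gt_eqF.
have k0 : kmass != 0 by rewrite gt_eqF// kmass_gt0.
have dN := is_derive_powV n k0 rn0.
have da : is_derive r 1 (fun r : R => 1 - sqn z / r ^+ 2) (2 * sqn z / r ^+ 3).
  have := is_deriveD (is_derive_cst (1 : R) r 1) (is_deriveZ (- sqn z) (is_derive_powV 2 (oner_neq0 R) rn0)).
  rewrite (_ : _ + _ = fun r : R => 1 - sqn z / r ^+ 2) => [/is_derive_eq|].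
    by apply; rewrite add0r /GRing.scale/= mul1r; field.
  by apply/funext => t; rewrite !fctE -mulNr -[X in _ / X]mul1r.
have := is_deriveM dN (@is_derive1_comp _ _ (fun r : R => 1 - sqn z / r ^+ 2) r _ _ (is_derive_flat (@pker R) _) da).
move=> /is_derive_eq; apply; rewrite lap_thetaE// /GRing.scale/= /ker /bump.
move: (flat _ _) (flat _ _) (_^-1 : R) => p q N.
by field.
Qed.

Lemma ker_scale r z : 0 < r -> kr r z = r ^- n * kr 1 (r^-1 *: z).
Proof.
move=> r0; rewrite /ker bump_scale// add0r expr1n mulr1 invfM mulrA; congr (_ * _).
by rewrite mulrC.
Qed.

Lemma xker_lipschitz : exists L : R, 0 <= L /\ forall i r w v, 0 < r ->
  `|w 0 i * kr r w - v 0 i * kr r v| <= L / r ^+ n * `|w - v| /\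
  `|w 0 i * kr r w| <= L * r / r ^+ n.
Proof.
pose X (i : 'I_n) w := kr 1 w * w 0 i.
have tX i : test_function (cube 0 1) (X i).
  apply: test_mul; last exact: ker_test.
  by apply: smooth_exprP; exact: SmoothCoord.
pose c i := sval (cid (test_lipschitz (tX i))).
pose d i := sval (cid (test_bounded (tX i))).
have c0 i : 0 <= c i by rewrite /c; case: cid => ? [].
have d0 i : 0 <= d i by rewrite /d; case: cid => ? [].
pose L := \sum_i (c i + d i).
have cL i : c i <= L.
  rewrite /L (bigD1 i)//= -addrA lerDl addr_ge0// sumr_ge0// => j _; exact: addr_ge0.
have dL i : d i <= L.
  rewrite /L (bigD1 i)//= addrAC lerDr addr_ge0// sumr_ge0// => j _; exact: addr_ge0.
exists L; split; first by apply: sumr_ge0 => i _; exact: addr_ge0.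
move=> i r w v r0; have rn : 0 < r ^+ n by rewrite exprn_gt0.
have E z : z 0 i * kr r z = r / r ^+ n * X i (r^-1 *: z).
  rewrite ker_scale// /X mxE; move: (kr _ _) (z 0 i) => p q; by field; rewrite !gt_eqF.
have rr0 : 0 <= r / r ^+ n by rewrite divr_ge0 ?ltW.
rewrite !E; split.
  rewrite -mulrBr normrM (ger0_norm rr0).
  have -> : r^-1 *: w = r^-1 *: v + r^-1 *: (w - v) by rewrite -scalerDr addrC subrK.
  have h : `|X i (r^-1 *: v + r^-1 *: (w - v)) - X i (r^-1 *: v)| <= c i * `|r^-1 *: (w - v)|.
    by rewrite /c; case: cid => ? [? ]; exact.
  apply: le_trans (ler_wpM2l rr0 h) _.
  rewrite normrZ (gtr0_norm (_ : 0 < r^-1)) ?invr_gt0//.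
  rewrite [leLHS](_ : _ = c i / r ^+ n * `|w - v|); last first.
    by move: rn; move: (r ^+ n) => p p0; field; rewrite !gt_eqF.
  by rewrite !ler_wpM2r ?invr_ge0 ?(ltW rn).
rewrite normrM (ger0_norm rr0) -[leRHS]mulrA mulrC.
have h : `|X i (r^-1 *: w)| <= d i by rewrite /d; case: cid => ? [? ]; exact.
by rewrite ler_wpM2r// (le_trans h).
Qed.

Lemma lap_theta_L1 f x r : L1 mu setT f -> 0 < r ->
  L1 mu setT (fun y => f y * lap_theta r (x - y)).
Proof.
move=> Lf r0; rewrite /lap_theta; under eq_fun do rewrite mulr_sumr.
apply: L1_sum => // i _; apply: conv_integrable Lf _.
exact: (test_partial i (test_partial i (theta_test r0))).
Qed.

(** Differentiation under the integral on ]r/2, 2 r[, where [lap_theta_bound] gives a majorant that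
    is a multiple of |f|. *)
Lemma is_derive_conv f x r : L1 mu setT f -> 0 < r ->
  is_derive r 1 (fun r : R => conv f (kr r) x) (r^-1 * conv f (lap_theta r) x).
Proof.
move=> Lf r0; have [c [c0 hc]] := lap_theta_bound.
pose k := (r / 2)^-1 * (c / (r / 2) ^+ n).
have h0 : 0 < r / 2 by rewrite divr_gt0.
have k0 : 0 <= k by rewrite mulr_ge0 ?divr_ge0 ?exprn_ge0 ?invr_ge0 ?(ltW h0).
pose g (q : R) y := f y * kr q (x - y).
have Ir : `]r / 2, 2 * r[%classic r by rewrite /= in_itv/=; apply/andP; split; lra.
have pos q : `]r / 2, 2 * r[%classic q -> 0 < q by rewrite /= in_itv/= => /andP[/(lt_trans h0)].
have dg q y : `]r / 2, 2 * r[%classic q -> is_derive q 1 (g ^~ y) (f y * (q^-1 * lap_theta q (x - y))).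
  by move=> /pos q0; exact: (is_deriveZ (f y) (is_derive_ker (x - y) q0)).
have Lg q : `]r / 2, 2 * r[%classic q -> mu.-integrable setT (EFin \o g q).
  by move=> /pos q0; exact: conv_integrable Lf (@ker_test R n q q0).
have der q y : `]r / 2, 2 * r[%classic q -> setT y -> derivable (g ^~ y) q 1.
  by move=> /(dg q y) [].
have G0 y : 0 <= `|f y| * k by rewrite mulr_ge0.
have LG : mu.-integrable setT (EFin \o (fun y => `|f y| * k)).
  by apply: L1Zr => //; exact: integrable_norm Lf.
have bound q y : `]r / 2, 2 * r[%classic q -> setT y -> `|partial1of2 g q y| <= `|f y| * k.
  move=> Iq _; have q0 := pos _ Iq; have [_ E] := dg q y Iq.
  rewrite partial1of2E E normrM ler_wpM2l// normrM ger0_norm ?invr_ge0 ?(ltW q0)//.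
  have qr : r / 2 <= q by move: Iq; rewrite /= in_itv/= => /andP[/ltW].
  apply: ler_pM => //; [by rewrite invr_ge0 ltW|by rewrite lef_pV2|].
  apply: le_trans (hc q (x - y) q0) _; rewrite ler_wpM2l// lef_pV2 ?posrE ?exprn_gt0//.
  by apply: lerXn2r => //; rewrite nnegrE ltW.
split; first exact: (derivable_under_integral measurableT Ir Lg der G0 LG bound).
have := differentiation_under_integral measurableT Ir Lg der G0 LG bound.
rewrite derive1E => ->.
rewrite /conv -RintegralZl//; last exact: lap_theta_L1.
apply: eq_Rintegral => y _; rewrite partial1of2E; have [_ ->] := dg r y Ir.
by rewrite mulrCA.
Qed.
End kernel_derivative.

Section morrey.
Variables (R : realType) (n : nat).
Local Notation rV := 'rV[R]_n.
Local Notation mu := (@lebn R n).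
Local Notation kr := (@ker R n).
Implicit Types (f : rV -> R) (x y z w : rV) (r s t : R).

Lemma mean_value_bound (h dh : R -> R) (u v b : R) : u <= v ->
  (forall t, u <= t <= v -> is_derive t 1 h (dh t) /\ `|dh t| <= b) ->
  `|h v - h u| <= b * (v - u).
Proof.
move=> uv H.
have uu : u \in `[u, v] by rewrite in_itv/= lexx.
have [||t tI ->] := @MVT_segment R h dh u v uv.
- by move=> t; rewrite in_itv/= => /andP[/ltW a1 /ltW a2]; have [] := H t (introT andP (conj a1 a2)).
- apply: derivable_within_continuous => t; rewrite in_itv/= => tI.
  by have [[]] := H t tI.
rewrite normrM (ger0_norm (_ : 0 <= v - u)) ?subr_ge0// ler_wpM2r ?subr_ge0//.
by have [] := H t; first by move: tI; rewrite in_itv.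
Qed.

Variables (f : rV -> R) (p : 'I_n -> rV -> R) (a : rV) (s : R).
Hypothesis Lf : L1 mu setT f.
Hypothesis Lp : forall i, L1 mu setT (p i).
Hypothesis weak : forall phi, test_function (cube a s) phi ->
  \int[mu]_x (f x * \sum_i partial i (partial i phi) x) =
  - \int[mu]_x (\sum_i partial i phi x * p i x).

(** The equation Lap f = div p tested with theta(x - y). One derivative stays on [theta], whose
    gradient is - z ker, so only integrals of p against z ker remain. *)
Lemma conv_lap r x : 0 < r -> cube x r `<=` cube a s ->
  conv f (lap_theta r) x = - \int[mu]_y (\sum_i (x - y) 0 i * kr r (x - y) * p i y).
Proof.
move=> r0 sub; have tt := theta_test n r0.
have tx := test_subset sub (test_reflect x tt).
have st : smooth (@theta R n r) by case: tt.
pose phi y := theta r (x - y).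
have E i : partial i phi = fun y => - partial i (theta r) (x - y) by exact: reflect_partial.
have E2 i y : partial i (partial i phi) y = partial i (partial i (theta r)) (x - y).
  have sp : smooth (partial i (theta r)) by exact: smooth_partial.
  have srx : smooth (fun y => partial i (theta r) (x - y)) by exact: reflect_smooth.
  rewrite E {1}/partial deriveN; last exact/diff_derivable/smooth_differentiable.
  have := congr1 (fun F => F y) (reflect_partial x i sp); rewrite {1}/partial => ->.
  by rewrite opprK.
have -> : conv f (lap_theta r) x = \int[mu]_y (f y * \sum_i partial i (partial i phi) y).
  have Ey y : lap_theta r (x - y) = \sum_i partial i (partial i phi) y.
    by apply: eq_bigr => i _; exact: esym (E2 i y).
  rewrite /conv.
  apply: eq_Rintegral => y _.
  exact: (congr1 (fun t => f y * t) (Ey y)).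
rewrite (weak tx).
congr (- _).
apply: eq_Rintegral => y _.
apply: eq_bigr => i _.
congr (_ * _).
rewrite -[LHS]/(partial i phi y) E.
by rewrite theta_partial// opprK.
Qed.

Variables (r0 A kap : R) (X : set rV).
Hypotheses (r00 : 0 < r0) (A0 : 0 <= A) (kap12 : 1/2 <= kap).
Local Notation rr j := (r0 / 5 ^+ j).
Hypothesis sub : forall x, X x -> cube x r0 `<=` cube a s.
Hypothesis decay : forall x i (j : nat), X x ->
  rr j * \int[mu]_(y in cube x (rr j)) `|p i y| <= A * kap ^+ j * rr j ^+ n.

Let rr0 j : 0 < rr j. Proof. by rewrite divr_gt0// exprn_gt0. Qed.
Let rrS j : 5 * rr j.+1 = rr j.
Proof.
rewrite exprS; have : 5 ^+ j != 0 :> R by rewrite gt_eqF// exprn_gt0.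
by move: (5 ^+ j) => z z0; field.
Qed.
Let rr_le j : rr j <= r0.
Proof. by rewrite ler_pdivrMr ?exprn_gt0// ler_peMr ?(ltW r00)// exprn_ege1// ler1n. Qed.
Let subj x r j : X x -> r <= rr j -> cube x r `<=` cube a s.
Proof. by move=> Xx rj; apply: subset_trans (sub Xx); apply: cubeS; exact: le_trans (rr_le j). Qed.

Let Lpa i D : measurable D -> L1 mu D (fun y => `|p i y|).
Proof. by move=> mD; apply: (L1S measurableT) => //; exact: integrable_norm (Lp i). Qed.

Let Lpi i D : measurable D -> L1 mu setT (fun y => `|p i y| * \1_D y).
Proof. by move=> mD; apply/(L1_restrict mu (fun y => `|p i y|) mD); exact: Lpa. Qed.

(** The two cubes serve for the difference of kernels centred at x and y; a single kernel is the
    case y = x. *)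
Let kernel_bound (k : 'I_n -> rV -> R) x y r j (b : R) : X x -> X y -> 0 <= b ->
  0 < r -> r <= rr j -> (forall i, measurable_fun setT (k i)) ->
  (forall i z, `|k i z| <= b * (\1_(cube x r) z + \1_(cube y r) z)) ->
  rr j * `|\int[mu]_z (\sum_i k i z * p i z)| <= n%:R * b * (2 * A) * kap ^+ j * rr j ^+ n.
Proof.
move=> Xx Xy b0 rp rj mk hk.
have mc z := @measurable_cube R n z r.
pose q i z := b * (`|p i z| * \1_(cube x r) z + `|p i z| * \1_(cube y r) z).
have Lq i : L1 mu setT (q i) by apply: L1Z => //; apply: L1D => //; exact: Lpi.
have kq i z : `|k i z * p i z| <= q i z.
  rewrite normrM; apply: le_trans (ler_wpM2r (normr_ge0 _) (hk i z)) _.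
  by rewrite /q -mulrDr mulrAC -mulrA [`|_| * _]mulrC mulrA.
have Lk i : L1 mu setT (fun z => k i z * p i z).
  apply: (@L1_dom _ _ _ _ _ _ (q i)) => //.
  by apply: measurable_funM => //; exact: (L1_measurable (Lp i)).
have intq i : rr j * \int[mu]_z q i z <= b * (2 * A) * kap ^+ j * rr j ^+ n.
  rewrite /q RintegralZl//; last by apply: L1D => //; exact: Lpi.
  rewrite RintegralD//; [|exact: Lpi|exact: Lpi].
  rewrite -(@Rintegral_setT _ _ _ mu _ (fun z => `|p i z|) (mc x)).
  rewrite -(@Rintegral_setT _ _ _ mu _ (fun z => `|p i z|) (mc y)).
  have le1 z : X z -> rr j * \int[mu]_(y in cube z r) `|p i y| <= A * kap ^+ j * rr j ^+ n.
    move=> Xz; apply: le_trans (decay i j Xz); rewrite ler_wpM2l ?(ltW (rr0 j))//.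
    apply: le_Rintegral_subset => //; [exact: measurable_cube|exact: cubeS|].
    by apply: Lpa; exact: measurable_cube.
  have := ler_wpM2l b0 (lerD (le1 x Xx) (le1 y Xy)).
  rewrite -mulrDr mulrCA => /le_trans; apply.
  by rewrite le_eqVlt; apply/orP; left; apply/eqP; ring.
apply: (@le_trans _ _ (rr j * \sum_i \int[mu]_z q i z)).
  rewrite ler_wpM2l ?(ltW (rr0 j))// Rintegral_sum//.
  apply: le_trans (ler_norm_sum _ _ _) _; apply: ler_sum => i _.
  apply: le_trans (le_normr_Rintegral measurableT (Lk i)) _.
  apply: le_Rintegral; [exact: measurableT|exact: integrable_norm (Lk i)|exact: Lq|].
  by move=> z _; exact: kq.
rewrite mulr_sumr; apply: le_trans (ler_sum _ (fun i _ => intq i)) _.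
by rewrite sumr_const card_ord -[leLHS]mulr_natl !mulrA.
Qed.

Let pow_le r j : rr j.+1 <= r -> rr j ^+ n <= 5 ^+ n * r ^+ n.
Proof.
move=> rj; rewrite -exprMn; apply: lerXn2r; rewrite ?nnegrE ?(ltW (rr0 j))//.
  by rewrite mulr_ge0// (le_trans _ rj)// ltW// (rr0 j.+1).
by rewrite -rrS ler_wpM2l.
Qed.

(** The radial derivative of the mollification is O(kap^j / rr j) on [rr(j+1), rr j], and its
    difference between x and y is O(|x - y| kap^j / (rr j)^2). Integration over the interval gains a
    factor rr j in each. *)
Lemma morrey_cauchy : exists B : R, 0 <= B /\
  (forall x j, X x -> `|conv f (kr (rr j.+1)) x - conv f (kr (rr j)) x| <= B * kap ^+ j) /\
  (forall x y j, X x -> X y ->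
     `|conv f (kr (rr j)) x - conv f (kr (rr j)) y| <= B * `|x - y| * (5 * kap) ^+ j).
Proof.
have [L [L0 hL]] := @xker_lipschitz R n.
have kap0 : 0 < kap by move: kap12; lra.
have kj j : 0 <= kap ^+ j by apply: exprn_ge0; exact: ltW.
pose B1 := n%:R * L * (2 * A) * 5 ^+ n.
have B10 : 0 <= B1 by rewrite /B1; repeat apply: mulr_ge0 => //; exact: exprn_ge0.
have mk x i r : measurable_fun setT (fun z : rV => (x - z) 0 i * kr r (x - z)).
  have m0 : measurable_fun setT (fun z : rV => z 0 i * kr r z).
    apply: measurable_funM; first exact: measurable_coord.
    apply: measurable_funM => //; apply: smooth_measurable; exact: bump_smooth.
  exact: (measurableT_comp m0 (@measurable_reflect R n x)).
have k0 x i r z : 0 < r -> ~ cube x r z -> (x - z) 0 i * kr r (x - z) = 0.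
  move=> rp nz; rewrite (_ : kr r (x - z) = 0) ?mulr0//; apply/eqP/negPn/negP => /(ker_supp rp) h.
  by apply: nz; apply/(@cube_norm R n x r z (ltW rp)); rewrite distrC.
have ind (D : set rV) z : 0 <= (\1_D z : R) by rewrite indicE.
have rpos r j : rr j.+1 <= r -> 0 < r by exact: lt_le_trans (rr0 j.+1).
have L_ x : X x -> forall r i, 0 < r -> cube x r `<=` cube a s ->
    L1 mu setT (fun y => (x - y) 0 i * kr r (x - y) * p i y).
  move=> Xx r i rp _; apply: (@L1_dom _ _ _ _ _ _ (fun y => L * r / r ^+ n * `|p i y|)) => //.
  - by apply: measurable_funM; [exact: mk|exact: (L1_measurable (Lp i))].
  - by move=> y _; rewrite normrM ler_wpM2r//; have [_] := hL i r (x - y) 0 rp.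
  - by apply: L1Z => //; exact: integrable_norm (Lp i).
(* Uses the size L r / r^n of z ker; the factor 5^n accounts for r >= rr(j+1). *)
have step1 x j r : X x -> rr j.+1 <= r -> r <= rr j -> rr j * `|r^-1 * conv f (lap_theta r) x| <= B1 * kap ^+ j.
  move=> Xx r1 r2; have rp := rpos _ _ r1; have rn : 0 < r ^+ n by rewrite exprn_gt0.
  have b0 : 0 <= L * r / r ^+ n by rewrite divr_ge0 ?mulr_ge0 ?(ltW rp) ?(ltW rn).
  have hk i z : `|(x - z) 0 i * kr r (x - z)| <= L * r / r ^+ n * (\1_(cube x r) z + \1_(cube x r) z).
    have [xz|xz] := pselect (cube x r z); last first.
      by rewrite k0// normr0 mulr_ge0// addr_ge0.
    rewrite indicE mem_set//=; have [_ h] := hL i r (x - z) 0 rp; apply: le_trans h _.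
    by rewrite ler_peMr// lerDl.
  have := kernel_bound Xx Xx b0 rp r2 (fun i => mk x i r) hk.
  rewrite conv_lap//; last exact: subj Xx r2.
  move=> /le_trans H; rewrite normrM normrN (ger0_norm (_ : 0 <= r^-1)) ?invr_ge0 ?(ltW rp)//.
  rewrite mulrCA -ler_pdivlMl ?invr_gt0// invrK; apply: H.
  rewrite /B1; apply: (@le_trans _ _ (n%:R * (L * r / r ^+ n) * (2 * A) * kap ^+ j * (5 ^+ n * r ^+ n))).
    apply: ler_wpM2l; last exact: pow_le.
    by repeat apply: mulr_ge0 => //.
  rewrite le_eqVlt; apply/orP; left; apply/eqP.
  by move: rn; move: (r ^+ n) (kap ^+ j) (5 ^+ n : R) => *; field; rewrite gt_eqF.
(* Uses the Lipschitz constant L / r^n of z ker instead of its size, hence one more power of rr j on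
   the left. *)
have step2 x y j r : X x -> X y -> rr j.+1 <= r -> r <= rr j ->
    rr j ^+ 2 * `|r^-1 * conv f (lap_theta r) x - r^-1 * conv f (lap_theta r) y| <= 5 * B1 * `|x - y| * kap ^+ j.
  move=> Xx Xy r1 r2; have rp := rpos _ _ r1; have rn : 0 < r ^+ n by rewrite exprn_gt0.
  have b0 : 0 <= L / r ^+ n * `|x - y| by rewrite mulr_ge0// divr_ge0// ltW.
  have mkk i : measurable_fun setT (fun z => (x - z) 0 i * kr r (x - z) - (y - z) 0 i * kr r (y - z)).
    by apply: measurable_funB; exact: mk.
  have hk i z : `|(x - z) 0 i * kr r (x - z) - (y - z) 0 i * kr r (y - z)| <=
      L / r ^+ n * `|x - y| * (\1_(cube x r) z + \1_(cube y r) z).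
    have [[xz|yz]|nxy] := pselect (cube x r z \/ cube y r z).
    - have [h _] := hL i r (x - z) (y - z) rp; apply: le_trans h _.
      by rewrite opprB addrA subrK ler_peMr// indicE mem_set//= lerDl.
    - have [h _] := hL i r (x - z) (y - z) rp; apply: le_trans h _.
      by rewrite opprB addrA subrK ler_peMr// [\1_(cube y r) z]indicE mem_set//= lerDr.
    have [nx ny] : ~ cube x r z /\ ~ cube y r z by split=> h; apply: nxy; [left|right].
    by rewrite !k0// subrr normr0 mulr_ge0// addr_ge0.
  have H := kernel_bound Xx Xy b0 rp r2 mkk hk.
  have E : \int[mu]_z (\sum_i ((x - z) 0 i * kr r (x - z) - (y - z) 0 i * kr r (y - z)) * p i z) =
      conv f (lap_theta r) y - conv f (lap_theta r) x.
    rewrite !conv_lap//; [|exact: subj Xx r2|exact: subj Xy r2].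
    rewrite opprK addrC -RintegralB//; last 2 first.
    - by apply: L1_sum => // i _; apply: L_ => //; exact: subj Xx r2.
    - by apply: L1_sum => // i _; apply: L_ => //; exact: subj Xy r2.
    apply: eq_Rintegral => z _; rewrite -sumrB; apply: eq_bigr => i _; exact: mulrBl.
  rewrite E distrC in H; rewrite -mulrBr normrM (ger0_norm (_ : 0 <= r^-1)) ?invr_ge0 ?(ltW rp)//.
  have h5 : rr j * r^-1 <= 5 by rewrite ler_pdivrMr// -rrS ler_wpM2l.
  have {}H : rr j * `|conv f (lap_theta r) x - conv f (lap_theta r) y| <= B1 * `|x - y| * kap ^+ j.
    apply: le_trans H _.
    apply: (@le_trans _ _ (n%:R * (L / r ^+ n * `|x - y|) * (2 * A) * kap ^+ j * (5 ^+ n * r ^+ n))).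
      apply: ler_wpM2l; last exact: pow_le.
      by repeat apply: mulr_ge0 => //.
    rewrite le_eqVlt; apply/orP; left; apply/eqP; rewrite /B1.
    by move: rn; move: (r ^+ n) (kap ^+ j) (5 ^+ n : R) (`|x - y|) => *; field; rewrite gt_eqF.
  have : rr j * r^-1 * (rr j * `|conv f (lap_theta r) x - conv f (lap_theta r) y|) <= 5 * (B1 * `|x - y| * kap ^+ j).
    by apply: ler_pM => //; rewrite mulr_ge0// ?invr_ge0 ltW.
  rewrite [5 * (_ * _ * _)](_ : _ = 5 * B1 * `|x - y| * kap ^+ j); last by ring.
  by apply: le_trans; rewrite le_eqVlt; apply/orP; left; apply/eqP; ring.
have C1 x j : X x -> `|conv f (kr (rr j.+1)) x - conv f (kr (rr j)) x| <= B1 * kap ^+ j.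
  move=> Xx; have rj : rr j.+1 <= rr j by rewrite -(rrS j) ler_peMl ?(ltW (rr0 _))// ler1n.
  have hm t : rr j.+1 <= t <= rr j -> is_derive t 1 (fun r => conv f (kr r) x) (t^-1 * conv f (lap_theta t) x) /\
      `|t^-1 * conv f (lap_theta t) x| <= B1 * kap ^+ j / rr j.
    move=> /andP[t1 t2]; split; first by apply: is_derive_conv => //; exact: rpos t1.
    by rewrite ler_pdivlMr// mulrC; exact: step1.
  have M : `|conv f (kr (rr j)) x - conv f (kr (rr j.+1)) x| <= B1 * kap ^+ j / rr j * (rr j - rr j.+1).
    exact: mean_value_bound rj hm.
  rewrite distrC; apply: le_trans M _; rewrite mulrAC ler_pdivrMr// ler_wpM2l//; first exact: mulr_ge0.
  by rewrite lerBlDr lerDl ltW.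
have C2 x y j : X x -> X y -> `|(conv f (kr (rr j.+1)) x - conv f (kr (rr j.+1)) y) -
    (conv f (kr (rr j)) x - conv f (kr (rr j)) y)| <= 5 * B1 * `|x - y| * kap ^+ j / rr j.
  move=> Xx Xy; have rj : rr j.+1 <= rr j by rewrite -(rrS j) ler_peMl ?(ltW (rr0 _))// ler1n.
  have hm t : rr j.+1 <= t <= rr j ->
      is_derive t 1 (fun r => conv f (kr r) x - conv f (kr r) y)
        (t^-1 * conv f (lap_theta t) x - t^-1 * conv f (lap_theta t) y) /\
      `|t^-1 * conv f (lap_theta t) x - t^-1 * conv f (lap_theta t) y| <=
        5 * B1 * `|x - y| * kap ^+ j / rr j ^+ 2.
    move=> /andP[t1 t2]; split; last by rewrite ler_pdivlMr ?exprn_gt0// mulrC; exact: step2.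
    by apply: is_deriveB; apply: is_derive_conv => //; exact: rpos t1.
  have M : `|(conv f (kr (rr j)) x - conv f (kr (rr j)) y) -
      (conv f (kr (rr j.+1)) x - conv f (kr (rr j.+1)) y)| <=
      5 * B1 * `|x - y| * kap ^+ j / rr j ^+ 2 * (rr j - rr j.+1) by exact: mean_value_bound rj hm.
  rewrite distrC; apply: le_trans M _.
  have c0 : 0 <= 5 * B1 * `|x - y| * kap ^+ j by repeat apply: mulr_ge0 => //.
  move: (rr0 j) (rr0 j.+1) c0; move: (rr j) (rr j.+1) (5 * B1 * _ * _) => u v c u0 v0 c0.
  apply: (@le_trans _ _ (c / u ^+ 2 * u)).
    by rewrite ler_wpM2l ?divr_ge0 ?sqr_ge0// lerBlDr lerDl ltW.
  by rewrite le_eqVlt; apply/orP; left; apply/eqP; field; rewrite gt_eqF.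
have [c [c0 hc]] := test_lipschitz (@ker_test R n r0 r00).
pose B2 := \int[mu]_y `|f y| * c.
have I0 : 0 <= \int[mu]_y `|f y| by apply: Rintegral_ge0.
have B20 : 0 <= B2 by rewrite mulr_ge0.
(* B1 serves for the increments in r, B2 for the Lipschitz bound at the initial radius r0, and 5 B1
   / r0 for the induction on j. *)
pose B := B1 + B2 + 5 * B1 / r0.
have B30 : 0 <= 5 * B1 / r0 by rewrite divr_ge0 ?mulr_ge0// ltW.
have B0 : 0 <= B by rewrite !addr_ge0.
exists B; split => //; split.
  move=> x j Xx; apply: le_trans (C1 x j Xx) _; rewrite ler_wpM2r ?exprn_ge0 ?(ltW kap0)//.
  by rewrite /B -addrA lerDl addr_ge0.
move=> x y j Xx Xy; elim: j => [|j IH].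
  rewrite expr0 divr1 mulr1; apply: (@le_trans _ _ (B2 * `|x - y|)); last first.
    by rewrite ler_wpM2r// /B addrAC lerDr addr_ge0.
  have Lfk z : L1 mu setT (fun y => f y * kr r0 (z - y)) by exact: conv_integrable Lf (@ker_test R n r0 r00).
  have LN : L1 mu setT (fun y => `|f y|) by exact: integrable_norm Lf.
  have -> : B2 * `|x - y| = \int[mu]_z (`|f z| * (c * `|x - y|)).
    by rewrite RintegralZr// /B2 mulrA.
  rewrite /conv -(RintegralB measurableT (Lfk x) (Lfk y)).
  apply: le_trans (le_normr_Rintegral measurableT (L1B measurableT (Lfk x) (Lfk y))) _.
  apply: le_Rintegral => //.
  - exact: integrable_norm (L1B measurableT (Lfk x) (Lfk y)).
  - by apply: L1Zr => //; exact: integrable_norm Lf.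
  move=> z _; rewrite -mulrBr normrM ler_wpM2l//.
  have -> : x - z = (y - z) + (x - y) by rewrite [RHS]addrC addrA subrK.
  exact: hc.
have h2 := C2 x y j Xx Xy.
apply: (@le_trans _ _ (B * `|x - y| * (5 * kap) ^+ j + 5 * B1 * `|x - y| * kap ^+ j / rr j)).
  have tri (p1 p2 q1 q2 : R) : `|p2| <= q1 -> `|p1 - p2| <= q2 -> `|p1| <= q1 + q2.
    by move=> ? ?; rewrite -[p1](subrK p2) addrC (le_trans (ler_normD _ _))// lerD.
  exact: tri IH h2.
have -> : 5 * B1 * `|x - y| * kap ^+ j / rr j = 5 * B1 / r0 * (`|x - y| * (5 * kap) ^+ j).
  rewrite exprMn; have := r00; have : 5 ^+ j != 0 :> R by rewrite gt_eqF// exprn_gt0.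
  by move: (5 ^+ j) => z z0 r1; field; rewrite z0 gt_eqF.
have q0 : 0 <= `|x - y| * (5 * kap) ^+ j by rewrite mulr_ge0// exprn_ge0// mulr_ge0// ltW.
rewrite exprS (_ : B * `|x - y| * (5 * kap * _) = B * (5 * kap) * (`|x - y| * (5 * kap) ^+ j)); last by ring.
rewrite -[B * _ * _ ^+ j]mulrA -mulrDl ler_wpM2r//.
(* The induction closes because B + 5 B1 / r0 <= 2 B <= 5 kap B when kap >= 1/2. *)
have : 5 * B1 / r0 <= B by rewrite /B lerDr addr_ge0.
by move: B0 kap12; move: (B) (5 * B1 / r0) => *; nra.
Qed.
End morrey.

(** With c = B/(1 - k), the sequences h j + c k^j and h j - c k^j are monotone in opposite
    directions and have a common limit, which encloses that of h with the stated rate. *)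
Lemma geometric_cvg (R : realType) (h : nat -> R) (B k : R) : 0 <= B -> 0 <= k -> k < 1 ->
  (forall j, `|h j.+1 - h j| <= B * k ^+ j) ->
  h @ \oo --> limn h /\ forall j, `|limn h - h j| <= B / (1 - k) * k ^+ j.
Proof.
move=> B0 k0 k1 hB; pose c := B / (1 - k).
have k10 : 0 < 1 - k by rewrite subr_gt0.
have cE j : c * k ^+ j - c * k ^+ j.+1 = B * k ^+ j.
  rewrite /c exprS; move: (k ^+ j) => q; field; by rewrite gt_eqF.
have c0 : 0 <= c by rewrite divr_ge0// ltW.
pose u j := h j + c * k ^+ j; pose v j := h j - c * k ^+ j.
have uS j : u j.+1 <= u j.
  by have := hB j; rewrite ler_norml -cE /u => /andP[_]; move: (h j) (h j.+1) (c * _) (c * _) => *; lra.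
have vS j : v j <= v j.+1.
  by have := hB j; rewrite ler_norml -cE /v => /andP[+ _]; move: (h j) (h j.+1) (c * _) (c * _) => *; lra.
have uni : nonincreasing_seq u by apply/nonincreasing_seqP.
have vnd : nondecreasing_seq v by apply/nondecreasing_seqP.
have vu j : v j <= u j by rewrite /u /v lerD2l ge0_cp// mulr_ge0// exprn_ge0.
have cu : cvgn u.
  apply: nonincreasing_is_cvgn => //; exists (v 0%N) => _ [j _ <-].
  exact: le_trans (vnd _ _ (leq0n j)) (vu j).
have ck : c * k ^+ j @[j --> \oo] --> (0 : R).
  rewrite -[X in _ --> X](mulr0 c); apply: cvgMl_tmp; apply: cvg_expr.
  by rewrite ger0_norm.
have ch : h @ \oo --> limn u.
  have -> : h = fun j => u j - c * k ^+ j by apply/funext => j; rewrite /u addrK.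
  by rewrite -[X in _ --> X]subr0; apply: cvgB.
have lh : limn h = limn u by apply: cvg_lim.
have cv : v @ \oo --> limn u.
  by rewrite -[X in _ --> X]subr0; apply: cvgB.
split; first by rewrite lh.
move=> j; rewrite lh ler_norml; apply/andP; split.
  have : v j <= limn u by rewrite -(cvg_lim _ cv)//; apply: nondecreasing_cvgn_le => //; apply/cvg_ex; eexists; exact: cv.
  by rewrite /v -/c; move: (limn u) (h j) (c * _) => *; lra.
have : limn u <= u j by exact: nonincreasing_cvgn_ge.
by rewrite /u -/c; move: (limn u) (h j) (c * _) => *; lra.
Qed.

(** * From decay to Hoelder continuity *)

Section local_holder.
Variables (R : realType) (n : nat).
Local Notation rV := 'rV[R]_n.
Local Notation mu := (@lebn R n).
Local Notation kr := (@ker R n).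
Implicit Types (a x y z : rV) (r s t lam kap : R) (f u e : rV -> R) (g V p : 'I_n -> rV -> R).

(** The exponent alpha with 5^-alpha = kap. *)
Definition holder_exp kap : R := - ln kap / ln 5.

Lemma ln5_gt0 : 0 < ln (5 : R). Proof. by rewrite ln_gt0// ltr1n. Qed.

Lemma holder_exp_gt0 kap : 0 < kap -> kap < 1 -> 0 < holder_exp kap.
Proof.
by move=> k0 k1; rewrite divr_gt0 ?ln5_gt0// oppr_gt0 ln_lt0// k0 k1.
Qed.

Lemma holder_exp_lt1 kap : 1/2 <= kap -> holder_exp kap < 1.
Proof.
move=> k; have k0 : 0 < kap by lra.
by rewrite ltr_pdivrMr ?ln5_gt0// mul1r -lnV ?posrE// ltr_ln ?posrE ?invr_gt0// invf_plt ?posrE//; lra.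
Qed.

Lemma powR_holder_exp kap r m : 0 < kap -> 0 < r ->
  (r / 5 ^+ m) `^ holder_exp kap = r `^ holder_exp kap * kap ^+ m.
Proof.
move=> k0 r0; have p5 : 0 < (5 : R) ^+ m by rewrite exprn_gt0.
rewrite /powR !gt_eqF ?divr_gt0// lnM ?posrE ?invr_gt0// lnV ?posrE// lnXn//.
rewrite -[kap in kap ^+ m]lnK ?posrE// -expRM_natl -expRD; congr expR.
rewrite mulrDr; congr (_ + _); rewrite /holder_exp -[_ *+ m]mulr_natl.
have := ln5_gt0; move: (ln 5) (ln kap) => l lk l0.
by field; rewrite gt_eqF.
Qed.

Lemma scale_exists r t : 0 < t -> t <= r -> exists j : nat, r / 5 ^+ j.+1 < t /\ t <= r / 5 ^+ j.
Proof.
move=> t0 tr; have r0 : 0 < r by exact: lt_le_trans tr.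
have ex : exists j : nat, r / 5 ^+ j < t.
  have c : r * (5^-1) ^+ j @[j --> \oo] --> (0 : R).
    rewrite -[X in _ --> X](mulr0 r); apply: cvgMl_tmp; apply: cvg_expr.
    by rewrite ger0_norm// invf_lt1// ltr1n.
  have /cvgrPdist_lt/(_ t t0)[N _ /(_ N (leqnn N))] := c.
  rewrite sub0r normrN ger0_norm ?mulr_ge0 ?exprn_ge0 ?(ltW r0)// => h; exists N.
  by rewrite -exprVn.
case: (ex_minnP ex) => [[|m] hm mmin].
  by move: hm; rewrite expr0 divr1 ltNge tr.
exists m; split => //; rewrite leNgt; apply/negP => /mmin; by rewrite ltnn.
Qed.

(** Passes from the quadratic decay of the energy to a decay of the L^1 norm by |q| <= r q^2 / (2 k)
    + k / (2 r), balanced by the expected size k / r of q. *)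
Lemma young_decay x r (q e : rV -> R) (k C : R) : 0 < r -> 0 < k ->
  L1 mu (cube x r) q -> L1 mu (cube x r) e -> {ae mu, forall y, cube x r y -> q y ^+ 2 <= e y} ->
  r ^+ 2 * \int[mu]_(y in cube x r) e y <= C * k ^+ 2 * r ^+ n ->
  r * \int[mu]_(y in cube x r) `|q y| <= (C + 2 ^+ n) / 2 * k * r ^+ n.
Proof.
move=> r0 k0 Lq Le qe he; have mc := @measurable_cube R n x r.
have LN : L1 mu (cube x r) (fun y => `|q y|) by exact: integrable_norm Lq.
have L1c : L1 mu (cube x r) (fun=> k / r / 2).
  apply: (@L1_bounded _ _ _ _ _ _ `|k / r / 2|) => //; exact: cube_finite.
have : \int[mu]_(y in cube x r) `|q y| <= r / k / 2 * \int[mu]_(y in cube x r) e y + k / r / 2 * (2 * r) ^+ n.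
  have <- : \int[mu]_(y in cube x r) (k / r / 2) = k / r / 2 * (2 * r) ^+ n.
    by rewrite /Rintegral integral_cst//= /lebn leb_cube// ltW.
  rewrite -RintegralZl// -RintegralD//; last exact: L1Z.
  apply: le_Rintegral_ae => //; first by apply: L1D => //; exact: L1Z.
  apply: filterS qe => y qe yQ; apply: (@le_trans _ _ (r / k / 2 * q y ^+ 2 + k / r / 2)); last first.
    by rewrite lerD2r ler_wpM2l ?qe// !divr_ge0 ?(ltW r0) ?(ltW k0).
  rewrite -(real_normK (num_real (q y))); move: (`|q y|) => t.
  rewrite -subr_ge0 (_ : _ - t = (r * t - k) ^+ 2 / (2 * r * k)); last first.
    by field; rewrite !gt_eqF.
  by rewrite divr_ge0 ?sqr_ge0// ?mulr_ge0// ltW.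
move=> h; apply: le_trans (ler_wpM2l (ltW r0) h) _.
rewrite mulrDr (_ : r * (r / k / 2 * _) = (2 * k)^-1 * (r ^+ 2 * \int[mu]_(y in cube x r) e y)); last first.
  by field; rewrite gt_eqF.
apply: le_trans (lerD (ler_wpM2l _ he) (lexx _)) _.
  by rewrite invr_ge0 mulr_ge0// ltW.
rewrite le_eqVlt; apply/orP; left; apply/eqP; rewrite exprMn.
by move: (r ^+ n) (2 ^+ n : R) => *; field; rewrite !gt_eqF.
Qed.

(** The mollifications converge to f in L^2 and to l uniformly on the cube, so the integral of (f -
    l)^2 there is below every positive number. *)
Lemma mollify_limit f l a s a' s' (r : nat -> R) (B : nat -> R) : L2 f ->
  (forall x, ~ cube a s x -> f x = 0) -> (forall k, 0 < r k) -> r k @[k --> \oo] --> (0 : R) ->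
  B k @[k --> \oo] --> (0 : R) ->
  (forall k x, cube a' s' x -> `|l x - conv f (kr (r k)) x| <= B k) ->
  {ae mu, forall x, cube a' s' x -> f x = l x}.
Proof.
move=> Lf f0 r0 rcvg Bcvg hB.
have mQ := @measurable_cube R n a' s'.
pose g k x := conv f (kr (r k)) x.
have mg k : measurable_fun setT (g k) by exact: (conv_measurable Lf f0 (r0 k)).
have gl x : cube a' s' x -> g k x @[k --> \oo] --> l x.
  move=> xQ; apply/cvgrPdist_le => eps eps0.
  have /cvgrPdist_le/(_ _ eps0) := Bcvg; apply: filterS => k.
  rewrite sub0r normrN => h; apply: le_trans (hB k x xQ) _; exact: le_trans (ler_norm _) h.
have ml : measurable_fun (cube a' s') l.
  apply: (measurable_fun_cvg (h := g)) => [k|x xQ]; first exact: measurable_funTS.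
  by apply: gl.
pose q x := (f x - l x) ^+ 2.
have mf : measurable_fun setT f by have [] := Lf.
have mq : measurable_fun (cube a' s') q.
  by apply: measurable_funX; apply: measurable_funB => //; exact: measurable_funTS.
have q0 x : 0 <= q x by exact: sqr_ge0.
have key eps : 0 < eps -> (\int[mu]_(x in cube a' s') (q x)%:E <= eps%:E)%E.
  move=> eps0; have e4 : 0 < eps / 4 by rewrite divr_gt0.
  have [d d0 hd] := mollify_L2 Lf f0 e4.
  pose m := (2 * `|s'|) ^+ n.
  have m0 : 0 <= m by rewrite exprn_ge0// mulr_ge0.
  have em : 0 < eps / (4 * (m + 1)) by rewrite divr_gt0// mulr_gt0// ltr_wpDl.
  have B2 : B k ^+ 2 @[k --> \oo] --> (0 : R) by have := cvgX2 Bcvg; rewrite expr0n.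
  have [k [h1 h2]] : exists k : nat, r k <= d /\ B k ^+ 2 <= eps / (4 * (m + 1)).
    have /cvgrPdist_le/(_ _ d0) n1 := rcvg; have /cvgrPdist_le/(_ _ em) n2 := B2.
    have [N _ /(_ N (leqnn N))[h1 h2]] := filterI n1 n2; exists N.
    move: h1 h2; rewrite !sub0r !normrN => h1 h2.
    by split; [exact: le_trans (ler_norm _) h1|exact: le_trans (ler_norm _) h2].
  have rk : 0 < r k <= d by rewrite r0.
  apply: (@le_trans _ _ (\int[mu]_(x in cube a' s') (2 * (g k x - f x) ^+ 2 + 2 * B k ^+ 2)%:E)%E).
    apply: ge0_le_integral => //.
    - by move=> x _; rewrite lee_fin q0.
    - exact/measurable_EFinP.
    - apply/measurable_EFinP; apply: measurable_funD => //; apply: measurable_funM => //.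
      by apply: measurable_funTS; apply: measurable_funX; exact: measurable_funB.
    move=> x xQ; rewrite lee_fin /q (_ : f x - l x = (f x - g k x) + (g k x - l x)); last by ring.
    apply: le_trans (sqrD_le _ _) _; apply: lerD; rewrite ler_wpM2l//.
      by rewrite -sqrrN opprB.
    have h := hB k x xQ; rewrite -(real_normK (num_real (_ - _))) distrC.
    exact: le_sqr.
  under eq_integral do rewrite EFinD.
  rewrite ge0_integralD//; last 3 first.
  - by move=> x _; rewrite lee_fin mulr_ge0// sqr_ge0.
  - apply/measurable_EFinP; apply: measurable_funM => //.
    by apply: measurable_funTS; apply: measurable_funX; exact: measurable_funB.
  - by move=> x _; rewrite lee_fin mulr_ge0// sqr_ge0.
  rewrite (_ : eps%:E = (eps / 2)%:E + (eps / 2)%:E)%E; last by rewrite -EFinD -splitr.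
  apply: leeD.
    under eq_integral do rewrite EFinM.
    rewrite ge0_integralZl//; last 2 first.
    - apply/measurable_EFinP; apply: measurable_funTS; apply: measurable_funX; exact: measurable_funB.
    - by move=> x _; rewrite lee_fin sqr_ge0.
    apply: (@le_trans _ _ (2%:E * (eps / 4)%:E)%E); last by rewrite -EFinM lee_fin; lra.
    rewrite lee_wpmul2l// ?lee_fin//; apply: le_trans (hd _ rk).
    apply: ge0_subset_integral => //.
    - by apply/measurable_EFinP; apply: measurable_funX; exact: measurable_funB.
    - by move=> x _; rewrite lee_fin sqr_ge0.
  rewrite integral_cst//.
  have mQle : (mu (cube a' s') <= m%:E)%E.
    rewrite /m -(@leb_cube R n a')//; apply: le_measure; rewrite ?inE//; first exact: measurable_cube.
    by apply: cubeS; exact: ler_norm.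
  apply: (@le_trans _ _ ((2 * B k ^+ 2)%:E * m%:E)%E).
    by apply: lee_wpmul2l => //; rewrite lee_fin mulr_ge0// sqr_ge0.
  rewrite -EFinM lee_fin; have : B k ^+ 2 * (4 * (m + 1)) <= eps.
    by rewrite -ler_pdivlMr// mulr_gt0// ltr_wpDl.
  by have := sqr_ge0 (B k); move: (B k ^+ 2) m0 => b; nra.
have Lq : L1 mu (cube a' s') q.
  by apply: L1_ge0 => //; apply: le_lt_trans (key 1 ltr01) _; rewrite ltry.
have q_le0 : \int[mu]_(x in cube a' s') q x <= 0.
  rewrite leNgt; apply/negP => I0; have := key (\int[mu]_(x in cube a' s') q x / 2).
  rewrite -L1_fin// lee_fin => /(_ _); rewrite divr_gt0// => /(_ isT); lra.
apply: filterS (Rintegral0_ae mQ Lq (fun x _ => q0 x) q_le0) => x h /h.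
by rewrite /q => /eqP; rewrite sqrf_eq0 subr_eq0 => /eqP.
Qed.
End local_holder.

Section local_regularity.
Variables (R : realType) (n : nat).
Local Notation rV := 'rV[R]_n.
Local Notation mu := (@lebn R n).
Local Notation kr := (@ker R n).
Implicit Types (a x y z : rV) (r s t lam kap : R) (f u e : rV -> R) (g V p : 'I_n -> rV -> R).

(** The radii 5^-k do not depend on the cube under consideration, so a single formula gives the
    representative on all of Omega. *)
Definition mollified_limit f x : R := limn (fun k : nat => conv f (kr (1 / 5 ^+ k)) x).

(** The solution u supplies the decay of the energy e, hence of p; the function f is any function
    with Lap f = div p. The exponent depends on lam and n alone. *)
Lemma local_holder lam : 0 < lam -> exists alpha : R, [/\ 0 < alpha, alpha < 1 &
  forall a s u g V e f p, 0 < s -> local_sol lam a s u g V e ->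
  L2 f -> (forall x, ~ cube a s x -> f x = 0) -> (forall i, L1 mu setT (p i)) ->
  {ae mu, forall x, cube a s x -> forall i, p i x ^+ 2 <= e x} ->
  (forall phi, test_function (cube a s) phi ->
    \int[mu]_x (f x * \sum_i partial i (partial i phi) x) =
    - \int[mu]_x (\sum_i partial i phi x * p i x)) ->
  exists (d C : R), [/\ 0 < d, 0 <= C,
    forall x y, cube a (s / 8) x -> cube a (s / 8) y -> `|x - y| <= d ->
      `|mollified_limit f x - mollified_limit f y| <= C * `|x - y| `^ alpha &
    {ae mu, forall x, cube a (s / 8) x -> f x = mollified_limit f x}]].
Proof.
move=> lam0; have [kap [C1 [k12 k1 C10 decay]]] := @energy_decay R n lam lam0.
have k0 : 0 < kap by lra.
exists (holder_exp kap); split; [exact: holder_exp_gt0|exact: holder_exp_lt1|].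
move=> a s u g V e f p s0 sol Lf f0 Lp pe weak.
have [h2 s4] : 2 * (s / 4) < s /\ 0 < s / 4 by split; lra.
have [M [M0 hM]] := sol_bounded lam0 sol s4 h2.
(* Then 5 r0 <= s / 8: cubes of radius 5 r0 centred in the cube of radius s / 8 stay in that of
   radius s / 4, where u is bounded. *)
have [N hN] : exists N : nat, 1 / 5 ^+ N <= s / 40.
  have t0 : 0 < Num.min 1 (s / 40) by rewrite lt_min ltr01 divr_gt0.
  have [|j [hj _]] := scale_exists t0 (_ : _ <= 1); first by rewrite ge_min lexx.
  by exists j.+1; apply: le_trans (ltW hj) _; rewrite ge_min lexx orbT.
pose r0 : R := 1 / 5 ^+ N.
have r00 : 0 < r0 by rewrite divr_gt0// exprn_gt0.
pose X : set rV := cube a (s / 8).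
have sub5 x : X x -> cube x (5 * r0) `<=` cube a (s / 4).
  move=> Xx y yx i; have := Xx i; have := yx i; move: hN; rewrite -/r0.
  by move: (r0) (a 0 i) (x 0 i) (y 0 i) => *; lra.
have sub4 : cube a (s / 4) `<=` cube a s by apply: cubeS; lra.
have rr0 j : 0 < r0 / 5 ^+ j by rewrite divr_gt0// exprn_gt0.
have rr_le j : r0 / 5 ^+ j <= r0 by rewrite ler_pdivrMr ?exprn_gt0// ler_peMr ?(ltW r00)// exprn_ege1// ler1n.
have subr x j : X x -> cube x (r0 / 5 ^+ j) `<=` cube a s.
  move=> Xx; apply: subset_trans sub4; apply: subset_trans (sub5 x Xx); apply: cubeS.
  by apply: le_trans (rr_le j) _; rewrite ler_peMl ?(ltW r00)// ler1n.
have sub1 x : X x -> cube x r0 `<=` cube a s.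
  by move=> Xx; have := @subr x 0%N Xx; rewrite expr0 divr1.
pose A := (C1 * M ^+ 2 + 2 ^+ n) / 2.
have A0 : 0 <= A by rewrite divr_ge0// addr_ge0// ?exprn_ge0// mulr_ge0// sqr_ge0.
have hdecay x i (j : nat) : X x -> r0 / 5 ^+ j * \int[mu]_(y in cube x (r0 / 5 ^+ j)) `|p i y| <=
    A * kap ^+ j * (r0 / 5 ^+ j) ^+ n.
  move=> Xx; have mc := @measurable_cube R n x (r0 / 5 ^+ j).
  apply: (@young_decay R n x _ (p i) e) => //.
  - by rewrite exprn_gt0.
  - exact: (L1S measurableT).
  - by apply: (L1S measurableT) => //; exact: sol_eL1 sol.
  - by apply: filterS pe => y hy /(subr x j Xx)/hy.
  apply: (decay _ _ _ _ _ _ _ _ M sol r00 _ M0 _ j); first by apply: subset_trans sub4; exact: sub5.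
  by apply: filterS hM => y hy /(sub5 x Xx)/hy.
have Lf1 : L1 mu setT f by exact: L2_cube_L1 Lf f0.
have [B [B0 [c1 c2]]] := morrey_cauchy Lf1 Lp weak r00 A0 k12 sub1 hdecay.
pose l := mollified_limit f.
pose D := B / (1 - kap).
have D0 : 0 <= D by rewrite divr_ge0// subr_ge0 ltW.
have lim x : X x -> forall j, `|l x - conv f (kr (r0 / 5 ^+ j)) x| <= D * kap ^+ j.
  move=> Xx; have [cv bd] := geometric_cvg B0 (ltW k0) k1 (fun j => c1 x j Xx).
  suff -> : l x = limn (fun j => conv f (kr (r0 / 5 ^+ j)) x) by [].
  (* The radii r0 / 5^j are those of [mollified_limit] shifted by N, so the limits coincide. *)
  have rE j : 1 / 5 ^+ (j + N) = r0 / 5 ^+ j.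
    rewrite exprD /r0; have : 5 ^+ N != 0 :> R by rewrite gt_eqF// exprn_gt0.
    have : 5 ^+ j != 0 :> R by rewrite gt_eqF// exprn_gt0.
    by move: (5 ^+ N) (5 ^+ j) => q1 q2 *; field; apply/andP.
  pose h k := conv f (kr (1 / 5 ^+ k)) x.
  have hE : (fun j => h (j + N)%N) = fun j => conv f (kr (r0 / 5 ^+ j)) x.
    by apply/funext => j; exact: (congr1 (fun r => conv f (kr r) x) (rE j)).
  have cv2 : h k @[k --> \oo] --> limn (fun j => conv f (kr (r0 / 5 ^+ j)) x).
    by rewrite -(cvg_shiftn N) hE.
  exact: (cvg_lim (@Rhausdorff R) cv2).
have ra : 0 < r0 `^ holder_exp kap by rewrite powR_gt0.
pose C := (2 * D + B * r0) / (kap * r0 `^ holder_exp kap).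
have C0 : 0 <= C.
  apply: divr_ge0; last by apply: mulr_ge0; exact: ltW.
  by apply: addr_ge0; apply: mulr_ge0 => //; exact: ltW.
exists r0, C; split => //.
- move=> x y Xx Xy xy; have [->|nxy] := eqVneq x y.
    by rewrite subrr normr0 mulr_ge0// powR_ge0.
  have d0 : 0 < `|x - y| by rewrite normr_gt0 subr_eq0.
  (* At the scale r0 / 5^j comparable to |x - y|, the distance to the limit and the Lipschitz bound
     of the mollification are both O(kap^j), that is O(|x - y|^alpha). *)
  have [j [j1 j2]] := scale_exists d0 xy.
  have p5 : 0 < (5 : R) ^+ j by rewrite exprn_gt0.
  have kj : 0 < kap ^+ j by rewrite exprn_gt0.
  have e1 : `|l x - l y| <= kap ^+ j * (2 * D + B * r0).
    have t1 := lim x Xx j; have t2 := lim y Xy j; have t3 := c2 x y j Xx Xy.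
    have t4 : B * `|x - y| * (5 * kap) ^+ j <= kap ^+ j * (B * r0).
      rewrite exprMn (_ : _ * _ * _ = kap ^+ j * (B * (`|x - y| * 5 ^+ j))); last by ring.
      by rewrite ler_wpM2l ?(ltW kj)// ler_wpM2l// -ler_pdivlMr.
    move: t1 t2 t3 t4; move: (l x) (l y) (conv _ _ x) (conv _ _ y) (kap ^+ j) => lx ly hx hy kj'.
    move: (B * _ * _ ^+ j) => q; rewrite !ler_norml => *.
    by apply/andP; split; lra.
  apply: le_trans e1 _.
  have e2 : kap ^+ j.+1 * r0 `^ holder_exp kap <= `|x - y| `^ holder_exp kap.
    rewrite mulrC -powR_holder_exp//; apply: ge0_ler_powR; rewrite ?nnegrE ?(ltW j1)//.
      exact/ltW/holder_exp_gt0.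
    exact: ltW (rr0 _).
  have -> : kap ^+ j * (2 * D + B * r0) = C * (kap ^+ j.+1 * r0 `^ holder_exp kap).
    rewrite /C exprS; move: ra; move: (r0 `^ _) (kap ^+ j) (2 * D + _) => q1 q2 q3 q10.
    by field; rewrite !gt_eqF.
  by rewrite ler_wpM2l.
apply: (@mollify_limit R n f l a s a (s / 8) (fun j => r0 / 5 ^+ j) (fun j => D * kap ^+ j)) => //.
- rewrite -[X in _ --> X](mulr0 r0); apply: cvgMl_tmp; under eq_cvg do rewrite -exprVn.
  by apply: cvg_expr; rewrite ger0_norm// invf_lt1// ltr1n.
- rewrite -[X in _ --> X](mulr0 D); apply: cvgMl_tmp.
  by apply: cvg_expr; rewrite ger0_norm// ltW.
- by move=> k x Xx; exact: lim.
Qed.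
End local_regularity.

(** * Exterior and Clifford algebra *)

Section clifford.
Variables (R : realType) (n : nat).
Local Open Scope set_scope.
Local Open Scope ring_scope.
Implicit Types (S T U : {set 'I_n}) (w : extalg R n) (i j : 'I_n) (v : 'rV[R]_n) (A B : 'M[R]_n).

(** With [tog], Clifford multiplication by e_j in coordinates: the coefficient of e_j /\ w + e_j _|
    w on e_S is [sgn j S * w (tog j S)]; the wedge acts when j is in S, the interior product
    otherwise. *)
Definition sgn j S : R := (-1) ^+ inversions [set j]%SET S.
Definition tog j S : {set 'I_n} := if j \in S then (S :\ j)%SET else (j |: S)%SET.

Lemma inversions1 j S : inversions [set j]%SET S = (\sum_(t in S) (t < j))%N.
Proof. by rewrite /inversions big_set1. Qed.

Lemma sgn_tog i j S : sgn j (tog i S) = (-1) ^+ (i < j)%N * sgn j S.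
Proof.
rewrite /sgn /tog !inversions1; case: ifPn => iS.
  rewrite [in RHS](big_setD1 i iS)/= exprD mulrA -exprD addnn -mul2n exprM sqrrN !expr1n.
  by rewrite mul1r.
by rewrite big_setU1//= exprD.
Qed.

Lemma in_tog t j S : (t \in tog j S) = (t == j) (+) (t \in S).
Proof.
by rewrite /tog; case: ifPn => jS; rewrite !inE; case: eqVneq => [->|_] //=; rewrite ?jS ?(negbTE jS).
Qed.

Lemma togC i j S : tog i (tog j S) = tog j (tog i S).
Proof. by apply/setP => t; rewrite !in_tog addbCA. Qed.

Lemma togK i S : tog i (tog i S) = S.
Proof. by apply/setP => t; rewrite !in_tog addbA addbb. Qed.

Lemma sgn_sqr j S : sgn j S * sgn j S = 1.
Proof. by rewrite /sgn -exprD addnn -mul2n exprM sqrrN !expr1n. Qed.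

Lemma sgn_togtog i S : sgn i S * sgn i (tog i S) = 1.
Proof. by rewrite sgn_tog ltnn expr0 mul1r sgn_sqr. Qed.

(* e_i and e_j anticommute in the Clifford algebra. *)
Lemma sgn_anti i j S : i != j -> sgn i S * sgn j (tog i S) = - (sgn j S * sgn i (tog j S)).
Proof.
move=> ij; rewrite !sgn_tog.
have -> : (-1) ^+ (i < j)%N = - (-1) ^+ (j < i)%N :> R.
  case: (ltngtP i j) => [_|_|/val_inj ije]; rewrite ?expr0 ?expr1 ?opprK//.
  by rewrite ije eqxx in ij.
by ring.
Qed.

Lemma d_coefE j w S : d_coef j w S = if j \in S then sgn j S * w (tog j S) else 0.
Proof.
rewrite /d_coef /wedge ffunE; case: ifPn => jS.
  rewrite (bigD1 [set j]%SET) ?finset.sub1set//= big1 ?addr0 => [|T /andP[_ /negbTE Tj]].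
    rewrite ffunE eqxx mulr1 /sgn /tog jS !inversions1; congr (_ ^+ _ * _).
    by rewrite [in RHS](big_setD1 j jS)/= ltnn.
  by rewrite ffunE Tj mulr0 mul0r.
rewrite big1// => T TS; rewrite ffunE; case: eqVneq => [TE|]; last by rewrite mulr0 mul0r.
by move: TS; rewrite TE finset.sub1set (negbTE jS).
Qed.

Lemma inner_scale_blade w (c : R) S : inner w (c *: blade R S) = c * w S.
Proof.
rewrite /inner (bigD1 S)//= big1 ?addr0 => [|T /negbTE TS].
  by rewrite !ffunE eqxx /GRing.scale/= mulr1 mulrC.
by rewrite !ffunE TS /GRing.scale/= !mulr0.
Qed.

Lemma delta_coefE j w S : delta_coef j w S = if j \in S then 0 else sgn j S * w (tog j S).
Proof.
rewrite /delta_coef /interior ffunE wedge_blade finset.disjoints1 /tog; case: (j \in S) => /=.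
  by rewrite /inner big1// => T _; rewrite ffunE mulr0.
by rewrite inner_scale_blade.
Qed.

Lemma Dplus_coefE j w S : (d_coef j w + delta_coef j w) S = sgn j S * w (tog j S).
Proof. by rewrite ffunE d_coefE delta_coefE; case: ifP; rewrite ?addr0 ?add0r. Qed.

Lemma Dminus_coefE j w S : (d_coef j w - delta_coef j w) S =
  (if j \in S then 1 else -1) * (sgn j S * w (tog j S)).
Proof.
rewrite [LHS](_ : _ = d_coef j w S - delta_coef j w S); last by rewrite !ffunE.
by rewrite d_coefE delta_coefE; case: ifP; rewrite ?subr0 ?sub0r ?mul1r ?mulN1r.
Qed.

Lemma card_tog j S : (#|tog j S| = if j \in S then #|S|.-1 else #|S|.+1)%N.
Proof.
rewrite /tog; case: ifPn => jS; last by rewrite finset.cardsU1 jS.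
by rewrite [in RHS](finset.cardsD1 j S) jS.
Qed.

(** Off-diagonal terms cancel in pairs. Used for sums of symmetric second derivatives against
    anticommuting signs. *)
Lemma antisym_sum (a : 'I_n -> 'I_n -> R) : (forall i j, i != j -> a i j = - a j i) ->
  \sum_i \sum_j a i j = \sum_i a i i.
Proof.
move=> aN; pose b i j := if i == j then 0 else a i j.
have bN i j : b i j = - b j i.
  by rewrite /b eq_sym; case: eqVneq => [_|ij]; [rewrite oppr0|rewrite aN// eq_sym].
have b0 : \sum_i \sum_j b i j = 0.
  have : \sum_i \sum_j b i j = - \sum_i \sum_j b i j.
    rewrite {1}exchange_big/= -sumrN; apply: eq_bigr => i _; rewrite -sumrN.
    by apply: eq_bigr => j _.
  by move: (\sum_i _) => q; lra.
transitivity (\sum_i \sum_j b i j + \sum_i a i i); last by rewrite b0 add0r.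
rewrite -big_split/=; apply: eq_bigr => i _.
rewrite (bigD1 i)//= [in RHS](bigD1 i)//= {1}/b eqxx add0r addrC; congr (_ + _).
by apply: eq_bigr => j ji; rewrite /b eq_sym (negbTE ji).
Qed.

Lemma vecE v U : vec v U = \sum_i v 0 i * (U == [set i]%SET)%:R.
Proof. by rewrite /vec sum_ffunE; apply: eq_bigr => i _; rewrite !ffunE. Qed.

Lemma vec1 v i : vec v [set i]%SET = v 0 i.
Proof.
rewrite vecE (bigD1 i)//= big1 ?addr0 ?eqxx ?mulr1// => j ji.
by rewrite (inj_eq (@finset.set1_inj _)) eq_sym (negbTE ji) mulr0.
Qed.

Lemma vec_basis i : vec (basis_vec R i) = blade R [set i]%SET.
Proof.
apply/ffunP => U; rewrite vecE ffunE (bigD1 i)//= big1 ?addr0 => [|j ji].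
  by rewrite basis_vecE eqxx mul1r.
by rewrite basis_vecE eq_sym (negbTE ji) mul0r.
Qed.

Lemma wedge_vecE v w U : wedge (vec v) w U = \sum_i v 0 i * d_coef i w U.
Proof.
rewrite /vec wedge_suml sum_ffunE; apply: eq_bigr => i _; by rewrite !ffunE.
Qed.

Let E A (l : seq 'I_n) := \big[@wedge R n/blade R finset.set0]_(i <- l) vec (basis_vec R i *m A).

(** A wedge product of k vectors is homogeneous of degree k, so exterior extensions preserve the
    grading. *)
Lemma wedge_hom A l U : #|U| != size l -> E A l U = 0.
Proof.
elim: l U => [|i l IH] U Ul.
  by rewrite /E big_nil ffunE; case: eqVneq => // U0; move: Ul; rewrite U0 finset.cards0.
rewrite /E big_cons wedge_vecE big1// => j _; rewrite d_coefE; case: ifPn => jU; last by rewrite mulr0.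
rewrite -/(E A l) IH ?mulr0//; rewrite card_tog jU; apply: contra Ul => /eqP h.
by rewrite /= -h prednK// card_gt0; apply/set0Pn; exists j.
Qed.

(** Each factor contributes a sum of n terms with a coefficient of size at most eps. *)
Lemma wedge_small A l U (eps : R) : 0 <= eps -> (forall i j, `|A i j| <= eps) ->
  `|E A l U| <= (n%:R * eps) ^+ size l.
Proof.
move=> e0 hA; elim: l U => [|i l IH] U.
  by rewrite /E big_nil ffunE expr0; case: eqP; rewrite ?normr1 ?normr0.
rewrite /E big_cons wedge_vecE -/(E A l) exprS -mulrA.
apply: le_trans (ler_norm_sum _ _ _) _.
rewrite [leRHS](_ : _ = \sum_(j < n) eps * (n%:R * eps) ^+ size l); last first.
  by rewrite sumr_const card_ord mulr_natl.
apply: ler_sum => j _; rewrite normrM; apply: ler_pM => //.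
  by rewrite -rowE mxE; exact: hA.
rewrite d_coefE; case: ifP => _; last by rewrite normr0 exprn_ge0// mulr_ge0.
by rewrite normrM /sgn normrX normrN1 expr1n mul1r.
Qed.

Lemma exterior_extE A w U : exterior_ext A w U = \sum_S w S * E A (enum S) U.
Proof. by rewrite /exterior_ext sum_ffunE; apply: eq_bigr => S _; rewrite ffunE. Qed.

Lemma exterior_ext_comp A B w : exterior_ext B (exterior_ext A w) = exterior_ext (A *m B) w.
Proof.
pose f : {linear extalg R n -> extalg R n} := exterior_ext B \o exterior_ext A.
pose g : {linear extalg R n -> extalg R n} := exterior_ext (A *m B).
apply: (eq_linear_blade (f := f) (g := g)) => S /=; rewrite !exterior_ext_blade.
elim: (enum S) => [|i l IH]; first by rewrite !big_nil exterior_ext1.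
by rewrite !big_cons exterior_ext_wedge exterior_ext_vec IH mulmxA.
Qed.

Lemma sum_singletons (c : {set 'I_n} -> R) : (forall T, #|T| != 1%N -> c T = 0) ->
  \sum_T c T = \sum_j c [set j]%SET.
Proof.
move=> c0; transitivity (\sum_j \sum_T (T == [set j]%SET)%:R * c T); last first.
  apply: eq_bigr => j _; rewrite (bigD1 [set j]%SET)//= eqxx mul1r big1 ?addr0// => T /negbTE ->.
  by rewrite mul0r.
rewrite exchange_big/=; apply: eq_bigr => T _; rewrite -mulr_suml.
have [/finset.cards1P[k ->]|/c0 ->] := boolP (#|T| == 1%N); last by rewrite mulr0.
rewrite (bigD1 k)//= eqxx big1 ?addr0 ?mul1r// => j jk.
by rewrite (inj_eq (@finset.set1_inj _)) eq_sym (negbTE jk).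
Qed.

Lemma exterior_ext1E A w i : exterior_ext A w [set i]%SET = \sum_j w [set j]%SET * A j i.
Proof.
rewrite exterior_extE sum_singletons => [|T T1].
  apply: eq_bigr => j _; rewrite /E -exterior_ext_blade -vec_basis exterior_ext_vec vec1.
  by rewrite -rowE mxE.
by rewrite wedge_hom ?mulr0// cards1 -cardE eq_sym.
Qed.

Definition grade (k : nat) w : extalg R n := [ffun S : {set 'I_n} => if #|S| == k then w S else 0].

Lemma exterior_ext_grade A k w : exterior_ext A (grade k w) = grade k (exterior_ext A w).
Proof.
apply/ffunP => U; rewrite [RHS]ffunE !exterior_extE; case: ifPn => Uk.
  apply: eq_bigr => S _; rewrite ffunE; case: ifPn => // Sk; rewrite mul0r.
  by rewrite wedge_hom ?mulr0// -cardE (eqP Uk) eq_sym.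
rewrite big1// => S _; rewrite ffunE; case: ifPn => [/eqP Sk|_]; last by rewrite mul0r.
by rewrite wedge_hom ?mulr0// -cardE Sk.
Qed.

Lemma enorm_ge0 v : 0 <= enorm v. Proof. exact: sqrtr_ge0. Qed.

Lemma enorm_sqr v : enorm v ^+ 2 = sqn v.
Proof. by rewrite /enorm sqr_sqrtr// sqn_ge0. Qed.

Lemma coord_enorm v i : `|v 0 i| <= enorm v.
Proof.
rewrite -(ler_sqr) ?nnegrE ?enorm_ge0// real_normK ?num_real// enorm_sqr; exact: coord_sqn.
Qed.

Lemma norm_enorm v : `|v| <= enorm v.
Proof.
have := (@cube_norm R n 0 (enorm v) v (enorm_ge0 v)).1; rewrite subr0; apply => i.
by rewrite mxE sub0r add0r -ler_norml coord_enorm.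
Qed.

Lemma enormZ (c : R) v : 0 <= c -> enorm (c *: v) = c * enorm v.
Proof.
move=> c0; rewrite /enorm (_ : \sum_i _ = c ^+ 2 * \sum_i v 0 i ^+ 2).
  by rewrite sqrtrM ?sqr_ge0// sqrtr_sqr ger0_norm.
by rewrite mulr_sumr; apply: eq_bigr => i _; rewrite mxE exprMn.
Qed.

(** The operator norm is a [sup], so the set must first be shown bounded, by the Cauchy-Schwarz
    inequality on the columns of A; the rest is homogeneity. *)
Lemma opnorm_bound A v : enorm (v *m A) <= opnorm A * enorm v.
Proof.
have ub : has_ubound [set enorm (v *m A) | v in [set v | enorm v <= 1]]%classic.
  exists (Num.sqrt (\sum_j n%:R * \sum_i A i j ^+ 2)) => _ [x /= x1 <-].
  rewrite /enorm ler_sqrt ?sumr_ge0// => [|j _]; last by rewrite mulr_ge0// sumr_ge0// => ? _; exact: sqr_ge0.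
  apply: ler_sum => j _; rewrite mxE; apply: le_trans (dot_sqr_le _ _) _.
  rewrite -mulrA ler_wpM2l//; apply: ler_piMl; first by apply: sumr_ge0 => i _; exact: sqr_ge0.
  by rewrite expr_le1// (le_trans (norm_enorm x)).
have [v0|v0] := eqVneq (enorm v) 0.
  have -> : v = 0 by apply/rowP => i; apply/eqP; rewrite mxE -normr_le0 -v0 coord_enorm.
  rewrite mul0mx (_ : enorm 0 = 0) ?mulr0//.
  by rewrite /enorm big1 ?sqrtr0// => i _; rewrite mxE expr0n.
have vp : 0 < enorm v by rewrite lt_neqAle eq_sym v0 enorm_ge0.
have := ub_le_sup ub; rewrite -/(opnorm A) => /(_ ((enorm v)^-1 * enorm (v *m A))) h.
rewrite -ler_pdivrMr// mulrC; apply: h; exists ((enorm v)^-1 *: v) => /=.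
  by rewrite enormZ ?invr_ge0 ?enorm_ge0// mulVf.
by rewrite -scalemxAl enormZ// invr_ge0 enorm_ge0.
Qed.

(* w = ext(A^k) w for all k, and the entries of A^k tend to 0. *)
Lemma exterior_ext_fixed A (kap : R) k w : opnorm A <= kap -> 0 <= kap -> kap < 1 ->
  grade k.+1 w = w -> exterior_ext A w = w -> w = 0.
Proof.
move=> Akap k0 k1 gw Aw; pose P m := iter m (fun B => B *m A) A.
have hA v : enorm (v *m A) <= kap * enorm v.
  by apply: le_trans (opnorm_bound _ _) _; rewrite ler_wpM2r ?enorm_ge0.
have Pw m : exterior_ext (P m) w = w.
  by elim: m => [//|m IH]; rewrite /P iterS -/(P m) -exterior_ext_comp IH.
have Pe m v : enorm (v *m P m) <= kap ^+ m * enorm v.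
  elim: m => [|m IH].
    rewrite expr0 mul1r; apply: le_trans (hA v) _; rewrite ler_piMl ?enorm_ge0//; exact: ltW.
  rewrite /P iterS -/(P m) mulmxA; apply: le_trans (hA _) _.
  by rewrite exprS -mulrA ler_wpM2l.
have Pij m i j : `|P m i j| <= kap ^+ m.
  have -> : P m i j = (basis_vec R i *m P m) 0 j by rewrite -rowE mxE.
  apply: le_trans (coord_enorm _ _) _; apply: le_trans (Pe _ _) _.
  rewrite ler_piMr ?exprn_ge0// /enorm (bigD1 i)//= big1 ?addr0 => [|l li].
    by rewrite basis_vecE eqxx expr1n sqrtr1.
  by rewrite basis_vecE eq_sym (negbTE li) expr0n.
apply/ffunP => U; rewrite ffunE; apply/eqP; rewrite -normr_le0.
pose W := \sum_S `|w S|.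
(* The ratio kap^(k+1) is below 1 because the degree k+1 is positive; in degree 0 the extension is
   the identity. *)
have bd m : `|w U| <= W * n%:R ^+ k.+1 * (kap ^+ k.+1) ^+ m.
  rewrite -{1}(Pw m) exterior_extE; apply: le_trans (ler_norm_sum _ _ _) _.
  rewrite /W -mulrA mulr_suml; apply: ler_sum => S _; rewrite normrM.
  have [Sk|Sk] := eqVneq #|S| k.+1; last first.
    by rewrite -gw ffunE (negbTE Sk) normr0 !mul0r.
  rewrite ler_wpM2l//.
  apply: le_trans (wedge_small _ _ _ (Pij m)) _; first exact: exprn_ge0.
  by rewrite -cardE Sk exprMn -exprM mulnC exprM.
have cv : W * n%:R ^+ k.+1 * (kap ^+ k.+1) ^+ m @[m --> \oo] --> (0 : R).
  rewrite -[X in _ --> X](mulr0 (W * n%:R ^+ k.+1)); apply: cvgMl_tmp; apply: cvg_expr.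
  by rewrite ger0_norm ?exprn_ge0// exprn_ilt1.
by apply: (ler_cvg_to (cvg_cst `|w U|) cv); apply: nearW.
Qed.
End clifford.

(** * Coordinates of the first-order system on a cube *)

Section beltrami_local.
Variables (R : realType) (n : nat).
Local Notation rV := 'rV[R]_n.
Local Notation mu := (@lebn R n).
Implicit Types (a x y : rV) (r s k : R) (phi psi f : rV -> R) (Omega : set rV)
  (F G P Q : rV -> extalg R n) (S T : {set 'I_n}).

(** The mollifications vanish on the smaller cube, since reflected kernels are test functions, and
    they converge to f almost everywhere along a sequence of radii. *)
Lemma du_bois_reymond f a s s' : L2 f -> (forall x, ~ cube a s x -> f x = 0) -> s' < s ->
  (forall phi, test_function (cube a s) phi -> \int[mu]_x (phi x * f x) = 0) ->
  {ae mu, forall x, cube a s' x -> f x = 0}.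
Proof.
move=> Lf f0 ss hf; have ss0 : 0 < s - s' by rewrite subr_gt0.
have [r [m [hr _ hm]]] := mollified_family (fun _ : unit => Lf) (fun _ => f0) ss0.
apply: filterS hm => x /(_ tt)[cx _ _] xs.
have c0 (k : nat) : conv f (@ker R n (r k)) x = 0.
  have /andP[r0 rs] := hr k.
  have sub : cube x (r k) `<=` cube a s.
    move=> y yx i; have := xs i; have := yx i; move: rs (a 0 i) (x 0 i) (y 0 i) => *; lra.
  rewrite -(hf _ (test_subset sub (test_reflect x (@ker_test R n _ r0)))).
  by apply: eq_Rintegral => y _; rewrite mulrC.
have cz : conv f (@ker R n (r k)) x @[k --> \oo] --> (0 : R) by apply: cvg_near_cst; exact: nearW.
by rewrite -(cvg_lim (@Rhausdorff R) cx); exact: (cvg_lim (@Rhausdorff R) cz).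
Qed.

(** Reduced to countable intersections of sets of full measure through [pickle]. *)
Lemma ae_forall_fin (I : finType) (p : I -> rV -> Prop) :
  (forall i, {ae mu, forall x, p i x}) -> {ae mu, forall x, forall i, p i x}.
Proof.
move=> h; have : {ae mu, forall x, forall k : nat, if @unpickle I k is Some i then p i x else True}.
  by apply/ae_foralln => k; case: unpickle => [i|]; [exact: h|exact: aeW].
by apply: filterS => x hx i; have := hx (pickle i); rewrite pickleK.
Qed.

(** Extension by 0 from a cube, which turns coordinates of fields on Omega into functions in L^2 of
    the whole space, as mollification requires. *)
Definition cut G a r S : rV -> R := fun x => G x S * \1_(cube a r) x.

Lemma cutE G a r S x : cube a r x -> cut G a r S x = G x S.
Proof. by move=> xr; rewrite /cut indicE mem_set// mulr1. Qed.

Lemma cut0 G a r S x : ~ cube a r x -> cut G a r S x = 0.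
Proof. by move=> xr; rewrite /cut indicE memNset// mulr0. Qed.

Lemma cut_L2 Omega G a r S : ext_L2 Omega G -> open Omega -> cube a r `<=` Omega -> L2 (cut G a r S).
Proof.
move=> [mG LG] oO sub; have mO := rV_open_measurable oO.
have mc := @measurable_cube R n a r.
have E : cut G a r S = (fun x => G x S) \_ (cube a r).
  by apply/funext => x; rewrite /cut /patch indicE; case: ifP => _; rewrite ?mulr1 ?mulr0.
have mS : measurable_fun setT (cut G a r S).
  by rewrite E; apply/(measurable_restrictT _ _).1 => //; exact: measurable_funS (mG S).
split => //; apply: L1_ge0 => //; first exact: measurable_funX.
  by move=> x _; exact: sqr_ge0.
have mN : measurable_fun Omega (fun x => (extnorm (G x) ^+ 2)%:E).
  apply/measurable_EFinP; have -> : (fun x => extnorm (G x) ^+ 2) = fun x => \sum_T G x T * G x T.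
    apply/funext => x; rewrite /extnorm sqr_sqrtr// /inner; apply: sumr_ge0 => T _.
    by rewrite -expr2 sqr_ge0.
  by apply: measurable_sum => T; apply: measurable_funM.
apply: le_lt_trans LG; rewrite [leRHS]integral_mkcond; apply: ge0_le_integral => //.
- by move=> x _; rewrite lee_fin sqr_ge0.
- by apply/measurable_EFinP; exact: measurable_funX.
- exact/(measurable_restrictT _ _).1.
move=> x _; rewrite /patch; case: ifPn => [_|xO]; last first.
  have nx : ~ cube a r x by move=> xr; case/negP: xO; rewrite inE; exact: sub.
  by rewrite cut0// expr0n.
rewrite lee_fin /extnorm sqr_sqrtr; last first.
  by apply: sumr_ge0 => T _; rewrite -expr2 sqr_ge0.
apply: (@le_trans _ _ (G x S * G x S)).
  rewrite /cut exprMn -expr2 ler_piMr ?sqr_ge0// indicE; case: (_ \in _); rewrite ?expr1n ?expr0n//=.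
rewrite /inner (bigD1 S)//= lerDl; apply: sumr_ge0 => T _; by rewrite -expr2 sqr_ge0.
Qed.

Lemma distributional_cut c Omega F G a r phi S : distributional c Omega F G -> open Omega ->
  cube a r `<=` Omega -> test_function (cube a r) phi ->
  \int[mu]_x (phi x * cut G a r S x) =
  - \int[mu]_x (\sum_j partial j phi x * (c j (F x) S * \1_(cube a r) x)).
Proof.
move=> dist oO sub tphi; have mO := rV_open_measurable oO.
have := dist phi (test_subset sub tphi) S.
have E1 : \int[leb R n]_(x in Omega) (phi x * G x S) = \int[mu]_x (phi x * cut G a r S x).
  rewrite [LHS](@Rintegral_setT _ _ _ mu _ _ mO); apply: eq_Rintegral => x _.
  have [xr|xr] := pselect (cube a r x).
    by rewrite cutE// indicE mem_set ?mulr1//; exact: sub.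
  have -> : phi x = 0 by apply/eqP/negPn/negP => /(test_supp tphi).
  by rewrite !mul0r.
have E2 : \int[leb R n]_(x in Omega) (\sum_j partial j phi x * c j (F x) S) =
    \int[mu]_x (\sum_j partial j phi x * (c j (F x) S * \1_(cube a r) x)).
  rewrite [LHS](@Rintegral_setT _ _ _ mu _ _ mO); apply: eq_Rintegral => x _.
  rewrite mulr_suml; apply: eq_bigr => j _.
  have [xr|xr] := pselect (cube a r x).
    by rewrite !indicE !mem_set ?mulr1//; exact: sub.
  have -> : partial j phi x = 0 by apply/eqP/negPn/negP => /(test_supp (test_partial j tphi)).
  by rewrite !mul0r.
by rewrite E1 E2.
Qed.

Lemma Dplus_cut Omega F P a r phi S : is_Dplus Omega F P -> open Omega ->
  cube a r `<=` Omega -> test_function (cube a r) phi ->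
  \int[mu]_x (phi x * cut P a r S x) =
  - \int[mu]_x (\sum_j partial j phi x * (sgn R j S * cut F a r (tog j S) x)).
Proof.
move=> dist oO sub tphi; rewrite (distributional_cut S dist oO sub tphi).
congr (- _); apply: eq_Rintegral => x _; apply: eq_bigr => j _.
by rewrite Dplus_coefE /cut !mulrA.
Qed.

Lemma Dminus_cut Omega F Q a r phi S : is_Dminus Omega F Q -> open Omega ->
  cube a r `<=` Omega -> test_function (cube a r) phi ->
  \int[mu]_x (phi x * cut Q a r S x) =
  - \int[mu]_x (\sum_j partial j phi x *
     ((if j \in S then 1 else -1) * (sgn R j S * cut F a r (tog j S) x))).
Proof.
move=> dist oO sub tphi; rewrite (distributional_cut S dist oO sub tphi).
congr (- _); apply: eq_Rintegral => x _; apply: eq_bigr => j _.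
by rewrite Dminus_coefE /cut !mulrA.
Qed.

Lemma test_mul_L1 phi f Omega : L1 mu setT f -> test_function Omega phi ->
  L1 mu setT (fun x => phi x * f x).
Proof. by move=> Lf tphi; under eq_fun do rewrite mulrC; exact: L1_mul_test Lf tphi. Qed.

Variables (Omega : set rV) (F P Q : rV -> extalg R n).
Hypotheses (oO : open Omega) (LF : ext_L2 Omega F) (LP : ext_L2 Omega P) (LQ : ext_L2 Omega Q).
Hypotheses (DP : is_Dplus Omega F P) (DQ : is_Dminus Omega F Q).

Section cube.
Variables (a : rV) (r : R).
Hypothesis sub : cube a r `<=` Omega.
Local Notation f := (cut F a r).
Local Notation p := (cut P a r).
Local Notation q := (cut Q a r).

Let L1c G S : ext_L2 Omega G -> L1 mu setT (cut G a r S).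
Proof. by move=> LG; apply: (L2_cube_L1 (cut_L2 S LG oO sub)) => x; exact: cut0. Qed.

(* D^+ squares to the Laplacian. *)
Lemma laplacian_cut psi S : test_function (cube a r) psi ->
  \int[mu]_x (f S x * \sum_i partial i (partial i psi) x) =
  - \int[mu]_x (\sum_i partial i psi x * (sgn R i S * p (tog i S) x)).
Proof.
move=> tpsi; have tp i := test_partial i tpsi; have tpp i j := test_partial j (tp i).
have spsi : smooth psi by case: tpsi.
have E i : \int[mu]_x (partial i psi x * (sgn R i S * p (tog i S) x)) =
    - \int[mu]_x (\sum_j sgn R i S * (partial j (partial i psi) x *
       (sgn R j (tog i S) * f (tog j (tog i S)) x))).
  under eq_Rintegral do rewrite mulrCA.
  rewrite RintegralZl//; last by apply: test_mul_L1 (tp i); exact: L1c.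
  rewrite (Dplus_cut (tog i S) DP oO sub (tp i)) mulrN; congr (- _).
  rewrite -RintegralZl//; last first.
    by apply: L1_sum => // j _; apply: test_mul_L1 (tpp i j); apply: L1Z => //; exact: L1c.
  by apply: eq_Rintegral => x _; rewrite mulr_sumr.
rewrite Rintegral_sum//; last by move=> i _; apply: test_mul_L1 (tp i); apply: L1Z => //; exact: L1c.
rewrite (eq_bigr _ (fun i _ => E i)) sumrN opprK -Rintegral_sum//; last first.
  move=> i _; apply: L1_sum => // j _; apply: L1Z => //; apply: test_mul_L1 (tpp i j).
  by apply: L1Z => //; exact: L1c.
apply: eq_Rintegral => x _; rewrite antisym_sum.
  rewrite mulr_sumr; apply: eq_bigr => i _; rewrite togK.
  have := @sgn_togtog R n i S; move: (sgn R i S) (sgn R i (tog i S)) (partial i _ x) (f S x) => s1 s2 t w h.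
  by rewrite (_ : s1 * (t * (s2 * w)) = (s1 * s2) * (w * t)); [rewrite h mul1r|ring].
move=> i j ij; rewrite togC (partialC j i spsi).
have := @sgn_anti R n i j S ij; move: (sgn R i S) (sgn R j S) (sgn R j (tog i S)) (sgn R i (tog j S)).
move: (partial i _ x) (f _ x) => t w s1 s2 s3 s4 h.
rewrite (_ : s1 * (t * (s3 * w)) = (s1 * s3) * (t * w)); last by ring.
by rewrite h; ring.
Qed.

Let g i x := 1/2 * p [set i]%SET x + 1/2 * q [set i]%SET x.
Let V i x := 1/2 * p [set i]%SET x - 1/2 * q [set i]%SET x.

(** The half sum of D^+ and D^- is d. On the blade e_i only j = i survives, and there [tog] gives
    the empty set, that is, the scalar part. *)
Lemma grad_cut phi i : test_function (cube a r) phi ->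
  \int[mu]_x (f finset.set0 x * partial i phi x) = - \int[mu]_x (g i x * phi x).
Proof.
move=> tphi; have tp j := test_partial j tphi.
have LfT T j c : L1 mu setT (fun x => partial j phi x * (c * f T x)).
  by apply: test_mul_L1 (tp j); apply: L1Z => //; exact: L1c.
have -> : \int[mu]_x (g i x * phi x) =
    1/2 * \int[mu]_x (phi x * p [set i]%SET x) + 1/2 * \int[mu]_x (phi x * q [set i]%SET x).
  have Lp : L1 mu setT (fun x => phi x * p [set i]%SET x) by apply: test_mul_L1 tphi; exact: L1c.
  have Lq : L1 mu setT (fun x => phi x * q [set i]%SET x) by apply: test_mul_L1 tphi; exact: L1c.
  rewrite -!RintegralZl// -RintegralD//; [|exact: L1Z|exact: L1Z].
  by apply: eq_Rintegral => x _; rewrite /g; ring.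
rewrite (Dplus_cut _ DP oO sub tphi) (Dminus_cut _ DQ oO sub tphi) !mulrN -opprD opprK.
rewrite -!RintegralZl//; last 2 first.
- apply: L1_sum => // j _; apply: test_mul_L1 (tp j); apply: L1Z => //; apply: L1Z => //; exact: L1c.
- by apply: L1_sum => // j _; exact: LfT.
rewrite -RintegralD//; last 2 first.
- by apply: L1Z => //; apply: L1_sum => // j _; exact: LfT.
- apply: L1Z => //; apply: L1_sum => // j _; apply: test_mul_L1 (tp j); apply: L1Z => //; apply: L1Z => //; exact: L1c.
apply: eq_Rintegral => x _; rewrite -mulrDr -big_split/= (bigD1 i)//= big1 ?addr0 => [|j ji].
  rewrite inE eqxx mul1r (_ : tog i [set i]%SET = finset.set0); last first.
    by apply/setP => t; rewrite in_tog !inE; case: (_ == _).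
  rewrite (_ : sgn R i [set i]%SET = 1); last by rewrite /sgn inversions11 ltnn.
  by rewrite mul1r; field.
by rewrite inE (negbTE ji); ring.
Qed.

(** The half difference of D^+ and D^- is delta, so V is delta of the bivector part and its
    divergence vanishes because delta squares to 0. *)
Lemma div_cut phi : test_function (cube a r) phi ->
  \int[mu]_x (\sum_i V i x * partial i phi x) = 0.
Proof.
move=> tphi; have tp j := test_partial j tphi; have tpp i j := test_partial j (tp i).
have sphi : smooth phi by case: tphi.
have LfT T i j c : L1 mu setT (fun x => partial j (partial i phi) x * (c * f T x)).
  by apply: test_mul_L1 (tpp i j); apply: L1Z => //; exact: L1c.
(* For j different from i the bivector coordinate on {i, j} occurs with opposite signs in b i j and
   b j i, while the second derivatives commute. *)
pose b i j x := partial j (partial i phi) x * ((if j == i then 0 else 1) * (sgn R j [set i]%SET * f (tog j [set i]%SET) x)).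
have Lb i j : L1 mu setT (b i j).
  by rewrite /b; apply: test_mul_L1 (tpp i j); apply: L1Z => //; apply: L1Z => //; exact: L1c.
have E i : \int[mu]_x (V i x * partial i phi x) = - \int[mu]_x (\sum_j b i j x).
  have Lp : L1 mu setT (fun x => partial i phi x * p [set i]%SET x) by apply: test_mul_L1 (tp i); exact: L1c.
  have Lq : L1 mu setT (fun x => partial i phi x * q [set i]%SET x) by apply: test_mul_L1 (tp i); exact: L1c.
  have -> : \int[mu]_x (V i x * partial i phi x) =
      1/2 * \int[mu]_x (partial i phi x * p [set i]%SET x) - 1/2 * \int[mu]_x (partial i phi x * q [set i]%SET x).
    rewrite -!RintegralZl// -RintegralB//; [|exact: L1Z|exact: L1Z].
    by apply: eq_Rintegral => x _; rewrite /V; ring.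
  rewrite (Dplus_cut _ DP oO sub (tp i)) (Dminus_cut _ DQ oO sub (tp i)) !mulrN opprK.
  have L1a : L1 mu setT (fun x => \sum_j partial j (partial i phi) x * (sgn R j [set i]%SET * f (tog j [set i]%SET) x)).
    by apply: L1_sum => // j _; exact: LfT.
  have L1b : L1 mu setT (fun x => \sum_j partial j (partial i phi) x *
      ((if j \in [set i]%SET then 1 else -1) * (sgn R j [set i]%SET * f (tog j [set i]%SET) x))).
    apply: L1_sum => // j _; apply: test_mul_L1 (tpp i j); apply: L1Z => //; apply: L1Z => //; exact: L1c.
  rewrite -!RintegralZl// addrC -opprB; congr (- _).
  rewrite -RintegralB//; [|exact: L1Z|exact: L1Z].
  apply: eq_Rintegral => x _; rewrite -mulrBr -sumrB mulr_sumr; apply: eq_bigr => j _.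
  by rewrite /b inE; case: eqVneq => _; field.
rewrite Rintegral_sum//; last first.
  move=> i _; have LV : L1 mu setT (V i) by apply: L1B => //; apply: L1Z => //; exact: L1c.
  exact: L1_mul_test LV (tp i).
rewrite (eq_bigr _ (fun i _ => E i)) sumrN -Rintegral_sum//; last by move=> i _; apply: L1_sum.
apply/eqP; rewrite oppr_eq0; apply/eqP; rewrite (_ : (fun x => _) = fun=> 0).
  by rewrite /Rintegral integral0.
apply/funext => x; rewrite antisym_sum => [|i j ij]; last first.
  rewrite /b (partialC j i sphi) eq_sym (negbTE ij).
  have -> : tog j [set i]%SET = tog i [set j]%SET.
    by apply/setP => t; rewrite !in_tog !inE addbC.
  have -> : sgn R j [set i]%SET = - sgn R i [set j]%SET.
    rewrite /sgn !inversions11; case: (ltngtP i j) => [_|_|/val_inj ije]; rewrite ?expr0 ?expr1 ?opprK//.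
    by rewrite ije eqxx in ij.
  by ring.
by apply: big1 => i _; rewrite /b eqxx mul0r mulr0.
Qed.
End cube.
End beltrami_local.

(** * The Beltrami equation *)

Section beltrami_cube.
Variables (R : realType) (n : nat).
Local Notation rV := 'rV[R]_n.
Local Notation mu := (@lebn R n).
Implicit Types (a x y : rV) (r s k : R) (S T : {set 'I_n}).
Variables (Omega : set rV) (M : rV -> 'M[R]_n) (F P Q : rV -> extalg R n) (kap : R).
Hypotheses (oO : open Omega) (LF : ext_L2 Omega F) (LP : ext_L2 Omega P) (LQ : ext_L2 Omega Q).
Hypotheses (DP : is_Dplus Omega F P) (DQ : is_Dminus Omega F Q).
Hypotheses (kap0 : 0 <= kap) (kap1 : kap < 1)
  (hM : {ae mu, forall x, Omega x -> opnorm (M x) <= kap})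
  (h02 : {ae mu, forall x, Omega x -> ext02 (F x)})
  (hQ : {ae mu, forall x, Omega x -> Q x = exterior_ext (M x) (P x)}).

Section cube.
Variables (a : rV) (s : R).
Hypotheses (s0 : 0 < s) (sub2 : cube a (2 * s) `<=` Omega).

Let ss : s < 2 * s. Proof. by have := s0; lra. Qed.

Let sub : cube a s `<=` Omega.
Proof. by apply: subset_trans sub2; apply: cubeS; exact: ltW. Qed.

Let F_off S j : {ae mu, forall x, #|tog j S| != 0%N -> #|tog j S| != 2%N ->
  cut F a (2 * s) (tog j S) x = 0}.
Proof.
apply: filterS h02 => x h t0 t2; have [xr|xr] := pselect (cube a (2 * s) x); last exact: cut0.
rewrite cutE//; apply/eqP/negPn/negP => /(h (sub2 xr)) [] E; [move: t0|move: t2]; by rewrite E eqxx.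
Qed.

Let L1c G S r : ext_L2 Omega G -> cube a r `<=` Omega -> L1 mu setT (cut G a r S).
Proof. by move=> LG subr; apply: (L2_cube_L1 (cut_L2 S LG oO subr)) => x; exact: cut0. Qed.

Let weak0 S (phi : rV -> R) (c : 'I_n -> R) : test_function (cube a (2 * s)) phi ->
  (forall j, c j != 0 -> #|tog j S| != 0%N /\ #|tog j S| != 2%N) ->
  \int[mu]_x (\sum_j partial j phi x * (c j * cut F a (2 * s) (tog j S) x)) = 0.
Proof.
move=> tphi hc; have z : {ae mu, forall x, setT x -> \sum_j partial j phi x * (c j * cut F a (2 * s) (tog j S) x) = 0}.
  apply: filterS (ae_forall_fin (fun j => F_off S j)) => x h _; apply: big1 => j _.
  have [->|/hc[t0 t2]] := eqVneq (c j) 0; first by rewrite mul0r mulr0.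
  by rewrite h// !mulr0.
rewrite (eq_Rintegral_ae measurableT _ _ z); first by rewrite /Rintegral integral0.
  apply: L1_sum => // j _; apply: test_mul_L1 (test_partial j tphi).
  by apply: L1Z => //; exact: L1c.
exact: integrable0.
Qed.

(** D^+ changes the degree by one and F has degrees 0 and 2. The test is made on the cube of radius
    2 s and read on that of radius s. *)
Let P_off S : #|S| != 1%N -> #|S| != 3%N -> {ae mu, forall x, cube a s x -> P x S = 0}.
Proof.
move=> S1 S3; have L2P := cut_L2 S LP oO sub2.
have h : {ae mu, forall x, cube a s x -> cut P a (2 * s) S x = 0}.
  apply: (du_bois_reymond L2P (fun x => @cut0 _ _ P a (2 * s) S x) ss) => phi tphi.
  rewrite (Dplus_cut S DP oO sub2 tphi) weak0 ?oppr0// => j _.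
  rewrite card_tog; case: ifPn => jS; last by split; move: S1 S3; case: #|S| => [|[|[|[|m]]]].
  have : (0 < #|S|)%N by rewrite card_gt0; apply/set0Pn; exists j.
  by split; move: S1 S3; move: H; case: #|S| => [|[|[|[|m]]]].
by apply: filterS h => x hx xs; rewrite -(hx xs) cutE//; exact: (cubeS (ltW ss) xs).
Qed.

(** In degree three only j in S can meet the degree two part of F, and for those j the coefficients
    of D^+ and D^- agree. *)
Let PQ3 S : #|S| = 3%N -> {ae mu, forall x, cube a s x -> P x S = Q x S}.
Proof.
move=> S3; have [L2P L2Q] := (cut_L2 S LP oO sub2, cut_L2 S LQ oO sub2).
have h : {ae mu, forall x, cube a s x -> cut P a (2 * s) S x - cut Q a (2 * s) S x = 0}.
  apply: (du_bois_reymond (L2B L2P L2Q) _ ss) => [x nx|phi tphi]; first by rewrite !cut0// subrr.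
  have tp j := test_partial j tphi.
  have LD (c : 'I_n -> R) : L1 mu setT (fun x => \sum_j partial j phi x * (c j * cut F a (2 * s) (tog j S) x)).
    apply: L1_sum => // j _; apply: test_mul_L1 (tp j); apply: L1Z => //; exact: L1c.
  have E1 := Dplus_cut S DP oO sub2 tphi.
  have E2 := Dminus_cut S DQ oO sub2 tphi.
  under eq_Rintegral do rewrite mulrBr.
  rewrite RintegralB//; [|by apply: test_mul_L1 tphi; exact: L1c|by apply: test_mul_L1 tphi; exact: L1c].
  rewrite E1 E2 opprK.
  have := @weak0 S phi (fun j => sgn R j S - (if j \in S then 1 else -1) * sgn R j S) tphi.
  have -> : \int[mu]_x (\sum_j partial j phi x * ((if j \in S then 1 else -1) * (sgn R j S * cut F a (2 * s) (tog j S) x))) =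
      \int[mu]_x (\sum_j partial j phi x * ((if j \in S then 1 else -1) * sgn R j S * cut F a (2 * s) (tog j S) x)).
    by apply: eq_Rintegral => x _; apply: eq_bigr => j _; congr (_ * _); exact: mulrA.
  rewrite addrC -RintegralB//; last 2 first.
  - exact: (LD (fun j => (if j \in S then 1 else -1) * sgn R j S)).
  - exact: (LD (fun j => sgn R j S)).
  move=> W; apply/eqP; rewrite -oppr_eq0 -RintegralN//; last first.
    by apply: L1B; [|exact: (LD (fun j => (if j \in S then 1 else -1) * sgn R j S))|exact: (LD (fun j => sgn R j S))].
  apply/eqP; rewrite -[RHS]W.
    apply: eq_Rintegral => x _; rewrite opprB -sumrB; apply: eq_bigr => j _.
    by rewrite mulrBl mulrBr.
  move=> j; rewrite card_tog; case: ifPn => jS; first by rewrite mul1r subrr eqxx.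
  by rewrite S3.
apply: filterS h => x hx xs; apply/eqP; rewrite -subr_eq0 -(hx xs).
by rewrite !cutE//; exact: (cubeS (ltW ss) xs).
Qed.

Let pointwise : {ae mu, forall x, cube a s x -> [/\ forall S, #|S| != 1%N -> P x S = 0,
  forall i, Q x [set i]%SET = \sum_j P x [set j]%SET * M x j i & opnorm (M x) <= kap]}.
Proof.
have h1 : {ae mu, forall x, forall S, cube a s x -> #|S| != 1%N -> #|S| != 3%N -> P x S = 0}.
  apply: ae_forall_fin => S; have [S1|S1] := eqVneq #|S| 1%N; first exact: aeW.
  have [S3|S3] := eqVneq #|S| 3%N; first exact: aeW.
  by apply: filterS (P_off S1 S3) => x h xs _ _; exact: h.
have h3 : {ae mu, forall x, forall S, cube a s x -> #|S| = 3%N -> P x S = Q x S}.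
  apply: ae_forall_fin => S; have [S3|S3] := eqVneq #|S| 3%N; last by apply: aeW => x _ /eqP; rewrite (negbTE S3).
  by apply: filterS (PQ3 S3) => x h xs _; exact: h.
apply: filterS2 (filterI h1 h3) (filterI hM hQ) => x [{}h1 {}h3] [Mx Qx] xs.
have xO := sub xs.
have g3 : grade 3 (P x) = 0.
  (* The exterior extension preserves degrees, and P and Q agree in degree three. *)
  apply: (@exterior_ext_fixed R n (M x) kap 2 _ (Mx xO) kap0 kap1).
    by apply/ffunP => S; rewrite !ffunE; case: eqP.
  rewrite exterior_ext_grade -Qx//; apply/ffunP => S; rewrite !ffunE; case: eqP => // S3.
  by rewrite h3.
split; [|by move=> i; rewrite Qx// exterior_ext1E|exact: Mx].
move=> S S1; have [S3|S3] := eqVneq #|S| 3%N; last exact: h1.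
by move/ffunP : g3 => /(_ S); rewrite !ffunE S3 eqxx.
Qed.

Let p i := cut P a s [set i]%SET.
Let q i := cut Q a s [set i]%SET.

(** The ellipticity constant comes from |q| <= kap |p| inserted in V . g = (|p|^2 - |q|^2) / 4. *)
Lemma beltrami_sol : local_sol ((1 - kap ^+ 2) / 4) a s (cut F a s finset.set0)
  (fun i x => 1/2 * p i x + 1/2 * q i x) (fun i x => 1/2 * p i x - 1/2 * q i x)
  (fun x => \sum_i p i x ^+ 2).
Proof.
have L2p i : L2 (p i) by exact: cut_L2 LP oO sub.
have L2q i : L2 (q i) by exact: cut_L2 LQ oO sub.
split.
- exact: cut_L2 LF oO sub.
- by move=> i; apply: L2D; exact: L2Z.
- by move=> i; apply: L2B; exact: L2Z.
- by apply: L1_sum => // i _; have [] := L2p i.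
- by move=> x; exact: cut0.
- by move=> i x nx; rewrite /p /q !cut0// !mulr0 addr0.
- by move=> phi i tphi; exact: (grad_cut oO LF LP LQ DP DQ sub i tphi).
- by move=> phi tphi; exact: (div_cut oO LF LP LQ DP DQ sub tphi).
apply: filterS pointwise => x h xs; have [P0 Qx Mx] := h xs.
pose v : rV := \row_i P x [set i]%SET.
have pE i : p i x = v 0 i by rewrite /p cutE// mxE.
have qE i : q i x = (v *m M x) 0 i.
  by rewrite /q cutE// Qx mxE; apply: eq_bigr => j _; rewrite mxE.
have qp : \sum_i q i x ^+ 2 <= kap ^+ 2 * \sum_i p i x ^+ 2.
  under eq_bigr do rewrite qE; under [in leRHS]eq_bigr do rewrite pE.
  rewrite -/(sqn _) -/(sqn v) -!enorm_sqr -exprMn; apply: le_sqr; first exact: enorm_ge0.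
  by apply: le_trans (opnorm_bound _ _) _; rewrite ler_wpM2r ?enorm_ge0.
have p0 : 0 <= \sum_i p i x ^+ 2 by apply: sumr_ge0 => i _; exact: sqr_ge0.
have qp1 : \sum_i q i x ^+ 2 <= \sum_i p i x ^+ 2.
  by apply: le_trans qp _; rewrite ler_piMl// expr_le1// ltW.
(* The signs 1 and -1 give the bounds for the gradient and for V together. *)
have half (sg : R) : sg ^+ 2 = 1 -> \sum_i (1/2 * p i x + sg * (1/2 * q i x)) ^+ 2 <= \sum_i p i x ^+ 2.
  move=> sg1; apply: (@le_trans _ _ (1/2 * \sum_i p i x ^+ 2 + 1/2 * \sum_i q i x ^+ 2)); last first.
    by move: qp1; move: (\sum_i _) (\sum_i _) => *; lra.
  rewrite !mulr_sumr -big_split/=; apply: ler_sum => i _.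
  apply: le_trans (sqrD_le _ _) _; rewrite !exprMn sg1 mul1r.
  by rewrite le_eqVlt; apply/orP; left; apply/eqP; field.
split.
- rewrite [leRHS](_ : _ = 1/4 * \sum_i p i x ^+ 2 - 1/4 * \sum_i q i x ^+ 2).
    by move: qp; move: (\sum_i _) (\sum_i _) => *; lra.
  by rewrite !mulr_sumr -sumrB; apply: eq_bigr => i _; field.
- by have := half 1 (expr1n _ _); under eq_bigr do rewrite [1 * (_ * _)]mul1r.
have sN : (-1) ^+ 2 = 1 :> R by rewrite sqrrN expr1n.
by have := half (-1) sN; under eq_bigr do rewrite mulN1r.
Qed.

(** All coordinates of D^+ F outside of degree one vanish, so the right-hand side for every
    coordinate of F is controlled by the energy of the scalar part. *)
Lemma beltrami_bound S : {ae mu, forall x, cube a s x -> forall i,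
  (sgn R i S * cut P a s (tog i S) x) ^+ 2 <= \sum_j p j x ^+ 2}.
Proof.
apply: filterS pointwise => x h xs i; have [P0 _ _] := h xs.
rewrite exprMn expr2 sgn_sqr mul1r cutE//.
have [/finset.cards1P[j ->]|T1] := boolP (#|tog i S| == 1%N).
  rewrite (bigD1 j)//= {1}/p cutE// lerDl; apply: sumr_ge0 => l _; exact: sqr_ge0.
by rewrite P0// expr0n; apply: sumr_ge0 => l _; exact: sqr_ge0.
Qed.
End cube.
End beltrami_cube.

(** * From cubes to compact subsets *)

Section holder.
Variables (R : realType) (n : nat).
Local Notation rV := 'rV[R]_n.
Local Notation mu := (@lebn R n).
Implicit Types (a x y z : rV) (r s kap alpha : R) (S : {set 'I_n}) (w : extalg R n).

Definition norm1 w : R := \sum_S `|w S|.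

Lemma norm1_ge0 w : 0 <= norm1 w. Proof. exact: sumr_ge0. Qed.

Lemma norm1B w w' : norm1 (w - w') <= norm1 w + norm1 w'.
Proof.
by rewrite /norm1 -big_split/=; apply: ler_sum => S _; rewrite !ffunE (le_trans (ler_normB _ _)).
Qed.

Lemma extnorm_norm1 w : extnorm w <= norm1 w.
Proof.
rewrite /extnorm -(ger0_norm (norm1_ge0 w)) -sqrtr_sqr; apply: ler_wsqrtr.
rewrite /inner expr2 {1}/norm1 mulr_suml; apply: ler_sum => S _.
have -> : w S * w S = `|w S| * `|w S| by rewrite -normrM ger0_norm// -expr2 sqr_ge0.
by rewrite ler_wpM2l// /norm1 (bigD1 S)//= lerDl sumr_ge0.
Qed.

(** For large k the kernel centred at x is supported in the cube on which the two functions
    agree. *)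
Lemma mollified_limit_local (f f' : rV -> R) a s x : (forall y, cube a s y -> f y = f' y) ->
  0 < s -> cube a (s / 8) x -> mollified_limit f x = mollified_limit f' x.
Proof.
move=> ff s0 xs; rewrite /mollified_limit.
set u := fun k : nat => conv f _ x; set v := fun k : nat => conv f' _ x.
have uv : \forall k \near \oo, u k = v k.
  have h0 : 0 < s / 8 by rewrite divr_gt0.
  have [N hN] : exists N : nat, 1 / 5 ^+ N <= s / 8.
    have t0 : 0 < Num.min 1 (s / 8) by rewrite lt_min ltr01.
    have [|j [hj _]] := scale_exists t0 (_ : _ <= 1); first by rewrite ge_min lexx.
    by exists j.+1; apply: le_trans (ltW hj) _; rewrite ge_min lexx orbT.
  exists N => // k /= Nk; rewrite /u /v /conv; apply: eq_Rintegral => y _.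
  have r0 : 0 < 1 / 5 ^+ k :> R by rewrite divr_gt0// exprn_gt0.
  have rk : 1 / 5 ^+ k <= s / 8.
    apply: le_trans hN; rewrite !mul1r lef_pV2 ?posrE ?exprn_gt0//.
    by rewrite ler_weXn2l// ler1n.
  have [->|/(ker_supp r0) h] := eqVneq (@ker R n (1 / 5 ^+ k) (x - y)) 0; first by rewrite !mulr0.
  congr (_ * _); apply: ff.
  have : cube x (1 / 5 ^+ k) y by apply/(@cube_norm R n x (1 / 5 ^+ k) y (ltW r0)); rewrite distrC.
  move=> yx i; have := yx i; have := xs i; move: rk s0.
  by move: (1 / 5 ^+ k) (a 0 i) (x 0 i) (y 0 i) => *; lra.
have vu : \forall k \near \oo, v k = u k by apply: filterS uv.
congr lim; apply/seteqP; split; exact: near_eq_cvg.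
Qed.

Lemma ess_contractive_bound (Omega : set rV) (M : rV -> 'M[R]_n) : ess_contractive Omega M ->
  exists kap : R, [/\ 0 <= kap, kap < 1 & {ae mu, forall x, Omega x -> opnorm (M x) <= kap}].
Proof.
move=> [_]; set K := ess_sup _ _ => K1.
have hK : {ae mu, forall x, (((fun x => (opnorm (M x))%:E) \_ Omega) x <= K)%E} by exact: ess_sup_ge.
have [k [k0 k1 Kk]] : exists k : R, [/\ 0 <= k, k < 1 & (K <= k%:E)%E].
  (* The essential supremum is an extended real: the value +oo contradicts K < 1, and for -oo the
     bound 0 serves. *)
  case: K K1 {hK} => [k|//|_]; last by exists 0; split; rewrite ?leNye.
  rewrite lte_fin => k1; exists (Num.max k 0); split; first by rewrite le_max lexx orbT.
    by rewrite gt_max k1 ltr01.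
  by rewrite lee_fin le_max lexx.
exists k; split => //; apply: filterS hK => x hx xO.
by move: (le_trans hx Kk); rewrite /patch mem_set// lee_fin.
Qed.

Lemma cube_nbhs (Omega : set rV) x : open Omega -> Omega x ->
  exists s, 0 < s /\ cube x s `<=` Omega.
Proof.
move=> oO /oO/nbhs_ballP[e /= e0 he]; have e2 : 0 < e / 2 by rewrite divr_gt0.
exists (e / 2); split => // y /(@cube_norm R n x (e / 2) y (ltW e2)) h; apply: he.
by rewrite -ball_normE /ball_/= distrC (le_lt_trans h)// ltr_pdivrMr// ltr_pMr// ltr1n.
Qed.

Lemma rat_approx x (r : R) : 0 < r -> exists q : 'rV[rat]_n, cube (map_mx ratr q : rV) r x.
Proof.
move=> r0; have h i : exists q : rat, x 0 i - r <= ratr q <= x 0 i + r.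
  have /rat_in_itvoo[q] : x 0 i - r < x 0 i + r by move: (x 0 i) => t; lra.
  by rewrite in_itv/= => /andP[/ltW a1 /ltW a2]; exists q; rewrite a1 a2.
exists (\row_i sval (cid (h i))) => i; rewrite !mxE; case: cid => q /=.
by move: (x 0 i) (ratr q) => t u; lra.
Qed.

(** The cubes with rational centre and radius 8 / 5^j are countably many, and the concentric cubes
    of radius 5^-j cover Omega. *)
Lemma ae_cover (Omega : set rV) (p : rV -> Prop) : open Omega ->
  (forall a s, 0 < s -> cube a (2 * s) `<=` Omega -> {ae mu, forall x, cube a (s / 8) x -> p x}) ->
  {ae mu, forall x, Omega x -> p x}.
Proof.
move=> oO h.
pose c (q : 'rV[rat]_n * nat) : rV * R := (map_mx ratr q.1, 8 / 5 ^+ q.2).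
have all : {ae mu, forall x, forall k : nat, if @unpickle ('rV[rat]_n * nat)%type k is Some q
    then cube (c q).1 (2 * (c q).2) `<=` Omega -> cube (c q).1 ((c q).2 / 8) x -> p x else True}.
  apply/ae_foralln => k; case: unpickle => [q|]; last exact: aeW.
  have [sub|nsub] := pselect (cube (c q).1 (2 * (c q).2) `<=` Omega); last by apply: aeW => x /nsub.
  have c0 : 0 < (c q).2 by rewrite divr_gt0// exprn_gt0.
  by apply: filterS (h _ _ c0 sub) => x hx _.
apply: filterS all => x hx xO; have [s [s0 sub]] := cube_nbhs oO xO.
(* The centre is at distance at most r from x and the cube has radius 8 r; its double has radius 16
   r and lies within 17 r of x. *)
have t0 : 0 < Num.min 1 (s / 17) by rewrite lt_min ltr01 divr_gt0.
have [|j [hj _]] := scale_exists t0 (_ : _ <= 1); first by rewrite ge_min lexx.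
pose r : R := 1 / 5 ^+ j.+1.
have r0 : 0 < r by rewrite divr_gt0// exprn_gt0.
have rs : 17 * r <= s.
  have : r <= s / 17 by apply: le_trans (ltW hj) _; rewrite ge_min lexx orbT.
  by lra.
have [q hq] := rat_approx x r0.
have := hx (pickle (q, j.+1)); rewrite pickleK /c/=.
have -> : 8 / 5 ^+ j.+1 = 8 * r by rewrite /r mul1r.
have -> : 8 * r / 8 = r by field.
apply => //; apply: subset_trans sub => y hy i; have := hy i; have := hq i.
by move: rs; move: (map_mx _ _ 0 i) (x 0 i) (y 0 i) => *; lra.
Qed.

(** Compactness gives one m that is a Hoelder constant at distances up to 1/(m+1) and a bound on K.
    Pairs farther apart are handled by the bound. The sup norm is at most the Euclidean norm, which
    fits the conclusion. *)
Lemma holder_compact (Omega : set rV) (F : rV -> extalg R n) alpha : 0 < alpha ->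
  (forall x, Omega x -> exists d C : R, [/\ 0 < d, 0 <= C & forall y z,
    `|y - x| <= d -> `|z - x| <= d -> norm1 (F y - F z) <= C * `|y - z| `^ alpha]) ->
  forall K : set rV, compact K -> K `<=` Omega -> exists C : R, forall x y, K x -> K y ->
    extnorm (F x - F y) <= C * enorm (x - y) `^ alpha.
Proof.
move=> al0 loc K cK KO.
pose p (m : nat) y := (forall z, `|y - z| <= m.+1%:R^-1 -> norm1 (F y - F z) <= m%:R * `|y - z| `^ alpha)
  /\ norm1 (F y) <= m%:R.
have /compact_near_coveringP cov := cK.
have [m _ /(_ m (leqnn m)) hm] : \forall m \near \oo, K `<=` p m.
  apply: cov => x /KO/loc [d [C [d0 C0 hC]]].
  have d2 : 0 < d / 2 by rewrite divr_gt0.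
  (* Each summand forces one requirement on m: Hoelder constant C, radius 1/(m+1) <= d / 2, and a
     bound for F within distance d of x. *)
  pose r := C + 2 / d + norm1 (F x) + C * d `^ alpha.
  have nb : nbhs x (fun y => `|y - x| <= d / 2).
    have /cvgrPdist_le/(_ _ d2) : id @ x --> x by exact: cvg_id.
    by apply: filterS => y; rewrite distrC.
  have [N _ hN] := @nbhs_infty_ger R r.
  exists ([set y | `|y - x| <= d / 2], [set m | (N <= m)%N]); first by split => //; exists N.
  move=> [y m] /= [yx Nm]; have rm : r <= m%:R by exact: hN.
  have dp : 0 <= d `^ alpha by exact: powR_ge0.
  have [Cm dm nm] : [/\ C <= m%:R, 2 / d <= m%:R & norm1 (F x) + C * d `^ alpha <= m%:R].
    have := norm1_ge0 (F x); have := mulr_ge0 C0 dp; have : 0 <= 2 / d by rewrite divr_ge0// ltW.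
    by move: rm C0; rewrite /r; move: (2 / d) (norm1 _) (C * _) (m%:R) => *; split; lra.
  have yd : `|y - x| <= d by move: yx; move: (`|_|) d0 => *; lra.
  split => [z zy|].
    have md : m.+1%:R^-1 <= d / 2.
      rewrite invf_ple ?posrE// invf_div (le_trans dm)// ler_nat.
      exact: leqnSn.
    have zd : `|z - x| <= d.
      rewrite (_ : z - x = (y - x) - (y - z)); last by rewrite opprB [RHS]addrC addrA subrK.
      apply: le_trans (ler_normB _ _) _; have := le_trans zy md; move: yx.
      by move: (`|_|) (`|_|) => *; lra.
    by apply: le_trans (hC y z yd zd) _; rewrite ler_wpM2r// powR_ge0.
  have xd : `|x - x| <= d by rewrite subrr normr0 ltW.
  have h := hC x y xd yd; have -> : F y = F x - (F x - F y) by rewrite subKr.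
  apply: le_trans (norm1B _ _) _; apply: le_trans nm; rewrite lerD2l; apply: le_trans h _.
  rewrite ler_wpM2l//; apply: ge0_ler_powR; rewrite ?nnegrE ?(ltW al0) ?(ltW d0)//.
  by rewrite distrC.
pose t := m.+1%:R^-1 `^ alpha : R.
have t0 : 0 < t by rewrite powR_gt0// invr_gt0.
(* The first term serves for close pairs; for distant pairs |x - y|^alpha >= t, and 2 m / t
   compensates. *)
pose C : R := m%:R + 2 * m%:R / t.
have C0 : 0 <= C by rewrite addr_ge0// divr_ge0 ?mulr_ge0// ltW.
exists C => x y Kx Ky; apply: le_trans (extnorm_norm1 _) _.
have [hx nx] := hm x Kx; have [_ ny] := hm y Ky.
apply: (@le_trans _ _ (C * `|x - y| `^ alpha)); last first.
  rewrite ler_wpM2l//; apply: ge0_ler_powR; rewrite ?nnegrE ?(ltW al0) ?enorm_ge0//.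
  exact: norm_enorm.
have p0 : 0 <= `|x - y| `^ alpha by exact: powR_ge0.
have [h|h] := leP `|x - y| m.+1%:R^-1.
  by apply: le_trans (hx y h) _; rewrite ler_wpM2r// lerDl divr_ge0 ?mulr_ge0// ltW.
have tp : t <= `|x - y| `^ alpha.
  by apply: ge0_ler_powR; rewrite ?nnegrE ?(ltW al0) ?invr_ge0// ltW.
apply: le_trans (norm1B _ _) _; apply: (@le_trans _ _ (2 * m%:R / t * t)).
  by rewrite divfK ?gt_eqF//; move: nx ny; move: (norm1 _) (norm1 _) (m%:R) => *; lra.
apply: ler_pM => //; rewrite ?(ltW t0)//; first by rewrite divr_ge0 ?mulr_ge0// ltW.
by rewrite lerDr.
Qed.
End holder.

Section beltrami_holder.
Variables (R : realType) (n : nat).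
Local Notation rV := 'rV[R]_n.
Local Notation mu := (@lebn R n).
Implicit Types (a x y : rV) (s : R).
Variables (Omega : set rV) (M : rV -> 'M[R]_n) (F P Q : rV -> extalg R n) (kap : R).
Hypotheses (oO : open Omega) (LF : ext_L2 Omega F) (LP : ext_L2 Omega P) (LQ : ext_L2 Omega Q).
Hypotheses (DP : is_Dplus Omega F P) (DQ : is_Dminus Omega F Q).
Hypotheses (kap0 : 0 <= kap) (kap1 : kap < 1)
  (hM : {ae mu, forall x, Omega x -> opnorm (M x) <= kap})
  (h02 : {ae mu, forall x, Omega x -> ext02 (F x)})
  (hQ : {ae mu, forall x, Omega x -> Q x = exterior_ext (M x) (P x)}).

(** Extended by 0 outside of Omega; by [mollified_limit_local] it coincides on each small cube with
    the limit built from the field cut off there. *)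
Definition representative x : extalg R n :=
  [ffun S => mollified_limit (fun y => F y S * \1_Omega y) x].

Lemma beltrami_holder : exists alpha : R, [/\ 0 < alpha, alpha < 1 &
  forall a s, 0 < s -> cube a (2 * s) `<=` Omega -> exists d C : R, [/\ 0 < d, 0 <= C,
    forall x y, cube a (s / 8) x -> cube a (s / 8) y -> `|x - y| <= d ->
      norm1 (representative x - representative y) <= C * `|x - y| `^ alpha &
    {ae mu, forall x, cube a (s / 8) x -> F x = representative x}]].
Proof.
have lam0 : 0 < (1 - kap ^+ 2) / 4.
  by rewrite divr_gt0// subr_gt0 expr_lt1.
have [alpha [al0 al1 loc]] := @local_holder R n _ lam0.
exists alpha; split => // a s s0 sub2.
have sub : cube a s `<=` Omega by apply: subset_trans sub2; apply: cubeS; have := s0; lra.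
have sol := beltrami_sol oO LF LP LQ DP DQ kap0 kap1 hM h02 hQ s0 sub2.
have locS S : exists dC : R * R, [/\ 0 < dC.1, 0 <= dC.2,
    forall x y, cube a (s / 8) x -> cube a (s / 8) y -> `|x - y| <= dC.1 ->
      `|representative x S - representative y S| <= dC.2 * `|x - y| `^ alpha &
    {ae mu, forall x, cube a (s / 8) x -> F x S = representative x S}].
  have L2P T : L2 (cut P a s T) by exact: cut_L2 LP oO sub.
  have L1P i : L1 mu setT (fun x => sgn R i S * cut P a s (tog i S) x).
    by apply: L1Z => //; apply: (L2_cube_L1 (L2P (tog i S))) => x; exact: cut0.
  have bnd := beltrami_bound oO LF LP LQ DP DQ kap0 kap1 hM h02 hQ s0 sub2 S.
  have weak phi (tphi : test_function (cube a s) phi) := laplacian_cut oO LF LP DP sub S tphi.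
  have [d [C [d0 C0 hol ae]]] := loc _ _ _ _ _ _ _ _ s0 sol (cut_L2 S LF oO sub)
    (fun x => @cut0 _ _ F a s S x) L1P bnd weak.
  have E x : cube a (s / 8) x -> representative x S = mollified_limit (cut F a s S) x.
    move=> xs; rewrite ffunE; apply: (mollified_limit_local _ s0 xs) => y ys.
    by rewrite cutE// indicE mem_set ?mulr1//; exact: sub.
  have s8 : s / 8 <= s by have := s0; lra.
  exists (d, C); split; [exact: d0|exact: C0| |].
    move=> x y xs ys xy.
    have h := hol x y xs ys xy.
    rewrite -(E x xs) -(E y ys) in h.
    exact: h.
  by apply: filterS ae => x h xs; rewrite (E x xs) -(h xs) cutE; [reflexivity|exact: (cubeS s8 xs)].
have subE (w w' : extalg R n) S : (w - w') S = w S - w' S by rewrite !ffunE.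
pose c S := sval (cid (locS S)).
have hc S := svalP (cid (locS S)).
have dpos S : 0 < (c S).1 by have [] := hc S.
have Cpos S : 0 <= (c S).2 by have [] := hc S.
(* The inverse of D is a radius that is admissible for all coordinates simultaneously. *)
pose D := \sum_S ((c S).1)^-1.
have Dle S : ((c S).1)^-1 <= D.
  by rewrite /D (bigD1 S)//= lerDl sumr_ge0// => T _; rewrite invr_ge0 ltW.
have D0 : 0 < D by apply: lt_le_trans (Dle finset.set0); rewrite invr_gt0.
exists D^-1, (\sum_S (c S).2); split.
- by rewrite invr_gt0.
- by apply: sumr_ge0.
- move=> x y xs ys xy; rewrite /norm1 mulr_suml; apply: ler_sum => S _.
  have [_ _ h _] := hc S; rewrite subE; apply: (h x y xs ys).
  by have dS := dpos S; apply: le_trans xy _; rewrite invf_ple ?posrE//; exact: Dle.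
have ae : {ae mu, forall x, forall S, cube a (s / 8) x -> F x S = representative x S}.
  by apply: ae_forall_fin => S; have [] := hc S.
by apply: filterS ae => x h xs; apply/ffunP => S; exact: h.
Qed.
End beltrami_holder.

Theorem theorem11p4 (R : realType) (n : nat) (Omega : set 'rV[R]_n)
    (M : 'rV[R]_n -> 'M[R]_n) (F : 'rV[R]_n -> extalg R n)
    (hOmega : domain Omega)
    (hM : ess_contractive Omega M)
    (hF : W12_d_delta_02 Omega F)
    (hsol : beltrami_solution Omega M F) :
  exists alpha : R, [/\ 0 < alpha, alpha < 1 & holder_loc Omega alpha F].
Proof.
have [oO _ _] := hOmega.
have [LF h02 _ _] := hF.
have [P [Q [LP LQ DP DQ hQ]]] := hsol.
have [kap [kap0 kap1 hkap]] := ess_contractive_bound hM.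
have [alpha [al0 al1 loc]] := beltrami_holder oO LF LP LQ DP DQ kap0 kap1 hkap h02 hQ.
exists alpha; split => //; exists (representative Omega F); split.
  apply: (ae_cover oO) => a s s0 sub; have [d [C [_ _ _ ae]]] := loc a s s0 sub.
  exact: ae.
apply: (holder_compact al0) => x xO; have [s [s0 sub]] := cube_nbhs oO xO.
have h2 : 0 < s / 2 by rewrite divr_gt0.
have sub2 : cube x (2 * (s / 2)) `<=` Omega by rewrite mulrC divfK.
have [d [C [d0 C0 hol _]]] := loc x (s / 2) h2 sub2.
have s8 : 0 < s / 2 / 8 by rewrite divr_gt0.
(* Two points within d / 2 of x are within d of each other. *)
exists (Num.min (d / 2) (s / 2 / 8)), C; split => //; first by rewrite lt_min divr_gt0.
move=> y z yx zx.
have dist w : `|w - x| <= Num.min (d / 2) (s / 2 / 8) -> `|w - x| <= d / 2 /\ cube x (s / 2 / 8) w.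
  rewrite le_min => /andP[w1 w2]; split => //.
  exact/(@cube_norm R n x (s / 2 / 8) w (ltW s8)).
have [yd ys] := dist y yx; have [zd zs] := dist z zx.
apply: hol => //; rewrite (_ : y - z = (y - x) - (z - x)); last by rewrite opprB addrA subrK.
apply: le_trans (ler_normB _ _) _; move: yd zd; move: (`|_|) (`|_|) => *; lra.
Qed.
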